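(* Let $N\geq3$, let $\Omega$ be a bounded smooth open subset of $\mathbb{R}^N$, and consider the problem $$-\Delta u=Q_\Omega(x)|u|^{2^*-2}u,\qquad u\in D^{1,2}(\mathbb{R}^N).\qquad(P)$$ Then the following statements hold true. (i) Problem $(P)$ does not have a least energy solution. (ii) If $\Omega$ is strictly starshaped, then $(P)$ admits only the trivial solution.
   Context: $\Omega$ is not necessarily connected. $2^*:=\frac{2N}{N-2}$; $Q_\Omega(x):=1$ if $x\in\Omega$ and $Q_\Omega(x):=-1$ if $x\in\mathbb{R}^N\smallsetminus\Omega$. $D^{1,2}(\mathbb{R}^N)=\{u\in L^{2^*}(\mathbb{R}^N):\nabla u\in L^2(\mathbb{R}^N;\mathbb{R}^N)\}$ with norm $\|u\|=(\int_{\mathbb{R}^N}|\nabla u|^2)^{1/2}$. Set $J_0(u):=\frac12\|u\|^2-\frac1{2^*}\int_{\mathbb{R}^N}Q_\Omega|u|^{2^*}$ for $u\in D^{1,2}(\mathbb{R}^N)$. Solutions of $(P)$ are the (real-valued) critical points of $J_0$. The Nehari manifold is $\mathcal{N}_0:=\{u\in D^{1,2}(\mathbb{R}^N):u\neq0,\ \|u\|^2=\int_{\mathbb{R}^N}Q_\Omega|u|^{2^*}\}$, and a least energy solution is a function $u\in\mathcal{N}_0$ with $J_0(u)=\inf_{\mathcal{N}_0}J_0$. $\Omega$ is strictly starshaped if there is a point $x_0\in\Omega$ such that $(\zeta-x_0)\cdot\nu_\Omega(\zeta)>0$ for every $\zeta\in\partial\Omega$, where $\nu_\Omega$ is the exterior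 unit normal to $\Omega$. *)

(* Defs.v *)
From HB Require Import structures.
From mathcomp Require Import all_boot all_order all_algebra.
From mathcomp Require Import all_classical all_reals all_analysis.

Set Implicit Arguments.
Unset Strict Implicit.
Unset Printing Implicit Defensive.

Import Order.TTheory GRing.Theory Num.Theory.
Import numFieldNormedType.Exports.

Local Open Scope classical_set_scope.
Local Open Scope ring_scope.

(* Lebesgue measure on row vectors: the sigma-algebra is the product (hence
   Borel) one generated by the coordinates, and the measure is the iterated
   product of the Lebesgue measure of the line. *)

Section measurable_rV.
Context {R : realType} (n : nat).

Let coord (i : 'I_n) (x : 'rV[R]_n) : measurableTypeR R := x 0 i.

Let rV_set0 : g_sigma_preimage coord set0.
Proof. exact: sigma_algebra0. Qed.

Let rV_setC A : g_sigma_preimage coord A -> g_sigma_preimage coord (~` A).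
Proof. exact: sigma_algebraC. Qed.

Let rV_bigcup (F : (set 'rV[R]_n)^nat) :
  (forall i, g_sigma_preimage coord (F i)) ->
  g_sigma_preimage coord (\bigcup_i (F i)).
Proof. exact: sigma_algebra_bigcup. Qed.

HB.instance Definition _ := @isMeasurable.Build default_measure_display
  'rV[R]_n (g_sigma_preimage coord) rV_set0 rV_setC rV_bigcup.

End measurable_rV.

Lemma measurable_coord {R : realType} n (i : 'I_n) :
  measurable_fun [set: 'rV[R]_n] (fun x => x 0 i : measurableTypeR R).
Proof.
move=> _ Y mY; rewrite setTI; apply: sub_sigma_algebra => /=.
rewrite -bigcup_seq/=; exists i => /=; first by rewrite mem_index_enum.
by exists Y => //; rewrite setTI.
Qed.

Lemma measurable_fun_rV d (T : measurableType d) {R : realType} n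
    (f : T -> 'rV[R]_n) :
  (forall i, measurable_fun [set: T] (fun t => f t 0 i : measurableTypeR R)) ->
  measurable_fun [set: T] f.
Proof.
move=> mf; set G := \big[setU/set0]_(i < n) preimage_set_system
  [set: 'rV[R]_n] (fun x => x 0 i : measurableTypeR R) measurable.
apply: (@measurability _ _ _ _ _ _ G) => //.
move=> _ [A + <-]; rewrite /G -bigcup_seq => -[i _ [B mB <-]].
by rewrite setTI [X in f @^-1` X]setTI -[X in measurable X]setTI; exact: mf.
Qed.

Section lebesgue_rV.
Context {R : realType}.

Definition cons_rV n (p : measurableTypeR R * 'rV[R]_n) : 'rV[R]_n.+1 :=
  \row_i if unlift ord0 i is Some j then p.2 0 j else p.1.

Lemma cons_rV0 n p : @cons_rV n p 0 0 = p.1.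
Proof. by rewrite mxE unlift_none. Qed.

Lemma cons_rVS n p (i : 'I_n) : cons_rV p 0 (lift ord0 i) = p.2 0 i.
Proof. by rewrite mxE liftK. Qed.

Lemma measurable_cons_rV n : measurable_fun setT (@cons_rV n).
Proof.
apply: measurable_fun_rV => i; case: (unliftP ord0 i) => [j|] ->.
  under eq_fun do rewrite cons_rVS.
  exact: measurableT_comp (measurable_coord j) measurable_snd.
under eq_fun do rewrite cons_rV0.
exact: measurable_fst.
Qed.

Section step.
Variables (n : nat) (m : {sigma_finite_measure set 'rV[R]_n -> \bar R}).

Definition cons_measure : set 'rV[R]_n.+1 -> \bar R :=
  pushforward (lebesgue_measure \x m)%E (@cons_rV n).

HB.instance Definition _ := Measure.copy cons_measure
  (measure_function_pushforward__canonical__measure_function_Measure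
    (lebesgue_measure \x m)%E (@measurable_cons_rV n)).

Let uncons (x : 'rV[R]_n.+1) : measurableTypeR R * 'rV[R]_n :=
  (x 0 0, \row_i x 0 (lift ord0 i)).

Let consK : cancel (@cons_rV n) uncons.
Proof.
by move=> [t v]; rewrite /uncons cons_rV0; congr pair; apply/rowP => i;
  rewrite mxE cons_rVS.
Qed.

Let unconsK : cancel uncons (@cons_rV n).
Proof.
move=> x; apply/rowP => i; case: (unliftP ord0 i) => [j|] ->.
  by rewrite cons_rVS mxE.
by rewrite cons_rV0.
Qed.

Let measurable_uncons : measurable_fun setT uncons.
Proof.
apply/measurable_fun_pairP; split; first exact: measurable_coord.
apply: measurable_fun_rV => i; under eq_fun do rewrite /= mxE.
exact: measurable_coord.
Qed.

Let cons_measure_sigma_finite : sigma_finite setT cons_measure.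
Proof.
have /sigma_finiteP[F [FT ndF mF]] := sigma_finiteT (@lebesgue_measure R).
have /sigma_finiteP[G [GT ndG mG]] := sigma_finiteT m.
exists (fun k => uncons @^-1` (F k `*` G k)) => [|k].
  rewrite -preimage_bigcup; apply/esym; rewrite -subTset => x _ /=.
  have [i _ Fi] : (\bigcup_i F i) (uncons x).1 by rewrite -FT.
  have [j _ Gj] : (\bigcup_i G i) (uncons x).2 by rewrite -GT.
  exists (maxn i j) => //; split.
    by move: Fi; exact/subsetPset/ndF/leq_maxl.
  by move: Gj; exact/subsetPset/ndG/leq_maxr.
have [? ?] := mF k; have [? ?] := mG k; split.
  by rewrite -[X in measurable X]setTI; apply: measurable_uncons => //;
    exact: measurableX.
rewrite /cons_measure /pushforward -comp_preimage.
rewrite (_ : uncons \o _ = id) ?preimage_id; last first.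
  by rewrite funeqE => p /=; rewrite consK.
by rewrite product_measure1E// lte_mul_pinfty// ge0_fin_numE.
Qed.

HB.instance Definition _ := Measure_isSigmaFinite.Build _ _ _ cons_measure
  cons_measure_sigma_finite.

End step.

Definition dirac0 : set 'rV[R]_0 -> \bar R := dirac (0 : 'rV[R]_0).

HB.instance Definition _ := Measure.on dirac0.

Let dirac0_sigma_finite : sigma_finite setT dirac0.
Proof.
exists (fun=> setT); first by rewrite bigcup_const.
by move=> _; split => //; rewrite /dirac0 diracT ltry.
Qed.

HB.instance Definition _ := Measure_isSigmaFinite.Build _ _ _ dirac0
  dirac0_sigma_finite.

Fixpoint lebesgue_rV n : {sigma_finite_measure set 'rV[R]_n -> \bar R} :=
  if n is k.+1 then cons_measure (lebesgue_rV k) else dirac0.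

Lemma lebesgue_rV_box n (A : 'I_n -> set (measurableTypeR R)) :
  (forall i, measurable (A i)) ->
  lebesgue_rV n [set x | forall i, A i (x 0 i)] =
  (\prod_(i < n) lebesgue_measure (A i))%E.
Proof.
elim: n A => [|n IHn] A mA.
  rewrite big_ord0 /=; transitivity (dirac0 setT); last exact: diracT.
  by congr dirac0; apply/seteqP; split => // x _ [].
have mB : measurable [set x : 'rV[R]_n | forall i, A (lift ord0 i) (x 0 i)].
  have -> : [set x : 'rV[R]_n | forall i, A (lift ord0 i) (x 0 i)] =
      \big[setI/setT]_(i < n)
        ((fun x : 'rV[R]_n => x 0 i : measurableTypeR R) @^-1` A (lift ord0 i)).
    rewrite -bigcap_seq; apply/seteqP; split => [x Ax i _|x Ax i]; first exact: Ax.
    by apply: Ax => /=; rewrite mem_index_enum.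
  apply: bigsetI_measurable => i _; rewrite -[X in measurable X]setTI.
  exact: measurable_coord.
rewrite big_ord_recl -IHn //= /cons_measure /pushforward -product_measure1E//.
congr (_ _); apply/seteqP; split => [[t v] /= Av|[t v] /= [At Av] i].
  split => [|i]; first by have := Av ord0; rewrite cons_rV0.
  by have := Av (lift ord0 i); rewrite cons_rVS.
by case: (unliftP ord0 i) => [j|] ->; rewrite ?cons_rV0 ?cons_rVS.
Qed.

End lebesgue_rV.

Section problem.
Context {R : realType} {N : nat}.
Implicit Types (u v phi rho : 'rV[R]_N -> R) (Omega : set 'rV[R]_N).

Local Notation mu := (lebesgue_rV N : {measure set 'rV[R]_N -> \bar R}).

Definition dot (x y : 'rV[R]_N) : R := \sum_(i < N) x 0 i * y 0 i.

(* The norm of the library on 'rV is the sup norm, whence this one. *)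
Definition enorm (x : 'rV[R]_N) : R := Num.sqrt (dot x x).

Definition partial (i : 'I_N) phi : 'rV[R]_N -> R :=
  fun x => 'D_(delta_mx 0 i) phi x.

Definition gradient phi (x : 'rV[R]_N) : 'rV[R]_N := \row_i partial i phi x.

Definition smooth phi := forall s : seq 'I_N,
  let psi := foldr partial phi s in
  continuous psi /\ forall i x, derivable psi x (delta_mx 0 i).

Definition boundary Omega := closure Omega `\` interior Omega.

(* Near its boundary point zeta, Omega is the sublevel set {rho < 0}. *)
Definition defining_function Omega (zeta : 'rV[R]_N) rho :=
  [/\ smooth rho, gradient rho zeta != 0 &
      \forall x \near zeta, Omega x <-> rho x < 0].

Definition smooth_open Omega := open Omega /\
  forall zeta, boundary Omega zeta -> exists rho, defining_function Omega zeta rho.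

Definition is_exterior_normal Omega (zeta nu : 'rV[R]_N) :=
  exists2 rho, defining_function Omega zeta rho &
    nu = (enorm (gradient rho zeta))^-1 *: gradient rho zeta.

Definition exterior_normal Omega (zeta : 'rV[R]_N) : 'rV[R]_N :=
  xget 0 [set nu | is_exterior_normal Omega zeta nu].

Definition strictly_starshaped Omega := exists2 x0, Omega x0 &
  forall zeta, boundary Omega zeta ->
    0 < dot (zeta - x0) (exterior_normal Omega zeta).

Definition crit_exp : R := 2 * N%:R / (N%:R - 2).

Definition test_function phi :=
  smooth phi /\ compact (closure [set x | phi x != 0]).

Definition weak_gradient u (g : 'rV[R]_N -> 'rV[R]_N) :=
  forall phi, test_function phi -> forall i : 'I_N,
    \int[mu]_x (u x * partial i phi x) = - \int[mu]_x (g x 0 i * phi x).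

Definition L2_weak_gradient u (g : 'rV[R]_N -> 'rV[R]_N) :=
  (forall i : 'I_N, (fun x => g x 0 i) \in Lfun mu 2%:E) /\ weak_gradient u g.

(* D^{1,2}, with elements represented by functions: equality in the space is
   equality almost everywhere. *)
Definition D12 u :=
  u \in Lfun mu crit_exp%:E /\ exists g, L2_weak_gradient u g.

(* The weak gradient is unique almost everywhere; one is chosen. *)
Definition nabla u : 'rV[R]_N -> 'rV[R]_N :=
  xget (cst 0) [set g | L2_weak_gradient u g].

Definition D12_norm u : R := Num.sqrt (\int[mu]_x (enorm (nabla u x) ^+ 2)).

Definition Q Omega (x : 'rV[R]_N) : R := if x \in Omega then 1 else -1.

Definition Qint Omega u : R :=
  \int[mu]_x (Q Omega x * `|u x| `^ crit_exp).

Definition J0 Omega u : R :=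
  2^-1 * D12_norm u ^+ 2 - crit_exp^-1 * Qint Omega u.

(* The Frechet derivative of J0 at u vanishes; functions modulo a.e. equality
   are not a normed module here, so the little-o is spelled out. *)
Definition critical_point Omega u := D12 u /\
  forall e : R, 0 < e -> exists2 d : R, 0 < d &
    forall v, D12 v -> D12_norm v < d ->
      `|J0 Omega (u \+ v) - J0 Omega u| <= e * D12_norm v.

Definition ae_zero u := u = cst 0 %[ae mu].

Definition nehari Omega := [set u | [/\ D12 u, ~ ae_zero u &
  D12_norm u ^+ 2 = Qint Omega u]].

Definition least_energy_solution Omega u :=
  nehari Omega u /\ J0 Omega u = inf (J0 Omega @` nehari Omega).

End problem.

(* Main.v *)
(* Both parts reduce to unique continuation: a function of D^{1,2} that vanishes
   off a bounded set and solves -Delta u = |u|^(p-2) u on the whole space, where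
   p = 2^*, is zero. Indeed one Brezis-Kato step puts |u|^(p-2) in L^N, and
   w = exp(t x_1) u satisfies 2t |d_1 w| <= | |u|^(p-2) w | in L^2. Since w has
   bounded support, Poincare's inequality in the direction x_1 turns this into
   w = 0 for t large.

   (i) Dilating a competitor about a point of Omega turns the weight Q into 1 in
   the limit. So a minimiser u satisfies int |v|^p <= K |grad v|^p for every v,
   where K |grad u|^p = int Q |u|^p. For v = u this forces u = 0 off Omega; then u
   is an extremal of the Sobolev inequality and solves -Delta u = |u|^(p-2) u.

   (ii) Let u^t be the dilation of u by e^t about the centre x0, normalised so
   as to keep both norms, and let Omega^t = x0 + e^t (Omega - x0), which contains
   Omega. Comparing J at u^t and at u yields |grad (u^t - u)|^2 = O(t^2) and
   E(t) := int_{Omega^t \ Omega} |u|^p = O(t^2); the relation between E(t) and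
   E(t/M) improves this to E(t) = O(t^p), so that the integral of u^2 over
   Omega^t \ Omega is o(t^2). This is what makes the restriction of u to the
   complement of Omega a function of D^{1,2}; testing the equation with it gives
   u = 0 off Omega. *)

Require Import Defs.
From mathcomp Require Import all_boot all_order all_algebra.
From mathcomp Require Import all_classical all_reals all_analysis.
From mathcomp Require Import measurable_realfun.
From mathcomp Require Import ring lra.
Import Order.TTheory GRing.Theory Num.Theory.
Import numFieldNormedType.Exports.
Local Open Scope classical_set_scope.
Local Open Scope ring_scope.
Set Implicit Arguments.
Unset Strict Implicit.
Unset Printing Implicit Defensive.

(** Solutions are only known to lie in D^{1,2}, which shapes (ii): a Pohozaev identity would need
    derivatives of u on the boundary. Dilations replace it. They keep both norms, so J changes only
    through E(t). The weak equation cancels the first-order term; the second-order remainder of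
    |.|^p is non-negative by convexity, so it has the good sign where Q = -1, and on the bounded set
    Omega it is absorbed up to a multiple of the integral of |u^t - u|^2, which is O(t^2).

    Adding one step s at a time gives E(ns) <= n 2^p (E(s) + O((ns)^p)), linear in n; for n >=
    2^(p+1) this beats the factor n^2 that O(t^2) alone would give. Hölder's inequality with a
    collar of volume O(t) then bounds the integral of u^2 by O(t^(3 - 2/p)). Strict starshapedness
    enters as a uniform cone condition: a point of Omega moved by at most e0 t and then contracted
    by e^(-t) is still in Omega. So a step h across the boundary ends in the collar of parameter
    h/e0.

    The estimate 2t |d_1 w| <= | |u|^(p-2) w | comes from testing the conjugated equation with
    central differences of w: they are skew-adjoint, so the symmetric terms vanish without any
    second derivative of w. *)

Lemma cvg_EFin_real (R : realType) (u : nat -> R) (l : R) :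
  u @ \oo --> l -> (fun n => (u n)%:E) @ \oo --> l%:E.
Proof. by move=> ul; apply: cvg_EFin => //; exact: nearW. Qed.

Lemma le_cvg_seq (R : realType) (u v : nat -> R) (a b : R) :
  u @ \oo --> a -> v @ \oo --> b -> (forall n, u n <= v n) -> a <= b.
Proof.
move=> ua vb uv; rewrite -(cvg_lim (@Rhausdorff R) ua) -(cvg_lim (@Rhausdorff R) vb).
apply: ler_lim; [by apply/cvg_ex; exists a | by apply/cvg_ex; exists b |].
exact: nearW.
Qed.

(** * Integrals of real-valued functions *)

Section integrals.
Context d (T : measurableType d) (R : realType)
  (mu : {measure set T -> \bar R}).
Implicit Types (f g : T -> R).

Notation I f := (Rintegral mu setT f).

Definition rint f := mu.-integrable setT (EFin \o f).

Lemma rint_measurable f : rint f -> measurable_fun setT f.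
Proof. by move=> /measurable_int/measurable_EFinP. Qed.

Lemma rint_le f g : measurable_fun setT f -> rint g ->
  (forall x, `|f x| <= g x) -> rint f.
Proof.
move=> mf ig fg; apply: le_integrable ig => //; first exact/measurable_EFinP.
by move=> x _ /=; rewrite lee_fin (le_trans (fg x))// ler_norm.
Qed.

Lemma rint0 : rint (fun=> 0).
Proof. exact: integrable0. Qed.

Lemma rintD f g : rint f -> rint g -> rint (fun x => f x + g x).
Proof. by move=> fi gi; have := integrableD measurableT fi gi. Qed.

Lemma rintB f g : rint f -> rint g -> rint (fun x => f x - g x).
Proof. by move=> fi gi; have := integrableB measurableT fi gi. Qed.

Lemma rintZ c f : rint f -> rint (fun x => c * f x).
Proof. by move=> fi; have := integrableZl measurableT c fi. Qed.

Lemma rint_norm f : rint f -> rint (fun x => `|f x|).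
Proof. exact: integrable_norm. Qed.

Lemma rint_sum (J : Type) (s : seq J) (f : J -> T -> R) :
  (forall j, rint (f j)) -> rint (fun x => \sum_(j <- s) f j x).
Proof.
move=> fi; elim: s => [|j s IH].
  by under eq_fun do rewrite big_nil; exact: rint0.
by under eq_fun do rewrite big_cons; exact: rintD.
Qed.

Lemma ID f g : rint f -> rint g -> I (fun x => f x + g x) = I f + I g.
Proof. by move=> fi gi; rewrite RintegralD. Qed.

Lemma IB f g : rint f -> rint g -> I (fun x => f x - g x) = I f - I g.
Proof. by move=> fi gi; rewrite RintegralB. Qed.

Lemma IZ c f : rint f -> I (fun x => c * f x) = c * I f.
Proof. by move=> fi; rewrite RintegralZl. Qed.

Lemma I0 : I (fun=> 0) = 0.
Proof. by rewrite /Rintegral integral0. Qed.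

Lemma I_sum (J : Type) (s : seq J) (f : J -> T -> R) :
  (forall j, rint (f j)) ->
  I (fun x => \sum_(j <- s) f j x) = \sum_(j <- s) I (f j).
Proof.
move=> fi; elim: s => [|j s IH].
  by rewrite big_nil; under eq_Rintegral do rewrite big_nil; rewrite I0.
rewrite big_cons -IH -ID//; last exact: rint_sum.
by under eq_Rintegral do rewrite big_cons.
Qed.

Lemma I_le f g : rint f -> rint g -> (forall x, f x <= g x) -> I f <= I g.
Proof. by move=> fi gi fg; apply: le_Rintegral. Qed.

Lemma I_ge0 f : (forall x, 0 <= f x) -> 0 <= I f.
Proof. by move=> f0; apply: Rintegral_ge0. Qed.

Lemma EFin_I f : rint f -> (I f)%:E = (\int[mu]_x (f x)%:E)%E.
Proof. by move=> fi; rewrite fineK//; exact: integrable_fin_num. Qed.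

Lemma I_norm f : rint f -> `|I f| <= I (fun x => `|f x|).
Proof. by move=> fi; exact: le_normr_Rintegral. Qed.

Lemma I_eq f g : (forall x, f x = g x) -> I f = I g.
Proof. by move=> fg; congr (Rintegral _ _ _); exact/funext. Qed.

Lemma rint_eq f g : (forall x, f x = g x) -> rint f -> rint g.
Proof. by move=> /funext ->. Qed.

Lemma I_ae f g : measurable_fun setT f -> measurable_fun setT g ->
  (\forall x \ae mu, f x = g x) -> I f = I g.
Proof.
move=> mf mg fg; congr fine; apply: ae_eq_integral => //;
  try exact/measurable_EFinP.
by apply: filterS fg => x -> .
Qed.

Lemma rint_ae f g : measurable_fun setT g -> rint f ->
  (\forall x \ae mu, f x = g x) -> rint g.
Proof.
move=> mg fi fg; apply/integrableP; split; first exact/measurable_EFinP.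
have /integrableP[mf] := fi; apply: le_lt_trans.
rewrite le_eqVlt; apply/orP; left; apply/eqP/ae_eq_integral => //.
- by apply: measurableT_comp => //; exact/measurable_EFinP.
- exact: measurableT_comp.
- by apply: filterS fg => x /= -> .
Qed.

Lemma I_eq0 f : rint f -> (forall x, 0 <= f x) -> I f = 0 ->
  \forall x \ae mu, f x = 0.
Proof.
move=> fi f0 If0; have := EFin_I fi; rewrite If0 => /esym H.
have : (\int[mu]_x `|(f x)%:E| = 0)%E.
  rewrite -[RHS]H; apply: eq_integral => x _.
  by rewrite gee0_abs// lee_fin.
move/ae_eq_integral_abs => /(_ measurableT) H1.
have := H1 (measurable_int _ fi).
by apply: filterS => x /= /(_ Logic.I) [].
Qed.

Lemma I_dct (F : nat -> T -> R) f g :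
  (forall n, measurable_fun setT (F n)) -> measurable_fun setT f -> rint g ->
  (forall n x, `|F n x| <= g x) ->
  (\forall x \ae mu, F ^~ x @ \oo --> f x) ->
  I (F n) @[n --> \oo] --> I f.
Proof.
move=> mF mf ig Fg Ff.
have [] := @dominated_convergence _ _ _ mu setT measurableT
  (fun n => EFin \o F n) (EFin \o f) (EFin \o g).
- by move=> n; exact/measurable_EFinP.
- exact/measurable_EFinP.
- apply: filterS Ff => x Fx _ /=.
  exact: cvg_EFin_real.
- exact: ig.
- by apply: nearW => x n _ /=; rewrite lee_fin.
move=> fi _ H; have : (\int[mu]_x (F n x)%:E)%E @[n --> \oo] --> (I f)%:E.
  by rewrite EFin_I.
by move=> /fine_cvgP[_].
Qed.

(** Integrability of the limit is part of the conclusion: this is how uniform bounds on truncations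
    become membership in L^2 or L^p. *)
Lemma I_fatou (F : nat -> T -> R) f C :
  (forall n, rint (F n)) -> measurable_fun setT f ->
  (forall n x, 0 <= F n x) ->
  (forall x, F ^~ x @ \oo --> f x) ->
  (forall n, I (F n) <= C) -> rint f /\ I f <= C.
Proof.
move=> iF mf F0 Ff FC.
have f0 x : 0 <= f x.
  by rewrite -(cvg_lim _ (Ff x))//; apply: limr_ge => //;
    [apply/cvg_ex; eexists; exact: Ff | apply: nearW => n; exact: F0].
have H : (\int[mu]_x (f x)%:E <= C%:E)%E.
  have := @fatou _ _ _ mu setT measurableT (fun n => EFin \o F n).
  have mF n : measurable_fun setT (EFin \o F n) by exact: measurable_int (iF n).
  move=> /(_ mF) => /(_ _)/le_trans => H.
  have -> : (\int[mu]_x (f x)%:E = \int[mu]_x limn_einf (fun n => (F n x)%:E))%E.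
    apply: eq_integral => x _; rewrite is_cvg_limn_einfE; last first.
      by apply/cvg_ex; exists (f x)%:E; exact: cvg_EFin_real (Ff x).
    by apply/esym/cvg_lim => //; exact: cvg_EFin_real (Ff x).
  apply: H.
    by move=> n x _ /=; rewrite lee_fin.
  apply: (@le_trans _ _ (limn_esup (fun n => (\int[mu]_x (F n x)%:E)%E))).
    exact: limn_einf_sup.
  rewrite limn_esup_lim; apply: lime_le; first exact: is_cvg_esups.
  apply: nearW => n; apply: ge_ereal_sup => _ [m /= _ <-].
  by rewrite -EFin_I// lee_fin.
have fi : rint f.
  apply/integrableP; split; first exact/measurable_EFinP.
  apply: le_lt_trans (ltry C); apply: le_trans H.
  rewrite le_eqVlt; apply/orP; left; apply/eqP/eq_integral => x _.
  by rewrite /= ger0_norm.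
by split => //; rewrite -lee_fin EFin_I.
Qed.

(** The integrals are summable, so the series of the [F n] has a finite sum almost everywhere and
    its terms tend to 0. Dyadic steps supply the geometric bound. *)
Lemma ae_cvg0 (F : nat -> T -> R) C (q : R) : 0 <= q < 1 ->
  (forall n, rint (F n)) -> (forall n x, 0 <= F n x) ->
  (forall n, I (F n) <= C * q ^+ n) ->
  \forall x \ae mu, F ^~ x @ \oo --> 0.
Proof.
move=> q01 iF F0 FC.
have mF n : measurable_fun setT (EFin \o F n) by exact: measurable_int (iF n).
have H : (\int[mu]_x (\sum_(n <oo) (F n x)%:E) < +oo)%E.
  rewrite integral_nneseries//; last by move=> n x _; rewrite lee_fin.
  apply: (@le_lt_trans _ _ (\sum_(n <oo) (`|C| * q ^+ n)%:E)%E).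
    apply: lee_nneseries => //.
      by move=> n _ _; apply: integral_ge0 => x _; rewrite lee_fin.
    move=> n _; rewrite -EFin_I// lee_fin (le_trans (FC n))//.
    by rewrite ler_wpM2r ?ler_norm// exprn_ge0//; case/andP: q01.
  have /cvg_ex[/= l Hl] : cvgn (series (geometric `|C| q)).
    by apply: is_cvg_geometric_series; rewrite ger0_norm; case/andP: q01.
  have -> : (\sum_(n <oo) (`|C| * q ^+ n)%:E)%E = l%:E.
    apply/cvg_lim => //.
    have -> : (fun n => \sum_(0 <= k < n) (`|C| * q ^+ k)%:E)%E =
        EFin \o series (geometric `|C| q).
      by apply/funext => n; rewrite /series/= -sumEFin.
    exact: cvg_EFin_real Hl.
  by rewrite ltry.
have iS : mu.-integrable setT (fun x => \sum_(n <oo) (F n x)%:E)%E.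
  apply/integrableP; split.
    by apply: (@ge0_emeasurable_sum _ _ _ setT (fun n x => (F n x)%:E) xpredT)
      => [n x _ _|n _]; [rewrite lee_fin|exact: mF].
  apply: le_lt_trans H; rewrite le_eqVlt; apply/orP; left; apply/eqP.
  apply: eq_integral => x _; rewrite gee0_abs//.
  by apply: nneseries_ge0 => n _ _; rewrite lee_fin.
have := integrable_ae measurableT iS; apply: filterS => x /(_ Logic.I) Sx.
have H1 : cvgn (series (F ^~ x)).
  apply: nondecreasing_is_cvgn.
    by apply/nondecreasing_seqP => n; rewrite seriesSr lerDl.
  exists (fine (\sum_(n <oo) (F n x)%:E)%E) => _ [n _ <-].
  rewrite -lee_fin fineK// /series/= -sumEFin.
  by apply: nneseries_lim_ge => k _ ; rewrite lee_fin.
exact: cvg_series_cvg_0.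
Qed.

End integrals.

(** * Convexity and growth of |a|^p *)

Section powers.
Context (R : realType).
Implicit Types (a b p q r s x y : R).

Lemma powR_le x y r : 0 <= r -> 0 <= x -> x <= y -> x `^ r <= y `^ r.
Proof.
move=> r0 x0 xy; apply: ge0_ler_powR => //; rewrite nnegrE//.
exact: le_trans xy.
Qed.

Lemma powRDe x r s : 0 < r -> 0 < s -> x `^ (r + s) = x `^ r * x `^ s.
Proof. by move=> r0 s0; rewrite powRD// gt_eqF ?addr_gt0. Qed.

(** A convex power lies above its tangents. This is Young's inequality for x^(q-1) and y, with the
    conjugate exponents q/(q-1) and q. *)
Lemma powR_tangent q x y : 1 <= q -> 0 <= x -> 0 <= y ->
  x `^ q + q * x `^ (q - 1) * (y - x) <= y `^ q.
Proof.
move=> q1 x0 y0; have [->|qN1] := eqVneq q 1.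
  by rewrite subrr powRr0 !powRr1//; lra.
have {}q1 : 1 < q by rewrite lt_neqAle eq_sym qN1.
have q0 : 0 < q by lra.
have q10 : 0 < q - 1 by lra.
have H : x `^ (q - 1) * y <= x `^ q * ((q - 1) / q) + y `^ q / q.
  have := @conjugate_powR _ (x `^ (q - 1)) y (q / (q - 1)) q (powR_ge0 _ _) y0.
  rewrite divr_gt0// => /(_ isT q0); rewrite -powRrM.
  rewrite [(q - 1) * _]mulrC divfK ?gt_eqF// [(q / (q - 1))^-1]invf_div; apply.
  by field; rewrite gt_eqF.
have E : x `^ (q - 1) * x = x `^ q by rewrite mulrC mulr_powRB1.
have {}H : q * (x `^ (q - 1) * y) <= x `^ q * (q - 1) + y `^ q.
  have -> : x `^ q * (q - 1) + y `^ q =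
    q * (x `^ q * ((q - 1) / q) + y `^ q / q) by field; rewrite gt_eqF.
  by rewrite ler_pM2l.
by rewrite mulrBr -!mulrA E; lra.
Qed.

Context (p : R).

(** The nonlinearity of the equation, that is, the derivative of |a|^p / p. *)
Definition psi a := `|a| `^ (p - 2) * a.

Lemma powR_p_sqr a (hp : 2 < p) : `|a| `^ (p - 2) * a ^+ 2 = `|a| `^ p.
Proof.
by rewrite -[a ^+ 2]real_normK ?num_real// -powR_mulrn// -powRDe ?subrK//; lra.
Qed.

Lemma psi_mul a (hp : 2 < p) : psi a * a = `|a| `^ p.
Proof. by rewrite /psi -mulrA -expr2 powR_p_sqr. Qed.

Lemma norm_psi a (hp : 2 < p) : `|psi a| = `|a| `^ (p - 1).
Proof.
rewrite normrM ger0_norm ?powR_ge0//.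
rewrite -[X in _ * X]powRr1// -powRDe//; last lra.
by congr (_ `^ _); lra.
Qed.

Lemma psiN a : psi (- a) = - psi a.
Proof. by rewrite /psi normrN mulrN. Qed.

Lemma psi0 : psi 0 = 0.
Proof. by rewrite /psi mulr0. Qed.

Lemma norm_psi_mul a (hp : 2 < p) : `|psi a| * `|a| = `|a| `^ p.
Proof. by rewrite norm_psi// mulrC mulr_powRB1//; lra. Qed.

Lemma powR_convex a b (hp : 2 < p) : `|a| `^ p + p * (psi a * (b - a)) <= `|b| `^ p.
Proof.
have p1 : 1 <= p by lra.
have := powR_tangent p1 (normr_ge0 a) (normr_ge0 b).
apply: le_trans.
rewrite lerD2l -mulrA ler_wpM2l//; first lra.
rewrite !mulrBr psi_mul// -norm_psi// norm_psi_mul// lerD2r.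
by rewrite -normrM ler_norm.
Qed.

Lemma psi_lip a b (hp : 2 < p) : `|psi b - psi a| <=
  (p - 1) * (`|a| `^ (p - 2) + `|b| `^ (p - 2)) * `|b - a|.
Proof.
(* For two points of the same sign, the tangent of the power p - 1 at the larger one suffices. *)
have K x y : 0 <= x -> x <= y -> `|psi y - psi x| <=
    (p - 1) * y `^ (p - 2) * (y - x).
  move=> x0 xy; have y0 := le_trans x0 xy.
  have E z : 0 <= z -> psi z = z `^ (p - 1).
    by move=> z0; rewrite -[LHS]ger0_norm ?norm_psi// ?ger0_norm// mulr_ge0// powR_ge0.
  rewrite !E// ger0_norm ?subr_ge0 ?powR_le//; last lra.
  have p1 : 1 <= p - 1 by lra.
  have := powR_tangent p1 y0 x0.
  have -> : p - 1 - 1 = p - 2 by lra.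
  lra.
have p1 : 0 <= p - 1 by lra.
wlog ab : a b / a <= b.
  move=> H; have [/H//|/ltW/H] := leP a b.
  by rewrite distrC [X in _ * X * _]addrC (distrC a b).
have ba : `|b - a| = b - a by rewrite ger0_norm// subr_ge0.
have n1 := powR_ge0 `|a| (p - 2).
have n2 := powR_ge0 `|b| (p - 2).
have [a0|a0] := leP 0 a.
  apply: le_trans (K a b a0 ab) _; rewrite ba (ger0_norm a0).
  rewrite ler_wpM2r ?subr_ge0// ler_wpM2l// (@ger0_norm _ b) ?(le_trans a0)//.
  by rewrite lerDr powR_ge0.
have [b0|b0] := leP b 0.
  have := K (- b) (- a); rewrite oppr_ge0 b0 lerN2 ab => /(_ isT isT).
  rewrite !psiN opprK addrC => /le_trans; apply.
  rewrite ba opprK (addrC (- a)) -(ltr0_norm a0).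
  rewrite ler_wpM2r//; first by rewrite (ltr0_norm a0); lra.
  rewrite ler_wpM2l//.
  by rewrite lerDl powR_ge0.
apply: le_trans (ler_normB _ _) _; rewrite ba /psi !normrM !(@ger0_norm _ (_ `^ _)) ?powR_ge0//.
rewrite (gtr0_norm b0) (ltr0_norm a0) in n1 n2 *.
set A := (- a) `^ _ in n1 *; set B := b `^ _ in n2 *.
have : 0 <= B * - a by apply: mulr_ge0 => //; lra.
have : 0 <= A * b by apply: mulr_ge0 => //; lra.
have : 0 <= (A + B) * (b - a) by apply: mulr_ge0; [exact: addr_ge0|lra].
move=> h1 h2 h3; have : (A + B) * (b - a) <= (p - 1) * ((A + B) * (b - a)).
  by rewrite ler_peMl//; lra.
by rewrite -[X in _ -> _ <= X]mulrA; lra.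
Qed.

(** Convexity at [b] bounds the remainder by p (psi b - psi a)(b - a), so a first-order estimate on
    [psi] replaces a second derivative. *)
Lemma powR_taylor a b (hp : 2 < p) : `|b| `^ p - `|a| `^ p - p * (psi a * (b - a)) <=
  p * (p - 1) * ((`|a| `^ (p - 2) + `|b| `^ (p - 2)) * (b - a) ^+ 2).
Proof.
have H := powR_convex b a hp.
apply: (@le_trans _ _ (p * ((psi b - psi a) * (b - a)))); first by lra.
rewrite -mulrA ler_pM2l; last lra.
apply: le_trans (ler_norm _) _; rewrite normrM.
apply: le_trans (ler_wpM2r (normr_ge0 _) (psi_lip a b hp)) _.
by rewrite -(real_normK (num_real (b - a))) expr2 !mulrA.
Qed.

Lemma powR_max x y r : 0 <= x -> 0 <= y -> Num.max x y `^ r <= x `^ r + y `^ r.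
Proof.
by move=> x0 y0; case: (leP x y) => _; rewrite (lerDl, lerDr) powR_ge0.
Qed.

Lemma powRD_le a b (hp : 2 < p) : `|a + b| `^ p <= 2 `^ p * (`|a| `^ p + `|b| `^ p).
Proof.
pose m : R := Num.max `|a| `|b|.
have m0 : 0 <= m by rewrite le_max normr_ge0.
apply: (@le_trans _ _ ((2 * m) `^ p)).
  apply: powR_le => //; first lra.
  rewrite (le_trans (ler_normD _ _))// mulr2n mulrDl !mul1r lerD// le_max lexx ?orbT//.
by rewrite powRM// ler_wpM2l ?powR_ge0// powR_max.
Qed.

Lemma psi_mul_le a b (hp : 2 < p) : `|psi a * b| <= `|a| `^ p + `|b| `^ p.
Proof.
pose m : R := Num.max `|a| `|b|.
have m0 : 0 <= m by rewrite le_max normr_ge0.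
apply: le_trans (powR_max p (normr_ge0 a) (normr_ge0 b)).
rewrite normrM norm_psi// -/m -[m `^ p](@mulr_powRB1 _ m)//; last lra.
rewrite mulrC ler_pM ?powR_ge0//; first by rewrite /m le_max lexx orbT.
by apply: powR_le; rewrite ?normr_ge0 ?le_max ?lexx//; lra.
Qed.

Lemma powR_sqr_le a b (hp : 2 < p) : `|a| `^ (p - 2) * b ^+ 2 <= `|a| `^ p + `|b| `^ p.
Proof.
pose m : R := Num.max `|a| `|b|.
have m0 : 0 <= m by rewrite le_max normr_ge0.
apply: le_trans (powR_max p (normr_ge0 a) (normr_ge0 b)).
rewrite -/m -[X in X `^ p]ger0_norm// -powR_p_sqr// ler_pM ?powR_ge0 ?sqr_ge0//.
  by apply: powR_le => //; [lra | rewrite (ger0_norm m0) le_max lexx].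
rewrite -[b ^+ 2]real_normK ?num_real// ler_pXn2r ?nnegrE//.
by rewrite le_max lexx orbT.
Qed.

(** This is [powR_sqr_le] for [b / s]. The free scale is optimised after integration, which yields
    Hölder's inequality up to a constant. *)
Lemma powR_sqr_le_scale a b s (hp : 2 < p) : 0 < s ->
  `|a| `^ (p - 2) * b ^+ 2 <= s ^+ 2 * `|a| `^ p + s `^ (2 - p) * `|b| `^ p.
Proof.
move=> s0; have := powR_sqr_le a (b / s) hp.
have s1 : 0 <= s by exact: ltW.
have sV : 0 < s^-1 by rewrite invr_gt0.
rewrite normrM (gtr0_norm sV) powRM ?(ltW sV)//.
rewrite -[s^-1 `^ p]/((s^-1) `^ p) -(powR_inv1 s1) -powRrM mulN1r powR_inv1//.
rewrite exprMn => H.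
have := ler_wpM2l (sqr_ge0 s) H.
have -> : s ^+ 2 * (`|a| `^ (p - 2) * (b ^+ 2 * s^-1 ^+ 2)) =
   `|a| `^ (p - 2) * b ^+ 2 by field; rewrite gt_eqF.
move=> /le_trans; apply; rewrite mulrDr lerD2l mulrCA mulrC.
rewrite -powR_mulrn// -powRD//.
by rewrite (gt_eqF s0) implybT.
Qed.

End powers.

Lemma norm_cvg0_le (R : realType) (u v : nat -> R) :
  (forall n, `|u n| <= v n) -> v @ \oo --> 0 -> u @ \oo --> 0.
Proof.
move=> uv v0; apply/norm_cvg0P; apply: (squeeze_cvgr _ (cvg_cst 0) v0).
by apply: nearW => n; rewrite normr_ge0 uv.
Qed.

(** * The space L^2 *)

Section L2_theory.
Context d (T : measurableType d) (R : realType)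
  (mu : {measure set T -> \bar R}).
Implicit Types (f g h : T -> R).

Notation I f := (Rintegral mu setT f).

Definition L2 f := measurable_fun setT f /\ rint mu (fun x => f x ^+ 2).
Definition n2 f := I (fun x => f x ^+ 2).
Definition ip f g := I (fun x => f x * g x).

Lemma n2_ge0 f : 0 <= n2 f.
Proof. by apply: I_ge0 => x; exact: sqr_ge0. Qed.

Lemma ipC f g : ip f g = ip g f.
Proof. by apply: I_eq => x; rewrite mulrC. Qed.

Lemma ipff f : ip f f = n2 f.
Proof. by apply: I_eq => x; rewrite expr2. Qed.

Lemma L2_rint_mul f g : L2 f -> L2 g -> rint mu (fun x => f x * g x).
Proof.
move=> [mf fi] [mg gi]; apply: (rint_le _ (rintD fi gi)).
  exact: measurable_funM.
move=> x; rewrite ler_norml; apply/andP; split.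
  by have := sqr_ge0 (f x + g x); rewrite sqrrD; have := sqr_ge0 (f x);
    have := sqr_ge0 (g x); lra.
by have := sqr_ge0 (f x - g x); rewrite sqrrB; have := sqr_ge0 (f x);
  have := sqr_ge0 (g x); lra.
Qed.

Lemma L2_dom f g c : measurable_fun setT f -> L2 g ->
  (forall x, `|f x| <= c * `|g x|) -> L2 f /\ n2 f <= c ^+ 2 * n2 g.
Proof.
move=> mf [mg gi] fg.
have H x : f x ^+ 2 <= c ^+ 2 * g x ^+ 2.
  rewrite -(real_normK (num_real (f x))) -(real_normK (num_real (g x))) -exprMn.
  have fx := fg x; rewrite ler_pXn2r ?nnegrE//.
  by apply: le_trans fx; exact: normr_ge0.
have fi : rint mu (fun x => f x ^+ 2).
  apply: (rint_le _ (rintZ (c ^+ 2) gi)); first exact: measurable_funX.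
  by move=> x; rewrite ger0_norm ?sqr_ge0.
split; first by split.
by rewrite /n2 -IZ//; apply: I_le => //; exact: rintZ.
Qed.

Lemma L2Z c f : L2 f -> L2 (fun x => c * f x).
Proof.
move=> L2f; have [mf _] := L2f.
apply: (proj1 (@L2_dom _ f `|c| _ L2f _)); first exact: measurable_funM.
by move=> x; rewrite normrM.
Qed.

Lemma L2D f g : L2 f -> L2 g -> L2 (fun x => f x + g x).
Proof.
move=> L2f L2g; have [mf fi] := L2f; have [mg gi] := L2g; split.
  exact: measurable_funD.
have := rintD (rintD fi (rintZ 2 (L2_rint_mul L2f L2g))) gi.
by apply: rint_eq => x; rewrite sqrrD mulr_natl.
Qed.

Lemma L2N f : L2 f -> L2 (fun x => - f x).
Proof.
by move=> /(L2Z (-1)); congr L2; apply/funext => x; rewrite mulN1r.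
Qed.

Lemma L2B f g : L2 f -> L2 g -> L2 (fun x => f x - g x).
Proof. by move=> L2f /L2N; exact: L2D. Qed.

Lemma L20 : L2 (fun=> 0).
Proof.
split => //; apply: rint_eq (rint0 _) => x; by rewrite expr0n.
Qed.

Lemma n20 : n2 (fun=> 0) = 0.
Proof. by rewrite /n2 (_ : (fun _ => _) = fun=> 0) ?I0//; apply/funext => x; rewrite expr0n. Qed.

Lemma ipDl f g h : L2 f -> L2 g -> L2 h ->
  ip (fun x => f x + g x) h = ip f h + ip g h.
Proof.
move=> fi gi hi; rewrite /ip -ID; try exact: L2_rint_mul.
by apply: I_eq => x; rewrite mulrDl.
Qed.

Lemma ipZl c f h : L2 f -> L2 h -> ip (fun x => c * f x) h = c * ip f h.
Proof.
move=> fi hi; rewrite /ip -IZ; last exact: L2_rint_mul.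
by apply: I_eq => x; rewrite mulrA.
Qed.

Lemma ipNl f h : L2 f -> L2 h -> ip (fun x => - f x) h = - ip f h.
Proof.
move=> fi hi; rewrite -mulN1r -ipZl//; congr ip.
by apply/funext => x; rewrite mulN1r.
Qed.

Lemma ipBl f g h : L2 f -> L2 g -> L2 h ->
  ip (fun x => f x - g x) h = ip f h - ip g h.
Proof. by move=> fi gi hi; rewrite ipDl// ?ipNl//; exact: L2N. Qed.

Lemma ipDr f g h : L2 f -> L2 g -> L2 h ->
  ip h (fun x => f x + g x) = ip h f + ip h g.
Proof. by move=> fi gi hi; rewrite ipC ipDl// !(ipC h). Qed.

Lemma ipBr f g h : L2 f -> L2 g -> L2 h ->
  ip h (fun x => f x - g x) = ip h f - ip h g.
Proof. by move=> fi gi hi; rewrite ipC ipBl// !(ipC h). Qed.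

Lemma ipZr c f h : L2 f -> L2 h -> ip h (fun x => c * f x) = c * ip h f.
Proof. by move=> fi hi; rewrite ipC ipZl// (ipC h). Qed.

Lemma n2Z c f : L2 f -> n2 (fun x => c * f x) = c ^+ 2 * n2 f.
Proof.
by move=> fi; rewrite -!ipff ipZl ?ipZr ?mulrA ?expr2//; exact: L2Z.
Qed.

Lemma n2N f : n2 (fun x => - f x) = n2 f.
Proof. by apply: I_eq => x; rewrite sqrrN. Qed.

Lemma n2D f g : L2 f -> L2 g ->
  n2 (fun x => f x + g x) = n2 f + 2 * ip f g + n2 g.
Proof.
move=> fi gi; rewrite -!ipff ipDl ?ipDr//; try exact: L2D.
by rewrite (ipC g f); lra.
Qed.

Lemma n2B f g : L2 f -> L2 g ->
  n2 (fun x => f x - g x) = n2 f - 2 * ip f g + n2 g.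
Proof.
move=> fi gi; rewrite n2D//; last exact: L2N.
by rewrite n2N (ipC f) ipNl// (ipC g); lra.
Qed.

Lemma n2_subC f g : n2 (fun x => f x - g x) = n2 (fun x => g x - f x).
Proof. by apply: I_eq => x; rewrite -sqrrN opprB. Qed.

Lemma cauchy_schwarz f g : L2 f -> L2 g -> ip f g ^+ 2 <= n2 f * n2 g.
Proof.
move=> fi gi; have Q t : 0 <= n2 f + 2 * (t * ip f g) + t ^+ 2 * n2 g.
  by rewrite -n2Z// -ipZr// -n2D//; [exact: n2_ge0 | exact: L2Z].
have [g0|g0] := eqVneq (n2 g) 0.
  suff -> : ip f g = 0 by rewrite expr0n mulr_ge0 ?n2_ge0.
  apply/eqP/negPn/negP => fg0.
  have := Q (- (n2 f + 1) / ip f g).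
  by rewrite g0 divfK// mulr0; have := n2_ge0 f; lra.
have {}g0 : 0 < n2 g by rewrite lt_neqAle eq_sym g0 n2_ge0.
have := Q (- ip f g / n2 g).
have -> : n2 f + 2 * (- ip f g / n2 g * ip f g) + (- ip f g / n2 g) ^+ 2 * n2 g
  = (n2 f * n2 g - ip f g ^+ 2) / n2 g by field; rewrite gt_eqF.
by rewrite pmulr_lge0 ?invr_gt0// subr_ge0.
Qed.

Lemma ip_le f g : L2 f -> L2 g -> `|ip f g| <= Num.sqrt (n2 f) * Num.sqrt (n2 g).
Proof.
move=> fi gi; rewrite -sqrtrM ?n2_ge0// -sqrtr_sqr ler_sqrt ?cauchy_schwarz//.
by rewrite mulr_ge0// n2_ge0.
Qed.

Lemma n2_triangle f g : L2 f -> L2 g ->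
  Num.sqrt (n2 (fun x => f x + g x)) <= Num.sqrt (n2 f) + Num.sqrt (n2 g).
Proof.
move=> fi gi; rewrite -(ler_pXn2r (_ : 0 < 2)%N)// ?nnegrE ?addr_ge0 ?sqrtr_ge0//.
rewrite sqr_sqrtr ?n2_ge0// n2D// sqrrD !sqr_sqrtr ?n2_ge0//.
rewrite lerD2r lerD2l -[leRHS]mulr_natl ler_wpM2l//.
exact: le_trans (ler_norm _) (ip_le fi gi).
Qed.

Lemma n2D_le f g : L2 f -> L2 g ->
  n2 (fun x => f x + g x) <= 2 * n2 f + 2 * n2 g.
Proof.
move=> fi gi; have := n2_ge0 (fun x => f x - g x).
by rewrite n2B// n2D//; lra.
Qed.

Lemma n2B_le f g : L2 f -> L2 g ->
  n2 (fun x => f x - g x) <= 2 * n2 f + 2 * n2 g.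
Proof.
move=> fi gi; have := n2_ge0 (fun x => f x + g x).
by rewrite n2B// n2D//; lra.
Qed.

Lemma ip_cvg (F : nat -> T -> R) f h : (forall n, L2 (F n)) -> L2 f -> L2 h ->
  (fun n => n2 (fun x => F n x - f x)) @ \oo --> 0 ->
  (fun n => ip (F n) h) @ \oo --> ip f h.
Proof.
move=> iF fi hi F0; apply/subr_cvg0.
have : (fun n => Num.sqrt (n2 (fun x => F n x - f x)) * Num.sqrt (n2 h)) @ \oo --> 0.
  rewrite -[X in _ --> X](mul0r (Num.sqrt (n2 h))); apply: cvgM; last exact: cvg_cst.
  rewrite -sqrtr0; apply: (cvg_comp _ _ F0); exact: sqrt_continuous.
apply: norm_cvg0_le => n.
by rewrite -ipBl//; apply: ip_le => //; exact: L2B.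
Qed.

Lemma n2_cvg (F : nat -> T -> R) f : (forall n, L2 (F n)) -> L2 f ->
  (fun n => n2 (fun x => F n x - f x)) @ \oo --> 0 ->
  (fun n => n2 (F n)) @ \oo --> n2 f.
Proof.
move=> iF fi F0.
have -> : (fun n => n2 (F n)) =
  (fun n => n2 (fun x => F n x - f x) + 2 * ip (F n) f - n2 f).
  by apply/funext => n; rewrite n2B//; lra.
rewrite [X in _ --> X](_ : _ = 0 + 2 * ip f f - n2 f); last by rewrite ipff; lra.
apply: cvgB; [apply: cvgD => // | exact: cvg_cst].
by apply: cvgM; [exact: cvg_cst | exact: ip_cvg].
Qed.

Lemma n2_eq0 f : L2 f -> n2 f = 0 -> \forall x \ae mu, f x = 0.
Proof.
move=> [mf fi] f0; have := I_eq0 fi (fun x => sqr_ge0 _) f0.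
by apply: filterS => x /eqP; rewrite sqrf_eq0 => /eqP.
Qed.

Lemma n2_dct0 (F : nat -> T -> R) g : (forall n, measurable_fun setT (F n)) ->
  L2 g -> (forall n x, `|F n x| <= g x) ->
  (\forall x \ae mu, F ^~ x @ \oo --> 0) ->
  n2 (F n) @[n --> \oo] --> 0.
Proof.
move=> mF [mg gi] Fg F0; rewrite -(I0 mu); apply: (I_dct _ _ gi) => //.
- by move=> n; exact: measurable_funX.
- move=> n x; rewrite ger0_norm ?sqr_ge0// -(real_normK (num_real (F n x))).
  by rewrite ler_pXn2r ?nnegrE ?normr_ge0// (le_trans _ (Fg n x)).
- apply: filterS F0 => x Fx; rewrite -[X in _ --> X](mul0r 0).
  by under eq_fun do rewrite expr2; exact: cvgM.
Qed.

End L2_theory.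

Lemma powR_divr (R : realType) (x y r : R) : 0 < x -> 0 < y ->
  (x / y) `^ r = x `^ r * y `^ (- r).
Proof.
move=> x0 y0; rewrite powRM ?invr_ge0 ?(ltW x0) ?(ltW y0)//.
by rewrite -(powR_inv1 (ltW y0)) -powRrM mulN1r.
Qed.

(** The scale s = (Y/X)^(1/p) makes s^2 X and s^(2-p) Y equal, both being X^(1-2/p) Y^(2/p). *)
Lemma powR_balance (R : realType) (p X Y : R) : 0 < p -> 0 < X -> 0 < Y ->
  ((Y / X) `^ p^-1) ^+ 2 * X + (Y / X) `^ p^-1 `^ (2 - p) * Y =
  2 * (X `^ (1 - 2 / p) * Y `^ (2 / p)).
Proof.
move=> p0 X0 Y0; rewrite -(@powR_mulrn _ _ 2) ?powR_ge0// -!powRrM !powR_divr//.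
have -> : p^-1 * 2 = 2 / p by rewrite mulrC.
have -> : p^-1 * (2 - p) = 2 / p - 1 by field; rewrite gt_eqF.
rewrite opprB !powRB ?(gt_eqF X0) ?(gt_eqF Y0) ?implybT// powRN.
rewrite !powRr1 ?(ltW X0) ?(ltW Y0)//.
set a := X `^ _; set b := Y `^ _; have a0 : a != 0 by rewrite gt_eqF// powR_gt0.
by field; rewrite a0 (gt_eqF Y0).
Qed.

(** * The space L^p *)

Section Lp_theory.
Context d (T : measurableType d) (R : realType)
  (mu : {measure set T -> \bar R}) (p : R).
Implicit Types (f g h : T -> R).

Notation I f := (Rintegral mu setT f).

Definition Lp f := measurable_fun setT f /\ rint mu (fun x => `|f x| `^ p).
Definition np f := I (fun x => `|f x| `^ p).

Lemma measurable_powR_norm f r : measurable_fun setT f ->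
  measurable_fun setT (fun x => `|f x| `^ r).
Proof.
move=> mf; apply: (measurableT_comp (measurable_powR r)).
exact: measurableT_comp.
Qed.

Lemma np_ge0 f : 0 <= np f.
Proof. by apply: I_ge0 => x; exact: powR_ge0. Qed.

Lemma Lp_dom f g c : 0 < p -> 0 <= c -> measurable_fun setT f -> Lp g ->
  (forall x, `|f x| <= c * `|g x|) -> Lp f /\ np f <= c `^ p * np g.
Proof.
move=> p0 c0 mf [mg gi] fg.
have H x : `|f x| `^ p <= c `^ p * `|g x| `^ p.
  by rewrite -powRM//; apply: powR_le => //; exact: ltW.
have fi : rint mu (fun x => `|f x| `^ p).
  apply: (rint_le _ (rintZ (c `^ p) gi)); first exact: measurable_powR_norm.
  by move=> x; rewrite ger0_norm ?powR_ge0.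
split; first by split.
by rewrite /np -IZ//; apply: I_le => //; exact: rintZ.
Qed.

Lemma LpZ c f : 0 < p -> Lp f -> Lp (fun x => c * f x).
Proof.
move=> p0 Lf; have [mf _] := Lf.
apply: (proj1 (@Lp_dom _ f `|c| _ _ _ Lf _)) => //; first exact: measurable_funM.
by move=> x; rewrite normrM.
Qed.

Lemma npN f : np (fun x => - f x) = np f.
Proof. by apply: I_eq => x; rewrite normrN. Qed.

Lemma Lp0 : 0 < p -> Lp (fun=> 0).
Proof.
move=> p0; split => //.
by apply: rint_eq (rint0 _) => x; rewrite normr0 powR0// gt_eqF.
Qed.

Lemma np_eq0 f : Lp f -> np f = 0 -> \forall x \ae mu, f x = 0.
Proof.
move=> [mf fi] f0; have := I_eq0 fi (fun x => powR_ge0 _ _) f0.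
by apply: filterS => x /powR_eq0_eq0 /normr0_eq0.
Qed.

Lemma Lp_psi_rint f g : 2 < p -> Lp f -> Lp g ->
  rint mu (fun x => psi p (f x) * g x).
Proof.
move=> hp [mf fi] [mg gi]; apply: (rint_le _ (rintD fi gi)).
  apply: measurable_funM => //; apply: measurable_funM => //.
  exact: measurable_powR_norm.
by move=> x; exact: psi_mul_le.
Qed.

Lemma Lp_sqr_rint f g : 2 < p -> Lp f -> Lp g ->
  rint mu (fun x => `|f x| `^ (p - 2) * g x ^+ 2).
Proof.
move=> hp [mf fi] [mg gi]; apply: (rint_le _ (rintD fi gi)).
  apply: measurable_funM; first exact: measurable_powR_norm.
  exact: measurable_funX.
by move=> x; rewrite ger0_norm ?powR_sqr_le// mulr_ge0 ?powR_ge0 ?sqr_ge0.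
Qed.

Lemma LpD f g : 2 < p -> Lp f -> Lp g ->
  Lp (fun x => f x + g x) /\ np (fun x => f x + g x) <= 2 `^ p * (np f + np g).
Proof.
move=> hp [mf fi] [mg gi].
have mfg : measurable_fun setT (fun x => f x + g x) by exact: measurable_funD.
have i2 : rint mu (fun x => 2 `^ p * (`|f x| `^ p + `|g x| `^ p)).
  by apply: rintZ; exact: rintD.
have fgi : rint mu (fun x => `|f x + g x| `^ p).
  apply: (rint_le _ i2); first exact: measurable_powR_norm.
  by move=> x; rewrite ger0_norm ?powR_ge0// powRD_le.
split; first by split.
rewrite /np -ID// -IZ; last exact: rintD.
by apply: I_le => // x; exact: powRD_le.
Qed.

Lemma LpB f g : 2 < p -> Lp f -> Lp g ->
  Lp (fun x => f x - g x) /\ np (fun x => f x - g x) <= 2 `^ p * (np f + np g).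
Proof.
move=> hp Lf Lg; rewrite -(npN g); apply: LpD => //.
have := @LpZ (-1) g; rewrite (_ : (fun x => -1 * g x) = fun x => - g x).
  by apply => //; lra.
by apply/funext => x; rewrite mulN1r.
Qed.

(* The factor 2 comes from optimising [powR_sqr_le_scale] over the scale. *)
Lemma Lp_sqr_le f g : 2 < p -> Lp f -> Lp g ->
  I (fun x => `|f x| `^ (p - 2) * g x ^+ 2) <=
    2 * (np f `^ (1 - 2 / p) * np g `^ (2 / p)).
Proof.
move=> hp Lf Lg; have [mf fi] := Lf; have [mg gi] := Lg.
have p0 : 0 < p by lra.
have S s : 0 < s -> I (fun x => `|f x| `^ (p - 2) * g x ^+ 2) <=
    s ^+ 2 * np f + s `^ (2 - p) * np g.
  move=> s0; rewrite /np -!IZ// -ID; try exact: rintZ.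
  apply: I_le; [exact: Lp_sqr_rint | by apply: rintD; exact: rintZ |].
  by move=> x; exact: powR_sqr_le_scale.
have [f0|f0] := eqVneq (np f) 0.
  rewrite f0 powR0 ?mul0r ?mulr0; last first.
    by rewrite gt_eqF// subr_gt0 ltr_pdivrMr//; lra.
  rewrite (I_ae (g := fun=> 0)) ?I0//.
  - exact: rint_measurable (Lp_sqr_rint hp Lf Lg).
  - have := np_eq0 Lf f0; apply: filterS => x ->.
    by rewrite normr0 powR0 ?mul0r// gt_eqF//; lra.
have [g0|g0] := eqVneq (np g) 0.
  rewrite g0 powR0 ?mulr0; last by rewrite gt_eqF// divr_gt0.
  rewrite (I_ae (g := fun=> 0)) ?I0//.
  - exact: rint_measurable (Lp_sqr_rint hp Lf Lg).
  - have := np_eq0 Lg g0; apply: filterS => x ->.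
    by rewrite expr0n mulr0.
have {}f0 : 0 < np f by rewrite lt_neqAle eq_sym f0 np_ge0.
have {}g0 : 0 < np g by rewrite lt_neqAle eq_sym g0 np_ge0.
have := S _ (powR_gt0 p^-1 (divr_gt0 g0 f0)).
by rewrite (powR_balance p0 f0 g0).
Qed.

End Lp_theory.

(** * Affine changes of variables *)

Section lebesgue_affine.
Context (R : realType).

Let aff1 (a c : R) (t : measurableTypeR R) : measurableTypeR R := a * t + c.

Let measurable_aff1 a c : measurable_fun setT (aff1 a c).
Proof. by apply: measurable_funD => //; apply: measurable_funM. Qed.

(** The measure [m2], [a] times the image of Lebesgue measure under t -> a t + c, agrees with
    Lebesgue measure on half-open intervals, hence everywhere. *)
Lemma lebesgue_measure_affine (a c : R) (f : measurableTypeR R -> \bar R) :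
  0 < a -> measurable_fun setT f -> (forall x, (0 <= f x)%E) ->
  (\int[lebesgue_measure]_x f (a * x + c)%R =
   (a^-1)%:E * \int[lebesgue_measure]_x f x)%E.
Proof.
move=> a0 mf f0.
pose m1 : {measure set (measurableTypeR R) -> \bar R} :=
  measure_function_pushforward__canonical__measure_function_Measure
    lebesgue_measure (measurable_aff1 a c).
pose m2 : {measure set (measurableTypeR R) -> \bar R} :=
  mscale (NngNum (ltW a0)) m1.
have E : (\int[lebesgue_measure]_x f x = \int[m2]_x f x)%E.
  apply: eq_measure_integral => A mA _.
  apply: lebesgue_measure_unique mA => _ [[b d]] _ <-.
  have -> : m2 [set` `]b, d]] = (a%:E * lebesgue_measure (aff1 a c @^-1` [set` `]b, d]]))%E by [].
  have -> : aff1 a c @^-1` [set` `]b, d]] = [set` `](b - c) / a, (d - c) / a]].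
    apply/seteqP; split => t /=; rewrite /aff1 !in_itv/= ltr_pdivrMr// ler_pdivlMr//;
      by rewrite mulrC ltrBlDr lerBrDr.
  rewrite !lebesgue_measure_itv/= !lte_fin ltr_pM2r ?invr_gt0// ltrD2r.
  case: ifPn => _; last by rewrite mule0.
  by rewrite -!EFinB -EFinM; congr EFin; field; rewrite gt_eqF.
rewrite E /m2 ge0_integral_mscale//= muleA -EFinM mulVf ?gt_eqF// mul1e.
by rewrite ge0_integral_pushforward.
Qed.

Lemma lebesgue_rVS n (f : 'rV[R]_n.+1 -> \bar R) :
  measurable_fun setT f -> (forall x, (0 <= f x)%E) ->
  (\int[lebesgue_rV n.+1]_x f x =
   \int[lebesgue_measure]_t \int[lebesgue_rV n]_v f (cons_rV (t, v)))%E.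
Proof.
move=> mf f0; rewrite /= /cons_measure.
rewrite [LHS](ge0_integral_pushforward (@measurable_cons_rV R n))//.
rewrite preimage_setT (fubini_tonelli1 (f \o @cons_rV R n))//.
  by apply: measurableT_comp => //; exact: measurable_cons_rV.
by move=> x; exact: f0.
Qed.

Lemma measurable_affine n (a : R) (c : 'rV[R]_n) :
  measurable_fun setT (fun x : 'rV[R]_n => a *: x + c).
Proof.
apply: measurable_fun_rV => i; under eq_fun do rewrite !mxE.
by apply: measurable_funD => //; apply: measurable_funM => //; exact: measurable_coord.
Qed.

Lemma cons_rV_affine n (a : R) (c : 'rV[R]_n.+1) t v :
  a *: cons_rV (t, v) + c =
  cons_rV (a * t + c 0 0, a *: v + \row_i c 0 (lift ord0 i)).
Proof.
apply/rowP => i; rewrite !mxE /=; case: unliftP => [j|] -> /=; by rewrite ?mxE.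
Qed.

Lemma lebesgue_rV_affine n (a : R) (c : 'rV[R]_n) (f : 'rV[R]_n -> \bar R) :
  0 < a -> measurable_fun setT f -> (forall x, (0 <= f x)%E) ->
  (\int[lebesgue_rV n]_x f (a *: x + c)%R =
   ((a ^+ n)^-1)%:E * \int[lebesgue_rV n]_x f x)%E.
Proof.
move=> a0; elim: n c f => [|n IH] c f mf f0.
  rewrite expr0 invr1 mul1e; apply: eq_integral => x _.
  by congr f; rewrite thinmx0; apply/esym; rewrite thinmx0.
have mfa : measurable_fun setT (fun x : 'rV[R]_n.+1 => f (a *: x + c)).
  by apply: measurableT_comp => //; exact: measurable_affine.
rewrite !lebesgue_rVS//.
set c' : 'rV_n := \row_i c 0 (lift ord0 i).
have mc t : measurable_fun setT (fun v => f (cons_rV (t, v))).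
  apply: measurableT_comp => //.
  by apply: (measurableT_comp (@measurable_cons_rV R n)); exact: measurable_pair1.
pose F (t : measurableTypeR R) := (\int[lebesgue_rV n]_v f (cons_rV (t, v)))%E.
have mF : measurable_fun setT F.
  apply: (@measurable_fun_fubini_tonelli_F _ _ _ _ _ _
    (fun z => f (cons_rV z))) => //.
  by apply: measurableT_comp => //; exact: measurable_cons_rV.
have F0 t : (0 <= F t)%E by exact: integral_ge0.
transitivity (\int[lebesgue_measure]_t (((a ^+ n)^-1)%:E * F (a * t + c 0 0)%R))%E.
  apply: eq_integral => t _; rewrite -(IH c')//.
  by apply: eq_integral => v _; rewrite cons_rV_affine.
rewrite ge0_integralZl; first 1 last.
- exact: measurableT.
- exact: (measurableT_comp mF (measurable_aff1 a (c 0 0))).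
- by move=> t _; exact: F0.
- by rewrite lee_fin invr_ge0 exprn_ge0// ltW.
by rewrite (lebesgue_measure_affine (c 0 0) a0 mF F0) muleA -EFinM -invfM -exprSr.
Qed.

End lebesgue_affine.

(** * Topology and measurability in R^n *)

Section rV_topology.
Context (R : realType) (n : nat).
Implicit Types (x y : 'rV[R]_n) (r : R).

Lemma norm_rV_leP x r : 0 <= r -> reflect (forall i, `|x 0 i| <= r) (`|x| <= r).
Proof.
move=> r0; rewrite -[X in X <= _]/(mx_norm x) mx_normrE.
apply: (iffP idP) => [/bigmax_leP[_ H] i|H]; first exact: (H (0, i)).
by apply/bigmax_leP; split => // -[i j] _ /=; rewrite (ord1 i).
Qed.

Lemma norm_rV_ltP x r : 0 < r -> reflect (forall i, `|x 0 i| < r) (`|x| < r).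
Proof.
move=> r0; rewrite -[X in X < _]/(mx_norm x) mx_normrE.
apply: (iffP idP) => [/bigmax_ltP[_ H] i|H]; first exact: (H (0, i)).
by apply/bigmax_ltP; split => // -[i j] _ /=; rewrite (ord1 i).
Qed.

Lemma norm_coord_le x i : `|x 0 i| <= `|x|.
Proof. by apply/norm_rV_leP. Qed.

Lemma countable_union_measurable d (T : measurableType d) (J : countType)
    (P : set J) (F : J -> set T) : (forall j, measurable (F j)) ->
  measurable (\bigcup_(j in P) F j).
Proof.
move=> mF.
have -> : \bigcup_(j in P) F j =
    \bigcup_k (if unpickle k is Some j then (if j \in P then F j else set0) else set0).
  apply/seteqP; split => [t [j Pj Fj]|t [k _]].
    by exists (pickle j) => //; rewrite pickleK mem_set.
  case: unpickle => [j|//]; case: ifPn => // /set_mem Pj Fj; by exists j.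
apply: bigcupT_measurable => k; case: unpickle => [j|//].
by case: ifPn.
Qed.

Lemma measurable_rV_box (A : 'I_n -> set (measurableTypeR R)) :
  (forall i, measurable (A i)) ->
  measurable [set x : 'rV[R]_n | forall i, A i (x 0 i)].
Proof.
move=> mA.
have -> : [set x : 'rV[R]_n | forall i, A i (x 0 i)] =
    \big[setI/setT]_(i < n)
      ((fun x : 'rV[R]_n => x 0 i : measurableTypeR R) @^-1` A i).
  rewrite -bigcap_seq; apply/seteqP; split => [x Ax i _|x Ax i]; first exact: Ax.
  by apply: Ax => /=; rewrite mem_index_enum.
apply: bigsetI_measurable => i _; rewrite -[X in measurable X]setTI.
exact: measurable_coord.
Qed.

(** Measurable sets are generated by the coordinates, not by the topology. The link is that an open
    set is the union of the countably many boxes it contains with rational centre and half-width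
    1/(k+1). *)
Lemma open_measurable_rV (U : set 'rV[R]_n) : open U -> measurable U.
Proof.
move=> oU.
pose B (q : 'rV[rat]_n * nat) : set 'rV[R]_n :=
  [set x | forall i, x 0 i \in
    `](ratr (q.1 0 i) - (q.2.+1%:R)^-1), (ratr (q.1 0 i) + (q.2.+1%:R)^-1)[].
have -> : U = \bigcup_(q in [set q | B q `<=` U]) B q.
  apply/seteqP; split => [x Ux|x [q]]; last exact.
  have /nbhs_ballP[e /= e0 eU] : nbhs x U by exact: open_nbhs_nbhs.
  have [k ke] : exists k : nat, (k.+1%:R^-1 : R) < e / 2.
    have e20 : 0 < e / 2 by rewrite divr_gt0.
    exists (Num.truncn (e / 2)^-1); rewrite -[ltRHS]invrK ltf_pV2 ?posrE ?invr_gt0//.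
    exact: truncnS_gt.
  set d : R := k.+1%:R^-1 in ke.
  have d0 : 0 < d by rewrite invr_gt0.
  have /(_ _)/cid-/all_sig[q Hq] : forall i, exists q : rat, ratr q \in `](x 0 i - d), (x 0 i + d)[.
    by move=> i; apply: rat_in_itvoo; lra.
  exists (\row_i q i, k).
    move=> y /= By; apply: eU; rewrite mx_norm_ball /ball_ /=.
    apply/norm_rV_ltP => // i; have := By i; have := Hq i; rewrite -/d !mxE /= !in_itv /=.
    by move=> /andP[? ?] /andP[? ?]; rewrite ltr_norml; apply/andP; split; lra.
  by move=> i; have := Hq i; rewrite mxE /= -/d !in_itv/= => /andP[? ?]; apply/andP; split; lra.
apply: countable_union_measurable => q.
by apply: (@measurable_rV_box (fun i => [set` _])) => i; exact: measurable_itv.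
Qed.

Lemma continuous_measurable_rV (f : 'rV[R]_n -> R) : continuous f ->
  measurable_fun setT f.
Proof.
move=> cf; apply: (@measurability _ _ _ _ _ _ (@RGenOpens.G R)).
  exact: RGenOpens.measurableE.
move=> _ [_ [a [b ->]] <-]; rewrite setTI; apply: open_measurable_rV.
by apply: open_comp => //= x _; exact: cf.
Qed.

End rV_topology.

(** * Scaling and translation of integrals on R^N *)

Section rV_integrals.
Context (R : realType) (N : nat).
Notation mu := (lebesgue_rV N : {measure set 'rV[R]_N -> \bar R}).
Notation I f := (Rintegral mu setT f).
Implicit Types (f g : 'rV[R]_N -> R) (a h : R) (c : 'rV[R]_N).

Let scale_ge0 a c f : 0 < a -> rint mu f -> (forall x, 0 <= f x) ->
  rint mu (fun x => f (a *: x + c)) /\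
  I (fun x => f (a *: x + c)) = (a ^+ N)^-1 * I f.
Proof.
move=> a0 fi f0.
have mf : measurable_fun setT (EFin \o f) by exact: measurable_int fi.
have E : (\int[mu]_x (f (a *: x + c))%:E = ((a ^+ N)^-1)%:E * (I f)%:E)%E.
  by rewrite EFin_I// -(lebesgue_rV_affine c a0 mf).
split; last by rewrite /Rintegral E -EFinM.
apply/integrableP; split.
  exact: (measurableT_comp mf (measurable_affine a c)).
under eq_integral do rewrite /= ger0_norm//.
by rewrite E -EFinM ltry.
Qed.

Lemma rint_affine a c f : 0 < a -> rint mu f ->
  rint mu (fun x => f (a *: x + c)).
Proof.
move=> a0 fi; have [i1 _] := scale_ge0 c a0 (rint_norm fi) (fun x => normr_ge0 _).
apply: (rint_le _ i1) => //.
exact: (measurableT_comp (rint_measurable fi) (measurable_affine a c)).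
Qed.

(** The formula holds for non-negative integrands, and [f] is the difference of f + |f| and |f|. *)
Lemma I_affine a c f : 0 < a -> rint mu f ->
  I (fun x => f (a *: x + c)) = (a ^+ N)^-1 * I f.
Proof.
move=> a0 fi; have i1 := rint_norm fi; have i2 := rintD fi i1.
have [j1 e1] := scale_ge0 c a0 i1 (fun x => normr_ge0 _).
have [|j2 e2] := scale_ge0 c a0 i2.
  by move=> x; have := ler_norm (- f x); rewrite normrN; lra.
transitivity (I (fun x => f (a *: x + c) + `|f (a *: x + c)|) -
              I (fun x => `|f (a *: x + c)|)).
  by rewrite -IB//; apply: I_eq => x; rewrite addrK.
by rewrite e1 e2 ID//; lra.
Qed.

Lemma measurable_comp_affine a c f : measurable_fun setT f ->
  measurable_fun setT (fun x : 'rV[R]_N => f (a *: x + c)).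
Proof. by move=> mf; exact: (measurableT_comp mf (measurable_affine a c)). Qed.

Lemma L2_affine a c f : 0 < a -> L2 mu f -> L2 mu (fun x => f (a *: x + c)).
Proof.
move=> a0 [mf fi]; split; first exact: measurable_comp_affine.
exact: (rint_affine c a0 fi).
Qed.

Lemma n2_affine a c f : 0 < a -> L2 mu f ->
  n2 mu (fun x => f (a *: x + c)) = (a ^+ N)^-1 * n2 mu f.
Proof. by move=> a0 [mf fi]; exact: (I_affine c a0 fi). Qed.

Lemma ip_affine a c f g : 0 < a -> L2 mu f -> L2 mu g ->
  ip mu (fun x => f (a *: x + c)) (fun x => g (a *: x + c)) =
  (a ^+ N)^-1 * ip mu f g.
Proof.
by move=> a0 fi gi; have := I_affine c a0 (L2_rint_mul fi gi).
Qed.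

Lemma Lp_affine p a c f : 0 < a -> Lp mu p f -> Lp mu p (fun x => f (a *: x + c)).
Proof.
move=> a0 [mf fi]; split; first exact: measurable_comp_affine.
exact: (rint_affine c a0 fi).
Qed.

Definition tau c f : 'rV[R]_N -> R := fun x => f (x + c).

Let tauE c f : tau c f = fun x => f (1 *: x + c).
Proof. by apply/funext => x; rewrite scale1r. Qed.

Lemma measurable_tau c f : measurable_fun setT f ->
  measurable_fun setT (tau c f).
Proof. by rewrite tauE; exact: measurable_comp_affine. Qed.

Lemma rint_tau c f : rint mu f -> rint mu (tau c f).
Proof. by rewrite tauE; apply: rint_affine. Qed.

Lemma I_tau c f : rint mu f -> I (tau c f) = I f.
Proof. by move=> fi; rewrite tauE I_affine// expr1n invr1 mul1r. Qed.

Lemma L2_tau c f : L2 mu f -> L2 mu (tau c f).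
Proof. by rewrite tauE; apply: L2_affine. Qed.

Lemma n2_tau c f : L2 mu f -> n2 mu (tau c f) = n2 mu f.
Proof. by move=> fi; rewrite tauE n2_affine// expr1n invr1 mul1r. Qed.

Lemma ip_tau c f g : L2 mu f -> L2 mu g ->
  ip mu (tau c f) (tau c g) = ip mu f g.
Proof. by move=> fi gi; rewrite !tauE ip_affine// expr1n invr1 mul1r. Qed.

Lemma Lp_tau p c f : Lp mu p f -> Lp mu p (tau c f).
Proof. by rewrite tauE; apply: Lp_affine. Qed.

Lemma tauK c f : tau (- c) (tau c f) = f.
Proof. by apply/funext => x; rewrite /tau subrK. Qed.

Lemma tauNK c f : tau c (tau (- c) f) = f.
Proof. by apply/funext => x; rewrite /tau addrK. Qed.

End rV_integrals.

(** * Test functions *)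

Section flat_functions.
Context (R : realType).
Implicit Types (P : {poly R}) (t h : R).

Lemma quad_is_derive (f : R -> R) x l C :
  (forall h, `|f (x + h) - f x - h * l| <= C * h ^+ 2) -> is_derive x 1 f l.
Proof.
move=> H.
have cv : (fun h => h^-1 *: ((f \o shift x) (h *: (1 : R)) - f x)) @ 0^' --> l.
  apply/cvgrPdist_le => /= e e0.
  have C1 : 0 < `|C| + 1 by rewrite ltr_wpDl.
  near=> h.
  have h0 : h != 0 by near: h; exact: nbhs_dnbhs_neq.
  have hn : 0 < `|h| by rewrite normr_gt0.
  rewrite /= -[h *: 1]/(h * 1) mulr1 (addrC h).
  have -> : l - h^-1 *: (f (x + h) - f x) = - (h^-1 * (f (x + h) - f x - h * l)).
    by rewrite -[_ *: _]/(_ * _); field.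
  rewrite normrN normrM normfV ler_pdivrMl//.
  apply: le_trans (H h) _.
  apply: (@le_trans _ _ (`|C| * `|h| ^+ 2)).
    by rewrite real_normK ?num_real// ler_wpM2r ?sqr_ge0// ler_norm.
  have : `|h| <= e / (`|C| + 1).
    near: h; apply: dnbhs0_le; by rewrite divr_gt0.
  rewrite ler_pdivlMr// => he; rewrite mulrC expr2 -mulrA ler_pM2l//.
  by apply: le_trans he; rewrite ler_wpM2l// lerDl.
by apply: DeriveDef; [apply/cvg_ex; exists l | exact: cvg_lim cv].
Unshelve. all: by end_near. Qed.

(** The classical smooth functions that are flat at 0. The polynomial is a parameter because
    differentiation only replaces P by X^2 (P - P'). *)
Definition flat P t : R := if 0 < t then P.[t^-1] * expR (- t^-1) else 0.

Lemma exprn_le_expR k (y : R) : 0 <= y -> y ^+ k <= k%:R ^+ k * expR y.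
Proof.
move=> y0; case: k => [|k]; first by rewrite !expr0 mul1r; rewrite -expR0 ler_expR.
have -> : expR y = expR (y / k.+1%:R) ^+ k.+1.
  by rewrite -expRM_natl mulrC divfK.
rewrite -exprMn ler_pXn2r ?nnegrE ?mulr_ge0 ?expR_ge0//.
rewrite mulrC -ler_pdivrMr ?ltr0n//; apply: le_trans (expR_ge1Dx _).
by rewrite lerDr.
Qed.

Lemma horner_le_expR P k : exists2 C : R, 0 <= C &
  forall y, 0 <= y -> `|P.[y]| * y ^+ k <= C * expR y.
Proof.
elim/poly_ind: P k => [|P c IH] k.
  by exists 0 => // y y0; rewrite horner0 normr0 !mul0r.
have [C C0 HC] := IH k.+1.
exists (C + `|c| * k%:R ^+ k) => [|y y0].
  by rewrite addr_ge0// mulr_ge0// exprn_ge0.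
rewrite hornerD hornerM hornerX hornerC [leRHS]mulrDl.
have h1 := ler_wpM2l (normr_ge0 c) (exprn_le_expR k y0); rewrite mulrA in h1.
apply: le_trans (lerD (HC y y0) h1).
rewrite exprS mulrA -mulrDl ler_wpM2r ?exprn_ge0//.
by apply: le_trans (ler_normD _ _) _; rewrite normrM (ger0_norm y0).
Qed.

(** Quadratic decay is what [quad_is_derive] needs to give the derivative 0 at the origin. *)
Lemma flat_quad P : exists C : R, forall h, `|flat P h| <= C * h ^+ 2.
Proof.
have [C C0 HC] := horner_le_expR P 2; exists C => h; rewrite /flat.
case: ifPn => h0; last by rewrite normr0 mulr_ge0 ?sqr_ge0.
have y0 : 0 < h^-1 by rewrite invr_gt0.
have := HC _ (ltW y0); rewrite normrM (gtr0_norm (expR_gt0 _)) expRN.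
rewrite -ler_pdivlMr ?exprn_gt0// => H.
rewrite ler_pdivrMr ?expR_gt0//; apply: le_trans H _.
by rewrite exprVn invrK mulrAC.
Qed.

Lemma is_derive_flat P t :
  is_derive t 1 (flat P) (flat ('X^2 * (P - P^`())) t).
Proof.
have [t0|t0|->] := ltrgtP t 0.
- rewrite [X in is_derive _ _ _ X](_ : _ = 0); last first.
    by rewrite /flat ifN// -leNgt ltW.
  apply: (@near_eq_is_derive R R R (cst 0)).
  near=> s; have s0 : s < 0 by near: s; exact: lt_nbhsl.
  by rewrite /flat ifN// -leNgt ltW.
- pose g s := P.[s^-1] * expR (- s^-1).
  apply: (@near_eq_is_derive _ _ _ g).
    near=> s; have s0 : 0 < s by near: s; exact: lt_nbhsr.
    by rewrite /flat s0.
  have dV : is_derive t 1 (fun s : R => s^-1) (- t ^- 2).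
    have := @is_deriveV R id t 1 1; rewrite gt_eqF// => /(_ isT (is_derive_id _ _)).
    by rewrite -[_ *: 1]/(_ * 1) mulr1.
  have dP := @is_derive1_comp R (horner P) (fun s : R => s^-1) t _ _
    (is_derive_poly P t^-1) dV.
  have dE := @is_derive1_comp R expR (fun s : R => - s^-1) t _ _
    (is_derive_expR (- t^-1)) (is_deriveN dV).
  have := is_deriveM dP dE; rewrite -[_ * _ : R -> R]/g => dg.
  rewrite [X in is_derive _ _ _ X](_ : _ = P.[t^-1] *: (expR (- t^-1) * - - t ^- 2) +
    expR (- t^-1) *: (P^`().[t^-1] * - t ^- 2)); first exact: dg.
  rewrite /flat t0 !hornerE /=.
  by rewrite /GRing.scale/=; field; rewrite gt_eqF.
have [C HC] := flat_quad P.
rewrite [X in is_derive _ _ _ X](_ : _ = 0); last by rewrite /flat ltxx.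
apply: (@quad_is_derive _ _ _ C) => h.
by rewrite add0r /flat ltxx mulr0 !subr0; exact: HC.
Unshelve. all: by end_near. Qed.

Lemma flat1_ge0 t : 0 <= flat 1 t.
Proof. by rewrite /flat; case: ifP => // _; rewrite hornerC mul1r expR_ge0. Qed.

Lemma flat1_le1 t : flat 1 t <= 1.
Proof.
rewrite /flat; case: ifP => // t0; rewrite hornerC mul1r -expR0 ler_expR.
by rewrite oppr_le0 invr_ge0 ltW.
Qed.

Lemma flat1_cvg t : (fun n => flat 1 (n%:R * t)) @ \oo --> ((0 < t)%R%:R : R).
Proof.
have [t0|t0] := ltP 0 t; last first.
  rewrite (_ : (fun n => _) = fun=> 0); first exact: cvg_cst.
  apply/funext => n; rewrite /flat ifN// -leNgt.
  by rewrite mulr_ge0_le0.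
have E : (fun n => expR (- (t^-1 * (n.+1%:R^-1)))) @ \oo --> (1 : R).
  have c : - (t^-1 * (n.+1%:R^-1)) @[n --> \oo] --> (0 : R).
    rewrite -[X in _ --> X]oppr0 -[X in _ --> - X](mulr0 t^-1).
    by apply: cvgN; apply: cvgM; [exact: cvg_cst | exact: cvg_harmonic].
  by have := cvg_comp _ _ c (@continuous_expR R 0); rewrite expR0.
rewrite -(cvg_shiftS); apply: cvg_trans E; apply: near_eq_cvg.
apply: nearW => n; rewrite /= /flat mulr_gt0// hornerC mul1r invfM.
by rewrite mulrC.
Qed.

End flat_functions.

Section bumps.
Context (R : realType) (N : nat).
Implicit Types (f g : 'rV[R]_N -> R) (c : 'rV[R]_N).

Notation e_ i := (delta_mx 0 i : 'rV[R]_N).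

(* The point of this algebra is that it is closed under partial derivatives. *)
Inductive bump : ('rV[R]_N -> R) -> Prop :=
| bump_cst a : bump (fun=> a)
| bump_flat P j a b : bump (fun x => flat P (a * x 0 j + b))
| bump_add f g : bump f -> bump g -> bump (fun x => f x + g x)
| bump_mul f g : bump f -> bump g -> bump (fun x => f x * g x).

Lemma bump_scale a f : bump f -> bump (fun x => a * f x).
Proof. by move=> bf; exact: (bump_mul (bump_cst a) bf). Qed.

Lemma bump_prod (J : Type) (s : seq J) (F : J -> 'rV[R]_N -> R) :
  (forall j, bump (F j)) -> bump (fun x => \prod_(j <- s) F j x).
Proof.
move=> bF; elim: s => [|j s IH].
  by under eq_fun do rewrite big_nil; exact: bump_cst.
by under eq_fun do rewrite big_cons; exact: bump_mul.
Qed.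

Lemma is_derive_line (f : 'rV[R]_N -> R) x v l :
  is_derive (0 : R) 1 (fun h : R => f (h *: v + x)) l -> is_derive x v f l.
Proof.
have E : (fun h : R => h^-1 *: (((fun h : R => f (h *: v + x)) \o shift 0)
    (h *: (1 : R)) - f (0 *: v + x))) =
    (fun h : R => h^-1 *: ((f \o shift x) (h *: v) - f x)).
  by apply/funext => h /=; rewrite scale0r add0r addr0 -[h *: 1]/(h * 1) mulr1.
by move=> [d1 d2]; split; rewrite /derivable /derive -E.
Qed.

Lemma bump_is_derive f i : bump f ->
  exists2 g, bump g & forall x, is_derive x (e_ i) f (g x).
Proof.
elim => {f} [a|P j a b|f g bf [f' bf' df] bg [g' bg' dg]|f g bf [f' bf' df] bg [g' bg' dg]].
- by exists (fun=> 0) => [|x]; [exact: bump_cst | exact: is_derive_cst].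
- pose Q := 'X^2 * (P - P^`()) : {poly R}.
  exists (fun x => (a * (i == j)%:R) * flat Q (a * x 0 j + b)) => [|x].
    by apply: bump_scale; exact: bump_flat.
  apply: is_derive_line.
  have E : (fun h : R => flat P (a * (h *: e_ i + x) 0 j + b)) =
     flat P \o (fun h : R => (a * (i == j)%:R) * h + (a * x 0 j + b)).
    apply/funext => h /=; congr flat; rewrite !mxE eqxx /= eq_sym; ring.
  rewrite E; have d1 : is_derive (0 : R) 1
      (fun h : R => (a * (i == j)%:R) * h + (a * x 0 j + b)) (a * (i == j)%:R).
    apply: (@quad_is_derive _ _ _ _ 0) => h; rewrite add0r mul0r mulr0 add0r.
    by rewrite addrK mulrC subrr normr0.
  have := @is_derive1_comp R (flat P) _ 0 _ _ (is_derive_flat P _) d1.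
  by rewrite mulr0 add0r [X in is_derive _ _ _ X -> _]mulrC.
- by exists (fun x => f' x + g' x) => [|x]; [exact: bump_add | exact: is_deriveD].
- exists (fun x => f x * g' x + g x * f' x) => [|x].
    by apply: bump_add; exact: bump_mul.
  exact: is_deriveM.
Qed.

Lemma flat_continuous P : continuous (@flat R P).
Proof.
move=> t; apply/differentiable_continuous/derivable1_diffP.
by have [] := is_derive_flat P t.
Qed.

Lemma bump_continuous f : bump f -> continuous f.
Proof.
elim => {f} [a|P j a b|f g bf cf bg cg|f g bf cf bg cg] x.
- exact: cst_continuous.
- apply: (@continuous_comp _ _ _ (fun x : 'rV[R]_N => a * x 0 j + b) (flat P));
    last exact: flat_continuous.
  apply: continuousD; last exact: cst_continuous.
  by apply: continuousM; [exact: cst_continuous | exact: coord_continuous].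
- exact: (continuousD (cf x) (cg x)).
- exact: (continuousM (cf x) (cg x)).
Qed.

Lemma bump_partial f s : bump f -> bump (foldr (@partial R N) f s).
Proof.
move=> bf; elim: s => [//|i s IH] /=.
have [g bg dg] := bump_is_derive i IH.
suff -> : partial i (foldr (@partial R N) f s) = g by [].
by apply/funext => x; have [] := dg x.
Qed.

Lemma bump_smooth f : bump f -> smooth f.
Proof.
move=> bf s psi; have bpsi : bump psi by exact: bump_partial.
split; first exact: bump_continuous.
by move=> i x; have [g bg dg] := bump_is_derive i bpsi; have [] := dg x.
Qed.

End bumps.

Import HBNNSimple.

(** * Density of smooth functions in L^2 *)

Section density.
Context (R : realType) (N : nat).
Notation mu := (lebesgue_rV N : {measure set 'rV[R]_N -> \bar R}).
Notation I f := (Rintegral mu setT f).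
Implicit Types (f g phi : 'rV[R]_N -> R) (A : set 'rV[R]_N).

(** The norm is the sup norm, so this ball is a box and its measure is a product of lengths. *)
Definition cube (r : R) : set 'rV[R]_N := [set x | `|x| < r].

Lemma cubeP r x : 0 < r -> cube r x <-> forall i, - r < x 0 i < r.
Proof.
move=> r0; split=> [/(norm_rV_ltP _ r0) H i|H]; first by rewrite -ltr_norml.
by apply/(norm_rV_ltP _ r0) => i; rewrite ltr_norml.
Qed.

Lemma measurable_cube r : measurable (cube r).
Proof.
apply: open_measurable_rV.
have -> : cube r = (fun x : 'rV[R]_N => `|x|) @^-1` [set t | t < r] by [].
apply: open_comp; last exact: open_lt.
by move=> x _; exact: norm_continuous.
Qed.

Lemma mu_cube_fin r : (mu (cube r) < +oo)%E.
Proof.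
have [r0|r0] := ltP 0 r; last first.
  rewrite (_ : cube r = set0) ?measure0//; apply/seteqP; split => // x /= xr.
  by have := lt_le_trans xr r0; rewrite ltNge normr_ge0.
have -> : cube r = [set x | forall i, (fun=> `](- r), r[%classic) i (x 0 i)].
  apply/seteqP; split => x.
    by move/(cubeP _ r0) => H i; rewrite /= in_itv/=; exact: H.
  by move=> H; apply/(cubeP _ r0) => i; have := H i; rewrite /= in_itv.
rewrite [X in (X < _)%E](@lebesgue_rV_box R N (fun=> `](- r), r[%classic)); last first.
  by move=> i; exact: measurable_itv.
rewrite (eq_bigr (fun=> (r + r)%:E)); last first.
  move=> i _; rewrite lebesgue_measure_itv /= lte_fin.
  by rewrite ifT ?opprK//; lra.
by rewrite prodEFin ltry.
Qed.

Lemma rint_indic A : measurable A -> (mu A < +oo)%E -> rint mu (\1_A : _ -> R).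
Proof.
move=> mA fA; apply/integrableP; split.
  by apply/measurable_EFinP; exact: measurable_indic.
under eq_integral do rewrite /= ger0_norm//.
by rewrite integral_indic// setIT.
Qed.

(** The approximants vanish off one fixed cube, which makes them test functions by [bump_test]. *)
Definition approximable r f := forall eps : R, 0 < eps ->
  exists phi, [/\ bump phi, forall x, ~ cube r x -> phi x = 0,
    L2 mu phi & n2 mu (fun x => phi x - f x) < eps].

Lemma approximableD r f g : L2 mu f -> L2 mu g ->
  approximable r f -> approximable r g -> approximable r (fun x => f x + g x).
Proof.
move=> Lf Lg af ag eps eps0; have e4 : 0 < eps / 4 by rewrite divr_gt0.
have [p [bp p0 Lp_ np]] := af _ e4; have [q [bq q0 Lq nq]] := ag _ e4.
exists (fun x => p x + q x); split; first exact: bump_add.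
- by move=> x xr; rewrite p0// q0// addr0.
- exact: L2D.
- have -> : (fun x => p x + q x - (f x + g x)) = fun x => (p x - f x) + (q x - g x).
    by apply/funext => x; ring.
  apply: le_lt_trans (n2D_le (L2B Lp_ Lf) (L2B Lq Lg)) _; lra.
Qed.

Lemma approximableZ r a f : L2 mu f -> approximable r f ->
  approximable r (fun x => a * f x).
Proof.
move=> Lf af eps eps0.
have e1 : 0 < eps / (a ^+ 2 + 1) by rewrite divr_gt0// ltr_wpDl// sqr_ge0.
have [p [bp p0 Lp_ np]] := af _ e1.
exists (fun x => a * p x); split; first exact: bump_scale.
- by move=> x xr; rewrite p0// mulr0.
- exact: L2Z.
- have -> : (fun x => a * p x - a * f x) = fun x => a * (p x - f x).
    by apply/funext => x; ring.
  rewrite n2Z; last exact: L2B.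
  move: np; rewrite ltr_pdivlMr; last by rewrite ltr_wpDl// sqr_ge0.
  by have := n2_ge0 mu (fun x => p x - f x); lra.
Qed.

Lemma approximable0 r : approximable r (fun=> 0).
Proof.
move=> eps eps0; exists (fun=> 0); split => //; first exact: bump_cst.
  exact: L20.
by under eq_fun do rewrite subrr; rewrite n20.
Qed.

Lemma approximable_lim r f (F : nat -> 'rV[R]_N -> R) : L2 mu f ->
  (forall n, L2 mu (F n)) -> (forall n, approximable r (F n)) ->
  n2 mu (fun x => F n x - f x) @[n --> \oo] --> 0 -> approximable r f.
Proof.
move=> Lf LF aF F0 eps eps0; have e4 : 0 < eps / 4 by rewrite divr_gt0.
have [n Hn] : exists n, n2 mu (fun x => F n x - f x) < eps / 4.
  move/cvgrPdist_lt : F0 => /(_ _ e4) [n _ Hn]; exists n.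
  have := Hn n (leqnn n); rewrite /= sub0r normrN ger0_norm//; exact: n2_ge0.
have [p [bp p0 Lp_ np]] := aF n _ e4.
exists p; split => //.
have -> : (fun x => p x - f x) = fun x => (p x - F n x) + (F n x - f x).
  by apply/funext => x; ring.
by apply: le_lt_trans (n2D_le (L2B Lp_ (LF n)) (L2B (LF n) Lf)) _; lra.
Qed.

Lemma L2_indic A : measurable A -> (mu A < +oo)%E -> L2 mu (\1_A : _ -> R).
Proof.
move=> mA fA; split; first exact: measurable_indic.
apply: rint_eq (rint_indic mA fA) => x.
by rewrite indicE; case: (x \in A); rewrite ?expr1n ?expr0n.
Qed.

Lemma mu_cap_fin A r : measurable A -> (mu (A `&` cube r) < +oo)%E.
Proof.
move=> mA; apply: le_lt_trans (mu_cube_fin r).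
apply: le_measure; rewrite ?inE//; last exact: measurable_cube.
by apply: measurableI => //; exact: measurable_cube.
Qed.

Lemma L2_indic_cap A r : measurable A -> L2 mu (\1_(A `&` cube r) : _ -> R).
Proof.
move=> mA; apply: L2_indic; last exact: mu_cap_fin.
by apply: measurableI => //; exact: measurable_cube.
Qed.

Lemma L2_indic_cube r : L2 mu (\1_(cube r) : _ -> R).
Proof. by apply: L2_indic; [exact: measurable_cube | exact: mu_cube_fin]. Qed.

Lemma cvg_prod_seq (J : Type) (s : seq J) (F : nat -> J -> R) (l : J -> R) :
  (forall j, F ^~ j @ \oo --> l j) ->
  (fun n => \prod_(j <- s) F n j) @ \oo --> \prod_(j <- s) l j.
Proof.
move=> Fl; elim: s => [|j s IH].
  by under eq_fun do rewrite big_nil; rewrite big_nil; exact: cvg_cst.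
by under eq_fun do rewrite big_cons; rewrite big_cons; exact: cvgM.
Qed.

Let rays := [set A : set 'rV[R]_N |
  exists a : 'I_N -> R, A = [set x | forall i, a i < x 0 i]].

(** Orthants are stable under intersection, as Dynkin's theorem requires, and within a cube their
    indicators are limits of products of [flat] functions. *)
Lemma rV_measurable_rays : @measurable _ 'rV[R]_N = <<s rays >>.
Proof.
apply/seteqP; split; last first.
  apply: smallest_sub; first exact: sigma_algebra_measurable.
  move=> _ [a ->]; have := @measurable_rV_box R N (fun i => `]a i, +oo[%classic).
  move=> /(_ (fun i => measurable_itv _)); congr measurable.
  by apply/seteqP; split => x H i; have := H i; rewrite /= in_itv/= andbT.
apply: smallest_sub; first exact: smallest_sigma_algebra.
move=> A; rewrite -bigcup_seq => -[i _ [B mB <-]]; rewrite setTI.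
pose rT := g_sigma_algebraType rays.
have mc : measurable_fun [set: rT] (fun x : rT => (x : 'rV[R]_N) 0 i : measurableTypeR R).
  apply: (@measurability _ _ _ _ _ _ (@RGenOInfty.G R)).
    exact: RGenOInfty.measurableE.
  move=> _ [_ [a ->] <-]; rewrite setTI.
  (* A half-space is the union of the orthants whose other coordinates are bounded below by -k. *)
  have -> : (fun x : rT => (x : 'rV[R]_N) 0 i) @^-1` `]a, +oo[%classic =
     \bigcup_k ([set x : 'rV[R]_N | forall j, (if j == i then a else - k%:R) < x 0 j] : set rT).
    apply/seteqP; split => x /=; rewrite in_itv/= andbT.
      move=> ax; exists (Num.truncn `|x : 'rV[R]_N|).+1 => // j.
      case: eqP => [->//|_].
      have := norm_coord_le (x : 'rV[R]_N) j; rewrite ler_norml => /andP[+ _].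
      by apply: lt_le_trans; rewrite ltrN2; exact: truncnS_gt.
    by move=> [k _ /(_ i)]; rewrite eqxx.
  apply: bigcupT_measurable => k; apply: sub_sigma_algebra.
  by exists (fun j => if j == i then a else - k%:R).
by have := mc measurableT B mB; rewrite setTI.
Qed.

Let approximable_ray r (a : 'I_N -> R) :
  approximable r (\1_([set x : 'rV[R]_N | forall i, a i < x 0 i] `&` cube r)).
Proof.
have [r0|r0] := ltP 0 r; last first.
  rewrite (_ : \1__ = fun=> 0); first exact: approximable0.
  apply/funext => x; rewrite indicE memNset// => -[_ /=].
  by move=> /lt_le_trans/(_ r0); rewrite ltNge normr_ge0.
set B := (X in \1_X).
pose m i := Num.max (a i) (- r).
(* Each factor vanishes off ]m i, r[ and tends to 1 on it, so the product tends to the indicator of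
   the box. *)
pose F n (x : 'rV[R]_N) : R :=
  \prod_i (flat 1 (n%:R * (x 0 i - m i)) * flat 1 (n%:R * (r - x 0 i))).
have bF n : bump (F n).
  apply: bump_prod => i; apply: bump_mul.
    have := @bump_flat R N 1 i n%:R (- n%:R * m i); congr bump.
    by apply/funext => x; rewrite mulrBr mulNr.
  have := @bump_flat R N 1 i (- n%:R) (n%:R * r); congr bump.
  by apply/funext => x; rewrite mulrBr mulNr addrC.
have mF n : measurable_fun setT (F n).
  by apply: continuous_measurable_rV; apply: bump_continuous; exact: bF.
have F0 n x : ~ cube r x -> F n x = 0.
  move=> xr; have [i Hi] : exists i, ~~ (- r < x 0 i < r).
    apply/existsP; apply: contra_notT xr; rewrite negb_exists => /forallP H.
    by apply/(cubeP _ r0) => i; have := H i; rewrite negbK.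
  rewrite /F (bigD1 i)//=; apply/eqP; rewrite mulf_eq0; apply/orP; left.
  rewrite mulf_eq0; move: Hi; rewrite negb_and -!leNgt => /orP[h|h]; apply/orP.
    left; rewrite /flat ifN// -leNgt mulr_ge0_le0// subr_le0 le_max h orbT//.
  by right; rewrite /flat ifN// -leNgt mulr_ge0_le0// subr_le0.
have F01 n x : 0 <= F n x <= 1.
  apply/andP; split.
    by apply: prodr_ge0 => i _; rewrite mulr_ge0// flat1_ge0.
  apply: prodr_ile1 => i _; rewrite mulr_ge0 ?flat1_ge0//=.
  by rewrite mulr_ile1 ?flat1_ge0 ?flat1_le1.
have dF n x : `|F n x - \1_B x| <= (\1_(cube r) x : R).
  have [xr|xr] := pselect (cube r x); last first.
    rewrite F0// /B !indicE memNset; last by case.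
    by rewrite memNset// subrr normr0.
  rewrite [X in _ <= X]indicE mem_set// indicE.
  have /andP[? ?] := F01 n x.
  by case: (x \in B); rewrite /= ?mulr1n ?mulr0n ler_norml; apply/andP; split; lra.
have LB : L2 mu (\1_B : _ -> R).
  apply: L2_indic_cap; rewrite rV_measurable_rays; apply: sub_sigma_algebra.
  by exists a.
have LF n : L2 mu (F n).
  apply: (proj1 (@L2_dom _ _ _ _ _ (\1_(cube r)) 1 _ _ _)) => //.
    exact: L2_indic_cube.
  move=> x; rewrite mul1r; have [xr|xr] := pselect (cube r x); last by rewrite F0// normr0.
  rewrite indicE mem_set// normr1; have /andP[? ?] := F01 n x.
  by rewrite ger0_norm.
apply: (@approximable_lim r _ F) => //.
  move=> n eps e0; exists (F n); split; [exact: bF|exact: F0|exact: LF|].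
  by under eq_fun do rewrite subrr; rewrite n20.
apply: (n2_dct0 _ (L2_indic_cube r)) => //.
  by move=> n; apply: measurable_funB => //; case: LB.
apply: nearW => x; apply/subr_cvg0.
have -> : \1_B x = \prod_i (((0 < x 0 i - m i)%R%:R : R) * ((0 < r - x 0 i)%R%:R : R)).
  rewrite indicE; have [Bx|Bx] := pselect (B x).
    rewrite mem_set//; case: Bx => Bx /(cubeP _ r0) xr; rewrite big1// => i _.
    have /andP[? ?] := xr i; rewrite !subr_gt0 /m gt_max (Bx i).
    by rewrite (_ : - r < x 0 i)// (_ : x 0 i < r)// mul1r.
  rewrite memNset//; apply/esym.
  have [i Hi] : exists i, ~~ ((m i < x 0 i) && (x 0 i < r)).
    apply/existsP; apply: contra_notT Bx; rewrite negb_exists => /forallP H; split.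
      by move=> i; have := H i; rewrite negbK /m gt_max => /andP[/andP[]].
    apply/(cubeP _ r0) => i; have := H i; rewrite negbK /m gt_max.
    by move=> /andP[/andP[_ ->] ->].
  rewrite (bigD1 i)//= !subr_gt0; move: Hi.
  by case: (m i < _); case: (_ < r) => //= _; rewrite ?mul0r ?mulr0 ?mul0r.
by apply: cvg_prod_seq => i; apply: cvgM; exact: flat1_cvg.
Qed.

Lemma approximable_indic r A : measurable A -> approximable r (\1_(A `&` cube r)).
Proof.
have AT : approximable r (\1_([set: 'rV[R]_N] `&` cube r)).
  have [r0|r0] := ltP 0 r; last first.
    rewrite (_ : _ `&` _ = [set x : 'rV[R]_N | forall i, 0 < x 0 i] `&` cube r).
      exact: approximable_ray.
    apply/seteqP; split => x [_ /=] /lt_le_trans/(_ r0);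
      by rewrite ltNge normr_ge0.
  rewrite (_ : _ `&` _ = [set x : 'rV[R]_N | forall i, - r < x 0 i] `&` cube r).
    exact: (approximable_ray r (fun=> - r)).
  apply/seteqP; split => x [_ xr]; split => //.
  by move=> i; have /(_ i)/andP[] := (cubeP x r0).1 xr.
have LT := L2_indic_cap r (measurableT : measurable [set: 'rV[R]_N]).
rewrite rV_measurable_rays; move: A.
apply: (@dynkin_induction _ _ rays (fun A => approximable r (\1_(A `&` cube r))));
  [exact: rV_measurable_rays | | exact: AT | | | ].
- move=> _ _ [a ->] [b ->]; exists (fun i => Num.max (a i) (b i)).
  apply/seteqP; split => x /=.
    by move=> [ax bx] i; rewrite gt_max ax bx.
  by move=> H; split=> i; have := H i; rewrite gt_max => /andP[].
- by move=> _ [a ->]; exact: approximable_ray.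
- move=> S mS aS.
  have := approximableD LT (L2Z (-1) (L2_indic_cap r mS)) AT
    (approximableZ (-1) (L2_indic_cap r mS) aS).
  congr approximable; apply/funext => x; rewrite mulN1r !indicE !in_setI in_setT in_setC.
  by case: (x \in S); case: (x \in cube r); rewrite /= ?subr0 ?subrr.
- move=> F mF tF aF.
  have mU : measurable (\bigcup_k F k) by exact: bigcupT_measurable.
  pose S n x : R := \sum_(k < n) \1_(F k `&` cube r) x.
  have LS n : L2 mu (S n).
    elim: n => [|n IH].
      rewrite (_ : S 0%N = fun=> 0); first exact: L20.
      by apply/funext => x; rewrite /S big_ord0.
    rewrite (_ : S n.+1 = fun x => S n x + \1_(F n `&` cube r) x).
      by apply: L2D => //; exact: L2_indic_cap.
    by apply/funext => x; rewrite /S big_ord_recr.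
  apply: (@approximable_lim r _ S) => //.
  + exact: L2_indic_cap.
  + elim=> [|n IH].
      rewrite (_ : S 0%N = fun=> 0); first exact: approximable0.
      by apply/funext => x; rewrite /S big_ord0.
    rewrite (_ : S n.+1 = fun x => S n x + \1_(F n `&` cube r) x).
      by apply: approximableD => //; exact: L2_indic_cap.
    by apply/funext => x; rewrite /S big_ord_recr.
  (* Disjointness makes the partial sum the indicator of a finite union, so it is at most 1 and
     dominated convergence applies. *)
  have SE n x : S n x = `[< exists2 k, (k < n)%N & (F k `&` cube r) x >]%:R.
    case: asboolP => [[k kn Fk]|H]; rewrite /S.
      rewrite (bigD1 (Ordinal kn))//= indicE mem_set// big1 ?addr0// => j jk.
      rewrite indicE memNset// => -[Fj _]; move/eqP: jk; apply; apply/val_inj => /=.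
      by apply: (tF j k) => //; exists x; split => //; case: Fk.
    by apply: big1 => j _; rewrite indicE memNset// => Fj; apply: H; exists j.
  apply: (n2_dct0 _ (L2_indic_cube r)).
  + by move=> n; apply: measurable_funB; [case: (LS n) | case: (L2_indic_cap r mU)].
  + move=> n x; rewrite SE; have [xr|xr] := pselect (cube r x); last first.
      rewrite asboolF; last by move=> [k _ []].
      by rewrite !indicE !memNset ?subrr ?normr0// => -[].
    rewrite [X in _ <= X]indicE mem_set// indicE.
    by case: asboolP => _; case: (_ \in _);
      rewrite /= ?mulr1n ?mulr0n ?subrr ?subr0 ?sub0r ?normrN ?normr0 ?normr1 ?ler01.
  + apply: nearW => x; apply/subr_cvg0; rewrite indicE.
    have [[[k _ Fk] xr]|Ux] := pselect ((\bigcup_k F k `&` cube r) x).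
      rewrite mem_set; last by split => //; exists k.
      apply: cvg_near_cst; exists k.+1 => // n /= kn; apply/eqP; rewrite SE.
      by rewrite asboolT//; exists k.
    rewrite memNset//; apply: cvg_near_cst; apply: nearW => n; apply/eqP; rewrite SE.
    by rewrite asboolF// => -[k kn [Fk xr]]; case: Ux; split => //; exists k.
Qed.

Let approximable_ge0 r f : L2 mu f -> (forall x, 0 <= f x) ->
  (forall x, ~ cube r x -> f x = 0) -> approximable r f.
Proof.
move=> Lf f0 fr; have mf : measurable_fun setT (EFin \o f).
  by apply/measurable_EFinP; case: Lf.
pose g := nnsfun_approx measurableT mf.
have gcv x : g^~ x @ \oo --> f x.
  have : EFin \o g^~ x @ \oo --> (EFin \o f) x.
    by apply: cvg_nnsfun_approx => // y _; rewrite lee_fin.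
  by move/fine_cvg.
have gf n x : 0 <= g n x <= f x.
  apply/andP; split; first by [].
  by rewrite -(cvg_lim _ (gcv x))//; apply: nondecreasing_cvgn_le;
    [move=> a b ab; exact/lefP/nd_nnsfun_approx | apply/cvg_ex; exists (f x)].
have Lg n : L2 mu (g n).
  apply: (proj1 (@L2_dom _ _ _ _ _ f 1 _ _ _)) => //.
  move=> x; have /andP[? ?] := gf n x; rewrite mul1r !ger0_norm//.
apply: (@approximable_lim r f g) => //.
  move=> n; rewrite (_ : (g n : _ -> R) = fun x => \sum_(y <- finmap.enum_fset (fset_set (range (g n))))
      y * \1_(g n @^-1` [set y] `&` cube r) x); last first.
    apply/funext => x; have [xr|xr] := pselect (cube r x).
      rewrite [LHS]fimfunE fsbig_finite//=; apply: eq_bigr => y _.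
      by rewrite !indicE in_setI (mem_set xr) andbT.
    rewrite big1 => [|y _]; last by rewrite indicE memNset ?mulr0// => -[].
    by have := gf n x; rewrite fr// -eq_le => /eqP.
  have mA y : measurable (g n @^-1` [set y] : set 'rV[R]_N).
    rewrite -[X in measurable X]setTI; exact: measurable_funP.
  have : L2 mu (fun x => \sum_(y <- finmap.enum_fset (fset_set (range (g n))))
      y * \1_(g n @^-1` [set y] `&` cube r) x) /\
    approximable r (fun x => \sum_(y <- finmap.enum_fset (fset_set (range (g n))))
      y * \1_(g n @^-1` [set y] `&` cube r) x); last by case.
  elim: (finmap.enum_fset _) => [|y s [IH1 IH2]].
    by under eq_fun do rewrite big_nil; split; [exact: L20|exact: approximable0].
  under eq_fun do rewrite big_cons.
  have Li := L2_indic_cap r (mA y); split; first by apply: L2D => //; exact: L2Z.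
  apply: approximableD => //; first exact: L2Z.
  by apply: approximableZ => //; exact: approximable_indic.
apply: (n2_dct0 _ Lf).
- by move=> n; apply: measurable_funB; [exact: measurable_funP | case: Lf].
- by move=> n x; have /andP[? ?] := gf n x; rewrite ler_norml; apply/andP; split; lra.
- apply: nearW => x; apply/subr_cvg0.
  exact: gcv.
Qed.

Lemma bump_dense r f : L2 mu f -> (forall x, ~ cube r x -> f x = 0) ->
  approximable r f.
Proof.
move=> Lf fr.
have mn : measurable_fun setT (fun x => `|f x|).
  by apply: measurableT_comp => //; case: Lf.
have Ln : L2 mu (fun x => `|f x|).
  by apply: (proj1 (@L2_dom _ _ _ _ _ f 1 _ _ _)) => // x; rewrite mul1r normr_id.
have L1 := L2D Ln Lf.
have a1 : approximable r (fun x => `|f x| + f x).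
  apply: approximable_ge0 => // x; last by move=> /fr ->; rewrite normr0 addr0.
  by have := ler_norm (- f x); rewrite normrN; lra.
have a2 : approximable r (fun x => `|f x|).
  by apply: approximable_ge0 => // x /fr ->; rewrite normr0.
have := approximableD L1 (L2Z (-1) Ln) a1 (approximableZ (-1) Ln a2).
by congr approximable; apply/funext => x; ring.
Qed.

End density.

(** * Bounds on test functions and their increments *)

Section test_functions.
Context (R : realType) (N : nat).
Implicit Types (phi f : 'rV[R]_N -> R) (x c : 'rV[R]_N) (i : 'I_N) (h s : R).

Notation e_ i := (delta_mx 0 i : 'rV[R]_N).
Notation mu := (lebesgue_rV N : {measure set 'rV[R]_N -> \bar R}).

Lemma line_is_derive f x v s l : is_derive (x + s *: v) v f l ->
  is_derive s 1 (fun h : R => f (x + h *: v)) l.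
Proof.
have E : (fun h : R => h^-1 *: (((fun h : R => f (x + h *: v)) \o shift s)
    (h *: (1 : R)) - f (x + s *: v))) =
    (fun h : R => h^-1 *: ((f \o shift (x + s *: v)) (h *: v) - f (x + s *: v))).
  apply/funext => h /=; rewrite -[h *: 1]/(h * 1) mulr1; congr (_ *: (f _ - _)).
  by rewrite scalerDl addrA addrAC addrC addrA.
by move=> [d1 d2]; split; rewrite /derivable /derive E.
Qed.

Lemma lipschitz_of_derive (f df : R -> R) C :
  (forall s, is_derive s 1 f (df s)) -> (forall s, `|df s| <= C) ->
  forall a b, `|f b - f a| <= C * `|b - a|.
Proof.
move=> dfP dfC a b; wlog ab : a b / a <= b.
  move=> H; have [/H//|/ltW/H] := leP a b.
  by rewrite distrC (distrC a).
have [|c _ ->] := @MVT_segment R f df a b ab (fun z _ => dfP z).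
  apply: continuous_subspaceT => x.
  by apply/differentiable_continuous/derivable1_diffP; have [] := dfP x.
by rewrite normrM ler_wpM2r.
Qed.

Lemma norm_delta_mx i h : `|h *: e_ i| <= `|h|.
Proof.
apply/norm_rV_leP => // j; rewrite !mxE eqxx /=.
by case: (j == i); rewrite ?mulr1 ?mulr0 ?normr0.
Qed.

Lemma not_cube_tau r x h i : `|h| <= 1 -> ~ cube (r + 1) x -> ~ cube r (x + h *: e_ i).
Proof.
move=> h1 xr xh; apply: xr; rewrite /cube /=.
have -> : x = (x + h *: e_ i) - h *: e_ i by rewrite addrK.
apply: le_lt_trans (ler_normB _ _) _; rewrite ltr_leD//.
exact: le_trans (norm_delta_mx i h) h1.
Qed.

Lemma cube_le r s x : r <= s -> cube r x -> cube s x.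
Proof. by move=> rs xr; exact: lt_le_trans xr rs. Qed.

Lemma test_smooth_derive phi i x : smooth phi ->
  is_derive x (e_ i) phi (partial i phi x).
Proof. by move=> sphi; have [_ /(_ i x) d] := sphi [::]; split. Qed.

Lemma test_support phi : test_function phi -> exists2 r : R, 0 < r &
  (forall x, ~ cube r x -> phi x = 0) /\
  (forall i x, ~ cube r x -> partial i phi x = 0).
Proof.
move=> [sphi cphi]; have [M [Mr HM]] := compact_bounded cphi.
exists (`|M| + 1); first by rewrite ltr_wpDl.
have H x : ~ cube (`|M| + 1) x -> ~ closure [set x | phi x != 0] x.
  move=> xr xc; apply: xr; rewrite /cube /=.
  apply: (@le_lt_trans _ _ (`|M| + 1/2)); last lra.
  by apply: (HM (`|M| + 1/2)) => //; have := ler_norm M; lra.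
split=> [x /H xc|i x /H xc].
  by apply/eqP/negPn/negP => px; apply: xc; exact: subset_closure.
have nz : \forall y \near x, cst 0 y = phi y.
  have : open_nbhs x (~` closure [set x | phi x != 0]).
    by split => //; apply: closed_openC; exact: closed_closure.
  move/open_nbhs_nbhs; apply: filterS => y yc /=; apply/esym.
  by apply/eqP/negPn/negP => py; apply: yc; exact: subset_closure.
rewrite /partial -(near_eq_derive _ nz).
by rewrite derive_cst.
Qed.

Lemma test_measurable phi : smooth phi -> measurable_fun setT phi.
Proof. by move=> /(_ [::])[c _]; exact: continuous_measurable_rV. Qed.

Lemma partial_measurable phi i : smooth phi -> measurable_fun setT (partial i phi).
Proof. by move=> /(_ [:: i])[c _]; exact: continuous_measurable_rV. Qed.

Lemma test_bound phi : test_function phi -> exists r M : R, [/\ 0 < r, 0 <= M,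
  forall i x, `|partial i phi x| <= M * \1_(cube r) x,
  forall x, `|phi x| <= M * \1_(cube r) x &
  forall i x h, `|h| <= 1 -> `|phi (x + h *: e_ i) - phi x| <= M * `|h| * \1_(cube r) x].
Proof.
move=> tphi; have [r r0 [phi0 dphi0]] := test_support tphi.
have [sphi _] := tphi.
have bd f : continuous f -> (forall x, ~ cube r x -> f x = 0) ->
    exists2 M : R, 0 <= M & forall x, `|f x| <= M.
  move=> cf f0; pose K := [set x : 'rV[R]_N | `|x| <= r].
  have cK : compact K.
    apply: bounded_closed_compact.
      by exists r; split; [exact: num_real | move=> y ry x /= xr; exact: le_trans xr (ltW ry)].
    have -> : K = (fun x : 'rV[R]_N => `|x|) @^-1` [set t | t <= r] by [].
    apply: closed_comp; last exact: closed_le.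
    by move=> x _; exact: norm_continuous.
  have /compact_bounded[M [_ HM]] : compact (f @` K).
    by apply: continuous_compact => //; apply: continuous_subspaceT => x; exact: cf.
  exists (`|M| + 1); first by rewrite addr_ge0.
  move=> x; have [xr|xr] := pselect (cube r x); last by rewrite f0// normr0 addr_ge0.
  apply: (HM (`|M| + 1)); first by rewrite (le_lt_trans (ler_norm M))// ltrDl.
  by exists x => //=; exact: ltW.
have /(_ _)/cid2-/all_sig2[M M0 HM] i : exists2 M : R, 0 <= M &
    forall x, `|partial i phi x| <= M.
  by apply: bd; [have [] := sphi [:: i] | exact: dphi0].
have [M1 M10 HM1] : exists2 M : R, 0 <= M & forall x, `|phi x| <= M.
  by apply: bd => //; have [] := sphi [::].
pose L := M1 + \sum_i M i.
have S0 : 0 <= \sum_i M i by apply: sumr_ge0 => i _.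
have L0 : 0 <= L by rewrite addr_ge0.
have ML i : M i <= L.
  by rewrite /L (bigD1 i)//= addrCA lerDl addr_ge0// sumr_ge0.
have M1L : M1 <= L by rewrite lerDl.
have r1 : r <= r + 1 by lra.
have i1 x : ~ cube (r + 1) x -> (\1_(cube (r + 1)) x : R) = 0.
  by move=> xr; rewrite indicE memNset.
have i2 x : cube (r + 1) x -> (\1_(cube (r + 1)) x : R) = 1.
  by move=> xr; rewrite indicE mem_set.
have nr x : ~ cube (r + 1) x -> ~ cube r x by move=> H /(cube_le r1).
(* The margin 1 covers the supports of the translates by [h *: e_ i] with |h| <= 1. *)
exists (r + 1), L; split => //; first by lra.
- move=> i x; have [xr|xr] := pselect (cube (r + 1) x).
    by rewrite i2// mulr1 (le_trans (HM i x)).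
  by rewrite i1// mulr0 dphi0 ?normr0//; exact: nr.
- move=> x; have [xr|xr] := pselect (cube (r + 1) x).
    by rewrite i2// mulr1 (le_trans (HM1 x)).
  by rewrite i1// mulr0 phi0 ?normr0//; exact: nr.
- move=> i x h h1; have [xr|xr] := pselect (cube (r + 1) x); last first.
    rewrite i1// mulr0 !phi0 ?subrr ?normr0//; first exact: nr.
    exact: not_cube_tau.
  rewrite i2// mulr1.
  have := @lipschitz_of_derive (fun s => phi (x + s *: e_ i))
    (fun s => partial i phi (x + s *: e_ i)) L _ _ 0 h.
  rewrite scale0r addr0 subr0; apply => s.
    by apply: line_is_derive; exact: test_smooth_derive.
  exact: le_trans (HM i _) (ML i).
Qed.

(** Differentiability tested on sequences, the form in which dominated convergence can compute the
    derivative of an integral. *)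
Lemma seq_derive_cvg (f : R -> R) s l :
  (forall u : nat -> R, (forall n, u n != 0 /\ `|u n| <= 1) -> u @ \oo --> 0 ->
    (fun n => (u n)^-1 * (f (s + u n) - f s)) @ \oo --> l) ->
  is_derive s 1 f l.
Proof.
move=> H; have cv : (fun h => h^-1 *: ((f \o shift s) (h *: (1 : R)) - f s)) @ 0^' --> l.
  have -> : (fun h => h^-1 *: ((f \o shift s) (h *: (1 : R)) - f s)) =
      fun h => h^-1 * (f (s + h) - f s).
    by apply/funext => h /=; rewrite -[h *: 1]/(h * 1) mulr1 (addrC h).
  have K (u : nat -> R) : (forall n, u n != 0) -> u @ \oo --> 0 ->
      (fun n => (u n)^-1 * (f (s + u n) - f s)) @ \oo --> l.
    move=> u0 uc; have [n _ Hn] : \forall n \near \oo, `|u n| <= 1.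
      by move/cvgr0_norm_le : uc; apply; exact: ltr01.
    rewrite -(cvg_shiftn n); apply: (H (fun k => u (k + n)%N)).
      by move=> k; split => //; apply: Hn => /=; rewrite leq_addl.
    by rewrite (cvg_shiftn n u).
  by apply/cvgr_dnbhsP => u [u0 uc]; exact: K.
by apply: DeriveDef; [apply/cvg_ex; exists l | exact: cvg_lim cv].
Qed.

Lemma derive_seq_cvg (f : R -> R) s l : is_derive s 1 f l ->
  forall u : nat -> R, (forall n, u n != 0) -> u @ \oo --> 0 ->
  (fun n => (u n)^-1 * (f (s + u n) - f s)) @ \oo --> l.
Proof.
move=> [/cvg_ex[/= l' cv] dl] u u0 uc.
have {dl} E : l' = l by rewrite -dl; apply/esym/cvg_lim.
rewrite -{}E; have -> : (fun n => (u n)^-1 * (f (s + u n) - f s)) =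
    (fun h => h^-1 *: ((f \o shift s) (h *: (1 : R)) - f s)) \o u.
  apply/funext => n /=; rewrite -[_ *: 1]/(_ * 1) mulr1 (addrC (u n)) //.
apply: cvg_comp cv => A /= [e e0 He].
move/cvgr0_norm_lt : uc => /(_ e e0); apply: filterS => n un.
by apply: He => //=; rewrite sub0r normrN.
Qed.

Lemma bump_tau phi c : bump phi -> bump (tau c phi).
Proof.
rewrite /tau; elim => {phi} [a|P j a b|f g _ bf _ bg|f g _ bf _ bg].
- exact: bump_cst.
- have := @bump_flat R N P j a (a * c 0 j + b); congr bump.
  by apply/funext => x; rewrite mxE mulrDr addrA.
- exact: bump_add.
- exact: bump_mul.
Qed.

Lemma bump_test phi r : bump phi -> (forall x, ~ cube r x -> phi x = 0) ->
  test_function phi.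
Proof.
move=> bphi phi0; split; first exact: bump_smooth.
apply: (subclosed_compact (B := [set x : 'rV[R]_N | `|x| <= r])).
- exact: closed_closure.
- apply: bounded_closed_compact.
    by exists r; split; [exact: num_real | move=> y ry x /= xr; exact: le_trans xr (ltW ry)].
  have -> : [set x : 'rV[R]_N | `|x| <= r] = (fun x : 'rV[R]_N => `|x|) @^-1` [set t | t <= r] by [].
  apply: closed_comp; last exact: closed_le.
  by move=> x _; exact: norm_continuous.
- rewrite closureE; apply: smallest_sub => [|x /=].
    have -> : [set x : 'rV[R]_N | `|x| <= r] = (fun x : 'rV[R]_N => `|x|) @^-1` [set t | t <= r] by [].
    apply: closed_comp; last exact: closed_le.
    by move=> x _; exact: norm_continuous.
  move=> px; apply/ltW; have [//|xr] := pselect (cube r x).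
  by move: px; rewrite phi0// eqxx.
Qed.

End test_functions.

(** * Weak gradients and difference quotients *)

Section gradients.
Context (R : realType) (N : nat) (p : R).
Implicit Types (u v f g phi : 'rV[R]_N -> R) (G : 'rV[R]_N -> 'rV[R]_N)
  (x c : 'rV[R]_N) (i : 'I_N) (h s : R).

Notation e_ i := (delta_mx 0 i : 'rV[R]_N).
Notation mu := (lebesgue_rV N : {measure set 'rV[R]_N -> \bar R}).
Notation I f := (Rintegral mu setT f).

Lemma Lfun_Lp f r : 0 < r -> f \in Lfun mu r%:E <-> Lp mu r f.
Proof.
move=> r0; have E : (\int[mu]_x `|(f x)%:E| `^ r = \int[mu]_x (`|f x| `^ r)%:E)%E.
  by apply: eq_integral => x _; rewrite -poweR_EFin.
have n0 : (0 <= \int[mu]_x (`|f x| `^ r)%:E)%E.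
  by apply: integral_ge0 => x _; rewrite lee_fin powR_ge0.
split=> [|[mf fi]].
  rewrite inE => /andP[/[!inE]/= mf]; rewrite /finite_norm unlock /= => lf.
  split => //; apply/integrableP; split.
    exact/measurable_EFinP/measurable_powR_norm.
  under eq_integral do rewrite /= ger0_norm ?powR_ge0//.
  apply: (@lty_poweRy _ _ r^-1); first by rewrite gt_eqF// invr_gt0.
  by rewrite -E.
rewrite inE; apply/andP; split; rewrite inE/= //.
rewrite /finite_norm unlock /= E poweR_lty//.
have /integrableP[_] := fi.
by under eq_integral do rewrite /= ger0_norm ?powR_ge0//.
Qed.

Lemma Lp2_L2 f : Lp mu 2 f <-> L2 mu f.
Proof.
have E x : `|f x| `^ 2 = f x ^+ 2.
  by rewrite (@powR_mulrn _ _ 2)// real_normK ?num_real.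
by split=> -[mf fi]; split => //; apply: rint_eq fi => x; rewrite E.
Qed.

Lemma Lfun_L2 f : f \in Lfun mu 2%:E <-> L2 mu f.
Proof. by rewrite -Lp2_L2; exact: Lfun_Lp. Qed.

(* Dyadic steps, so that the squares of the increments of a function with a weak
   gradient are summable and its translates converge almost everywhere. *)
Definition hs (n : nat) : R := 2^-1 ^+ n.

Lemma hs_gt0 n : 0 < hs n.
Proof. by rewrite exprn_gt0// invr_gt0. Qed.

Lemma hs_le1 n : hs n <= 1.
Proof. by rewrite exprn_ile1 ?invr_ge0// invf_le1// ler1n. Qed.

Lemma hs_cvg0 : hs @ \oo --> 0.
Proof. by apply: cvg_expr; rewrite ger0_norm ?invr_ge0// invf_lt1// ltr1n. Qed.

Definition dq i h u : 'rV[R]_N -> R := fun x => h^-1 * (u (x + h *: e_ i) - u x).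

(* [G] is the weak gradient of [u], as a strong L^2 limit of difference quotients:
   in this form the calculus rules need no mollification. *)
Definition grad u G := [/\ Lp mu p u, forall i, L2 mu (fun x => G x 0 i),
  forall i n, L2 mu (dq i (hs n) u) &
  forall i, n2 mu (fun x => dq i (hs n) u x - G x 0 i) @[n --> \oo] --> 0].

Lemma rint_mul_cube u r : 2 < p -> Lp mu p u ->
  rint mu (fun x => `|u x| * \1_(cube r) x).
Proof.
move=> hp [mu_ ui]; have ci := rint_indic (@measurable_cube R N r) (@mu_cube_fin R N r).
apply: (rint_le _ (rintD ci ui)).
  apply: measurable_funM; first exact: measurableT_comp.
  by apply: measurable_indic; exact: measurable_cube.
move=> x; rewrite ger0_norm ?mulr_ge0// indicE.
case: (_ \in _); rewrite /= ?mulr1n ?mulr0n ?mulr0 ?add0r ?powR_ge0// mulr1.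
(* Taking a = 1 gives |u| <= 1 + |u|^p, which is integrable on a cube. *)
have := @psi_mul_le R p 1 (u x) hp; rewrite /psi normr1 !powR1 mul1r normrM normr1 mul1r.
by [].
Qed.

Lemma Lp_mul_L2_cube u r : 2 < p -> Lp mu p u ->
  L2 mu (fun x => u x * \1_(cube r) x).
Proof.
move=> hp [mu_ ui]; have ci := rint_indic (@measurable_cube R N r) (@mu_cube_fin R N r).
have mc : measurable_fun setT (fun x => u x * \1_(cube r) x).
  apply: measurable_funM => //.
  by apply: measurable_indic; exact: measurable_cube.
split => //; apply: (rint_le _ (rintD ci ui)); first exact: measurable_funX.
move=> x; rewrite ger0_norm ?sqr_ge0// indicE.
case: (_ \in _); rewrite /= ?mulr1n ?mulr0n ?mulr0 ?expr0n ?add0r ?powR_ge0// mulr1.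
by have := @powR_sqr_le R p 1 (u x) hp; rewrite normr1 !powR1 mul1r.
Qed.

Lemma rint_mul_bounded u f r M : 2 < p -> Lp mu p u -> measurable_fun setT f ->
  (forall x, `|f x| <= M * \1_(cube r) x) -> rint mu (fun x => u x * f x).
Proof.
move=> hp Lu mf fM; have [mu_ _] := Lu.
apply: (rint_le _ (rintZ M (rint_mul_cube r hp Lu))); first exact: measurable_funM.
by move=> x; rewrite normrM mulrCA ler_wpM2l.
Qed.

Lemma L2_bounded_cube f r M : 0 <= M -> measurable_fun setT f ->
  (forall x, `|f x| <= M * \1_(cube r) x) -> L2 mu f.
Proof.
move=> M0 mf fM; apply: (proj1 (@L2_dom _ _ _ _ _ (\1_(cube r)) M _ _ _)) => //.
  exact: L2_indic_cube.
by move=> x; rewrite (ger0_norm (_ : 0 <= \1_(cube r) x)).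
Qed.

Lemma test_L2 phi : test_function phi -> L2 mu phi.
Proof.
move=> tphi; have [r [M [r0 M0 _ H _]]] := test_bound tphi.
by apply: (L2_bounded_cube M0 _ H); apply: test_measurable; case: tphi.
Qed.

Lemma test_dq_cvg u phi i (d : nat -> R) : 2 < p -> Lp mu p u ->
  test_function phi -> (forall n, d n != 0) -> d @ \oo --> 0 ->
  I (fun x => u x * dq i (d n) phi x) @[n --> \oo] -->
  I (fun x => u x * partial i phi x).
Proof.
move=> hp Lu tphi d1 d0; have [sphi _] := tphi.
have [r [M [r0 M0 H1 H2 H3]]] := test_bound tphi.
have [mu_ _] := Lu; have mphi := test_measurable sphi.
have [n0 _ Hn0] : \forall n \near \oo, `|d n| <= 1.
  by move/cvgr0_norm_le : d0; apply; exact: ltr01.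
rewrite -(cvg_shiftn n0).
apply: (I_dct _ _ (rintZ M (rint_mul_cube r hp Lu))).
- move=> n; apply: measurable_funM => //; apply: measurable_funM => //.
  by apply: measurable_funB => //; exact: (measurable_tau (d (n + n0)%N *: e_ i) mphi).
- by apply: measurable_funM => //; exact: partial_measurable.
- move=> n x; rewrite normrM mulrCA ler_wpM2l// /dq normrM normfV.
  rewrite ler_pdivrMl ?normr_gt0//.
  by rewrite mulrA [_ * M]mulrC; apply: H3; apply: Hn0 => /=; rewrite leq_addl.
- apply: nearW => x; apply: cvgM; first exact: cvg_cst.
  have := @line_is_derive R N phi x (e_ i) 0 (partial i phi x).
  rewrite scale0r addr0 => /(_ (test_smooth_derive i x sphi)).
  move/derive_seq_cvg => /(_ d d1 d0).
  rewrite /dq; under eq_fun do rewrite add0r scale0r addr0.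
  by rewrite -(cvg_shiftn n0).
Qed.

Lemma I_tau_mul u phi c : rint mu (fun x => u x * phi (x + c)) ->
  I (fun x => u x * phi (x + c)) = I (fun x => u (x - c) * phi x).
Proof.
move=> ui; rewrite -(I_tau (- c) ui); apply: I_eq => x.
by rewrite /tau subrK.
Qed.

Lemma rint_test u phi c : 2 < p -> Lp mu p u -> test_function phi ->
  rint mu (fun x => u x * phi (x + c)).
Proof.
move=> hp Lu tphi; have [r [M [r0 M0 _ H _]]] := test_bound tphi.
have [sphi _] := tphi.
have := rint_mul_bounded hp (Lp_tau (- c) Lu) (test_measurable sphi) H.
move=> /(rint_tau c); apply: rint_eq => x.
by rewrite /tau addrK.
Qed.

(** Discrete integration by parts: translation invariance moves the difference quotient to the other
    factor and reverses its step. *)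
Lemma I_dq u phi i h : 2 < p -> Lp mu p u -> test_function phi -> h != 0 ->
  I (fun x => u x * dq i (- h) phi x) = - I (fun x => dq i h u x * phi x).
Proof.
move=> hp Lu tphi h0.
have i1 := rint_test (- (h *: e_ i)) hp Lu tphi.
have i0 := rint_test 0 hp Lu tphi.
have i2 := rint_test 0 hp (Lp_tau (h *: e_ i) Lu) tphi.
transitivity (- (h^-1 * (I (fun x => u x * phi (x - h *: e_ i)) -
   I (fun x => u x * phi (x + 0))))).
  rewrite -IB// -IZ; last exact: rintB.
  rewrite -[RHS]mulN1r -IZ; last by apply: rintZ; exact: rintB.
  by apply: I_eq => x; rewrite /dq addr0 invrN scaleNr; ring.
congr (- _); rewrite I_tau_mul//.
have -> : I (fun x => u (x - - (h *: e_ i)) * phi x) =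
    I (fun x => tau (h *: e_ i) u x * phi (x + 0)).
  by apply: I_eq => x; rewrite addr0 /tau opprK.
rewrite -IB// -IZ; last exact: rintB.
by apply: I_eq => x; rewrite /dq /tau !addr0; ring.
Qed.

Lemma bump_dense_seq r f : L2 mu f -> (forall x, ~ cube r x -> f x = 0) ->
  exists F : nat -> 'rV[R]_N -> R, [/\ forall n, bump (F n),
    forall n x, ~ cube r x -> F n x = 0, forall n, L2 mu (F n) &
    n2 mu (fun x => F n x - f x) @[n --> \oo] --> 0].
Proof.
move=> Lf fr; have H (n : nat) := bump_dense Lf fr (_ : 0 < n.+1%:R^-1).
have /(_ _)/cid-/all_sig[F HF] (n : nat) : exists phi, [/\ bump phi,
    forall x, ~ cube r x -> phi x = 0, L2 mu phi &
    n2 mu (fun x => phi x - f x) < n.+1%:R^-1].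
  by apply: bump_dense => //; rewrite invr_gt0.
exists F; split=> [n|n|n|]; try by have [] := HF n.
apply: (@norm_cvg0_le R _ (fun n => n.+1%:R^-1)); last exact: cvg_harmonic.
by move=> n; rewrite ger0_norm ?n2_ge0//; have [_ _ _ /ltW] := HF n.
Qed.

(** Membership in L^2 by duality. Testing with bumps that approximate w on a cube gives |w|^2 <= C
    |w| there, and Fatou's lemma lets the cube grow. *)
Lemma bump_bounded_L2 w C : 2 < p -> Lp mu p w -> 0 <= C ->
  (forall r phi, bump phi -> (forall x, ~ cube r x -> phi x = 0) -> L2 mu phi ->
    `|I (fun x => w x * phi x)| <= C * Num.sqrt (n2 mu phi)) ->
  L2 mu w /\ n2 mu w <= C ^+ 2.
Proof.
move=> hp Lw C0 H; have [mw _] := Lw.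
have K r : n2 mu (fun x => w x * \1_(cube r) x) <= C ^+ 2.
  set f := fun x => w x * \1_(cube r) x; have Lf : L2 mu f by exact: Lp_mul_L2_cube.
  have [x xr|F [bF F0 LF cF]] := @bump_dense_seq r f Lf.
    by rewrite /f indicE memNset// mulr0.
  have E n : ip mu (F n) f = I (fun x => w x * F n x).
    apply: I_eq => x; rewrite /f mulrCA mulrA indicE.
    have [xr|xr] := pselect (cube r x); first by rewrite mem_set// mulr1.
    by rewrite F0// mulr0 mul0r.
  have c1 := ip_cvg LF Lf Lf cF; rewrite ipff in c1.
  have c2 := n2_cvg LF Lf cF.
  have : n2 mu f <= C * Num.sqrt (n2 mu f).
    have c3 : C * Num.sqrt (n2 mu (F n)) @[n --> \oo] --> C * Num.sqrt (n2 mu f).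
      by apply: cvgM; [exact: cvg_cst | apply: (cvg_comp _ _ c2); exact: sqrt_continuous].
    apply: (le_cvg_seq c1 c3) => n.
    by rewrite E (le_trans (ler_norm _))//; exact: (H r _ (bF n) (F0 n) (LF n)).
  rewrite -{1}(sqr_sqrtr (n2_ge0 mu f)) -[X in _ -> X <= _](sqr_sqrtr (n2_ge0 mu f)).
  have := sqrtr_ge0 (n2 mu f); rewrite le_eqVlt => /predU1P[<- _|s0].
    by rewrite expr0n sqr_ge0.
  by rewrite expr2 ler_pM2r// => sC; rewrite ler_sqr ?nnegrE// ltW.
have [wi wC] : rint mu (fun x => w x ^+ 2) /\ I (fun x => w x ^+ 2) <= C ^+ 2.
  apply: (@I_fatou _ _ _ _ (fun n x => (w x * \1_(cube n%:R) x) ^+ 2)).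
  - by move=> n; case: (@Lp_mul_L2_cube w n%:R hp Lw).
  - exact: measurable_funX.
  - by move=> n x; exact: sqr_ge0.
  - move=> x; apply: cvg_near_cst; exists (Num.truncn `|x|).+1 => // n /= xn.
    rewrite indicE mem_set ?mulr1//= /cube /=.
    by apply: lt_le_trans (truncnS_gt _) _; rewrite ler_nat.
  - by move=> n; exact: K.
by split => //; split.
Qed.

(** As a function of s, the pairing [m s] of [phi] with the translate of [u] by s has as derivative
    the pairing of G_i with a translate of [phi], by definition of the weak gradient. Cauchy-Schwarz
    makes it Lipschitz. *)
Lemma weak_translation_bound u G i h phi r : 2 < p -> Lp mu p u ->
  L2_weak_gradient u G -> bump phi -> (forall x, ~ cube r x -> phi x = 0) ->
  L2 mu phi ->
  `|I (fun x => (u (x + h *: e_ i) - u x) * phi x)| <=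
    (Num.sqrt (n2 mu (fun x => G x 0 i)) * Num.sqrt (n2 mu phi)) * `|h|.
Proof.
move=> hp Lu [LG wG] bphi phi0 Lphi.
have tphi : test_function phi by exact: bump_test phi0.
have tt c : test_function (tau c phi).
  apply: (@bump_test _ _ _ (r + `|c|)); first exact: bump_tau.
  move=> x xr; rewrite /tau phi0// => xc; apply: xr; rewrite /cube /=.
  by rewrite -[x](addrK c) (le_lt_trans (ler_normB _ _))// ltrD2r.
pose m s := I (fun x => u x * phi (x + (- s) *: e_ i)).
pose dm s := I (fun x => G x 0 i * tau ((- s) *: e_ i) phi x).
have LGi : L2 mu (fun x => G x 0 i) by apply/Lfun_L2/LG.
have := @lipschitz_of_derive R m dm
  (Num.sqrt (n2 mu (fun x => G x 0 i)) * Num.sqrt (n2 mu phi)) _ _ 0 h.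
have mE s : m s = I (fun x => u (x + s *: e_ i) * phi x).
  rewrite /m I_tau_mul; last exact: rint_test.
  by apply: I_eq => x; rewrite scaleNr opprK.
have -> : m h - m 0 = I (fun x => (u (x + h *: e_ i) - u x) * phi x).
  rewrite !mE -IB.
  - by apply: I_eq => x; rewrite scale0r addr0 mulrBl.
  - have := rint_test 0 hp (Lp_tau (h *: e_ i) Lu) tphi.
    by apply: rint_eq => x; rewrite addr0.
  - have := rint_test 0 hp Lu tphi.
    by apply: rint_eq => x; rewrite scale0r !addr0.
rewrite subr0; apply => s; last first.
  rewrite -(n2_tau ((- s) *: e_ i) Lphi).
  by apply: ip_le => //; exact: L2_tau.
apply: seq_derive_cvg => d d1 d0.
have -> : dm s = - I (fun x => u x * partial i (tau ((- s) *: e_ i) phi) x).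
  by rewrite wG// opprK.
have -> : (fun n => (d n)^-1 * (m (s + d n) - m s)) =
  (fun n => - I (fun x => u x * dq i (- d n) (tau ((- s) *: e_ i) phi) x)).
  apply/funext => n; rewrite /m -IB; try exact: rint_test.
  rewrite -IZ; last by apply: rintB; exact: rint_test.
  have i3 : rint mu (fun x => u x * dq i (- d n) (tau ((- s) *: e_ i) phi) x).
    have := rintZ (- (d n)^-1) (rintB (rint_test (- d n *: e_ i) hp Lu (tt ((- s) *: e_ i)))
       (rint_test 0 hp Lu (tt ((- s) *: e_ i)))).
    by apply: rint_eq => x; rewrite /dq addr0 invrN; ring.
  rewrite -[RHS]mulN1r -IZ//; apply: I_eq => x; rewrite /dq /tau invrN.
  have -> : x + - (s + d n) *: e_ i = x + - d n *: e_ i + - s *: e_ i.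
    by rewrite opprD scalerDl -addrA [X in _ = x + X]addrC.
  by ring.
apply: cvgN; apply: (@test_dq_cvg u (tau ((- s) *: e_ i) phi) i (fun n => - d n)) => //.
  by move=> n; rewrite oppr_eq0; case: (d1 n).
by rewrite -oppr0; exact: cvgN.
Qed.

Lemma weak_translation u G i h : 2 < p -> Lp mu p u -> L2_weak_gradient u G ->
  L2 mu (fun x => u (x + h *: e_ i) - u x) /\
  n2 mu (fun x => u (x + h *: e_ i) - u x) <= h ^+ 2 * n2 mu (fun x => G x 0 i).
Proof.
move=> hp Lu wG.
have Lw := (LpB hp (Lp_tau (h *: e_ i) Lu) Lu).1.
have [||L2w n2w] := @bump_bounded_L2 (fun x => u (x + h *: e_ i) - u x)
  (Num.sqrt (n2 mu (fun x => G x 0 i)) * `|h|) hp Lw.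
- by rewrite mulr_ge0 ?sqrtr_ge0.
- move=> r phi bphi phi0 Lphi.
  by rewrite mulrAC; exact: weak_translation_bound wG bphi phi0 Lphi.
- split => //; apply: le_trans n2w _.
  by rewrite exprMn sqr_sqrtr ?n2_ge0// real_normK ?num_real// mulrC.
Qed.

(** Weak convergence with a norm bound is strong convergence: since |dq| <= |g|, one has |dq - g|^2
    <= 2 |g|^2 - 2 <dq, g>, and this tends to 0. *)
Lemma weak_dq_cvg u G i (d : nat -> R) : 2 < p -> Lp mu p u ->
  L2_weak_gradient u G -> (forall n, d n != 0) -> d @ \oo --> 0 ->
  n2 mu (fun x => dq i (d n) u x - G x 0 i) @[n --> \oo] --> 0.
Proof.
move=> hp Lu wG d1 d0; have LG j : L2 mu (fun x => G x 0 j).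
  by have [LG _] := wG; apply/Lfun_L2/LG.
have Ldq n : L2 mu (dq i (d n) u).
  by apply: L2Z; have [] := weak_translation i (d n) hp Lu wG.
pose g : 'rV[R]_N -> R := fun x => G x 0 i.
have Lg : L2 mu g := LG i.
have n2dq n : n2 mu (dq i (d n) u) <= n2 mu g.
  have [L1 n1] := weak_translation i (d n) hp Lu wG.
  rewrite /dq n2Z// -[leRHS]mul1r -(@mulVf _ (d n ^+ 2)) ?expf_neq0 //.
  by rewrite exprVn -mulrA ler_wpM2l// invr_ge0 sqr_ge0.
have weak r phi : bump phi -> (forall x, ~ cube r x -> phi x = 0) ->
    ip mu (dq i (d n) u) phi @[n --> \oo] --> ip mu g phi.
  move=> bphi phi0; have tphi : test_function phi by exact: bump_test phi0.
  have -> : ip mu g phi = - I (fun x => u x * partial i phi x).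
    by have [_ w] := wG; rewrite w// opprK.
  have -> : (fun n => ip mu (dq i (d n) u) phi) =
     fun n => - I (fun x => u x * dq i (- d n) phi x).
    by apply/funext => n; rewrite I_dq ?opprK//.
  apply: cvgN; apply: test_dq_cvg => //.
    by move=> n; rewrite oppr_eq0.
  by rewrite -oppr0; exact: cvgN.
(* The limit [g] is not a bump: it is cut to a large cube and approximated there, uniformly in n
   because |dq - g|^2 <= 4 |g|^2. *)
have ipg : ip mu (dq i (d n) u) g @[n --> \oo] --> n2 mu g.
  pose g_ (k : nat) x := g x * \1_(cube k%:R) x.
  have Lg_ k : L2 mu (g_ k).
    apply: (proj1 (@L2_dom _ _ _ _ _ g 1 _ _ _)) => //.
      apply: measurable_funM; first by case: Lg.
      by apply: measurable_indic; exact: measurable_cube.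
    by move=> x; rewrite normrM mul1r ler_piMr// indicE; case: (_ \in _);
      rewrite ?normr1 ?normr0.
  have g_cvg : n2 mu (fun x => g_ k x - g x) @[k --> \oo] --> 0.
    apply: (n2_dct0 (g := fun x => `|g x|)).
    - by move=> k; apply: measurable_funB; [case: (Lg_ k) | case: Lg].
    - apply: (proj1 (@L2_dom _ _ _ _ _ g 1 _ _ _)) => //.
        by apply: measurableT_comp => //; case: Lg.
      by move=> x; rewrite normr_id mul1r.
    - move=> k x; rewrite /g_ indicE; case: (_ \in _);
        by rewrite ?mulr1 ?mulr0 ?subrr ?normr0 ?sub0r ?normrN.
    - apply: nearW => x; apply: cvg_near_cst.
      exists (Num.truncn `|x|).+1 => // k /= xk.
      rewrite /g_ indicE mem_set ?mulr1 ?subrr//= /cube /=.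
      by apply: lt_le_trans (truncnS_gt _) _; rewrite ler_nat.
  have n2d n : n2 mu (fun x => dq i (d n) u x - g x) <= 4 * n2 mu g.
    apply: le_trans (n2B_le (Ldq n) Lg) _.
    by have := n2dq n; rewrite -/g; have := n2_ge0 mu g; lra.
  apply/cvgrPdist_le => e e0.
  (* it suffices to approximate [g] up to [dd] in the square norm *)
  pose dd := e ^+ 2 / 4 / (4 * n2 mu g + 1) / 4.
  have c0 : 0 < 4 * n2 mu g + 1 by have := n2_ge0 mu g; lra.
  have dd0 : 0 < dd by rewrite !divr_gt0// exprn_gt0.
  have [k gk] : exists k, n2 mu (fun x => g_ k x - g x) < dd.
    move/cvgrPdist_lt : g_cvg => /(_ _ dd0) [n _ Hn]; exists n.
    by have := Hn n (leqnn n); rewrite /= sub0r normrN ger0_norm ?n2_ge0.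
  have [|phi [bphi phi0 Lphi phig]] := @bump_dense R N k%:R (g_ k) (Lg_ k) _ dd dd0.
    by move=> x xk; rewrite /g_ indicE memNset// mulr0.
  have Lgp : L2 mu (fun x => g x - phi x) by exact: L2B.
  have gphi : n2 mu (fun x => g x - phi x) <= e ^+ 2 / 4 / (4 * n2 mu g + 1).
    rewrite (n2_subC mu g); have -> : (fun x => phi x - g x) =
        (fun x => (phi x - g_ k x) + (g_ k x - g x)).
      by apply/funext => x; ring.
    apply: le_trans (n2D_le (L2B Lphi (Lg_ k)) (L2B (Lg_ k) Lg)) _.
    by move: phig gk; rewrite /dd; lra.
  move/cvgrPdist_le : (weak _ _ bphi phi0) => /(_ (e / 2)).
  rewrite divr_gt0// => /(_ isT) [n0 _ Hn0]; exists n0 => // n /Hn0 /= H.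
  have Ld : L2 mu (fun x => dq i (d n) u x - g x) by apply: L2B; [exact: Ldq|exact: Lg].
  have -> : n2 mu g - ip mu (dq i (d n) u) g =
    (ip mu g phi - ip mu (dq i (d n) u) phi) -
    ip mu (fun x => dq i (d n) u x - g x) (fun x => g x - phi x).
    rewrite (ipBr Lg Lphi Ld) (ipBl (Ldq n) Lg Lg) (ipBl (Ldq n) Lg Lphi).
    by rewrite ipff; ring.
  apply: le_trans (ler_normB _ _) _; rewrite [e]splitr lerD//.
  rewrite -(ler_pXn2r (_ : 0 < 2)%N)// ?nnegrE ?divr_ge0// ?(ltW e0)//.
  rewrite real_normK ?num_real//; apply: le_trans (cauchy_schwarz Ld Lgp) _.
  apply: (@le_trans _ _ ((4 * n2 mu g + 1) * (e ^+ 2 / 4 / (4 * n2 mu g + 1)))).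
    apply: ler_pM; rewrite ?n2_ge0//.
    by apply: le_trans (n2d n) _; rewrite lerDl.
  rewrite mulrC divfK ?gt_eqF// expr_div_n.
  by rewrite (_ : 2 ^+ 2 = 4 :> R)//; ring.
have cB : n2 mu g - 2 * ip mu (dq i (d n) u) g + n2 mu g @[n --> \oo] --> 0.
  rewrite [X in _ --> X](_ : _ = n2 mu g - 2 * n2 mu g + n2 mu g); last by ring.
  apply: cvgD; last exact: cvg_cst.
  by apply: cvgB; [exact: cvg_cst | apply: cvgM => //; exact: cvg_cst].
apply: norm_cvg0_le cB => n; rewrite ger0_norm ?n2_ge0//.
by rewrite (n2B (Ldq n) Lg) !lerD2r; exact: n2dq.
Qed.

Lemma weak_gradient_grad u G : 2 < p -> Lp mu p u -> L2_weak_gradient u G ->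
  grad u G.
Proof.
move=> hp Lu wG; split => // [i|i n|i].
- by have [LG _] := wG; apply/Lfun_L2/LG.
- by apply: L2Z; have [] := weak_translation i (hs n) hp Lu wG.
- by apply: weak_dq_cvg => //; [move=> n; rewrite gt_eqF ?hs_gt0 | exact: hs_cvg0].
Qed.

Lemma grad_weak_gradient u G : 2 < p -> grad u G -> L2_weak_gradient u G.
Proof.
move=> hp [Lu LG Ldq cdq]; split=> [i|phi tphi i]; first exact/Lfun_L2.
have Lphi := test_L2 tphi.
have c1 := ip_cvg (Ldq i) (LG i) Lphi (cdq i).
have c2 : I (fun x => u x * dq i (- hs n) phi x) @[n --> \oo] -->
    I (fun x => u x * partial i phi x).
  apply: test_dq_cvg => //.
    by move=> n; rewrite oppr_eq0 gt_eqF ?hs_gt0.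
  by rewrite -oppr0; apply: cvgN; exact: hs_cvg0.
have E : (fun n => I (fun x => u x * dq i (- hs n) phi x)) =
    fun n => - ip mu (dq i (hs n) u) phi.
  by apply/funext => n; rewrite I_dq// gt_eqF// hs_gt0.
rewrite E in c2; apply: (cvg_unique (@Rhausdorff R) c2).
exact: cvgN.
Qed.

End gradients.

(** * Calculus rules for gradients *)

Section gradient_calculus.
Context (R : realType) (N : nat) (p : R).
Implicit Types (u v f g : 'rV[R]_N -> R) (G H : 'rV[R]_N -> 'rV[R]_N)
  (x c : 'rV[R]_N) (i k : 'I_N) (h s : R).

Notation e_ i := (delta_mx 0 i : 'rV[R]_N).
Notation mu := (lebesgue_rV N : {measure set 'rV[R]_N -> \bar R}).
Notation I f := (Rintegral mu setT f).
Notation grad := (grad p).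

Definition comp i G : 'rV[R]_N -> R := fun x => G x 0 i.

Lemma grad_Lp u G : grad u G -> Lp mu p u.
Proof. by case. Qed.

Lemma grad_L2 u G i : grad u G -> L2 mu (comp i G).
Proof. by case=> _ LG _ _; exact: LG. Qed.

Lemma grad_unique u G H i : grad u G -> grad u H ->
  n2 mu (fun x => comp i G x - comp i H x) = 0.
Proof.
move=> [_ LG Ld cG] [_ LH _ cH].
have c0 : (fun n => 2 * n2 mu (fun x => dq i (hs R n) u x - G x 0 i) +
    2 * n2 mu (fun x => dq i (hs R n) u x - H x 0 i)) @ \oo --> 0.
  rewrite -[X in _ --> X]addr0 -[X in _ --> X + _](mulr0 2) -[X in _ --> _ + X](mulr0 2).
  by apply: cvgD; apply: cvgM => //; exact: cvg_cst.
apply/eqP; rewrite eq_le n2_ge0 andbT.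
apply: (le_cvg_seq (cvg_cst _) c0) => n.
have -> : (fun x => comp i G x - comp i H x) =
  fun x => (dq i (hs R n) u x - H x 0 i) - (dq i (hs R n) u x - G x 0 i).
  by apply/funext => x; rewrite /comp; ring.
rewrite addrC; apply: n2B_le; exact: L2B.
Qed.

Lemma gradD u v G H : 2 < p -> grad u G -> grad v H ->
  grad (fun x => u x + v x) (fun x => G x + H x).
Proof.
move=> hp [Lu LG Ldu cG] [Lv LH Ldv cH].
have E i n : dq i (hs R n) (fun x => u x + v x) =
    fun x => dq i (hs R n) u x + dq i (hs R n) v x.
  by apply/funext => x; rewrite /dq; ring.
split=> [|i|i n|i].
- exact: (LpD hp Lu Lv).1.
- by under eq_fun do rewrite mxE; exact: L2D.
- by rewrite E; exact: L2D.
have c0 : (fun n => 2 * n2 mu (fun x => dq i (hs R n) u x - G x 0 i) +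
    2 * n2 mu (fun x => dq i (hs R n) v x - H x 0 i)) @ \oo --> 0.
  rewrite -[X in _ --> X]addr0 -[X in _ --> X + _](mulr0 2) -[X in _ --> _ + X](mulr0 2).
  by apply: cvgD; apply: cvgM => //; exact: cvg_cst.
apply: norm_cvg0_le c0 => n; rewrite ger0_norm ?n2_ge0// E.
have -> : (fun x => dq i (hs R n) u x + dq i (hs R n) v x - (G x + H x) 0 i) =
  fun x => (dq i (hs R n) u x - G x 0 i) + (dq i (hs R n) v x - H x 0 i).
  by apply/funext => x; rewrite mxE; ring.
by apply: n2D_le; exact: L2B.
Qed.

Lemma gradZ a u G : 0 < p -> grad u G ->
  grad (fun x => a * u x) (fun x => a *: G x).
Proof.
move=> p0 [Lu LG Ldu cG].
have E i n : dq i (hs R n) (fun x => a * u x) = fun x => a * dq i (hs R n) u x.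
  by apply/funext => x; rewrite /dq; ring.
split=> [|i|i n|i].
- exact: LpZ.
- by under eq_fun do rewrite mxE; exact: L2Z.
- by rewrite E; exact: L2Z.
rewrite -(mulr0 (a ^+ 2)); apply: cvg_trans (cvgM (cvg_cst _) (cG i)).
apply: near_eq_cvg; apply: nearW => n /=; rewrite -n2Z; last first.
  by apply: L2B; [exact: Ldu | exact: LG].
by apply: I_eq => x; rewrite E mxE -mulrBr.
Qed.

Lemma gradB u v G H : 2 < p -> grad u G -> grad v H ->
  grad (fun x => u x - v x) (fun x => G x - H x).
Proof.
move=> hp gu gv; have := gradD hp gu (gradZ (-1) _ gv).
have -> : (fun x => u x + -1 * v x) = (fun x => u x - v x).
  by apply/funext => x; rewrite mulN1r.
have -> : (fun x => G x + -1 *: H x) = (fun x => G x - H x).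
  by apply/funext => x; rewrite scaleN1r.
by apply; lra.
Qed.

Lemma grad0 : 0 < p -> grad (fun=> 0 : R) (fun=> 0 : 'rV[R]_N).
Proof.
move=> p0; have E i n : dq i (hs R n) (fun=> 0) = (fun=> 0) :> ('rV[R]_N -> R).
  by apply/funext => x; rewrite /dq subrr mulr0.
split=> [|i|i n|i].
- exact: Lp0.
- by under eq_fun do rewrite mxE; exact: L20.
- by rewrite E; exact: L20.
- under eq_fun do rewrite E.
  rewrite (_ : (fun n => n2 _ _) = fun=> 0); first exact: cvg_cst.
  apply/funext => n; under eq_fun do rewrite mxE subr0.
  exact: n20.
Qed.

Lemma grad_translation u G i h : 2 < p -> grad u G ->
  L2 mu (fun x => u (x + h *: e_ i) - u x) /\
  n2 mu (fun x => u (x + h *: e_ i) - u x) <= h ^+ 2 * n2 mu (comp i G).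
Proof.
move=> hp gu; apply: (weak_translation _ _ hp (grad_Lp gu)).
exact: (grad_weak_gradient hp gu).
Qed.

Lemma grad_dq_cvg u G i (d : nat -> R) : 2 < p -> grad u G ->
  (forall n, d n != 0) -> d @ \oo --> 0 ->
  n2 mu (fun x => dq i (d n) u x - G x 0 i) @[n --> \oo] --> 0.
Proof.
move=> hp gu d0 dc.
exact: (weak_dq_cvg i hp (grad_Lp gu) (grad_weak_gradient hp gu) d0 dc).
Qed.

Lemma grad_dq_L2 u G i h : 2 < p -> grad u G ->
  L2 mu (dq i h u).
Proof. by move=> hp gu; apply: L2Z; have [] := grad_translation i h hp gu. Qed.

(** The dilation turns the step [hs R n] into [a * hs R n], which need not be dyadic. This is why
    [grad_dq_cvg] is stated for arbitrary null sequences. *)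
Lemma grad_affine a c u G : 2 < p -> 0 < a -> grad u G ->
  grad (fun x => u (a *: x + c)) (fun x => a *: G (a *: x + c)).
Proof.
move=> hp a0 gu; have [Lu LG Ldu cG] := gu.
have E i n : dq i (hs R n) (fun x => u (a *: x + c)) =
    fun x => a * dq i (a * hs R n) u (a *: x + c).
  apply/funext => x; rewrite /dq scalerDr scalerA addrAC mulrA; congr (_ * _).
  by field; rewrite !gt_eqF// hs_gt0.
split=> [|i|i n|i].
- exact: Lp_affine.
- by under eq_fun do rewrite mxE; apply: L2Z; exact: L2_affine (LG i).
- by rewrite E; apply: L2Z; apply: L2_affine => //; exact: grad_dq_L2 gu.
have c1 : n2 mu (fun x => dq i (a * hs R n) u x - G x 0 i) @[n --> \oo] --> 0.
  apply: (@grad_dq_cvg u G i (fun n => a * hs R n)) => //.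
    by move=> n; rewrite gt_eqF// mulr_gt0// hs_gt0.
  by rewrite -(mulr0 a); apply: cvgM; [exact: cvg_cst | exact: hs_cvg0].
rewrite -(mulr0 (a ^+ 2 * (a ^+ N)^-1)).
apply: cvg_trans (cvgM (cvg_cst _) c1).
apply: near_eq_cvg; apply: nearW => n /=; rewrite -mulrA -(n2_affine c)//; last first.
  by apply: L2B; [exact: grad_dq_L2 gu | exact: LG].
rewrite -n2Z; last first.
  apply: (@L2_affine _ _ _ _ (fun x => dq i (a * hs R n) u x - G x 0 i)) => //.
  by apply: L2B; [exact: grad_dq_L2 gu | exact: LG].
by apply: I_eq => x; rewrite E mxE -mulrBr.
Qed.

Lemma grad_tau c u G : 2 < p -> grad u G -> grad (tau c u) (fun x => G (x + c)).
Proof.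
move=> hp gu; have := grad_affine c hp ltr01 gu.
have -> : (fun x => u (1 *: x + c)) = tau c u.
  by apply/funext => x; rewrite scale1r.
have -> : (fun x => 1 *: G (1 *: x + c)) = (fun x => G (x + c)).
  by apply/funext => x; rewrite !scale1r.
by [].
Qed.

Lemma ae_tau f c : measurable_fun setT f ->
  (\forall x \ae mu, f x = 0) -> \forall x \ae mu, f (x + c) = 0.
Proof.
move=> mf f0; have mf1 : measurable_fun setT (fun x => (f x != 0)%:R : R).
  have -> : (fun x => (f x != 0)%:R : R) = \1_(f @^-1` (~` [set 0])).
    apply/funext => x; rewrite indicE; congr (_%:R); congr nat_of_bool.
    apply/idP/idP => [fx|/set_mem/= fx]; last exact/eqP.
    by apply/mem_set => /=; apply/eqP.
  apply: measurable_indic; rewrite -[X in measurable X]setTI.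
  by apply: mf => //; apply: measurableC.
have i1 : rint mu (fun x => (f x != 0)%:R : R).
  apply: (rint_ae mf1 (rint0 mu)); apply: filterS f0 => x ->.
  by rewrite eqxx.
have := I_eq0 (rint_tau c i1) (fun x => ler0n _ _).
rewrite I_tau// (I_ae (g := fun=> 0)) ?I0//; last first.
  by apply: filterS f0 => x ->; rewrite eqxx.
move=> /(_ erefl); apply: filterS => x /eqP.
by rewrite /tau pnatr_eq0 eqb0 negbK => /eqP.
Qed.

Lemma grad_ae u v G : measurable_fun setT v -> grad u G ->
  (\forall x \ae mu, u x = v x) -> grad v G.
Proof.
move=> mv [Lu LG Ldu cG] uv; have [mu_ ui] := Lu.
have Lv : Lp mu p v.
  split => //; apply: rint_ae ui _; first exact: measurable_powR_norm.
  by apply: filterS uv => x ->.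
have mdq i n : measurable_fun setT (dq i (hs R n) v).
  apply: measurable_funM => //; apply: measurable_funB => //.
  exact: (measurable_tau (hs R n *: e_ i) mv).
have dE i n : \forall x \ae mu, dq i (hs R n) u x = dq i (hs R n) v x.
  have m0 : measurable_fun setT (fun x => u x - v x) by exact: measurable_funB.
  have u0 : \forall x \ae mu, u x - v x = 0.
    by apply: filterS uv => x ->; rewrite subrr.
  have := ae_tau (hs R n *: e_ i) m0 u0; apply: filterS2 u0 => x h1 h2.
  rewrite /dq (_ : u x = v x); last by apply/eqP; rewrite -subr_eq0 h1.
  by rewrite (_ : u _ = v (x + hs R n *: e_ i))//; apply/eqP; rewrite -subr_eq0 h2.
have Ldv i n : L2 mu (dq i (hs R n) v).
  split => //; have [_ di] := Ldu i n.
  apply: rint_ae di _; first exact: measurable_funX.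
  by apply: filterS (dE i n) => x ->.
split => // i; have := cG i; apply: cvg_trans; apply: near_eq_cvg; apply: nearW => n /=.
apply: I_ae.
- by apply: measurable_funX; apply: measurable_funB; [case: (Ldu i n)|case: (LG i)].
- by apply: measurable_funX; apply: measurable_funB; [case: (Ldv i n)|case: (LG i)].
- by apply: filterS (dE i n) => x ->.
Qed.

End gradient_calculus.

(** * The chain rule *)

Section chain_rule.
Context (R : realType) (N : nat) (p : R).
Implicit Types (u v f g : 'rV[R]_N -> R) (G H : 'rV[R]_N -> 'rV[R]_N)
  (x c : 'rV[R]_N) (i k : 'I_N) (h s : R).

Notation e_ i := (delta_mx 0 i : 'rV[R]_N).
Notation mu := (lebesgue_rV N : {measure set 'rV[R]_N -> \bar R}).
Notation I f := (Rintegral mu setT f).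
Notation grad := (grad p).
Notation hs := (hs R).

Lemma cvg0_sqr (a : nat -> R) : (fun n => a n ^+ 2) @ \oo --> 0 -> a @ \oo --> 0.
Proof.
move=> a0; apply: (@norm_cvg0_le _ _ (fun n => Num.sqrt (a n ^+ 2))).
  by move=> n; rewrite sqrtr_sqr.
rewrite -sqrtr0; apply: (cvg_comp _ _ a0); exact: sqrt_continuous.
Qed.

Lemma grad_translation_ae u G i : 2 < p -> grad u G ->
  \forall x \ae mu, u (x + hs n *: e_ i) - u x @[n --> \oo] --> 0.
Proof.
move=> hp gu.
(* The ratio 1/4 is the square of the dyadic ratio 1/2, since the squared increments are O([hs n] ^
   2). *)
have q0 : (0 : R) <= 4^-1 by rewrite invr_ge0.
have q1 : 4^-1 < (1 : R) by rewrite invf_lt1// ltr1n.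
have := @ae_cvg0 _ _ _ mu (fun n x => (u (x + hs n *: e_ i) - u x) ^+ 2)
  (n2 mu (comp i G)) 4^-1.
have Hn n : L2 mu (fun x => u (x + hs n *: e_ i) - u x) /\
    n2 mu (fun x => u (x + hs n *: e_ i) - u x) <= n2 mu (comp i G) * 4^-1 ^+ n.
  have [H1 H2] := grad_translation i (hs n) hp gu; split => //.
  apply: le_trans H2 _; rewrite mulrC ler_wpM2l ?n2_ge0//.
  rewrite /hs -exprM mulnC exprM (_ : 2^-1 ^+ 2 = 4^-1 :> R)//.
  by rewrite exprVn; congr (_^-1); ring.
move=> H; rewrite q0 q1 in H; have := H isT (fun n => (Hn n).1.2) (fun n x => sqr_ge0 _) (fun n => (Hn n).2).
by apply: filterS => x; exact: cvg0_sqr.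
Qed.

(** The error of the difference quotient is dF(u)(dq - G) plus the Taylor remainder of [F] over h.
    The latter is at most min(2L, M |D|) |dq|, where D is the increment of u: bounded by the
    Lipschitz condition, small where D is small by the quadratic one. *)
Lemma grad_chain (F dF : R -> R) (L M : R) u G : 2 < p ->
  measurable_fun setT F -> measurable_fun setT dF -> F 0 = 0 -> 0 <= L -> 0 <= M ->
  (forall t, `|dF t| <= L) -> (forall a b, `|F b - F a| <= L * `|b - a|) ->
  (forall a b, `|F b - F a - dF a * (b - a)| <= M * (b - a) ^+ 2) ->
  grad u G -> grad (fun x => F (u x)) (fun x => dF (u x) *: G x).
Proof.
move=> hp mF mdF F0 L0 M0 dFL FL FM gu; have [Lu LG Ldu cG] := gu.
have mu_ : measurable_fun setT u by case: Lu.
have mFu : measurable_fun setT (fun x => F (u x)) by exact: measurableT_comp.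
have mdFu : measurable_fun setT (fun x => dF (u x)) by exact: measurableT_comp.
have mdq i n : measurable_fun setT (dq i (hs n) (fun x => F (u x))).
  apply: measurable_funM => //; apply: measurable_funB => //.
  exact: (measurable_tau (hs n *: e_ i) mFu).
have dFq i n x : `|dq i (hs n) (fun x => F (u x)) x| <= L * `|dq i (hs n) u x|.
  by rewrite /dq !normrM mulrCA ler_wpM2l.
have LFG i : L2 mu (fun x => (dF (u x) *: G x) 0 i).
  apply: (proj1 (@L2_dom _ _ _ _ _ (comp i G) L _ _ _)).
  - under eq_fun do rewrite mxE; apply: measurable_funM => //.
    by case: (LG i).
  - exact: LG.
  - by move=> x; rewrite mxE normrM ler_wpM2r.
split.
- apply: (proj1 (@Lp_dom _ _ _ _ _ _ u L _ _ _ _ _)) => //; first by lra.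
  by move=> x; have := FL 0 (u x); rewrite F0 !subr0.
- exact: LFG.
- by move=> i n; exact: (proj1 (L2_dom (mdq i n) (Ldu i n) (dFq i n))).
move=> i; pose D n x : R := u (x + hs n *: e_ i) - u x.
(* What is left of the remainder once |dq| is replaced by |dq - G| + |G|. It is dominated by 2L |G|
   and tends to 0 almost everywhere, because the increments do. *)
pose b n x : R := Num.min (2 * L) (M * `|D n x|) * `|G x 0 i|.
have mD n : measurable_fun setT (D n).
  by apply: measurable_funB => //; exact: (measurable_tau (hs n *: e_ i) mu_).
have LnG : L2 mu (fun x => `|G x 0 i|).
  apply: (proj1 (@L2_dom _ _ _ _ _ (comp i G) 1 _ _ _)); last 2 first.
  - exact: LG.
  - by move=> x; rewrite normr_id mul1r.
  by apply: measurableT_comp => //; case: (LG i).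
have mb n : measurable_fun setT (b n).
  apply: measurable_funM; last by case: LnG.
  apply: measurable_minr => //; apply: measurable_funM => //.
  exact: measurableT_comp.
have min0 n x : 0 <= Num.min (2 * L) (M * `|D n x|).
  by rewrite le_min !mulr_ge0.
have Lb n : L2 mu (b n) /\ n2 mu (b n) <= (2 * L) ^+ 2 * n2 mu (fun x => `|G x 0 i|).
  apply: L2_dom => // x; rewrite normrM ler_wpM2r// ger0_norm//.
  by rewrite ge_min lexx.
have cb : n2 mu (b n) @[n --> \oo] --> 0.
  apply: (n2_dct0 mb (g := fun x => (2 * L) * `|G x 0 i|)); first exact: L2Z.
    move=> n x; rewrite normrM normr_id ler_wpM2r// ger0_norm//.
    by rewrite ge_min lexx.
  have := grad_translation_ae i hp gu; apply: filterS => x Dx.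
  rewrite -(mul0r `|G x 0 i|); apply: cvgM; last exact: cvg_cst.
  apply: (@norm_cvg0_le _ _ (fun n => M * `|D n x|)).
    by move=> n; rewrite ger0_norm// ge_min lexx orbT.
  rewrite -(mulr0 M) -(normr0 R); apply: cvgM; first exact: cvg_cst.
  exact: cvg_norm.
have key n x : `|dq i (hs n) (fun x => F (u x)) x - (dF (u x) *: G x) 0 i| <=
    (3 * L) * `|dq i (hs n) u x - G x 0 i| + `|b n x|.
  have h0 := hs_gt0 R n.
  have E : dq i (hs n) (fun x => F (u x)) x - (dF (u x) *: G x) 0 i =
    (hs n)^-1 * (F (u (x + hs n *: e_ i)) - F (u x) - dF (u x) * D n x) +
    dF (u x) * (dq i (hs n) u x - G x 0 i).
    by rewrite /dq mxE /D; ring.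
  rewrite E; apply: le_trans (ler_normD _ _) _.
  have Dq : D n x = hs n * dq i (hs n) u x.
    by rewrite /dq mulrA mulfV ?mul1r// gt_eqF.
  have A1 : `|(hs n)^-1 * (F (u (x + hs n *: e_ i)) - F (u x) - dF (u x) * D n x)| <=
      Num.min (2 * L) (M * `|D n x|) * `|dq i (hs n) u x|.
    rewrite normrM normfV (gtr0_norm h0) ler_pdivrMl//.
    rewrite mulrCA -[X in X * `|dq _ _ _ _|](gtr0_norm h0) -normrM -Dq.
    rewrite minr_pMl// le_min; apply/andP; split; last first.
      by rewrite -mulrA -expr2 real_normK ?num_real//; exact: FM.
    apply: le_trans (ler_normB _ _) _; rewrite mulr2n mulrDl mul1r mulrDl.
    by rewrite lerD// normrM ler_wpM2r.
  have A2 : `|dF (u x) * (dq i (hs n) u x - G x 0 i)| <=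
      L * `|dq i (hs n) u x - G x 0 i| by rewrite normrM ler_wpM2r.
  have A3 : Num.min (2 * L) (M * `|D n x|) * `|dq i (hs n) u x| <=
      Num.min (2 * L) (M * `|D n x|) * (`|dq i (hs n) u x - G x 0 i| + `|G x 0 i|).
    rewrite ler_wpM2l// -{1}[dq i (hs n) u x](subrK (G x 0 i)).
    exact: ler_normD.
  have A4 : Num.min (2 * L) (M * `|D n x|) * `|dq i (hs n) u x - G x 0 i| <=
      (2 * L) * `|dq i (hs n) u x - G x 0 i|.
    by rewrite ler_wpM2r// ge_min lexx.
  have A5 : `|b n x| = Num.min (2 * L) (M * `|D n x|) * `|G x 0 i|.
    by rewrite normrM normr_id ger0_norm.
  rewrite A5; apply: le_trans (lerD A1 A2) _.
  by rewrite mulrDr in A3; lra.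
have Ldiff n : L2 mu (fun x => dq i (hs n) u x - G x 0 i) by exact: L2B.
have Lsum n : L2 mu (fun x => (3 * L) * `|dq i (hs n) u x - G x 0 i| + `|b n x|) /\
    n2 mu (fun x => (3 * L) * `|dq i (hs n) u x - G x 0 i| + `|b n x|) <=
    2 * ((3 * L) ^+ 2 * n2 mu (fun x => dq i (hs n) u x - G x 0 i)) + 2 * n2 mu (b n).
  have [B1 B2] := @L2_dom _ _ _ mu (fun x => (3 * L) * `|dq i (hs n) u x - G x 0 i|)
    (fun x => dq i (hs n) u x - G x 0 i) (3 * L)
    (measurable_funM (measurable_cst _) (measurableT_comp (@normr_measurable _ _) (Ldiff n).1))
    (Ldiff n) (fun x => ltac:(by rewrite normrM normr_id ger0_norm ?mulr_ge0)).
  have [C1 C2] := @L2_dom _ _ _ mu (fun x => `|b n x|) (b n) 1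
    (measurableT_comp (@normr_measurable _ _) (mb n)) (Lb n).1
    (fun x => ltac:(by rewrite normr_id mul1r)).
  split; first exact: L2D.
  apply: le_trans (n2D_le B1 C1) _; rewrite expr1n mul1r in C2.
  by rewrite lerD// ler_wpM2l.
have c0 : 2 * ((3 * L) ^+ 2 * n2 mu (fun x => dq i (hs n) u x - G x 0 i)) +
    2 * n2 mu (b n) @[n --> \oo] --> 0.
  rewrite [X in _ --> X](_ : _ = 2 * ((3 * L) ^+ 2 * 0) + 2 * 0); last by ring.
  apply: cvgD; last by apply: cvgM => //; exact: cvg_cst.
  apply: cvgM; first exact: cvg_cst.
  by apply: cvgM; [exact: cvg_cst | exact: cG].
apply: norm_cvg0_le c0 => n; rewrite ger0_norm ?n2_ge0//.
have [S1 S2] := Lsum n; apply: le_trans S2.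
have := @L2_dom _ _ _ mu _ _ 1 _ S1 _ => /(_ (fun x =>
   dq i (hs n) (fun x => F (u x)) x - (dF (u x) *: G x) 0 i)) [].
- by apply: measurable_funB; [exact: mdq | case: (LFG i)].
- move=> x; rewrite mul1r [X in _ <= X]ger0_norm; first exact: key.
  by rewrite addr_ge0// mulr_ge0// mulr_ge0.
by rewrite expr1n mul1r.
Qed.

End chain_rule.

Lemma measurable_fun_comp d1 d2 (T1 : measurableType d1) (T2 : measurableType d2)
    (R : realType) (f : T2 -> R) (g : T1 -> T2) :
  measurable_fun setT f -> measurable_fun setT g -> measurable_fun setT (fun x => f (g x)).
Proof. exact: measurableT_comp. Qed.

Lemma measurable_fun_comp_snd d1 d2 (T1 : measurableType d1) (T2 : measurableType d2)
    (R : realType) (f : T2 -> R) :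
  measurable_fun setT f -> measurable_fun setT (fun z : T1 * T2 => f z.2).
Proof. by move=> mf; exact: measurable_fun_comp mf measurable_snd. Qed.

(** * Translation estimates and the measure of level sets *)

Section spread.
Context (R : realType) (N : nat) (p : R).
Implicit Types (u v f g : 'rV[R]_N -> R) (G H : 'rV[R]_N -> 'rV[R]_N)
  (x y c : 'rV[R]_N) (i k : 'I_N) (h s : R).

Notation e_ i := (delta_mx 0 i : 'rV[R]_N).
Notation mu := (lebesgue_rV N : {measure set 'rV[R]_N -> \bar R}).
Notation I f := (Rintegral mu setT f).
Notation grad := (grad p).

Definition en G : R := \sum_i n2 mu (comp i G).

Lemma en_ge0 G : 0 <= en G.
Proof. by apply: sumr_ge0 => i _; exact: n2_ge0. Qed.

Lemma n2_comp_le_en G i : n2 mu (comp i G) <= en G.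
Proof. by rewrite /en (bigD1 i)//= lerDl sumr_ge0// => j _; exact: n2_ge0. Qed.

(** The translation is made one coordinate at a time: N steps, each of length at most the sup norm
    of [y], whence the factor N. *)
Lemma grad_tau_le u G y : 2 < p -> grad u G ->
  L2 mu (fun x => u (x + y) - u x) /\
  n2 mu (fun x => u (x + y) - u x) <= (N%:R * `|y|) ^+ 2 * en G.
Proof.
move=> hp gu; pose ys (s : seq 'I_N) := \sum_(i <- s) y 0 i *: e_ i.
have K (s : seq 'I_N) : L2 mu (fun x => u (x + ys s) - u x) /\
    Num.sqrt (n2 mu (fun x => u (x + ys s) - u x)) <=
    (size s)%:R * (`|y| * Num.sqrt (en G)).
  elim: s => [|i s [IH1 IH2]].
    rewrite /ys big_nil; under eq_fun do rewrite addr0 subrr.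
    by rewrite n20 sqrtr0 mul0r; split; [exact: L20|].
  have [H1 H2] := grad_translation i (y 0 i) hp gu.
  have E : (fun x => u (x + ys (i :: s)) - u x) =
     fun x => tau (ys s) (fun x => u (x + y 0 i *: e_ i) - u x) x + (u (x + ys s) - u x).
    apply/funext => x; rewrite /tau.
    have -> : x + ys (i :: s) = x + ys s + y 0 i *: e_ i.
      by rewrite /ys big_cons (addrC (y 0 i *: _)) addrA.
    by rewrite addrA subrK.
  have L1 : L2 mu (tau (ys s) (fun x => u (x + y 0 i *: e_ i) - u x)) by exact: L2_tau.
  rewrite E; split; first exact: L2D.
  apply: le_trans (n2_triangle L1 IH1) _; rewrite n2_tau//.
  rewrite /= -natr1 mulrDl mul1r addrC lerD//.
  apply: (@le_trans _ _ (Num.sqrt (y 0 i ^+ 2 * n2 mu (comp i G)))).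
    by rewrite ler_sqrt// mulr_ge0 ?sqr_ge0// n2_ge0.
  rewrite sqrtrM ?sqr_ge0// sqrtr_sqr ler_pM ?normr_ge0 ?sqrtr_ge0//.
    exact: norm_coord_le.
  by rewrite ler_sqrt ?en_ge0// n2_comp_le_en.
have := K (index_enum 'I_N).
have -> : ys (index_enum 'I_N) = y.
  by rewrite /ys [RHS]matrix_sum_delta big_ord1.
move=> [K1 K2]; split => //.
have sz : size (index_enum 'I_N) = N by rewrite -[RHS]card_ord cardE enumT.
rewrite sz in K2; rewrite -(sqr_sqrtr (n2_ge0 mu _)) -[X in _ * X](sqr_sqrtr (en_ge0 G)).
rewrite -exprMn ler_pXn2r ?nnegrE ?sqrtr_ge0 ?mulr_ge0 ?sqrtr_ge0//.
by rewrite -mulrA.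
Qed.

Lemma measurable_fun_add_rV :
  measurable_fun setT (fun z : 'rV[R]_N * 'rV[R]_N => z.1 + z.2).
Proof.
apply: measurable_fun_rV => i; under eq_fun do rewrite mxE.
apply: measurable_funD.
  exact: (measurableT_comp (measurable_coord i) measurable_fst).
exact: (measurableT_comp (measurable_coord i) measurable_snd).
Qed.

Lemma mu_cube r : 0 < r -> mu (@cube R N r) = ((2 * r) ^+ N)%:E.
Proof.
move=> r0; have -> : @cube R N r = [set x | forall i, (fun=> `](- r), r[%classic) i (x 0 i)].
  apply/seteqP; split => x.
    by move/(cubeP _ r0) => H i; rewrite /= in_itv/=; exact: H.
  by move=> H; apply/(cubeP _ r0) => i; have := H i; rewrite /= in_itv.
rewrite [LHS](@lebesgue_rV_box R N (fun=> `](- r), r[%classic)); last first.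
  by move=> i; exact: measurable_itv.
rewrite (eq_bigr (fun=> (2 * r)%:E)); last first.
  move=> i _; rewrite lebesgue_measure_itv /= lte_fin ifT; last by lra.
  by rewrite -EFinB; congr EFin; ring.
by rewrite prodEFin prodr_const card_ord.
Qed.

Lemma I_indic (A : set 'rV[R]_N) : measurable A -> (mu A < +oo)%E ->
  I (\1_A) = fine (mu A).
Proof. by move=> mA _; rewrite /Rintegral integral_indic// setIT. Qed.

(* Averaging |f(x+y) - f(x)|^2 over a cube whose volume is twice that of the
   support of f: for half of the y, the first term vanishes. *)
Lemma measure_level_le f H (A B : set 'rV[R]_N) r : 2 < p -> 0 < r -> grad f H ->
  measurable A -> measurable B -> (mu A < +oo)%E -> (mu B < +oo)%E ->
  (forall x, ~ A x -> f x = 0) -> (forall x, B x -> 1 <= `|f x|) ->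
  (2 * r) ^+ N = 2 * fine (mu A) ->
  fine (mu B) <= 2 * ((N%:R * r) ^+ 2 * en H).
Proof.
move=> hp r0 gf mA mB fA fB f0 f1 rA.
have mcube := @measurable_cube R N r.
set a := fine (mu A); set b := fine (mu B).
have a0 : 0 < a.
  have : 0 < 2 * a by rewrite -rA exprn_gt0// mulr_gt0.
  by rewrite pmulr_rgt0.
have b0 : 0 <= b by apply: fine_ge0.
set K := (N%:R * r) ^+ 2 * en H.
have K0 : 0 <= K by rewrite mulr_ge0 ?sqr_ge0 ?en_ge0.
have [mf _] := grad_Lp gf.
pose hh y x : R := \1_B x * \1_A (x + y).
have mAy y : measurable_fun setT (fun x : 'rV[R]_N => \1_A (x + y) : R).
  by apply: (@measurable_tau R N y (\1_A)); exact: measurable_indic.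
have ihh y : rint mu (hh y).
  apply: (rint_le _ (rint_indic mB fB)).
    by apply: measurable_funM => //; exact: measurable_indic.
  move=> x; rewrite /hh !indicE; case: (x \in B); case: (_ \in A);
    by rewrite /= ?mulr1n ?mulr0n ?mul1r ?mul0r ?normr0 ?normr1.
have step y : (b * \1_(cube r) y)%:E%E = (b * \1_(cube r) y)%:E%E by [].
have {}step y : b * \1_(cube r) y <= K * \1_(cube r) y + I (hh y).
  have [yr|yr] := pselect (cube r y); last first.
    rewrite indicE memNset// !mulr0 add0r; apply: I_ge0 => x.
    by rewrite /hh mulr_ge0.
  rewrite indicE mem_set// !mulr1.
  have [Ly ny] := grad_tau_le y hp gf.
  apply: (@le_trans _ _ (n2 mu (fun x => f (x + y) - f x) + I (hh y))); last first.
    rewrite lerD2r; apply: le_trans ny _.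
    rewrite /K ler_wpM2r ?en_ge0// ler_pXn2r ?nnegrE ?mulr_ge0// ?(ltW r0)//.
    by rewrite ler_wpM2l//; exact: ltW.
  rewrite /b -I_indic// -ID//; last by case: Ly.
  apply: I_le; [exact: rint_indic | by apply: rintD => //; case: Ly |].
  move=> x; rewrite /hh !indicE; have [Bx|Bx] := pselect (B x); last first.
    by rewrite memNset// mul0r addr0 sqr_ge0.
  rewrite mem_set// mul1r; have [Ax|Ax] := pselect (A (x + y)).
    by rewrite mem_set// lerDr sqr_ge0.
  rewrite memNset// addr0 f0// sub0r sqrrN -(real_normK (num_real _)).
  by rewrite expr_ge1// f1.
have mhh : measurable_fun setT (fun z : 'rV[R]_N * 'rV[R]_N => (hh z.1 z.2)%:E).
  apply/measurable_EFinP; apply: measurable_funM.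
    by apply: measurable_fun_comp_snd; exact: measurable_indic.
  apply: (@measurable_fun_comp _ _ _ _ R (\1_A) (fun z : 'rV[R]_N * 'rV[R]_N => z.2 + z.1)).
    exact: measurable_indic.
  by under eq_fun do rewrite addrC; exact: measurable_fun_add_rV.
have hh0 z : (0 <= (hh z.1 z.2)%:E)%E by rewrite lee_fin mulr_ge0.
(* By translation invariance the integral in y of 1_A(x + y) is |A| for every x. *)
have tonelli : (\int[mu]_y \int[mu]_x (hh y x)%:E = (b * a)%:E)%E.
  rewrite (@fubini_tonelli _ _ _ _ _ (lebesgue_rV N) (lebesgue_rV N)
    (fun z => (hh z.1 z.2)%:E) mhh hh0)/=.
  transitivity (\int[mu]_x (\1_B x * a)%:E)%E.
    apply: eq_integral => x _; rewrite EFinM /hh.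
    under eq_integral do rewrite EFinM.
    rewrite ge0_integralZl ?lee_fin//; last first.
      apply/measurable_EFinP; under eq_fun do rewrite addrC.
      exact: mAy.
    congr (_ * _)%E; rewrite /a -I_indic// -(I_tau x) ?EFin_I; last exact: rint_indic.
    - by apply: eq_integral => y _; rewrite /tau addrC.
    - by apply: rint_tau; exact: rint_indic.
  under eq_integral do rewrite mulrC EFinM.
  rewrite ge0_integralZl ?lee_fin//.
  - by rewrite integral_indic// setIT -(fineK (_ : mu B \is a fin_num)) ?ge0_fin_numE// -EFinM mulrC.
  - by apply/measurable_EFinP; exact: measurable_indic.
  - exact: ltW.
(* Integrating [step] over the cube, of volume 2a. The last term is half of the left side, hence b
   <= 2K. *)
have main : ((b * (2 * a))%:E <= (K * (2 * a) + b * a)%:E)%E.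
  rewrite -rA EFinM -{1}(mu_cube r0).
  have -> : (b%:E * mu (@cube R N r) = \int[mu]_y (b * \1_(cube r) y)%:E)%E.
    under eq_integral do rewrite EFinM.
    rewrite ge0_integralZl ?lee_fin//; last by apply/measurable_EFinP; exact: measurable_indic.
    by rewrite integral_indic// setIT.
  rewrite EFinD -tonelli EFinM -(mu_cube r0).
  have -> : (K%:E * mu (@cube R N r) = \int[mu]_y (K * \1_(cube r) y)%:E)%E.
    under eq_integral do rewrite EFinM.
    rewrite ge0_integralZl ?lee_fin//; last by apply/measurable_EFinP; exact: measurable_indic.
    by rewrite integral_indic// setIT.
  have mint : measurable_fun setT (fun y => \int[mu]_x (hh y x)%:E)%E.
    exact: (@measurable_fun_fubini_tonelli_F _ _ _ _ _ (lebesgue_rV N)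
      (fun z => (hh z.1 z.2)%:E) mhh hh0).
  rewrite -ge0_integralD//.
  - apply: ge0_le_integral => //.
    + by move=> y _; rewrite lee_fin mulr_ge0.
    + by apply/measurable_EFinP; apply: measurable_funM => //; exact: measurable_indic.
    + apply: emeasurable_funD => //; apply/measurable_EFinP.
      by apply: measurable_funM => //; exact: measurable_indic.
    + by move=> y _; rewrite -EFin_I// -EFinD lee_fin; exact: step.
  - by move=> y _; rewrite lee_fin mulr_ge0.
  - by apply/measurable_EFinP; apply: measurable_funM => //; exact: measurable_indic.
  - by move=> y _; apply: integral_ge0 => x _; exact: (hh0 (y, x)).
rewrite lee_fin in main; rewrite -(ler_pM2r a0).
by lra.
Qed.

End spread.

(** * The Sobolev inequality *)

Section truncations.
Context (R : realType).
Implicit Types a b t : R.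

Definition psq t := Num.max t 0 ^+ 2.

Lemma psq_rem a b : `|psq b - psq a - 2 * Num.max a 0 * (b - a)| <= (b - a) ^+ 2.
Proof.
have := sqr_ge0 a; have := sqr_ge0 b; have := sqr_ge0 (b - a).
rewrite /psq ler_norml; case: (leP a 0) => ha; case: (leP b 0) => hb h1 h2 h3;
  rewrite ?expr0n /=; apply/andP; split; try lra.
- have : 0 <= - a * b by rewrite mulr_ge0 ?oppr_ge0 // ltW.
  by lra.
- have : 0 <= a * - b by rewrite mulr_ge0 ?oppr_ge0 // ltW.
  by lra.
Qed.

Lemma quad_lipschitz (F dF : R -> R) (L M : R) :
  (forall a b, `|F b - F a - dF a * (b - a)| <= M * (b - a) ^+ 2) ->
  (forall t, `|dF t| <= L) -> forall a b, `|F b - F a| <= L * `|b - a|.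
Proof.
move=> FM dFL; apply: lipschitz_of_derive dFL => s.
apply: (@quad_is_derive _ _ _ _ M) => h.
by have := FM s (s + h); rewrite (addrC s) addrK mulrC.
Qed.

(* A C^{1,1} even function with T = 0 on [-1, 1] and T = 1 off ]-2, 2[. *)
Definition step1 t := 2 * (psq (t - 1) - 2 * psq (t - 3 / 2) + psq (t - 2)).
Definition dstep1 t :=
  4 * (Num.max (t - 1) 0 - 2 * Num.max (t - 3 / 2) 0 + Num.max (t - 2) 0).
Definition step t := step1 t + step1 (- t).
Definition dstep t := dstep1 t - dstep1 (- t).

Lemma dstep1_bound t : 0 <= dstep1 t <= 2.
Proof.
by rewrite /dstep1; case: (leP (t - 1) 0); case: (leP (t - 3 / 2) 0);
  case: (leP (t - 2) 0) => *; apply/andP; split; lra.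
Qed.

Lemma dstep1_le1 t : t <= 1 -> dstep1 t = 0.
Proof.
by rewrite /dstep1; case: (leP (t - 1) 0); case: (leP (t - 3 / 2) 0);
  case: (leP (t - 2) 0) => *; lra.
Qed.

Lemma dstep1_ge2 t : 2 <= t -> dstep1 t = 0.
Proof.
by rewrite /dstep1; case: (leP (t - 1) 0); case: (leP (t - 3 / 2) 0);
  case: (leP (t - 2) 0) => *; lra.
Qed.

Lemma step1_le1 t : t <= 1 -> step1 t = 0.
Proof.
rewrite /step1 /psq; case: (leP (t - 1) 0); case: (leP (t - 3 / 2) 0);
  case: (leP (t - 2) 0) => *; rewrite ?expr0n /=; try lra.
Qed.

Lemma step1_ge2 t : 2 <= t -> step1 t = 1.
Proof.
rewrite /step1 /psq; case: (leP (t - 1) 0); case: (leP (t - 3 / 2) 0);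
  case: (leP (t - 2) 0) => ? ? ? ?; rewrite ?expr0n /=; try lra; try by field.
by rewrite (_ : t = 2); [field | lra].
Qed.

Lemma step1_rem a b : `|step1 b - step1 a - dstep1 a * (b - a)| <= 8 * (b - a) ^+ 2.
Proof.
have := psq_rem (a - 1) (b - 1); have := psq_rem (a - 3 / 2) (b - 3 / 2).
have := psq_rem (a - 2) (b - 2); rewrite /step1 /dstep1.
have E c : b - c - (a - c) = b - a by ring.
rewrite !E !ler_norml => /andP[? ?] /andP[? ?] /andP[? ?].
by apply/andP; split; lra.
Qed.

Lemma step_rem a b : `|step b - step a - dstep a * (b - a)| <= 16 * (b - a) ^+ 2.
Proof.
have := step1_rem a b; have := step1_rem (- a) (- b).
have -> : - b - - a = - (b - a) by ring.
rewrite sqrrN !ler_norml /step /dstep => /andP[? ?] /andP[? ?].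
by apply/andP; split; lra.
Qed.

Lemma step_le1 t : `|t| <= 1 -> step t = 0.
Proof.
by rewrite ler_norml => /andP[? ?]; rewrite /step !step1_le1 ?addr0//; lra.
Qed.

Lemma step_ge2 t : 2 <= `|t| -> step t = 1.
Proof.
rewrite /step ler_normr => /orP[H|H].
  by rewrite step1_ge2// step1_le1 ?addr0//; lra.
by rewrite (step1_ge2 H) step1_le1 ?add0r//; lra.
Qed.

Lemma dstep_bound t : `|dstep t| <= 2.
Proof.
have /andP[? ?] := dstep1_bound t; have /andP[? ?] := dstep1_bound (- t).
by rewrite /dstep ler_norml; apply/andP; split; lra.
Qed.

Lemma dstep_off t : ~~ (1 <= `|t| < 2) -> dstep t = 0.
Proof.
rewrite negb_and -ltNge -leNgt => /orP[|].
  rewrite ltr_norml => /andP[? ?].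
  by rewrite /dstep !dstep1_le1 ?subrr//; lra.
rewrite /dstep ler_normr => /orP[H|H].
  by rewrite dstep1_ge2// dstep1_le1 ?subrr//; lra.
by rewrite (dstep1_ge2 H) dstep1_le1 ?subrr//; lra.
Qed.

Lemma step_lip a b : `|step b - step a| <= 2 * `|b - a|.
Proof. exact: (quad_lipschitz step_rem dstep_bound). Qed.

Lemma lipschitz_measurable (F : R -> R) L :
  (forall a b, `|F b - F a| <= L * `|b - a|) -> measurable_fun setT F.
Proof.
move=> FL; apply: continuous_measurable_fun => x; apply/cvgrPdist_lt => e e0; near=> y.
rewrite distrC; apply: le_lt_trans (FL _ _) _; rewrite distrC.
have L1 : 0 < `|L| + 1 by apply: ltr_wpDl.
apply: (@le_lt_trans _ _ ((`|L| + 1) * `|x - y|)).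
  by rewrite ler_wpM2r// ler_wpDr// ler_norm.
rewrite mulrC -ltr_pdivlMr//; near: y; apply: cvgr_dist_lt => //.
by rewrite divr_gt0.
Unshelve. all: by end_near.
Qed.

Lemma measurable_dstep : measurable_fun setT dstep.
Proof.
have m c : measurable_fun setT (fun t => Num.max (t - c) 0).
  by apply: measurable_maxr => //; exact: measurable_funB.
have m1 : measurable_fun setT dstep1.
  apply: measurable_funM => //; apply: measurable_funD => //.
  by apply: measurable_funB => //; exact: measurable_funM.
apply: measurable_funB => //; apply: (measurable_fun_comp m1); exact: measurable_funN.
Qed.

End truncations.

Section sobolev.
Context (R : realType) (N : nat) (p : R).
Implicit Types (u v f g : 'rV[R]_N -> R) (G H : 'rV[R]_N -> 'rV[R]_N)
  (x y c : 'rV[R]_N) (i k : 'I_N) (h s rho : R).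

Notation mu := (lebesgue_rV N : {measure set 'rV[R]_N -> \bar R}).
Notation I f := (Rintegral mu setT f).
Notation grad := (grad p).

Definition level v rho : set 'rV[R]_N := [set x | rho <= `|v x|].
Definition shell v rho : set 'rV[R]_N := [set x | rho <= `|v x| < 2 * rho].

Lemma measurable_level v rho : measurable_fun setT v -> measurable (level v rho).
Proof.
move=> mv; have -> : level v rho = (fun x => `|v x|) @^-1` `[rho, +oo[.
  by apply/seteqP; split => x; rewrite /level /= in_itv /= andbT.
rewrite -[X in measurable X]setTI.
have m : measurable_fun setT (fun x => `|v x|) by exact: measurableT_comp.
by apply: m => //; exact: measurable_itv.
Qed.

Lemma shell_level v rho : shell v rho = level v rho `\` level v (2 * rho).
Proof.
apply/seteqP; split => x; rewrite /shell /level /=.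
  by move=> /andP[h1 h2]; split => //; apply/negP; rewrite -ltNge.
by move=> [h1 /negP]; rewrite -ltNge => h2; apply/andP.
Qed.

Lemma measurable_shell v rho : measurable_fun setT v -> measurable (shell v rho).
Proof.
by move=> mv; rewrite shell_level; apply: measurableD; exact: measurable_level.
Qed.

Lemma chebyshev_level v rho : 0 < p -> 0 < rho -> Lp mu p v ->
  (mu (level v rho) < +oo)%E /\ rho `^ p * fine (mu (level v rho)) <= np mu p v.
Proof.
move=> p0 r0 [mv iv]; have mA := measurable_level rho mv.
have rp : 0 < rho `^ p by exact: powR_gt0.
have H : (mu (level v rho) <= ((rho `^ p)^-1 * np mu p v)%:E)%E.
  have -> : (mu (level v rho) = \int[mu]_x (\1_(level v rho) x)%:E)%E.
    by rewrite integral_indic// setIT.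
  rewrite /np -IZ// EFin_I; last exact: rintZ.
  apply: ge0_le_integral => //.
  - by apply/measurable_EFinP; exact: measurable_indic.
  - exact: measurable_int (rintZ _ iv).
  move=> x _; rewrite lee_fin indicE; have [Bx|Bx] := pselect (level v rho x).
    rewrite mem_set//= mulrC ler_pdivlMr// mul1r.
    by apply: powR_le; rewrite ?(ltW p0) ?(ltW r0).
  by rewrite memNset//= mulr_ge0 ?invr_ge0 ?powR_ge0.
have fA : (mu (level v rho) < +oo)%E by apply: le_lt_trans H (ltry _).
split => //; rewrite mulrC -ler_pdivlMr// mulrC -lee_fin fineK//.
by rewrite ge0_fin_numE.
Qed.

(** The Dirichlet energy of [v] on a shell between two heights; over disjoint dyadic shells these
    energies sum to at most [en G]. *)
Definition Dshell v G rho : R := en (fun x => \1_(shell v rho) x *: G x).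

Lemma L2_cut (A : set 'rV[R]_N) f : measurable A -> L2 mu f ->
  L2 mu (fun x => \1_A x * f x) /\ n2 mu (fun x => \1_A x * f x) <= n2 mu f.
Proof.
move=> mA Lf; rewrite -[n2 mu f]mul1r -(expr1n _ 2); apply: L2_dom => //.
  by apply: measurable_funM; [exact: measurable_indic | case: Lf].
by move=> x; rewrite mul1r indicE; case: (x \in A); rewrite ?mul1r ?mul0r ?normr0.
Qed.

(** The truncation step(v / rho) is 0 below height rho and 1 above 2 rho, with its gradient carried
    by the shell in between. [measure_level_le] bounds the upper level set by this energy times
    |lower level set|^(2/N), and Chebyshev bounds the latter factor. *)
Lemma level_step v G rho : 2 < p -> (0 < N)%N -> 1 - 2 / p = 2 / N%:R ->
  0 < rho -> grad v G ->
  (2 * rho) `^ p * fine (mu (level v (2 * rho))) <=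
  2 `^ p * (8 * N%:R ^+ 2) * np mu p v `^ (1 - 2 / p) * Dshell v G rho.
Proof.
move=> hp N0 pN r0 gv; have p0 : 0 < p by lra.
have Lv := grad_Lp gv; have [mv _] := Lv.
have [fA cA] := chebyshev_level p0 r0 Lv.
have r20 : 0 < 2 * rho by lra.
have [fB _] := chebyshev_level p0 r20 Lv.
set a := fine (mu (level v rho)) in cA; set b := fine (mu _).
have a0 : 0 <= a by exact: fine_ge0.
have D0 : 0 <= Dshell v G rho by exact: en_ge0.
have [a_eq0|a_neq0] := eqVneq a 0.
  have -> : b = 0.
    apply/eqP; rewrite eq_le fine_ge0// andbT -a_eq0; apply: fine_le.
    - by rewrite ge0_fin_numE.
    - by rewrite ge0_fin_numE.
    apply: le_measure; rewrite ?inE; [exact: measurable_level..|].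
    by move=> x; rewrite /level /=; apply: le_trans; lra.
  by rewrite mulr0 !mulr_ge0 ?powR_ge0 ?sqr_ge0.
have {}a0 : 0 < a by rewrite lt_neqAle eq_sym a_neq0.
have NR : 0 < N%:R :> R by rewrite ltr0n.
(* The cube of half-side r has volume 2a; the case a = 0 was set aside because r must be
   positive. *)
pose r := (2 * a) `^ (N%:R)^-1 / 2.
have rpos : 0 < r by rewrite divr_gt0 ?powR_gt0// mulr_gt0.
have rE : (2 * r) ^+ N = 2 * a.
  rewrite /r mulrC divfK ?gt_eqF// -powR_mulrn ?powR_ge0// -powRrM mulVf ?gt_eqF//.
  by rewrite powRr1// mulr_ge0// ltW.
have gw : grad (fun x => step (rho^-1 * v x)) (fun x => dstep (rho^-1 * v x) *: (rho^-1 *: G x)).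
  apply: (@grad_chain R N p (@step R) (@dstep R) 2 16 (fun x => rho^-1 * v x)
    (fun x => rho^-1 *: G x)) => //.
  - exact: (lipschitz_measurable (@step_lip R)).
  - exact: measurable_dstep.
  - by apply: step_le1; rewrite normr0.
  - exact: dstep_bound.
  - exact: step_lip.
  - exact: step_rem.
  - exact: gradZ.
have vr x : `|rho^-1 * v x| = rho^-1 * `|v x| by rewrite normrM normfV (gtr0_norm r0).
have := @measure_level_le R N p _ _ (level v rho) (level v (2 * rho)) r hp rpos gw
  (measurable_level _ mv) (measurable_level _ mv) fA fB _ _ rE.
rewrite -/b => H0; have {H0} : b <= 2 * ((N%:R * r) ^+ 2 *
   en (fun x => dstep (rho^-1 * v x) *: (rho^-1 *: G x))).
  apply: H0 => x.
    move=> /negP; rewrite -ltNge => Hx; apply: step_le1.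
    by rewrite vr ler_pdivrMl// mulr1 ltW.
  move=> Hx; rewrite step_ge2 ?normr1// vr ler_pdivlMl// mulrC; exact: Hx.
have : en (fun x => dstep (rho^-1 * v x) *: (rho^-1 *: G x)) <= 4 * rho ^- 2 * Dshell v G rho.
  rewrite /Dshell /en mulr_sumr; apply: ler_sum => i _.
  have -> : 4 * rho ^- 2 = (2 * rho^-1) ^+ 2 by rewrite exprMn exprVn; ring.
  apply: (proj2 (L2_dom _ _ _)).
  - exact: (grad_L2 i gw).1.
  - under [comp _ _]eq_fun do rewrite mxE.
    by apply: (L2_cut _ _).1; [exact: measurable_shell | exact: grad_L2 gv].
  move=> x; rewrite /comp !mxE indicE; have [Sx|Sx] := pselect (shell v rho x).
    rewrite mem_set// mul1r !normrM normfV (gtr0_norm r0) mulrA.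
    by rewrite ler_wpM2r// ler_wpM2r ?invr_ge0 ?(ltW r0)// dstep_bound.
  rewrite dstep_off ?mul0r ?normr0 ?mulr_ge0 ?invr_ge0 ?(ltW r0)//.
  apply/negP => H; apply: Sx; rewrite /shell /=.
  by rewrite vr ler_pdivlMl// ltr_pdivrMl// mulr1 (mulrC rho) in H.
set E := en _ => HE Hb.
have rsq : (2 * r) ^+ 2 = (2 * a) `^ (1 - 2 / p).
  rewrite pN /r mulrC divfK ?gt_eqF// -powR_mulrn ?powR_ge0// -powRrM.
  by congr (_ `^ _); exact: mulrC.
have ea : (2 * a) `^ (1 - 2 / p) <= 4 * (np mu p v `^ (1 - 2 / p) * rho `^ (2 - p)).
  have e0 : 0 <= 1 - 2 / p by rewrite subr_ge0 ler_pdivrMr// mul1r ltW.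
  have e1 : 1 - 2 / p <= 1 by rewrite gerBl divr_ge0// ltW.
  have np0 := np_ge0 mu p v.
  have aB : a <= np mu p v * (rho `^ p)^-1 by rewrite ler_pdivlMr ?powR_gt0// mulrC.
  apply: (@le_trans _ _ ((2 * (np mu p v * (rho `^ p)^-1)) `^ (1 - 2 / p))).
    by apply: powR_le; rewrite ?ler_pM2l// mulr_ge0// ltW.
  have rp0 : 0 <= (rho `^ p)^-1 by rewrite invr_ge0 powR_ge0.
  rewrite powRM//; last by rewrite mulr_ge0.
  rewrite powRM//.
  have -> : (rho `^ p)^-1 `^ (1 - 2 / p) = rho `^ (2 - p).
    rewrite -powRN -powRrM; congr (_ `^ _); field; rewrite gt_eqF//.
  rewrite ler_wpM2r ?mulr_ge0 ?powR_ge0//.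
  apply: (@le_trans _ _ 2); last by lra.
  by rewrite -[X in _ <= X](powRr1 (ler0n _ 2)) ler_powR// ler1n.
have bb : b <= 8 * N%:R ^+ 2 * np mu p v `^ (1 - 2 / p) * (rho `^ (2 - p) * rho ^- 2) * Dshell v G rho.
  apply: le_trans Hb _.
  have -> : 2 * ((N%:R * r) ^+ 2 * E) = N%:R ^+ 2 * (2^-1 * (2 * r) ^+ 2 * E) by field.
  rewrite rsq.
  have -> : 8 * N%:R ^+ 2 * np mu p v `^ (1 - 2 / p) * (rho `^ (2 - p) * rho ^- 2) * Dshell v G rho =
    N%:R ^+ 2 * (2^-1 * (4 * (np mu p v `^ (1 - 2 / p) * rho `^ (2 - p))) * (4 * rho ^- 2 * Dshell v G rho)).
    by field; rewrite gt_eqF.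
  rewrite ler_wpM2l ?sqr_ge0// ler_pM ?mulr_ge0 ?powR_ge0 ?en_ge0 ?invr_ge0//.
  by rewrite ler_wpM2l ?invr_ge0.
(* The exponent 2 - p comes from Chebyshev and -2 from the gradient of the truncation. They add up
   to -p because 2/N = 1 - 2/p, so the estimate is the same at every height. *)
have e1 : rho `^ (2 - p) * rho ^- 2 = (rho `^ p)^-1.
  rewrite -(powR_mulrn 2 (ltW r0)) -!powRN -powRD ?(gt_eqF r0) ?implybT//.
  by congr (_ `^ _); ring.
rewrite powRM ?(ltW r0)// -mulrA.
rewrite e1 in bb; rewrite -!mulrA ler_wpM2l ?powR_ge0// mulrC -ler_pdivlMr ?powR_gt0//.
apply: le_trans bb _; rewrite le_eqVlt; apply/orP; left; apply/eqP; ring.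
Qed.

Lemma indic_shell v rho x : 0 < rho ->
  \1_(shell v rho) x = \1_(level v rho) x - \1_(level v (2 * rho)) x :> R.
Proof.
move=> r0; rewrite shell_level !indicE in_setD.
have [h2|h2] := boolP (x \in level v (2 * rho)).
  rewrite (_ : x \in level v rho) ?subrr ?andbF//; apply/mem_set.
  by move/set_mem: h2; rewrite /level /=; apply: le_trans; lra.
by rewrite andbT subr0.
Qed.

Lemma indic_shell_sum v rho x n : 0 < rho ->
  \sum_(j < n) \1_(shell v (rho * 2 ^+ j)) x =
  \1_(level v rho) x - \1_(level v (rho * 2 ^+ n)) x :> R.
Proof.
move=> r0; elim: n => [|n IH]; first by rewrite big_ord0 expr0 mulr1 subrr.
rewrite big_ord_recr /= IH indic_shell ?mulr_gt0 ?exprn_gt0//.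
by rewrite exprS mulrCA addrA subrK.
Qed.

Lemma Dshell_sum v G rho n : measurable_fun setT v -> 0 < rho -> (forall i, L2 mu (comp i G)) ->
  \sum_(j < n) Dshell v G (rho * 2 ^+ j) <= en G.
Proof.
move=> mv r0 LG; rewrite /Dshell /en exchange_big /=; apply: ler_sum => i _.
have E j : n2 mu (comp i (fun x => \1_(shell v (rho * 2 ^+ j)) x *: G x)) =
    I (fun x => \1_(shell v (rho * 2 ^+ j)) x * comp i G x ^+ 2).
  apply: I_eq => x; rewrite /comp mxE exprMn indicE.
  by case: (_ \in _); rewrite ?expr1n ?expr0n.
have iE j : rint mu (fun x => \1_(shell v (rho * 2 ^+ j)) x * comp i G x ^+ 2).
  apply: (rint_le _ (LG i).2).
    apply: measurable_funM; first by apply: measurable_indic; exact: measurable_shell.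
    by apply: measurable_funX; case: (LG i).
  move=> x; rewrite normrM [X in _ * X]ger0_norm ?sqr_ge0// ler_piMl ?sqr_ge0//.
  by rewrite indicE; case: (_ \in _); rewrite ?normr1 ?normr0.
under eq_bigr do rewrite E; rewrite -I_sum; last by move=> j; exact: iE.
apply: I_le; [by apply: rint_sum => j; exact: iE | exact: (LG i).2 |].
move=> x; rewrite -mulr_suml indic_shell_sum// ler_piMl ?sqr_ge0//.
Qed.

(** Truncation method: on each dyadic shell |v|^p is comparable to its lower height, so [level_step]
    bounds its integral there by the energy of the shell just below, and these energies add up. *)
Lemma sobolev_bound v G : 2 < p -> (0 < N)%N -> 1 - 2 / p = 2 / N%:R -> grad v G ->
  np mu p v <= 2 `^ p * (2 `^ p * (8 * N%:R ^+ 2)) * np mu p v `^ (1 - 2 / p) * en G.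
Proof.
move=> hp N0 pN gv; have p0 : 0 < p by lra.
have Lv := grad_Lp gv; have [mv iv] := Lv.
set K := 2 `^ p * (8 * _); set B := np mu p v `^ _.
have K0 : 0 <= K by rewrite mulr_ge0 ?powR_ge0// mulr_ge0 ?sqr_ge0.
(* The part of |v|^p at heights between 2^(1-n) and 2^(1+n), which is 2n dyadic shells. *)
pose g n x : R := `|v x| `^ p * (\1_(level v (2 * hs R n)) x - \1_(level v (2 * hs R n * 2 ^+ (n + n))) x).
have h0 n : 0 < 2 * hs R n by rewrite mulr_gt0// hs_gt0.
have gE n x : g n x = \sum_(j < n + n) `|v x| `^ p * \1_(shell v (2 * hs R n * 2 ^+ j)) x.
  by rewrite -mulr_sumr indic_shell_sum.
have ii (A : set 'rV[R]_N) : measurable A -> rint mu (fun x => `|v x| `^ p * \1_A x).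
  move=> mA; apply: (rint_le _ iv).
    by apply: measurable_funM; [exact: (measurable_powR_norm p mv) | exact: measurable_indic].
  move=> x; rewrite normrM ger0_norm ?powR_ge0// ler_piMr ?powR_ge0//.
  by rewrite indicE; case: (_ \in _); rewrite ?normr1 ?normr0.
have is_ n j : rint mu (fun x => `|v x| `^ p * \1_(shell v (2 * hs R n * 2 ^+ j)) x).
  by apply: ii; exact: measurable_shell.
have [] // := @I_fatou _ _ _ mu g (fun x => `|v x| `^ p) (2 `^ p * K * B * en G).
- move=> n; apply: (rint_eq (f := fun x => \sum_(j < n + n) `|v x| `^ p * \1_(shell v (2 * hs R n * 2 ^+ j)) x)).
    by move=> x; rewrite gE.
  by apply: rint_sum => j; exact: is_.
- exact: measurable_powR_norm.
- by move=> n x; rewrite gE sumr_ge0// => j _; rewrite mulr_ge0 ?powR_ge0.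
- move=> x; have [vx|vx] := eqVneq (v x) 0.
    rewrite (_ : g ^~ x = fun=> `|v x| `^ p); first exact: cvg_cst.
    by apply/funext => n; rewrite /g vx normr0 powR0 ?gt_eqF// mul0r.
  have v0 : 0 < `|v x| by rewrite normr_gt0.
  apply: (@cvg_trans _ ((fun=> `|v x| `^ p : R) @ \oo)); last exact: cvg_cst.
  apply: near_eq_cvg; have hc := @hs_cvg0 R.
  near=> n; rewrite /g !indicE.
  have hn : hs R n < Num.min (`|v x| / 2) (`|v x|)^-1.
    have : `|0 - hs R n| < Num.min (`|v x| / 2) (`|v x|)^-1.
      near: n; move/cvgrPdist_lt: hc; apply.
      by rewrite lt_min invr_gt0 v0 andbT divr_gt0.
    by rewrite sub0r normrN gtr0_norm// hs_gt0.
  move: hn; rewrite lt_min => /andP[hn1 hn2].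
  rewrite mem_set; last by rewrite /level /=; lra.
  rewrite memNset ?subr0 ?mulr1//= /level /= => hx.
  have : 2 * hs R n * 2 ^+ (n + n) = 2 / hs R n.
    rewrite /hs exprVn invrK exprD -mulrA; congr (_ * _).
    by rewrite mulrA mulVf ?mul1r// expf_neq0.
  move=> e; rewrite e ler_pdivrMr ?hs_gt0// in hx.
  by move: hn2; rewrite -(ltr_pM2l v0) mulfV ?gt_eqF//; lra.
move=> n; rewrite (I_eq mu (gE n)) I_sum; last by move=> j; exact: is_.
apply: (@le_trans _ _ (\sum_(j < n + n) 2 `^ p * (K * B * Dshell v G (hs R n * 2 ^+ j)))).
  apply: ler_sum => j _.
  have r0 : 0 < hs R n * 2 ^+ j by rewrite mulr_gt0 ?hs_gt0// exprn_gt0.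
  have r20 : 0 < 2 * (hs R n * 2 ^+ j) by rewrite mulr_gt0.
  have [fB _] := chebyshev_level p0 r20 Lv.
  have mB := measurable_level (2 * (hs R n * 2 ^+ j)) mv.
  apply: (@le_trans _ _ (2 `^ p * ((2 * (hs R n * 2 ^+ j)) `^ p * fine (mu (level v (2 * (hs R n * 2 ^+ j))))))).
    rewrite -I_indic// -!IZ; last 2 first.
      by apply: rintZ; exact: rint_indic.
      exact: rint_indic.
    apply: I_le; [exact: is_ | by apply: rintZ; apply: rintZ; exact: rint_indic |].
    move=> x; rewrite -[2 * hs R n * 2 ^+ j]mulrA indicE.
    have [Sx|Sx] := pselect (shell v (2 * (hs R n * 2 ^+ j)) x); last first.
      by rewrite memNset// mulr0 !mulr_ge0 ?powR_ge0.
    rewrite mem_set// mulr1; case/andP: (Sx) => S1 S2.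
    rewrite indicE mem_set// mulr1 -powRM ?(ltW r20)//.
    by apply: powR_le; rewrite ?normr_ge0 ?(ltW p0)// ltW.
  by rewrite ler_wpM2l ?powR_ge0//; exact: level_step.
rewrite -mulr_sumr -mulr_sumr [X in X <= _]mulrA [X in X * _]mulrA.
have KB : 0 <= 2 `^ p * K * B by rewrite !mulr_ge0 ?powR_ge0.
apply: (ler_wpM2l KB).
by apply: Dshell_sum; [exact: mv | exact: hs_gt0 | move=> i; exact: grad_L2 gv].
Unshelve. all: by end_near.
Qed.

(** The previous bound has a power of [np] on both sides; [np] is finite, so it can be divided
    out. *)
Lemma sobolev : 2 < p -> (0 < N)%N -> 1 - 2 / p = 2 / N%:R ->
  exists2 C : R, 0 < C & forall v G, grad v G -> np mu p v `^ (2 / p) <= C * en G.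
Proof.
move=> hp N0 pN; have p0 : 0 < p by lra.
exists (2 `^ p * (2 `^ p * (8 * N%:R ^+ 2))).
  by rewrite !mulr_gt0 ?powR_gt0 ?ltr0n.
set C := 2 `^ p * (_ * _) => v G gv; have := sobolev_bound hp N0 pN gv; rewrite -/C.
have C0 : 0 <= C by rewrite /C !mulr_ge0 ?powR_ge0.
have := np_ge0 mu p v; rewrite le_eqVlt => /predU1P[<- _|n0].
  by rewrite powR0 ?mulr_ge0 ?en_ge0// gt_eqF// divr_gt0.
rewrite powRD ?(gt_eqF n0) ?implybT// powRr1 ?(ltW n0)// powRN.
rewrite [X in _ <= X * _](_ : _ = np mu p v * (C / np mu p v `^ (2 / p))); last by rewrite mulrCA.
rewrite -mulrA ler_pMr// mulrAC ler_pdivlMr ?mul1r// powR_gt0//.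
Qed.

End sobolev.

(** * Higher integrability *)

Section truncated_powers.
Context (R : realType).
Implicit Types a b t L : R.

Lemma mean_value (F dF : R -> R) : (forall s : R, is_derive s (1 : R) F (dF s)) ->
  forall a b, exists2 c, `|c - a| <= `|b - a| & F b - F a = dF c * (b - a).
Proof.
move=> FP a b; have cF A : {within A, continuous F}.
  apply: continuous_subspaceT => x.
  by apply/differentiable_continuous/derivable1_diffP; have [] := FP x.
have [ab|ba] := leP a b.
  have [c] := MVT_segment ab (fun z _ => FP z) (cF _).
  rewrite in_itv /= => /andP[ac cb] E; exists c => //.
  by rewrite !ger0_norm ?subr_ge0 ?lerB//; apply: (le_trans ac).
have [c] := MVT_segment (ltW ba) (fun z _ => FP z) (cF _).
rewrite in_itv /= => /andP[ac cb] E; exists c.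
  by rewrite !ler0_norm ?subr_le0 ?lerN2 ?lerB// ltW.
by rewrite -opprB E; ring.
Qed.

Lemma lipschitz_derive_rem (F dF : R -> R) (K : R) :
  (forall s : R, is_derive s (1 : R) F (dF s)) -> (forall a b, `|dF b - dF a| <= K * `|b - a|) ->
  forall a b, `|F b - F a - dF a * (b - a)| <= K * (b - a) ^+ 2.
Proof.
move=> FP dFK a b.
have K0 : 0 <= K by have := dFK 0 1; rewrite subr0 normr1 mulr1; apply: le_trans.
have [c cab ->] := mean_value FP a b.
rewrite -mulrBl normrM -real_normK ?num_real// expr2 mulrA ler_wpM2r//.
by apply: le_trans (dFK _ _) _; rewrite ler_wpM2l.
Qed.

Definition clamp L t := t - Num.max (t - L) 0 + Num.max (- t - L) 0.

Lemma clamp_norm L t : 0 < L -> `|clamp L t| <= L.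
Proof.
by rewrite ler_norml /clamp; case: (leP (t - L) 0); case: (leP (- t - L) 0) => *; apply/andP; split; lra.
Qed.

Lemma clamp_lip L a b : 0 < L -> `|clamp L b - clamp L a| <= `|b - a|.
Proof.
move=> L0; wlog ab : a b / a <= b.
  move=> H; have [/H//|/ltW/H] := leP a b; by rewrite distrC (distrC a).
rewrite [X in _ <= X]ger0_norm ?subr_ge0// ler_norml /clamp.
by case: (leP (a - L) 0); case: (leP (- a - L) 0); case: (leP (b - L) 0);
  case: (leP (- b - L) 0) => *; apply/andP; split; lra.
Qed.

(* Equal to [t ^+ 2] on [-L, L] and affine beyond. *)
Definition tsqr L t := t ^+ 2 - psq (t - L) - psq (- t - L).

Lemma tsqr_rem L a b : `|tsqr L b - tsqr L a - 2 * clamp L a * (b - a)| <= 3 * (b - a) ^+ 2.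
Proof.
have := psq_rem (a - L) (b - L); have := psq_rem (- a - L) (- b - L).
have -> : b - L - (a - L) = b - a by ring.
have -> : - b - L - (- a - L) = - (b - a) by ring.
rewrite sqrrN !ler_norml /tsqr /clamp => /andP[? ?] /andP[? ?].
by apply/andP; split; lra.
Qed.

(* Equal to [t ^+ 3] on [-L, L] and affine beyond. *)
Definition tcube L t := t ^+ 3 - psq (t - L) * (2 * L + t) + psq (- t - L) * (2 * L - t).

Lemma is_derive_tcube L t : 0 < L -> is_derive t 1 (tcube L) (3 * clamp L t ^+ 2).
Proof.
move=> L0; have d1 : is_derive t 1 (fun t => psq (t - L)) (2 * Num.max (t - L) 0).
  apply: (@quad_is_derive _ _ _ _ 1) => h; have := psq_rem (t - L) (t + h - L).
  by rewrite mul1r (_ : t + h - L - (t - L) = h) 1?[h * _]mulrC//; ring.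
have d2 : is_derive t 1 (fun t => psq (- t - L)) (- (2 * Num.max (- t - L) 0)).
  apply: (@quad_is_derive _ _ _ _ 1) => h; have := psq_rem (- t - L) (- (t + h) - L).
  by rewrite mul1r (_ : - (t + h) - L - (- t - L) = - h) ?sqrrN ?mulrN 1?[h * _]mulrC//; ring.
have -> : tcube L = (fun t : R => t) ^+ 3 - (fun t => psq (t - L)) * (cst (2 * L) + id) +
   (fun t => psq (- t - L)) * (cst (2 * L) - id).
  by apply/funext => s; rewrite /tcube /= !fctE.
have dc : is_derive t (1 : R) (cst (2 * L)) 0 by exact: is_derive_cst.
have di : is_derive t (1 : R) (fun t : R => t) 1 by exact: is_derive_id.
have dB := is_deriveB (is_deriveX 3 di) (is_deriveM d1 (is_deriveD dc di)).
have dD := is_deriveD dB (is_deriveM d2 (is_deriveB dc di)).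
apply: (is_derive_eq dD); rewrite /GRing.scale /= /psq /clamp !fctE.
by case: (leP (t - L) 0); case: (leP (- t - L) 0) => h1 h2;
  first [ring | lra].
Qed.

Lemma tcube_rem L a b : 0 < L ->
  `|tcube L b - tcube L a - 3 * clamp L a ^+ 2 * (b - a)| <= 6 * L * (b - a) ^+ 2.
Proof.
move=> L0; apply: (lipschitz_derive_rem (fun s => is_derive_tcube s L0)) => {}a {}b.
have -> : 3 * clamp L b ^+ 2 - 3 * clamp L a ^+ 2 =
  3 * ((clamp L b + clamp L a) * (clamp L b - clamp L a)) by ring.
rewrite normrM ger0_norm// normrM.
have h1 : `|clamp L b + clamp L a| <= 2 * L.
  have := clamp_norm a L0; have := clamp_norm b L0.
  by have := ler_normD (clamp L b) (clamp L a); lra.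
have := ler_pM (normr_ge0 _) (normr_ge0 _) h1 (clamp_lip a b L0).
by lra.
Qed.

Lemma tsqr_mid L t : `|t| <= L -> tsqr L t = t ^+ 2.
Proof.
rewrite ler_norml /tsqr /psq => /andP[h1 h2].
by case: (leP (t - L) 0); case: (leP (- t - L) 0) => *; rewrite ?expr0n /=; lra.
Qed.

Lemma tsqr_bound L t : 0 < L -> 0 <= tsqr L t <= t ^+ 2.
Proof.
move=> L0; have h := sqr_ge0 t; have h1 := sqr_ge0 (t - L); have h2 := sqr_ge0 (- t - L).
rewrite /tsqr /psq; case: (leP (t - L) 0); case: (leP (- t - L) 0) => h3 h4;
  rewrite ?expr0n /=; apply/andP; split; try lra.
- have : 0 <= L * (- 2 * t - L) by rewrite mulr_ge0//; lra.
  by lra.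
- have : 0 <= L * (2 * t - L) by rewrite mulr_ge0//; lra.
  by lra.
Qed.

(** When the equation is tested with tcube(u), this bounds the nonlinear term by |u|^(p-2)
    tsqr(u)^2, a weight times the square of a function in D^{1,2}. *)
Lemma tcube_le L t : 0 < L -> 0 <= t * tcube L t <= tsqr L t ^+ 2.
Proof.
move=> L0; rewrite /tsqr /tcube /psq.
case: (leP (t - L) 0); case: (leP (- t - L) 0) => h3 h4; rewrite ?expr0n /=.
- rewrite !mul0r !subr0 addr0 -exprS -exprM lexx andbT.
  by rewrite (exprM t 2 2) sqr_ge0.
- have -> : t * (t ^+ 3 - 0 * (2 * L + t) + (- t - L) ^+ 2 * (2 * L - t)) =
     L ^+ 2 * (- t * (- 3 * t - 2 * L)) by ring.
  apply/andP; split.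
    by rewrite mulr_ge0 ?sqr_ge0// mulr_ge0//; lra.
  rewrite -subr_ge0.
  have -> : (t ^+ 2 - 0 - (- t - L) ^+ 2) ^+ 2 - L ^+ 2 * (- t * (-3 * t - 2 * L)) =
    L ^+ 2 * (t + L) ^+ 2 by ring.
  by rewrite mulr_ge0 ?sqr_ge0.
- have -> : t * (t ^+ 3 - (t - L) ^+ 2 * (2 * L + t) + 0 * (2 * L - t)) =
     L ^+ 2 * (t * (3 * t - 2 * L)) by ring.
  apply/andP; split.
    by rewrite mulr_ge0 ?sqr_ge0// mulr_ge0//; lra.
  rewrite -subr_ge0.
  have -> : (t ^+ 2 - (t - L) ^+ 2 - 0) ^+ 2 - L ^+ 2 * (t * (3 * t - 2 * L)) =
    L ^+ 2 * (t - L) ^+ 2 by ring.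
  by rewrite mulr_ge0 ?sqr_ge0.
- by exfalso; lra.
Qed.

Lemma measurable_clamp L : 0 < L -> measurable_fun setT (clamp L).
Proof.
by move=> L0; apply: (@lipschitz_measurable _ _ 1) => a b; rewrite mul1r clamp_lip.
Qed.

End truncated_powers.

Section bootstrap.
Context (R : realType) (N : nat) (p : R).
Implicit Types (u v f g : 'rV[R]_N -> R) (G H : 'rV[R]_N -> 'rV[R]_N)
  (x y c : 'rV[R]_N) (i k : 'I_N).

Notation mu := (lebesgue_rV N : {measure set 'rV[R]_N -> \bar R}).
Notation I f := (Rintegral mu setT f).
Notation grad := (grad p).

Definition ipG G H : R := \sum_i ip mu (comp i G) (comp i H).

(** The large values of [f]: their L^p norm is small when [K] is large, and what is removed is
    bounded. *)
Definition cut f K : 'rV[R]_N -> R := fun x => if `|f x| <= K then 0 else f x.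

Lemma measurable_cut f K : measurable_fun setT f -> measurable_fun setT (cut f K).
Proof.
move=> mf; apply: measurable_fun_ifT => //.
by apply: measurable_fun_ler => //; exact: measurableT_comp.
Qed.

Lemma Lp_cut f K : 0 < p -> Lp mu p f -> Lp mu p (cut f K).
Proof.
move=> p0 Lf; apply: (proj1 (@Lp_dom _ _ _ _ _ _ f 1 _ _ _ _ _)) => //.
  by apply: measurable_cut; case: Lf.
by move=> x; rewrite mul1r /cut; case: ifP => _ //; rewrite normr0.
Qed.

Lemma np_cut_cvg f : 0 < p -> Lp mu p f -> np mu p (cut f n%:R) @[n --> \oo] --> 0.
Proof.
move=> p0 Lf; have [mf intf] := Lf; rewrite -(I0 mu).
apply: (I_dct _ _ intf) => //.
- by move=> n; apply: measurable_powR_norm; exact: measurable_cut.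
- move=> n x; rewrite ger0_norm ?powR_ge0// /cut; case: ifP => _ //.
  by rewrite normr0 powR0 ?powR_ge0// gt_eqF.
apply: nearW => x; apply: (@cvg_trans _ ((fun=> 0 : R) @ \oo)); last exact: cvg_cst.
apply: near_eq_cvg; near=> n; rewrite /cut ifT ?normr0 ?powR0 ?gt_eqF//.
by near: n; exact: nbhs_infty_ger.
Unshelve. all: by end_near.
Qed.

Lemma np_cut_small f e : 2 < p -> Lp mu p f -> 0 < e ->
  exists2 K : R, 0 <= K & np mu p (cut f K) `^ (1 - 2 / p) <= e.
Proof.
move=> hp Lf e0; have p0 : 0 < p by lra.
have q0 : 0 < 1 - 2 / p by rewrite subr_gt0 ltr_pdivrMr// mul1r.
pose d := e `^ (1 - 2 / p)^-1.
have d0 : 0 < d by exact: powR_gt0.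
have /cvgrPdist_lt/(_ _ d0)[n _ /(_ n (leqnn n))] := np_cut_cvg p0 Lf.
rewrite /= sub0r normrN ger0_norm ?np_ge0// => nd; exists n%:R => //.
have -> : e = d `^ (1 - 2 / p).
  by rewrite /d -powRrM mulVf ?powRr1 ?(ltW e0)// gt_eqF.
by apply: powR_le; rewrite ?np_ge0 ?ltW.
Qed.

Lemma Lp_sqr_small (C : R) g e v H : 2 < p -> 0 < C ->
  (forall v G, grad v G -> np mu p v `^ (2 / p) <= C * en G) ->
  Lp mu p g -> np mu p g `^ (1 - 2 / p) <= e / (2 * C) -> grad v H ->
  I (fun x => `|g x| `^ (p - 2) * v x ^+ 2) <= e * en H.
Proof.
move=> hp C0 sob Lg ge gv.
apply: le_trans (Lp_sqr_le hp Lg (grad_Lp gv)) _.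
apply: (@le_trans _ _ (2 * (e / (2 * C) * (C * en H)))).
  by rewrite ler_pM2l// ler_pM ?powR_ge0//; exact: sob gv.
by rewrite le_eqVlt; apply/orP; left; apply/eqP; field; rewrite gt_eqF.
Qed.

(** For f in L^p the potential |f|^(p-2) is critical for the Sobolev inequality, so only its part
    above a large height can be made small against the Dirichlet energy. *)
Lemma Lp_cut_small (C : R) f e : 2 < p -> 0 < C ->
  (forall v G, grad v G -> np mu p v `^ (2 / p) <= C * en G) ->
  Lp mu p f -> 0 < e -> exists2 K : R, 0 <= K & forall v H, grad v H ->
    I (fun x => `|cut f K x| `^ (p - 2) * v x ^+ 2) <= e * en H.
Proof.
move=> hp C0 sob Lf e0; have eC : 0 < e / (2 * C) by rewrite divr_gt0// mulr_gt0.
have [K K0 HK] := np_cut_small hp Lf eC; exists K => // v H gv.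
by apply: (Lp_sqr_small hp C0 sob _ HK gv); apply: Lp_cut => //; lra.
Qed.

Lemma rint_cut_split f v K : 2 < p -> 0 <= K -> Lp mu p f -> Lp mu p v ->
  rint mu (fun x => `|cut f K x| `^ (p - 2) * v x ^+ 2).
Proof. by move=> hp K0 Lf Lv; apply: Lp_sqr_rint => //; apply: Lp_cut => //; lra. Qed.

(* One step of the Brezis-Kato iteration. *)
Lemma higher_integrability (C : R) u G : 2 < p -> 0 < C ->
  (forall v G, grad v G -> np mu p v `^ (2 / p) <= C * en G) ->
  grad u G -> (forall v H, grad v H -> ipG G H = I (fun x => psi p (u x) * v x)) ->
  Lp mu p (fun x => u x ^+ 2).
Proof.
move=> hp C0 sob gu EL; have p0 : 0 < p by lra.
have Lu := grad_Lp gu; have [mu_ iu] := Lu.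
have e0 : 0 < 4^-1 :> R by rewrite invr_gt0.
have [K K0 HK] := Lp_cut_small hp C0 sob Lu e0.
(* Below, en H <= 2 (K^2 np + en H / 4), which absorbs to en H <= 4 K^2 np; the Sobolev inequality
   then gives Z, whatever the truncation height L. *)
pose Z := 4 * C * (K ^+ 2 * np mu p u).
have np0 := np_ge0 mu p u.
have Z0 : 0 <= Z by rewrite /Z !mulr_ge0 ?(ltW C0)// sqr_ge0.
have gF L : 0 < L -> grad (fun x => tsqr L (u x)) (fun x => (2 * clamp L (u x)) *: G x).
  move=> L0.
  have dF t : `|2 * clamp L t| <= 2 * L by rewrite normrM ger0_norm// ler_pM2l// clamp_norm.
  have lF := quad_lipschitz (tsqr_rem L) dF.
  apply: (@grad_chain R N p (tsqr L) (fun t => 2 * clamp L t) (2 * L) 3) => //.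
  - exact: lipschitz_measurable lF.
  - by apply: measurable_funM => //; exact: measurable_clamp.
  - by rewrite tsqr_mid ?expr0n// normr0 ltW.
  - by rewrite mulr_ge0// ltW.
  - exact: tsqr_rem.
have gG L : 0 < L -> grad (fun x => tcube L (u x)) (fun x => (3 * clamp L (u x) ^+ 2) *: G x).
  move=> L0.
  have dF t : `|3 * clamp L t ^+ 2| <= 3 * L ^+ 2.
    by rewrite normrM ger0_norm// ler_pM2l// normrX ler_pXn2r ?nnegrE ?(ltW L0)// clamp_norm.
  have lF := quad_lipschitz (fun a b => tcube_rem a b L0) dF.
  apply: (@grad_chain R N p (tcube L) (fun t => 3 * clamp L t ^+ 2) (3 * L ^+ 2) (6 * L)) => //.
  - exact: lipschitz_measurable lF.
  - by apply: measurable_funM => //; apply: measurable_funX; exact: measurable_clamp.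
  - rewrite /tcube /psq; case: (leP (0 - L) 0); case: (leP (- 0 - L) 0) => *; rewrite ?expr0n /=; lra.
  - by rewrite mulr_ge0// sqr_ge0.
  - by rewrite mulr_ge0// ltW.
  - by move=> a b; exact: tcube_rem.
have bound L : 0 < L -> np mu p (fun x => tsqr L (u x)) `^ (2 / p) <= Z.
  move=> L0; have LF := grad_Lp (gF L L0).
  set H := fun x => (2 * clamp L (u x)) *: G x.
  (* The derivatives match: the square of that of [tsqr] is 4 clamp^2, and twice that of [tcube] is
     6 clamp^2. *)
  have E1 : en H <= 2 * ipG G (fun x => (3 * clamp L (u x) ^+ 2) *: G x).
    rewrite /en /ipG mulr_sumr; apply: ler_sum => i _.
    have i1 := L2_rint_mul (grad_L2 i gu) (grad_L2 i (gG L L0)).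
    rewrite /n2 /ip -IZ//; apply: I_le; [exact: (grad_L2 i (gF L L0)).2 | exact: rintZ |].
    move=> x; rewrite /comp !mxE.
    have -> : 2 * (G x 0 i * (3 * clamp L (u x) ^+ 2 * G x 0 i)) =
      6 * (clamp L (u x) * G x 0 i) ^+ 2 by ring.
    have -> : (2 * clamp L (u x) * G x 0 i) ^+ 2 = 4 * (clamp L (u x) * G x 0 i) ^+ 2 by ring.
    by rewrite ler_wpM2r ?sqr_ge0// ler_nat.
  have i2 := rint_cut_split hp K0 Lu LF.
  have E2 : ipG G (fun x => (3 * clamp L (u x) ^+ 2) *: G x) <=
      K ^+ 2 * np mu p u + 4^-1 * en H.
    rewrite (EL _ _ (gG L L0)).
    apply: (@le_trans _ _ (K ^+ 2 * np mu p u +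
      I (fun x => `|cut u K x| `^ (p - 2) * tsqr L (u x) ^+ 2))); last first.
      by rewrite lerD2l; exact: HK (gF L L0).
    rewrite -IZ// -ID//; last exact: rintZ.
    apply: I_le; [exact: Lp_psi_rint (grad_Lp (gG L L0)) | by apply: rintD => //; exact: rintZ |].
    move=> x; rewrite /psi -mulrA.
    have /andP[h1 h2] := tcube_le (u x) L0.
    apply: (@le_trans _ _ (`|u x| `^ (p - 2) * tsqr L (u x) ^+ 2)).
      by rewrite ler_wpM2l ?powR_ge0.
    rewrite /cut; case: ifP => uK; last first.
      by rewrite lerDr mulr_ge0 ?sqr_ge0 ?powR_ge0.
    apply: ler_wpDr; first by rewrite mulr_ge0 ?powR_ge0 ?sqr_ge0.
    have /andP[h3 h4] := tsqr_bound (u x) L0.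
    apply: (@le_trans _ _ (`|u x| `^ (p - 2) * (u x ^+ 2) ^+ 2)).
      by rewrite ler_wpM2l ?powR_ge0// ler_pXn2r ?nnegrE ?sqr_ge0.
    rewrite expr2 mulrA powR_p_sqr// mulrC ler_wpM2r ?powR_ge0//.
    by rewrite -[u x ^+ 2]real_normK ?num_real// ler_pXn2r ?nnegrE.
  apply: le_trans (sob _ _ (gF L L0)) _; rewrite -/H /Z [4 * C]mulrC -mulrA ler_pM2l//.
  by lra.
have [] // := @I_fatou _ _ _ mu (fun n x => `|tsqr n.+1%:R (u x)| `^ p)
  (fun x => `|u x ^+ 2| `^ p) (Z `^ (p / 2)).
- by move=> n; have [] := grad_Lp (gF n.+1%:R (ltr0Sn _ n)).
- by apply: measurable_powR_norm; exact: measurable_funX.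
- move=> x; apply: (@cvg_trans _ ((fun=> `|u x ^+ 2| `^ p : R) @ \oo)); last exact: cvg_cst.
  apply: near_eq_cvg; near=> n; rewrite tsqr_mid//.
  apply: (@le_trans _ _ n%:R); last by rewrite ler_nat.
  by near: n; exact: nbhs_infty_ger.
- move=> n; have := bound _ (ltr0Sn _ n); rewrite -/(np _ _ _).
  set X := np _ _ _ => XZ; have X0 : 0 <= X by exact: np_ge0.
  have -> : X = X `^ (2 / p) `^ (p / 2).
    rewrite -powRrM (_ : 2 / p * (p / 2) = 1) ?powRr1//.
    by field; rewrite gt_eqF.
  by apply: powR_le; rewrite ?powR_ge0// divr_ge0// ltW.
move=> i2 _; split=> //; exact: measurable_funX.
Unshelve. all: by end_near.
Qed.

End bootstrap.

(** * Unique continuation *)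

Section compact_support.
Context (R : realType) (N : nat) (p : R).
Implicit Types (u v w z f g : 'rV[R]_N -> R) (G H : 'rV[R]_N -> 'rV[R]_N)
  (x y c : 'rV[R]_N) (i k : 'I_N) (t h r : R).

Notation e_ i := (delta_mx 0 i : 'rV[R]_N).
Notation mu := (lebesgue_rV N : {measure set 'rV[R]_N -> \bar R}).
Notation I f := (Rintegral mu setT f).
Notation grad := (grad p).

(** The support conditions hold at every point and include the gradient, so that exponential weights
    are bounded wherever they matter. *)
Definition cgrad r u G := [/\ grad u G, forall x, ~ cube r x -> u x = 0 &
  forall x, ~ cube r x -> G x = 0].

Lemma dq_off r u i n x : (forall x, ~ cube r x -> u x = 0) -> ~ cube (r + 1) x ->
  dq i (hs R n) u x = 0.
Proof.
move=> u0 xr; rewrite /dq !u0 ?subrr ?mulr0//.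
  by move=> xr'; apply: xr; apply: cube_le xr'; rewrite lerDl.
by apply: not_cube_tau => //; rewrite ger0_norm ?hs_le1// ltW// hs_gt0.
Qed.

(** A gradient is determined only almost everywhere. It may be set to 0 off the cube enlarged by 1,
    where all the difference quotients vanish, the steps being at most 1. *)
Lemma cgrad_cut r u G : grad u G -> (forall x, ~ cube r x -> u x = 0) ->
  cgrad (r + 1) u (fun x => \1_(cube (r + 1)) x *: G x).
Proof.
move=> gu u0; have [Lu LG Ldu cG] := gu; split; last 2 first.
- by move=> x xr; apply: u0 => xr'; apply: xr; apply: cube_le xr'; rewrite lerDl.
- by move=> x xr; rewrite indicE memNset// scale0r.
have mc : measurable (@cube R N (r + 1)) by exact: measurable_cube.
have LG' i : L2 mu (fun x => (\1_(cube (r + 1)) x *: G x) 0 i).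
  by under eq_fun do rewrite mxE; apply: (L2_cut _ (LG i)).1.
split => // i; have := cG i; apply: norm_cvg0_le => n.
rewrite ger0_norm ?n2_ge0//.
apply: (@le_trans _ _ (1 ^+ 2 * n2 mu (fun x => dq i (hs R n) u x - G x 0 i))); last first.
  by rewrite expr1n mul1r.
apply: (proj2 (L2_dom _ _ _)).
- by apply: measurable_funB; [case: (Ldu i n) | case: (LG' i)].
- exact: L2B.
move=> x; rewrite mul1r mxE indicE; have [xr|xr] := pselect (cube (r + 1) x).
  by rewrite mem_set// mul1r.
by rewrite memNset// mul0r subr0 (dq_off _ _ u0)// normr0.
Qed.

Lemma cgrad_tau r u G i h : 2 < p -> `|h| <= 1 -> cgrad r u G ->
  cgrad (r + 1) (tau (h *: e_ i) u) (fun x => G (x + h *: e_ i)).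
Proof.
move=> hp h1 [gu u0 G0]; split; first exact: grad_tau.
  by move=> x xr; apply: u0; exact: not_cube_tau.
by move=> x xr; apply: G0; exact: not_cube_tau.
Qed.

Lemma cgradB r u v G H : 2 < p -> cgrad r u G -> cgrad r v H ->
  cgrad r (fun x => u x - v x) (fun x => G x - H x).
Proof.
move=> hp [gu u0 G0] [gv v0 H0]; split; first exact: gradB.
  by move=> x xr; rewrite u0// v0// subr0.
by move=> x xr; rewrite G0// H0// subr0.
Qed.

Lemma Lp_L2_cube u r : 2 < p -> Lp mu p u -> (forall x, ~ cube r x -> u x = 0) -> L2 mu u.
Proof.
move=> hp Lu u0; have E : (fun x => u x * \1_(cube r) x) = u.
  apply/funext => x; rewrite indicE; have [xr|xr] := pselect (cube r x).
    by rewrite mem_set// mulr1.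
  by rewrite memNset// mulr0 u0.
by rewrite -E; exact: (Lp_mul_L2_cube r hp Lu).
Qed.

Lemma cgrad_comp r u G i : cgrad r u G -> L2 mu (comp i G).
Proof. by case=> gu _ _; exact: grad_L2 gu. Qed.

Lemma cgrad_L2 r u G : 2 < p -> cgrad r u G -> L2 mu u.
Proof. by move=> hp [gu u0 _]; apply: Lp_L2_cube u0 => //; exact: grad_Lp gu. Qed.

Lemma expR_rem (s : R) : `|expR s - 1 - s| <= expR `|s| * s ^+ 2.
Proof.
have h1 := expR_ge1Dx s; have h2 := expR_ge1Dx (- s).
have h3 : expR s - 1 <= s * expR s.
  have : expR s * (1 - s) <= expR s * expR (- s) by rewrite ler_wpM2l// expR_ge0.
  by rewrite expRN mulfV ?gt_eqF ?expR_gt0//; lra.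
rewrite ger0_norm; last by lra.
have [s0|s0] := leP 0 s.
  have : s * (expR s - 1) <= s * (s * expR s) by rewrite ler_wpM2l.
  by rewrite ger0_norm//; lra.
have : s * (expR s - 1) <= s * s by apply: ler_wnM2l; lra.
have : 1 * s ^+ 2 <= expR `|s| * s ^+ 2.
  by rewrite ler_wpM2r ?sqr_ge0// -expR0 ler_expR.
by lra.
Qed.

Definition expw i t : 'rV[R]_N -> R := fun x => expR (t * x 0 i).

Lemma measurable_expw i t : measurable_fun setT (expw i t).
Proof.
apply: (measurable_fun_comp (f := @expR R)); first exact: measurable_expR.
by apply: measurable_funM => //; exact: measurable_coord.
Qed.

Lemma expw_bound i t r x : cube r x -> 0 <= expw i t x <= expR (`|t| * r).
Proof.
move=> xr; rewrite /expw expR_ge0 ler_expR; apply: le_trans (ler_norm _) _.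
by rewrite normrM ler_wpM2l//; apply: le_trans (norm_coord_le _ _) _; exact: ltW.
Qed.

Lemma expw_tau i k t h x : expw i t (x + h *: e_ k) = expR (t * h * (k == i)%:R) * expw i t x.
Proof.
by rewrite /expw !mxE eqxx/= eq_sym mulrDr expRD mulrC mulrA.
Qed.

Lemma L2_expw i t r f : 0 <= r -> L2 mu f -> (forall x, ~ cube r x -> f x = 0) ->
  L2 mu (fun x => expw i t x * f x) /\
  n2 mu (fun x => expw i t x * f x) <= expR (`|t| * r) ^+ 2 * n2 mu f.
Proof.
move=> r0 Lf f0; apply: L2_dom => //.
  by apply: measurable_funM; [exact: measurable_expw | case: Lf].
move=> x; have [xr|xr] := pselect (cube r x); last first.
  by rewrite f0// mulr0 normr0 mulr0.
have /andP[h1 h2] := expw_bound i t xr.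
by rewrite normrM ger0_norm// ler_wpM2r.
Qed.

(** The product rule is exact for difference quotients: translation multiplies the weight by the
    constant [cc], which tends to 1, and [dd], which tends to 0, is the error of the difference
    quotient of the weight. *)
Lemma cgrad_expw i t r u G : 2 < p -> 0 <= r -> cgrad r u G ->
  cgrad r (fun x => expw i t x * u x)
    (fun x => expw i t x *: (G x + (t * u x) *: e_ i)).
Proof.
move=> hp r0 cu; have [gu u0 G0] := cu; have [Lu LG Ldu cG] := gu.
have L2u := cgrad_L2 hp cu; have p0 : 0 < p by lra.
split; last 2 first.
- by move=> x xr; rewrite u0// mulr0.
- by move=> x xr; rewrite u0// G0// mulr0 scale0r addr0 scaler0.
have r1 : 0 <= r + 1 by rewrite addr_ge0.
have u1 x : ~ cube (r + 1) x -> u x = 0.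
  by move=> xr; apply: u0 => xr'; apply: xr; apply: cube_le xr'; rewrite lerDl.
have G1 x : ~ cube (r + 1) x -> G x = 0.
  by move=> xr; apply: G0 => xr'; apply: xr; apply: cube_le xr'; rewrite lerDl.
pose d k : R := (k == i)%:R.
pose cc n k := expR (t * hs R n * d k).
pose dd n k := (hs R n)^-1 * (cc n k - 1) - t * d k.
have Ecomp k x : (expw i t x *: (G x + (t * u x) *: e_ i)) 0 k =
    expw i t x * (G x 0 k + t * d k * u x).
  by rewrite !mxE eqxx /= /d mulrAC.
have Edq k n x : dq k (hs R n) (fun x => expw i t x * u x) x =
    expw i t x * (cc n k * dq k (hs R n) u x + (dd n k + t * d k) * u x).
  by rewrite /dq expw_tau /dd /cc -/(d k); ring.
have LA k : L2 mu (fun x => G x 0 k + t * d k * u x).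
  by apply: L2D; [exact: LG | exact: L2Z].
have LB k n : L2 mu (fun x => cc n k * dq k (hs R n) u x + (dd n k + t * d k) * u x).
  by apply: L2D; apply: L2Z.
split.
- apply: (proj1 (@Lp_dom _ _ _ _ _ _ u (expR (`|t| * r)) _ _ _ _ _)) => //.
    by apply: measurable_funM; [exact: measurable_expw | case: Lu].
  move=> x; have [xr|xr] := pselect (cube r x); last first.
    by rewrite u0// mulr0 normr0 mulr0.
  have /andP[h1 h2] := expw_bound i t xr.
  by rewrite normrM ger0_norm// ler_wpM2r.
- move=> k; under eq_fun do rewrite Ecomp.
  apply: (L2_expw i t r0 (LA k) _).1 => x xr.
  by rewrite u0// G0// mxE mulr0 addr0.
- move=> k n; rewrite (funext (Edq k n)).
  apply: (L2_expw i t r1 (LB k n) _).1 => x xr.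
  by rewrite u1// (dq_off _ _ u0)// !mulr0 addr0.
move=> k; pose f n x := cc n k * (dq k (hs R n) u x - G x 0 k) + ((cc n k - 1) * G x 0 k + dd n k * u x).
have Lf1 n : L2 mu (fun x => dq k (hs R n) u x - G x 0 k) by exact: L2B.
have Lf2 n : L2 mu (fun x => (cc n k - 1) * G x 0 k + dd n k * u x).
  by apply: L2D; apply: L2Z => //; exact: LG.
have Lf n : L2 mu (f n) by apply: L2D => //; exact: L2Z.
have f0 n x : ~ cube (r + 1) x -> f n x = 0.
  by move=> xr; rewrite /f u1// (dq_off _ _ u0)// G1// mxE !mulr0 subr0 mulr0 !addr0.
have cc1 : (fun n => cc n k) @ \oo --> (1 : R).
  have th0 : (fun n => t * hs R n * d k) @ \oo --> (0 : R).
    rewrite [X in _ --> X](_ : _ = t * 0 * d k); last by ring.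
    by apply: cvgM; [apply: cvgM; [exact: cvg_cst | exact: hs_cvg0] | exact: cvg_cst].
  by rewrite -(expR0 R); exact: (cvg_comp _ _ th0 (@continuous_expR R 0)).
have dd0 : (fun n => dd n k) @ \oo --> (0 : R).
  apply: (@norm_cvg0_le _ _ (fun n => expR `|t| * t ^+ 2 * hs R n)); last first.
    by rewrite -[X in _ --> X](mulr0 (expR `|t| * t ^+ 2)); apply: cvgM; [exact: cvg_cst | exact: hs_cvg0].
  move=> n; have h0 := hs_gt0 R n.
  have -> : dd n k = (hs R n)^-1 * (cc n k - 1 - t * hs R n * d k).
    by rewrite /dd; field; rewrite gt_eqF.
  rewrite normrM normfV (gtr0_norm h0) ler_pdivrMl//.
  apply: le_trans (expR_rem _) _.
  have dk : 0 <= d k <= 1 by rewrite /d; case: (k == i); rewrite ?ler01 ?lexx.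
  case/andP: dk => d0 d1.
  have -> : hs R n * (expR `|t| * t ^+ 2 * hs R n) = expR `|t| * (t * hs R n) ^+ 2 by ring.
  have hd : hs R n * d k <= 1.
    by apply: mulr_ile1 => //; [exact: ltW | exact: hs_le1].
  apply: ler_pM; rewrite ?expR_ge0 ?sqr_ge0//.
    have hd0 : 0 <= hs R n * d k by apply: mulr_ge0 => //; exact: ltW.
    by rewrite ler_expR -mulrA normrM (ger0_norm hd0); exact: (ler_piMr (normr_ge0 t) hd).
  by rewrite exprMn; apply: ler_piMr; [exact: sqr_ge0 | exact: exprn_ile1].
pose A n := 2 * (cc n k ^+ 2 * n2 mu (fun x => dq k (hs R n) u x - G x 0 k)) +
    2 * (2 * ((cc n k - 1) ^+ 2 * n2 mu (comp k G)) + 2 * (dd n k ^+ 2 * n2 mu u)).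
have c0 : A @ \oo --> 0.
  rewrite [X in _ --> X](_ : _ = 2 * (1 ^+ 2 * 0) +
    2 * (2 * ((1 - 1) ^+ 2 * n2 mu (comp k G)) + 2 * (0 ^+ 2 * n2 mu u))); last by ring.
  have c2 (a b : R) (B : nat -> R) : B @ \oo --> a -> (fun n => 2 * (B n ^+ 2 * b)) @ \oo --> 2 * (a ^+ 2 * b).
    move=> Ba; apply: cvgM; [exact: cvg_cst | apply: cvgM; last exact: cvg_cst].
    by rewrite expr2; under eq_fun do rewrite expr2; exact: cvgM.
  apply: cvgD.
    apply: cvgM; [exact: cvg_cst | apply: cvgM; last exact: cG].
    by rewrite expr2; under eq_fun do rewrite expr2; exact: cvgM.
  apply: cvgM; [exact: cvg_cst | apply: cvgD; apply: c2 => //].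
  by apply: cvgB => //; exact: cvg_cst.
have c1 : (fun n => expR (`|t| * (r + 1)) ^+ 2 * A n) @ \oo --> 0.
  rewrite -[X in _ --> X](mulr0 (expR (`|t| * (r + 1)) ^+ 2)).
  by apply: cvgM; [exact: cvg_cst | exact: c0].
apply: norm_cvg0_le c1 => n; rewrite ger0_norm ?n2_ge0//.
have -> : (fun x => dq k (hs R n) (fun x => expw i t x * u x) x -
    (expw i t x *: (G x + (t * u x) *: e_ i)) 0 k) = fun x => expw i t x * f n x.
  by apply/funext => x; rewrite Edq Ecomp /f; ring.
apply: le_trans (L2_expw i t r1 (Lf n) (f0 n)).2 _.
rewrite ler_wpM2l ?sqr_ge0//.
apply: le_trans (n2D_le (L2Z _ (Lf1 n)) (Lf2 n)) _; rewrite n2Z// lerD2l ler_wpM2l//.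
by apply: le_trans (n2D_le (L2Z _ (LG k)) (L2Z _ L2u)) _; rewrite !n2Z.
Qed.

End compact_support.

Section unique_continuation.
Context (R : realType) (N : nat) (p : R).
Implicit Types (u v w z f g : 'rV[R]_N -> R) (G H W Z : 'rV[R]_N -> 'rV[R]_N)
  (x y c : 'rV[R]_N) (i k : 'I_N) (t h r s : R).

Notation e_ i := (delta_mx 0 i : 'rV[R]_N).
Notation mu := (lebesgue_rV N : {measure set 'rV[R]_N -> \bar R}).
Notation I f := (Rintegral mu setT f).
Notation grad := (grad p).
Notation cgrad := (cgrad p).

Lemma sum_delta i (X : 'I_N -> R) : \sum_k (k == i)%:R * X k = X i.
Proof.
rewrite (bigD1 i)//= eqxx mul1r big1 ?addr0// => k /negbTE ->.
by rewrite mul0r.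
Qed.

(* Conjugating the Laplacian with exp(t x_i). *)
Lemma conjugated_equation r s i t u G z Z w W : 2 < p -> 0 <= r -> 0 <= s ->
  cgrad r u G -> (forall v H, grad v H -> ipG G H = I (fun x => psi p (u x) * v x)) ->
  cgrad s z Z -> w = (fun x => expw i t x * u x) ->
  W = (fun x => expw i t x *: (G x + (t * u x) *: e_ i)) ->
  ipG W Z + t * (ip mu (comp i W) z - ip mu w (comp i Z)) - t ^+ 2 * ip mu w z =
  I (fun x => `|u x| `^ (p - 2) * w x * z x).
Proof.
move=> hp r0 s0 cu EL cz wE WE.
have cw : cgrad r w W by rewrite wE WE; exact: cgrad_expw.
have [gv _ _] := cgrad_expw i t hp s0 cz.
have -> : I (fun x => `|u x| `^ (p - 2) * w x * z x) =
    I (fun x => psi p (u x) * (expw i t x * z x)).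
  by apply: I_eq => x; rewrite wE /psi; ring.
rewrite -(EL _ _ gv) /ipG.
have Lw := cgrad_L2 hp cw; have Lz := cgrad_L2 hp cz.
have LW k := cgrad_comp k cw; have LZ k := cgrad_comp k cz.
have E k : ip mu (comp k G) (comp k (fun x => expw i t x *: (Z x + (t * z x) *: e_ i))) =
    ip mu (comp k W) (comp k Z) + (k == i)%:R *
      (t * (ip mu (comp k W) z - ip mu w (comp k Z)) - t ^+ 2 * ip mu w z).
  rewrite /ip -(IB (L2_rint_mul (LW k) Lz) (L2_rint_mul Lw (LZ k))).
  have i1 := rintB (L2_rint_mul (LW k) Lz) (L2_rint_mul Lw (LZ k)).
  have i2 := L2_rint_mul Lw Lz.
  rewrite -IZ// -IZ// -IB; [|exact: rintZ..].
  rewrite -IZ; last by apply: rintB; exact: rintZ.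
  rewrite -ID; [|exact: L2_rint_mul|by apply: rintZ; apply: rintB; exact: rintZ].
  apply: I_eq => x; rewrite WE wE /comp !mxE eqxx /=.
  by case: (k == i) => /=; ring.
under [X in _ = X]eq_bigr do rewrite E.
by rewrite big_split /= sum_delta; ring.
Qed.

(** Central differences are skew-adjoint. *)
Lemma ip_tau_diff f g c : L2 mu f -> L2 mu g ->
  ip mu f (fun x => tau c g x - tau (- c) g x) = - ip mu (fun x => tau c f x - tau (- c) f x) g.
Proof.
move=> Lf Lg; have Tf := L2_tau c Lf; have Tg := L2_tau c Lg.
have Tf' := L2_tau (- c) Lf; have Tg' := L2_tau (- c) Lg.
rewrite ipBr// ipBl//.
have -> : ip mu f (tau c g) = ip mu (tau (- c) f) g.
  by rewrite -(ip_tau (- c) Lf Tg) tauK.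
have -> : ip mu f (tau (- c) g) = ip mu (tau c f) g.
  by rewrite -(ip_tau c Lf Tg') tauNK.
by rewrite opprB.
Qed.

(** In the conjugated equation tested with the central difference [z n] of [w], the symmetric terms
    ipG W Z and t^2 <w, z> vanish and the first-order ones add up to 2t <W_i, z>. Dividing by 2h and
    letting h tend to 0 gives 2t |W_i|^2 = <|u|^(p-2) w, W_i>; Cauchy-Schwarz concludes. *)
Lemma carleman r i t u G w W : 2 < p -> 0 <= r -> 0 <= t ->
  cgrad r u G -> (forall v H, grad v H -> ipG G H = I (fun x => psi p (u x) * v x)) ->
  w = (fun x => expw i t x * u x) ->
  W = (fun x => expw i t x *: (G x + (t * u x) *: e_ i)) ->
  L2 mu (fun x => `|u x| `^ (p - 2) * w x) ->
  (2 * t) ^+ 2 * n2 mu (comp i W) <= n2 mu (fun x => `|u x| `^ (p - 2) * w x).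
Proof.
move=> hp r0 t0 cu EL wE WE LV.
have cw : cgrad r w W by rewrite wE WE; exact: cgrad_expw.
have Lw := cgrad_L2 hp cw; have LW k := cgrad_comp k cw.
have r1 : 0 <= r + 1 by rewrite addr_ge0.
pose c n := hs R n *: e_ i.
pose z n x := tau (c n) w x - tau (- c n) w x.
pose Z n x := W (x + c n) - W (x - c n).
have cN n : - c n = (- hs R n) *: e_ i by rewrite scaleNr.
have h1 n : `|hs R n| <= 1 by rewrite ger0_norm ?hs_le1// ltW// hs_gt0.
have cz n : cgrad (r + 1) (z n) (Z n).
  apply: cgradB => //; first exact: cgrad_tau.
  by rewrite cN; apply: cgrad_tau => //; rewrite normrN.
have Lz n := cgrad_L2 hp (cz n).
have key n : 2 * t * ip mu (comp i W) (z n) = ip mu (fun x => `|u x| `^ (p - 2) * w x) (z n).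
  rewrite -[RHS](conjugated_equation hp r0 r1 cu EL (cz n) wE WE).
  have E k : comp k (Z n) = fun x => tau (c n) (comp k W) x - tau (- c n) (comp k W) x.
    by apply/funext => x; rewrite /comp /tau !mxE.
  have anti f : L2 mu f -> ip mu f (fun x => tau (c n) f x - tau (- c n) f x) = 0.
    by move=> Lf; have := ip_tau_diff (c n) Lf Lf; rewrite [in RHS]ipC; lra.
  have -> : ipG W (Z n) = 0 by rewrite /ipG big1// => k _; rewrite E anti.
  have -> : ip mu w (comp i (Z n)) = - ip mu (z n) (comp i W) by rewrite E ip_tau_diff.
  have -> : ip mu w (z n) = 0 by rewrite anti.
  by rewrite (ipC _ (z n)); ring.
pose y n x := (2 * hs R n)^-1 * z n x.
have hn0 n : 2 * hs R n != 0 by rewrite gt_eqF// mulr_gt0// hs_gt0.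
have Ly n : L2 mu (y n) by exact: L2Z.
have key2 n : 2 * t * ip mu (comp i W) (y n) = ip mu (fun x => `|u x| `^ (p - 2) * w x) (y n).
  by rewrite /y !ipZr// mulrCA key.
have [gw _ _] := cw.
have d1 := grad_dq_cvg i hp gw (fun n => lt0r_neq0 (hs_gt0 R n)) (@hs_cvg0 R).
have d2 : n2 mu (fun x => dq i (- hs R n) w x - W x 0 i) @[n --> \oo] --> 0.
  apply: (@grad_dq_cvg _ _ _ _ _ i (fun n => - hs R n) hp gw).
    by move=> n; rewrite oppr_eq0 gt_eqF// hs_gt0.
  by rewrite -oppr0; apply: cvgN; exact: hs_cvg0.
have yc : n2 mu (fun x => y n x - comp i W x) @[n --> \oo] --> 0.
  pose A n := 2^-1 * n2 mu (fun x => dq i (hs R n) w x - W x 0 i) +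
    2^-1 * n2 mu (fun x => dq i (- hs R n) w x - W x 0 i).
  have c0 : A @ \oo --> 0.
    rewrite [X in _ --> X](_ : _ = 2^-1 * 0 + 2^-1 * 0); last by ring.
    by apply: cvgD; [apply: cvgM d1 | apply: cvgM d2]; exact: cvg_cst.
  apply: norm_cvg0_le c0 => n; rewrite ger0_norm ?n2_ge0//.
  have -> : (fun x => y n x - comp i W x) = fun x =>
      2^-1 * ((dq i (hs R n) w x - W x 0 i) + (dq i (- hs R n) w x - W x 0 i)).
    apply/funext => x; rewrite /y /z /tau /dq /comp cN.
    by field; rewrite gt_eqF// hs_gt0.
  have l1 : L2 mu (fun x => dq i (hs R n) w x - W x 0 i).
    by apply: L2B; [exact: grad_dq_L2 gw | exact: LW].
  have l2 : L2 mu (fun x => dq i (- hs R n) w x - W x 0 i).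
    by apply: L2B; [exact: grad_dq_L2 gw | exact: LW].
  rewrite n2Z; last exact: L2D.
  by have := n2D_le l1 l2; rewrite /A; lra.
have E : 2 * t * n2 mu (comp i W) = ip mu (fun x => `|u x| `^ (p - 2) * w x) (comp i W).
  have c1 := ip_cvg Ly (LW i) (LW i) yc.
  have c2 := ip_cvg Ly (LW i) LV yc.
  have l1 : (fun n => 2 * t * ip mu (y n) (comp i W)) @ \oo --> 2 * t * ip mu (comp i W) (comp i W).
    by apply: cvgM => //; exact: cvg_cst.
  have l2 : (fun n => 2 * t * ip mu (y n) (comp i W)) @ \oo -->
      ip mu (comp i W) (fun x => `|u x| `^ (p - 2) * w x).
    by under eq_fun do rewrite [ip _ _ (comp i W)]ipC key2 ipC.
  by rewrite -ipff ipC -(cvg_lim _ l1)// (cvg_lim _ l2)// ipC.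
have := cauchy_schwarz LV (LW i); rewrite -E exprMn.
have := n2_ge0 mu (comp i W); rewrite le_eqVlt => /predU1P[<- _|W0].
  by rewrite mulr0 n2_ge0.
by rewrite [X in _ * X]expr2 mulrA ler_pM2r.
Qed.

(** Translation by 2r makes the supports of w and its translate disjoint, so the squared norm of the
    increment is 2 |w|^2, while it is at most 4 r^2 |W_i|^2. *)
Lemma poincare r i w W : 2 < p -> 0 <= r -> cgrad r w W ->
  n2 mu w <= 2 * r ^+ 2 * n2 mu (comp i W).
Proof.
move=> hp r0 cw; have [gw w0 _] := cw; have Lw := cgrad_L2 hp cw.
have [L1 H] := grad_translation i (2 * r) hp gw.
have E : (fun x => (w (x + (2 * r) *: e_ i) - w x) ^+ 2) =
   fun x => tau ((2 * r) *: e_ i) (fun x => w x ^+ 2) x + w x ^+ 2.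
  apply/funext => x; rewrite /tau; have [xr|xr] := pselect (cube r x); last first.
    by rewrite (w0 _ xr) subr0 expr0n addr0.
  rewrite (w0 (x + (2 * r) *: e_ i)) ?sub0r ?sqrrN ?expr0n ?add0r// => xr'.
  have := norm_coord_le (x + (2 * r) *: e_ i) i; have := norm_coord_le x i.
  move: xr xr'; rewrite /cube /= !mxE !eqxx mulr1 => h1 h2.
  by rewrite !ler_norml => /andP[? ?] /andP[? ?]; lra.
move: H; rewrite [X in X <= _]/n2 E ID; last 2 first.
- by apply: rint_tau; case: Lw.
- by case: Lw.
by rewrite I_tau; [rewrite -/(n2 _ _); lra | case: Lw].
Qed.

(** The square of |u|^(p-2) is |u^2|^(p-2), so the hypothesis u^2 in L^p makes multiplication by the
    potential map into L^2. *)
Lemma L2_potential u w : 2 < p -> Lp mu p (fun x => u x ^+ 2) -> measurable_fun setT u ->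
  Lp mu p w -> L2 mu w ->
  L2 mu (fun x => `|u x| `^ (p - 2) * w x) /\
  forall K, 0 <= K -> n2 mu (fun x => `|u x| `^ (p - 2) * w x) <=
    I (fun x => `|cut (fun x => u x ^+ 2) K x| `^ (p - 2) * w x ^+ 2) +
    K `^ (p - 2) * n2 mu w.
Proof.
move=> hp Lu2 mu_ Lw Lw2; have E x : (`|u x| `^ (p - 2) * w x) ^+ 2 =
    `|u x ^+ 2| `^ (p - 2) * w x ^+ 2.
  by rewrite exprMn normrX expr2 -powRM// -expr2.
have iE := Lp_sqr_rint hp Lu2 Lw.
have L2V : L2 mu (fun x => `|u x| `^ (p - 2) * w x).
  split; last exact: rint_eq iE.
  by apply: measurable_funM; [exact: measurable_powR_norm | case: Lw].
split => // K K0; have ic := rint_cut_split hp K0 Lu2 Lw.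
rewrite /n2 -IZ; last by case: Lw2.
rewrite -ID//; last by apply: rintZ; case: Lw2.
apply: I_le; [by case: L2V | by apply: rintD => //; apply: rintZ; case: Lw2 |].
move=> x; rewrite E /cut; case: ifP => uK.
  rewrite normr0 powR0 ?mul0r ?add0r; last by rewrite gt_eqF// subr_gt0.
  by rewrite ler_wpM2r ?sqr_ge0//; apply: powR_le => //; lra.
by rewrite lerDl mulr_ge0 ?powR_ge0 ?sqr_ge0.
Qed.

Lemma ipG_unique u G H Z : (forall i, L2 mu (comp i Z)) -> grad u G -> grad u H ->
  ipG G Z = ipG H Z.
Proof.
move=> LZ gu gv; apply: eq_bigr => i _; apply/eqP; rewrite -subr_eq0.
have LG := grad_L2 i gu; have LH := grad_L2 i gv.
rewrite -ipBl// -normr_eq0 eq_le normr_ge0 andbT.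
apply: le_trans (ip_le (L2B LG LH) (LZ i)) _.
by rewrite (grad_unique i gu gv) sqrtr0 mul0r.
Qed.

(** With D = |w|^2 and X = | |u|^(p-2) w |^2, [carleman] and [poincare] give 2 t^2 D <= rr^2 X.
    Testing with w itself then bounds the energy of w by (rr^2 + 1) X. Since X is at most a small
    multiple of this energy plus K' D, it is at most X/2 for the chosen t. *)
Lemma unique_continuation (C : R) r u G : 2 < p -> (0 < N)%N -> 0 < C ->
  (forall v G, grad v G -> np mu p v `^ (2 / p) <= C * en G) -> 0 <= r ->
  grad u G -> (forall x, ~ cube r x -> u x = 0) ->
  (forall v H, grad v H -> ipG G H = I (fun x => psi p (u x) * v x)) ->
  \forall x \ae mu, u x = 0.
Proof.
move=> hp N0 C0 sob r0 gu u0 EL; pose i := Ordinal N0.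
have Lu2 := higher_integrability hp C0 sob gu EL.
have [mu_ _] := grad_Lp gu.
have cu := cgrad_cut gu u0; set G' := fun x => _ in cu; have [gu' _ _] := cu.
have EL' v H : grad v H -> ipG G' H = I (fun x => psi p (u x) * v x).
  by move=> gv; rewrite -(EL _ _ gv); apply: ipG_unique gu' gu => k; exact: grad_L2 gv.
set rr := r + 1 in cu; have rr0 : 0 <= rr by rewrite addr_ge0.
have q0 : 0 < rr ^+ 2 + 1 by rewrite ltr_wpDl ?sqr_ge0.
have e0 : 0 < (4 * (rr ^+ 2 + 1))^-1 by rewrite invr_gt0 mulr_gt0.
have [K K0 HK] := Lp_cut_small hp C0 sob Lu2 e0.
set K' := K `^ (p - 2); have K'0 : 0 <= K' by exact: powR_ge0.
(* Chosen so that 2 K' rr^2 <= t <= t^2, whence K' D <= X/4; the constant in [e0] makes the energy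
   term contribute the other X/4. *)
pose t := 1 + 2 * K' * rr ^+ 2.
have t1 : 1 <= t by rewrite lerDl !mulr_ge0 ?sqr_ge0.
pose w x := expw i t x * u x.
pose W x := expw i t x *: (G' x + (t * u x) *: e_ i).
have cw : cgrad rr w W by exact: cgrad_expw.
have [gw w0 _] := cw; have Lw := cgrad_L2 hp cw.
have [LV HV] := L2_potential hp Lu2 mu_ (grad_Lp gw) Lw.
have t0 : 0 <= t by apply: le_trans t1.
have h1 := carleman hp rr0 t0 cu EL' (erefl w) (erefl W) LV.
have h2 := poincare i hp rr0 cw.
have h3 := conjugated_equation hp rr0 rr0 cu EL' cw (erefl w) (erefl W).
have h4 := le_trans (HV K K0) (lerD (HK _ _ gw) (lexx (K' * n2 mu w))).
rewrite [ip mu (comp i W) w]ipC subrr mulr0 addr0 ipff in h3.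
have h5 : ip mu (fun x => `|u x| `^ (p - 2) * w x) w <=
    n2 mu (fun x => `|u x| `^ (p - 2) * w x) + n2 mu w.
  have := n2_ge0 mu (fun x => `|u x| `^ (p - 2) * w x - w x); rewrite n2B//.
  by have := n2_ge0 mu w; have := n2_ge0 mu (fun x => `|u x| `^ (p - 2) * w x); lra.
rewrite -/(ip _ _ _) in h3; have B : ipG W W = en W.
  by apply: eq_bigr => k _; rewrite ipff.
rewrite B in h3.
move: h1 h2 h3 h4 h5 (n2_ge0 mu w) (n2_ge0 mu (comp i W)).
set A := n2 mu (comp i W); set D := n2 mu w; set X := n2 mu (fun x => _ * _).
set P := ip mu _ _; set EW := en W => h1 h2 h3 h4 h5 D0 A0.
suff D_0 : D = 0.
  have := n2_eq0 Lw D_0; apply: filterS => x /eqP.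
  by rewrite /w mulf_eq0 (gt_eqF (expR_gt0 _))/= => /eqP.
have tt : t <= t ^+ 2 by rewrite expr2 ler_peMr.
have X0 : 0 <= X by exact: n2_ge0.
have tD : 2 * t ^+ 2 * D <= rr ^+ 2 * X.
  have : 2 * t ^+ 2 * D <= 2 * t ^+ 2 * (2 * rr ^+ 2 * A).
    by rewrite ler_wpM2l ?mulr_ge0 ?sqr_ge0.
  have : rr ^+ 2 * ((2 * t) ^+ 2 * A) <= rr ^+ 2 * X by rewrite ler_wpM2l ?sqr_ge0.
  by lra.
have D1 : 2 * D <= rr ^+ 2 * X.
  have : 1 * D <= t ^+ 2 * D by rewrite ler_wpM2r//; exact: le_trans tt.
  by lra.
have BX : EW <= (rr ^+ 2 + 1) * X by lra.
have KX : K' * D <= 4^-1 * X.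
  have tK : 2 * K' * rr ^+ 2 * D <= t ^+ 2 * D.
    by rewrite ler_wpM2r//; apply: le_trans tt; rewrite lerDr.
  have s0 : 0 < rr ^+ 2 by rewrite exprn_gt0// ltr_wpDl.
  rewrite -(ler_pM2l s0); lra.
have : (4 * (rr ^+ 2 + 1))^-1 * EW <= 4^-1 * X.
  rewrite invfM -mulrA ler_pM2l// mulrC ler_pdivrMr// mulrC; exact: BX.
move=> eX; have X_0 : X = 0 by lra.
by apply/eqP; rewrite eq_le D0 andbT; move: D1; rewrite X_0 mulr0; lra.
Qed.

End unique_continuation.

(** * The functional and its critical points *)

Section functional.
Context (R : realType) (N : nat).
Implicit Types (u v w f g q : 'rV[R]_N -> R) (G H : 'rV[R]_N -> 'rV[R]_N)
  (x y c : 'rV[R]_N) (i k : 'I_N) (t h r s : R) (Omega : set 'rV[R]_N).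

Notation mu := (lebesgue_rV N : {measure set 'rV[R]_N -> \bar R}).
Notation I f := (Rintegral mu setT f).
Notation p := (@crit_exp R N).
Notation grad := (grad p).

Lemma crit_exp_gt2 : (3 <= N)%N -> 2 < p.
Proof.
move=> hN; have N3 : 3 <= N%:R :> R by rewrite ler_nat.
by rewrite /crit_exp ltr_pdivlMr; lra.
Qed.

Lemma crit_exp_sobolev : (3 <= N)%N -> 1 - 2 / p = 2 / N%:R.
Proof.
move=> hN; have N3 : 3 <= N%:R :> R by rewrite ler_nat.
by rewrite /crit_exp; field; rewrite ?mulf_neq0 ?gt_eqF//; lra.
Qed.

Lemma D12_grad u : 2 < p -> D12 u <-> exists G, grad u G.
Proof.
move=> hp; have p0 : 0 < p by lra.
split=> [[/(Lfun_Lp _ p0) Lu [G wG]]|[G gu]].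
  by exists G; exact: weak_gradient_grad.
split; first by apply/(Lfun_Lp _ p0); exact: grad_Lp gu.
by exists G; exact: grad_weak_gradient gu.
Qed.

Lemma en_unique u G H : grad u G -> grad u H -> en G = en H.
Proof.
move=> gu gv; apply: eq_bigr => i _.
have le A B : grad u A -> grad u B -> n2 mu (comp i A) <= n2 mu (comp i B).
  move=> gA gB; have LA := grad_L2 i gA; have LB := grad_L2 i gB.
  rewrite -ler_sqrt ?n2_ge0//.
  have := n2_triangle (L2B LA LB) LB; rewrite (grad_unique i gA gB) sqrtr0 add0r.
  by rewrite (_ : (fun x => _) = comp i A)//; apply/funext => x; rewrite subrK.
by apply/eqP; rewrite eq_le !le.
Qed.

Lemma D12_norm_sqr u G : 2 < p -> grad u G -> D12_norm u ^+ 2 = en G.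
Proof.
move=> hp gu; have p0 : 0 < p by lra.
have gn : grad u (nabla u).
  apply: weak_gradient_grad => //; first exact: grad_Lp gu.
  by apply: (@xgetPex _ _ [set g | L2_weak_gradient u g]); exists G; exact: grad_weak_gradient gu.
rewrite (en_unique gu gn) /D12_norm sqr_sqrtr; last first.
  by apply: I_ge0 => x; rewrite sqr_ge0.
rewrite /en /n2 -I_sum; last by move=> i; exact: (grad_L2 i gn).2.
apply: I_eq => x; rewrite /enorm sqr_sqrtr /dot; last first.
  by apply: sumr_ge0 => i _; rewrite -expr2 sqr_ge0.
by apply: eq_bigr => i _; rewrite expr2.
Qed.

Lemma J0E Omega u G : 2 < p -> grad u G ->
  J0 Omega u = 2^-1 * en G - p^-1 * I (fun x => Q Omega x * `|u x| `^ p).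
Proof. by move=> hp gu; rewrite /J0 (D12_norm_sqr hp gu). Qed.

Lemma D12_norm_en u G : 2 < p -> grad u G -> D12_norm u = Num.sqrt (en G).
Proof.
by move=> hp gu; rewrite -(D12_norm_sqr hp gu) sqrtr_sqr ger0_norm// /D12_norm sqrtr_ge0.
Qed.

Lemma norm_Q Omega x : `|Q Omega x| = 1.
Proof. by rewrite /Q; case: ifP => _; rewrite ?normrN normr1. Qed.

Lemma Q_indic Omega x : Q Omega x = 2 * \1_Omega x - 1.
Proof. by rewrite /Q indicE; case: (x \in Omega) => /=; lra. Qed.

Lemma measurable_Q Omega : measurable Omega -> measurable_fun setT (Q Omega).
Proof.
move=> mO; rewrite (_ : Q Omega = fun x => 2 * \1_Omega x - 1); last first.
  by apply/funext => x; exact: Q_indic.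
apply: measurable_funB => //; apply: measurable_funM => //; exact: measurable_indic.
Qed.

Lemma rint_weight q f : measurable_fun setT q -> (forall x, `|q x| <= 1) ->
  rint mu f -> rint mu (fun x => q x * f x).
Proof.
move=> mq q1 rf; have mf := rint_measurable rf.
apply: (rint_le _ (rint_norm rf)); first exact: measurable_funM.
by move=> x; rewrite normrM ler_piMl.
Qed.

(** The pointwise remainder lies between 0 ([powR_convex]) and a quadratic bound ([powR_taylor]), so
    the weight may have any sign. *)
Lemma weight_expand q u v : 2 < p -> measurable_fun setT q -> (forall x, `|q x| <= 1) ->
  Lp mu p u -> Lp mu p v -> exists2 K, 0 <= K & forall t, `|t| <= 1 ->
    `|I (fun x => q x * `|u x + t * v x| `^ p) - I (fun x => q x * `|u x| `^ p) -
      t * (p * I (fun x => q x * (psi p (u x) * v x)))| <= K * t ^+ 2.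
Proof.
move=> hp mq q1 Lu Lv; have p0 : 0 < p by lra.
have [mu_ iu] := Lu; have [mv iv] := Lv.
pose c : R := p * (p - 1); have c0 : 0 <= c by rewrite mulr_ge0//; lra.
(* Two uses of [powR_sqr_le] give at most 2 (|u|^p + |v|^p) + |u + t v|^p - |u|^p, and [powRD_le]
   contributes 2^p. *)
pose D := 2 + 2 `^ p; have D0 : 0 <= D by rewrite addr_ge0// powR_ge0.
exists (c * (D * (np mu p u + np mu p v))).
  by apply: mulr_ge0 => //; apply: mulr_ge0 => //; apply: addr_ge0; exact: np_ge0.
move=> t t1; have Ltv := LpZ t p0 Lv; have [[muv iuv] _] := LpD hp Lu Ltv.
have ip_ := Lp_psi_rint hp Lu Lv.
have -> : I (fun x => q x * `|u x + t * v x| `^ p) - I (fun x => q x * `|u x| `^ p) -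
      t * (p * I (fun x => q x * (psi p (u x) * v x))) =
    I (fun x => q x * (`|u x + t * v x| `^ p - `|u x| `^ p - p * (psi p (u x) * (t * v x)))).
  have r1 := rint_weight mq q1 iuv; have r2 := rint_weight mq q1 iu.
  have r3 := rint_weight mq q1 ip_.
  rewrite -IZ// -IZ; last exact: rintZ.
  rewrite -IB// -IB; [|exact: rintB|by apply: rintZ; exact: rintZ].
  by apply: I_eq => x; ring.
have rr : rint mu (fun x => `|u x + t * v x| `^ p - `|u x| `^ p - p * (psi p (u x) * (t * v x))).
  apply: (rint_eq (f := fun x => (`|u x + t * v x| `^ p - `|u x| `^ p) - (t * p) * (psi p (u x) * v x))).
    by move=> x; ring.
  by apply: rintB; [exact: rintB | exact: rintZ].
have rw := rint_weight mq q1 rr.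
apply: le_trans (I_norm rw) _.
have -> : c * (D * (np mu p u + np mu p v)) * t ^+ 2 =
    I (fun x => (c * D * t ^+ 2) * (`|u x| `^ p + `|v x| `^ p)).
  by rewrite (IZ _ (rintD iu iv)) (ID iu iv) -!/(np _ _ _); ring.
apply: I_le; [exact: rint_norm | by apply: rintZ; exact: rintD |] => x.
rewrite normrM; apply: le_trans (ler_piMl (normr_ge0 _) (q1 x)) _.
have h1 := powR_convex (u x) (u x + t * v x) hp.
have h2 := powR_taylor (u x) (u x + t * v x) hp.
rewrite (addrC (u x)) addrK addrC in h1 h2.
rewrite ger0_norm; last by lra.
apply: le_trans h2 _; rewrite exprMn.
have -> : p * (p - 1) * ((`|u x| `^ (p - 2) + `|u x + t * v x| `^ (p - 2)) * (t ^+ 2 * v x ^+ 2)) =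
  c * t ^+ 2 * ((`|u x| `^ (p - 2) + `|u x + t * v x| `^ (p - 2)) * v x ^+ 2) by rewrite /c; ring.
have -> : c * D * t ^+ 2 * (`|u x| `^ p + `|v x| `^ p) =
  c * t ^+ 2 * (D * (`|u x| `^ p + `|v x| `^ p)) by ring.
apply: ler_wpM2l; first by rewrite mulr_ge0 ?sqr_ge0.
rewrite mulrDl.
have h3 := powR_sqr_le (u x) (v x) hp; have h4 := powR_sqr_le (u x + t * v x) (v x) hp.
have h5 := powRD_le (u x) (t * v x) hp.
have h6 : `|t * v x| `^ p <= `|v x| `^ p.
  by apply: powR_le; rewrite ?(ltW p0)// normrM ler_piMl.
have : 2 `^ p * (`|u x| `^ p + `|t * v x| `^ p) <= 2 `^ p * (`|u x| `^ p + `|v x| `^ p).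
  by rewrite ler_wpM2l ?powR_ge0// lerD2l.
have := powR_ge0 `|u x| p; have := powR_ge0 `|v x| p.
by rewrite /D; lra.
Qed.

Lemma en_expand u v G H t : grad u G -> grad v H ->
  en (fun x => G x + t *: H x) = en G + t * (2 * ipG G H) + t ^+ 2 * en H.
Proof.
move=> gu gv; rewrite /en /ipG !mulr_sumr -!big_split /=; apply: eq_bigr => i _.
have LG := grad_L2 i gu; have LH := grad_L2 i gv.
have -> : comp i (fun x => G x + t *: H x) = fun x => comp i G x + t * comp i H x.
  by apply/funext => x; rewrite /comp !mxE.
by rewrite n2D//; [rewrite n2Z// ipZr//; ring | exact: L2Z].
Qed.

Lemma quad_le0 (a C d : R) : 0 < d ->
  (forall t, 0 < t -> t <= d -> t * a <= C * t ^+ 2) -> a <= 0.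
Proof.
move=> d0 H; rewrite leNgt; apply/negP => a0.
have C0 : 0 < `|C| + 1 by rewrite ltr_wpDl.
pose t := Num.min d (a / (2 * (`|C| + 1))).
have t0 : 0 < t by rewrite lt_min d0 divr_gt0// mulr_gt0.
have td : t <= d by rewrite ge_min lexx.
have ta : t <= a / (2 * (`|C| + 1)) by rewrite ge_min lexx orbT.
have := H t t0 td; rewrite expr2 mulrCA ler_pM2l//.
rewrite ler_pdivlMr ?mulr_gt0// in ta.
have : C * t <= `|C| * t by rewrite ler_wpM2r ?(ltW t0)// ler_norm.
by lra.
Qed.

(** The inequality <= 0 in every direction suffices, since the direction may be reversed. The
    definition of a critical point costs e t for each e > 0, removed by letting t and then e tend to
    0. *)
Lemma critical_equation Omega u G v H : 2 < p -> measurable Omega ->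
  critical_point Omega u -> grad u G -> grad v H ->
  ipG G H = I (fun x => Q Omega x * (psi p (u x) * v x)).
Proof.
move=> hp mO [_ cr] gu; have p0 : 0 < p by lra.
set P := fun v => I (fun x => Q Omega x * (psi p (u x) * v x)).
have mQ := measurable_Q mO; have Q1 x : `|Q Omega x| <= 1 by rewrite norm_Q.
have Lu := grad_Lp gu.
suff main w W : grad w W -> ipG G W - P w <= 0.
  move=> gv; apply/eqP; rewrite eq_le -subr_le0 main//=.
  have := main _ _ (gradZ (-1) p0 gv);
  have -> : ipG G (fun x => -1 *: H x) = - ipG G H.
    rewrite /ipG -sumrN; apply: eq_bigr => i _.
    rewrite -[RHS]mulN1r -ipZr//; [|exact: grad_L2 gv|exact: grad_L2 gu].
    by congr ip; apply/funext => x; rewrite /comp !mxE.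
  have -> : P (fun x => -1 * v x) = - P v.
    rewrite /P -[RHS]mulN1r -IZ; last by apply: rint_weight => //; apply: Lp_psi_rint => //; exact: grad_Lp gv.
    by apply: I_eq => x; ring.
  by rewrite -/(P v); lra.
move=> gw; have Lw := grad_Lp gw.
have [K K0 HK] := weight_expand hp mQ Q1 Lu Lw.
apply/ler_addgt0Pl => e e0; rewrite addr0.
(* With slope e/s the allowed variation along t w is at most e t; the 1 keeps s positive. *)
pose s := Num.sqrt (en W) + 1; have s0 : 0 < s by rewrite ltr_wpDl ?sqrtr_ge0.
have e1 : 0 < e / s by rewrite divr_gt0.
have [d d0 Hd] := cr _ e1.
suff : ipG G W - P w - e <= 0 by lra.
apply: (@quad_le0 _ (p^-1 * K) (Num.min 1 (d / s))).
  by rewrite lt_min ltr01 divr_gt0.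
move=> t t0; rewrite le_min => /andP[t1 td].
have gtw := gradZ t p0 gw.
have ntw : D12_norm (fun x => t * w x) = t * Num.sqrt (en W).
  rewrite (D12_norm_en hp gtw) -[t in RHS]gtr0_norm// -sqrtr_sqr -sqrtrM ?sqr_ge0//.
  congr Num.sqrt; rewrite /en mulr_sumr; apply: eq_bigr => i _.
  by rewrite -n2Z; [congr n2; apply/funext => x; rewrite /comp !mxE | exact: grad_L2 gw].
have D12tw : D12 (fun x => t * w x) by apply/D12_grad => //; eexists; exact: gtw.
have small : D12_norm (fun x => t * w x) < d.
  rewrite ntw; apply: (@lt_le_trans _ _ (t * s)); first by rewrite ltr_pM2l// ltrDl.
  by rewrite -ler_pdivlMr.
have := Hd _ D12tw small; rewrite ntw.
have gutw : grad (u \+ (fun x => t * w x)) (fun x => G x + t *: W x) := gradD hp gu gtw.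
have J1 : J0 Omega (u \+ (fun x => t * w x)) =
    2^-1 * (en G + t * (2 * ipG G W) + t ^+ 2 * en W) -
    p^-1 * I (fun x => Q Omega x * `|u x + t * w x| `^ p).
  by rewrite (J0E Omega hp gutw) (en_expand t gu gw).
rewrite J1 (J0E Omega hp gu).
have := HK t; rewrite (ger0_norm (ltW t0)) => /(_ t1).
rewrite -/(P w).
set A := I _; set B := I _; rewrite !ler_norml => /andP[h1 h2] /andP[h3 h4].
have h5 : p^-1 * (A - B - t * (p * P w)) <= p^-1 * (K * t ^+ 2).
  by rewrite ler_wpM2l ?invr_ge0// ltW.
have h6 : p^-1 * (A - B - t * (p * P w)) = p^-1 * A - p^-1 * B - t * P w.
  by field; rewrite gt_eqF.
have h7 : e / s * (t * Num.sqrt (en W)) <= t * e.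
  rewrite mulrCA ler_wpM2l ?(ltW t0)// -mulrA ler_piMr ?(ltW e0)// mulrC.
  by rewrite ler_pdivrMr// mul1r lerDl.
have h8 : 0 <= t ^+ 2 * en W by rewrite mulr_ge0 ?sqr_ge0 ?en_ge0.
by rewrite h6 in h5; lra.
Qed.

End functional.

(** * Least energy solutions *)

Section least_energy.
Context (R : realType) (N : nat).
Implicit Types (u v w f g q : 'rV[R]_N -> R) (G H : 'rV[R]_N -> 'rV[R]_N)
  (x y c : 'rV[R]_N) (i k : 'I_N) (a t h r s : R) (Omega : set 'rV[R]_N).

Notation mu := (lebesgue_rV N : {measure set 'rV[R]_N -> \bar R}).
Notation I f := (Rintegral mu setT f).
Notation p := (@crit_exp R N).
Notation grad := (grad p).

Lemma powR_pred (A q : R) : 0 < A -> A `^ q = A `^ (q - 1) * A.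
Proof.
move=> A0; have -> : A `^ q = A `^ (q - 1 + 1) by rewrite subrK.
by rewrite powRD ?(gt_eqF A0) ?implybT// powRr1// ltW.
Qed.

(* The dilations that leave both the Dirichlet integral and the L^p norm invariant. *)
Definition dil a c v : 'rV[R]_N -> R := fun x => a `^ (N%:R / p) * v (a *: x + c).

Lemma grad_dil a c v G : 2 < p -> 0 < a -> grad v G ->
  grad (dil a c v) (fun x => a `^ (N%:R / p) *: (a *: G (a *: x + c))).
Proof. by move=> hp a0 gv; apply: gradZ; [lra | exact: grad_affine]. Qed.

Lemma en_dil a c v G : (3 <= N)%N -> 0 < a -> grad v G ->
  en (fun x => a `^ (N%:R / p) *: (a *: G (a *: x + c))) = en G.
Proof.
move=> hN a0 gv; have N3 : 3 <= N%:R :> R by rewrite ler_nat.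
apply: eq_bigr => i _; have LG := grad_L2 i gv.
have -> : comp i (fun x => a `^ (N%:R / p) *: (a *: G (a *: x + c))) =
    fun x => (a `^ (N%:R / p) * a) * comp i G (a *: x + c).
  by apply/funext => x; rewrite /comp !mxE mulrA.
rewrite n2Z; last exact: L2_affine.
rewrite n2_affine// mulrA exprMn -(powR_mulrn 2 (powR_ge0 a (N%:R / p))) -powRrM.
rewrite -[RHS]mul1r; congr (_ * _); apply/eqP.
rewrite -(powR_mulrn 2 (ltW a0)) -(powR_mulrn N (ltW a0)) -powRN -!powRD ?(gt_eqF a0) ?implybT//.
rewrite (_ : _ + _ = 0) ?powRr0//.
by rewrite /crit_exp; field; rewrite ?mulf_neq0 ?gt_eqF//; lra.
Qed.

Lemma I_dil a c v q : 2 < p -> 0 < a -> Lp mu p v -> measurable_fun setT q ->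
  (forall x, `|q x| <= 1) ->
  I (fun x => q x * `|dil a c v x| `^ p) = I (fun y => q (a^-1 *: (y - c)) * `|v y| `^ p).
Proof.
move=> hp a0 Lv mq q1; have p0 : 0 < p by lra.
have [mv iv] := Lv.
have mq' : measurable_fun setT (fun y : 'rV[R]_N => q (a^-1 *: (y - c))).
  have -> : (fun y : 'rV[R]_N => q (a^-1 *: (y - c))) = fun y => q (a^-1 *: y + - (a^-1 *: c)).
    by apply/funext => y; rewrite scalerBr.
  by apply: measurable_comp_affine; rewrite ?invr_gt0.
have i1 : rint mu (fun y => q (a^-1 *: (y - c)) * `|v y| `^ p) by exact: rint_weight.
have aN : (a ^+ N) != 0 by rewrite expf_neq0// gt_eqF.
have -> : I (fun x => q x * `|dil a c v x| `^ p) =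
    I (fun x => a ^+ N * (q (a^-1 *: (a *: x + c - c)) * `|v (a *: x + c)| `^ p)).
  apply: I_eq => x; rewrite addrK scalerA mulVf ?scale1r ?(gt_eqF a0)// mulrCA.
  rewrite /dil normrM ger0_norm ?powR_ge0// powRM ?powR_ge0// -powRrM divfK ?(gt_eqF p0)//.
  by rewrite powR_mulrn// ltW.
rewrite IZ; last exact: (rint_affine c a0 i1).
by rewrite (I_affine c a0 i1) mulVKf.
Qed.

Lemma ball_of_open Omega x : open Omega -> Omega x ->
  exists2 r, 0 < r & forall y, `|y - x| < r -> Omega y.
Proof.
move=> oO Ox; have /nbhs_normP[r /= r0 H] : nbhs x Omega by exact: open_nbhs_nbhs.
by exists r => // y yx; apply: H; rewrite /= distrC.
Qed.

(** After the change of variables the weight is evaluated at (y + n x1)/(n + 1), which tends to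
    [x1], so it is eventually 1 at every y. *)
Lemma blow_up Omega x1 v : 2 < p -> open Omega -> Omega x1 -> Lp mu p v ->
  (fun n => I (fun x => Q Omega x * `|dil n.+1%:R (- (n%:R *: x1)) v x| `^ p)) @ \oo --> np mu p v.
Proof.
move=> hp oO Ox Lv; have [mv iv] := Lv.
have mO := open_measurable_rV oO; have mQ := measurable_Q mO.
have Q1 x : `|Q Omega x| <= 1 by rewrite norm_Q.
have E n : I (fun x => Q Omega x * `|dil n.+1%:R (- (n%:R *: x1)) v x| `^ p) =
    I (fun y => Q Omega (n.+1%:R^-1 *: (y + n%:R *: x1)) * `|v y| `^ p).
  by rewrite (I_dil _ hp (ltr0Sn R n) Lv mQ Q1) opprK.
under eq_fun do rewrite E.
apply: (I_dct _ _ iv).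
- move=> n; apply: measurable_funM; last exact: measurable_powR_norm.
  under eq_fun do rewrite scalerDr.
  by apply: measurable_comp_affine => //; rewrite invr_gt0.
- exact: measurable_powR_norm.
- by move=> n x; rewrite normrM norm_Q mul1r ger0_norm ?powR_ge0.
apply: nearW => y; have [r r0 Hr] := ball_of_open oO Ox.
apply: (@cvg_trans _ ((fun=> `|v y| `^ p : R) @ \oo)); last exact: cvg_cst.
apply: near_eq_cvg; near=> n.
have -> : Q Omega (n.+1%:R^-1 *: (y + n%:R *: x1)) = 1; last by rewrite mul1r.
rewrite /Q ifT//; apply/mem_set/Hr.
have n0 : 0 < n.+1%:R :> R by rewrite ltr0n.
have -> : n.+1%:R^-1 *: (y + n%:R *: x1) - x1 = n.+1%:R^-1 *: (y - x1).
  apply: (scalerI (lt0r_neq0 n0)).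
  rewrite scalerBr !scalerA mulfV ?(gt_eqF n0)// !scale1r.
  by rewrite -natr1 scalerDl scale1r opprD addrA addrK.
rewrite normrZ ger0_norm ?invr_ge0// ltr_pdivrMl// -ltr_pdivrMr//.
apply: (@le_lt_trans _ _ n%:R); last by rewrite ltr_nat.
by near: n; exact: nbhs_infty_ger.
Unshelve. all: by end_near.
Qed.

Lemma bounded_cube Omega : bounded_set Omega ->
  exists2 r, 0 < r & Omega `<=` @cube R N r.
Proof. by move=> /ex_strict_bound_gt0[r r0 H]; exists r => // x Ox; exact: H. Qed.

(** Multiplying [u] by the indicator of Omega changes it on a null set only and gives a
    representative that vanishes everywhere off a cube. *)
Lemma uc_bounded Omega u G : (3 <= N)%N -> measurable Omega -> bounded_set Omega ->
  grad u G -> (\forall x \ae mu, Omega x \/ u x = 0) ->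
  (forall v H, grad v H -> ipG G H = I (fun x => psi p (u x) * v x)) ->
  \forall x \ae mu, u x = 0.
Proof.
move=> hN mO bO gu uO EL; have hp := crit_exp_gt2 R hN.
have N0 : (0 < N)%N by exact: leq_trans hN.
have [C C0 sob] := sobolev hp N0 (crit_exp_sobolev R hN).
have [r r0 Or] := bounded_cube bO.
have [mu_ _] := grad_Lp gu.
pose u' x := \1_Omega x * u x.
have mu' : measurable_fun setT u'.
  by apply: measurable_funM => //; exact: measurable_indic.
have uu' : \forall x \ae mu, u x = u' x.
  apply: filterS uO => x; rewrite /u' indicE; have [Ox|Ox] := pselect (Omega x).
    by rewrite mem_set// mul1r.
  by rewrite memNset// mul0r; case.
have gu' := grad_ae mu' gu uu'.
have u'0 : \forall x \ae mu, u' x = 0.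
  apply: (unique_continuation hp N0 C0 sob (ltW r0) gu').
    by move=> x xr; rewrite /u' indicE memNset ?mul0r// => /Or.
  move=> v H gv; rewrite (EL _ _ gv); have Lv := grad_Lp gv.
  apply: I_ae.
  - exact: rint_measurable (Lp_psi_rint hp (grad_Lp gu) Lv).
  - exact: rint_measurable (Lp_psi_rint hp (grad_Lp gu') Lv).
  - by apply: filterS uu' => x ->.
by apply: filterS2 uu' u'0 => x ->.
Qed.

Lemma nehari_grad Omega u : 2 < p -> nehari Omega u -> exists G, [/\ grad u G,
  ~ (\forall x \ae mu, u x = 0) & en G = I (fun x => Q Omega x * `|u x| `^ p)].
Proof.
move=> hp [/(D12_grad _ hp)[G gu] nz E]; exists G; split => //.
  by move=> H; apply: nz; apply: filterS H => x ->.
by rewrite -(D12_norm_sqr hp gu).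
Qed.

Lemma grad_nehari Omega u G : 2 < p -> grad u G -> ~ (\forall x \ae mu, u x = 0) ->
  en G = I (fun x => Q Omega x * `|u x| `^ p) -> nehari Omega u.
Proof.
move=> hp gu nz E; split.
- by apply/D12_grad => //; exists G.
- by move=> H; apply: nz; move: H; apply: filterS => x /= ->.
- by rewrite (D12_norm_sqr hp gu).
Qed.

Lemma J0_nehari Omega u G : 2 < p -> grad u G ->
  en G = I (fun x => Q Omega x * `|u x| `^ p) -> J0 Omega u = (2^-1 - p^-1) * en G.
Proof. by move=> hp gu E; rewrite (J0E Omega hp gu) -E mulrBl. Qed.

Lemma np_pos u : Lp mu p u -> ~ (\forall x \ae mu, u x = 0) -> 0 < np mu p u.
Proof.
move=> Lu nz; rewrite lt_neqAle np_ge0 andbT eq_sym; apply/eqP => n0.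
by apply: nz; exact: (np_eq0 Lu n0).
Qed.

Lemma np_ae0 u : 0 < p -> measurable_fun setT u -> (\forall x \ae mu, u x = 0) -> np mu p u = 0.
Proof.
move=> p0 mu_ u0; rewrite -(I0 mu); apply: I_ae => //; first exact: measurable_powR_norm.
by apply: filterS u0 => x ->; rewrite normr0 powR0// gt_eqF.
Qed.

Lemma Qint_le_np Omega u : measurable Omega -> Lp mu p u ->
  I (fun x => Q Omega x * `|u x| `^ p) <= np mu p u.
Proof.
move=> mO [mu_ iu]; have mQ := measurable_Q mO.
apply: I_le => //; first by apply: rint_weight => // x; rewrite norm_Q.
move=> x; have := ler_norm (Q Omega x); rewrite norm_Q => h.
by rewrite ler_piMl ?powR_ge0.
Qed.

Section minimizer.
Variables (Omega : set 'rV[R]_N) (u : 'rV[R]_N -> R) (G : 'rV[R]_N -> 'rV[R]_N).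
Hypotheses (hN : (3 <= N)%N) (oO : open Omega) (gu : grad u G).
Hypotheses (nz : ~ (\forall x \ae mu, u x = 0))
  (uE : en G = I (fun x => Q Omega x * `|u x| `^ p))
  (umin : forall v, nehari Omega v -> J0 Omega u <= J0 Omega v).

Let hp : 2 < p := crit_exp_gt2 R hN.
Let N0 : (0 < N)%N := leq_trans (isT : (0 < 3)%N) hN.
Let p0 : 0 < p. Proof. by have := hp; lra. Qed.
Let mO : measurable Omega := open_measurable_rV oO.

Lemma en_pos v H : grad v H -> 0 < np mu p v -> 0 < en H.
Proof.
move=> gv nv; have [C C0 sob] := sobolev hp N0 (crit_exp_sobolev R hN).
have := sob _ _ gv; have : 0 < np mu p v `^ (2 / p) by exact: powR_gt0.
by move=> h /(lt_le_trans h); rewrite pmulr_rgt0.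
Qed.

Let enG0 : 0 < en G := en_pos gu (np_pos (grad_Lp gu) nz).

(** When the weighted integral is positive, a multiple of v lies on the Nehari manifold, where J0 is
    1/2 - 1/p times the energy; minimality then compares energies. Otherwise the left side is not
    positive. *)
Lemma min_weighted v H : grad v H ->
  en G `^ (p / 2 - 1) * I (fun x => Q Omega x * `|v x| `^ p) <= en H `^ (p / 2).
Proof.
move=> gv; set q := I _.
have [q0|q0] := leP q 0.
  apply: (@le_trans _ _ 0); last exact: powR_ge0.
  by rewrite mulr_ge0_le0// powR_ge0.
have Lv := grad_Lp gv.
have nv : 0 < np mu p v by apply: lt_le_trans q0 (Qint_le_np mO Lv).
have B0 := en_pos gv nv; set B := en H in B0 *.
(* The solution of s^2 B = s^p q, the Nehari condition for [s * v]. *)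
pose s := (B / q) `^ (p - 2)^-1.
have s0 : 0 < s by rewrite powR_gt0// divr_gt0.
have p2 : 0 < p - 2 by have := hp; lra.
have sp : s `^ (p - 2) = B / q.
  by rewrite /s -powRrM mulVf ?gt_eqF// powRr1// divr_ge0// ltW.
have gsv := gradZ s p0 gv.
have enE : en (fun x => s *: H x) = s ^+ 2 * B.
  rewrite /B /en mulr_sumr; apply: eq_bigr => i _.
  by rewrite -n2Z; [congr n2; apply/funext => x; rewrite /comp !mxE | exact: grad_L2 gv].
have qE : I (fun x => Q Omega x * `|s * v x| `^ p) = s `^ p * q.
  rewrite -IZ.
    apply: I_eq => x; rewrite normrM (gtr0_norm s0) powRM ?(ltW s0)//; ring.
  have [_ iv] := Lv; apply: rint_weight => //; first exact: measurable_Q.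
  by move=> x; rewrite norm_Q.
have E : en (fun x => s *: H x) = I (fun x => Q Omega x * `|s * v x| `^ p).
  rewrite enE qE (_ : p = 2 + (p - 2)); last by ring.
  rewrite powRD ?(gt_eqF s0) ?implybT// sp -powR_mulrn ?(ltW s0)//.
  by rewrite -mulrA divfK// gt_eqF.
have nzs : ~ (\forall x \ae mu, s * v x = 0).
  move=> sv0; have : \forall x \ae mu, v x = 0.
    by apply: filterS sv0 => x /eqP; rewrite mulf_eq0 (gt_eqF s0) => /eqP.
  by move/(np_ae0 p0 Lv.1) => v0; rewrite v0 ltxx in nv.
have := umin (grad_nehari hp gsv nzs E).
rewrite (J0_nehari hp gu uE) (J0_nehari hp gsv E) enE ler_pM2l; last first.
  by rewrite subr_gt0 ltf_pV2// posrE.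
move=> h.
have h2 : en G `^ (p / 2 - 1) <= (s ^+ 2 * B) `^ (p / 2 - 1).
  by apply: powR_le => //; [lra | exact: ltW].
have h3 : (s ^+ 2 * B) `^ (p / 2 - 1) * q = B `^ (p / 2).
  rewrite powRM ?sqr_ge0 ?(ltW B0)// -powR_mulrn ?(ltW s0)// -powRrM.
  have -> : 2%:R * (p / 2 - 1) = p - 2 by field.
  rewrite sp (powR_pred (p / 2) B0).
  by field; rewrite gt_eqF.
by rewrite -h3 ler_wpM2r// ltW.
Qed.

Lemma min_np v H : grad v H -> en G `^ (p / 2 - 1) * np mu p v <= en H `^ (p / 2).
Proof.
(* For empty Omega there is no centre of dilation, but then en G = - np u contradicts en G > 0. *)
move=> gv; have [[x1 Ox]|noO] := pselect (exists x, Omega x); last first.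
  have E : en G = - np mu p u.
    rewrite uE -[RHS]mulN1r -IZ; last by case: (grad_Lp gu).
    apply: I_eq => x; rewrite /Q memNset// => Ox; apply: noO; by exists x.
  by have := enG0; rewrite E oppr_gt0 ltNge np_ge0.
have c1 := blow_up hp oO Ox (grad_Lp gv).
have c2 : (fun n => en G `^ (p / 2 - 1) *
    I (fun x => Q Omega x * `|dil n.+1%:R (- (n%:R *: x1)) v x| `^ p)) @ \oo -->
    en G `^ (p / 2 - 1) * np mu p v.
  by apply: cvgM => //; exact: cvg_cst.
apply: (le_cvg_seq c2 (cvg_cst (en H `^ (p / 2)))) => n.
have n0 : 0 < n.+1%:R :> R by rewrite ltr0n.
have := min_weighted (grad_dil (- (n%:R *: x1)) hp n0 gv).
by rewrite (en_dil (- (n%:R *: x1)) hN n0 gv).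
Qed.

(** For v = u, [min_np] reads np u <= en G, while en G is the integral of Q |u|^p and so is at most
    np u. Equality leaves no room for u where Q = -1. *)
Lemma min_support : (\forall x \ae mu, Omega x \/ u x = 0) /\ np mu p u = en G.
Proof.
have A0 := enG0; have [mu_ iu] := grad_Lp gu.
have h : np mu p u <= en G.
  have := min_np gu; rewrite (powR_pred (p / 2) A0).
  by rewrite ler_pM2l// powR_gt0.
have npE : np mu p u = en G.
  by apply/eqP; rewrite eq_le h uE Qint_le_np//; exact: grad_Lp gu.
split => //; have mQ := measurable_Q mO.
have iQ : rint mu (fun x => Q Omega x * `|u x| `^ p).
  by apply: rint_weight => // x; rewrite norm_Q.
have := I_eq0 (rintB iu iQ); rewrite IB// -uE -/(np _ _ _) npE subrr.
have le0 x : 0 <= `|u x| `^ p - Q Omega x * `|u x| `^ p.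
  rewrite subr_ge0 ler_piMl ?powR_ge0//.
  by have := ler_norm (Q Omega x); rewrite norm_Q.
move=> /(_ le0 erefl); apply: filterS => x.
have [Ox|Ox] := pselect (Omega x); first by left.
rewrite /Q memNset// => h0; right.
have : `|u x| `^ p = 0 by lra.
by move/eqP; rewrite powR_eq0 normr_eq0 => /andP[/eqP].
Qed.

(** By [min_support], u attains equality in [min_np], and this is the first variation there. On the
    left np(u + t w) is bounded below by convexity; on the right 1 + x <= exp x replaces the
    expansion of the power p/2. One-sided in t, then applied to -v. *)
Lemma min_equation v H : grad v H -> ipG G H = I (fun x => psi p (u x) * v x).
Proof.
have A0 := enG0; set A := en G in A0; have [_ npE] := min_support.
suff main w W : grad w W -> I (fun x => psi p (u x) * w x) - ipG G W <= 0.
  move=> gv; apply/eqP; rewrite eq_le -[X in _ && X]subr_le0 main// andbT.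
  have := main _ _ (gradZ (-1) p0 gv).
  have -> : ipG G (fun x => -1 *: H x) = - ipG G H.
    rewrite /ipG -sumrN; apply: eq_bigr => i _.
    rewrite -[RHS]mulN1r -ipZr//; [|exact: grad_L2 gv|exact: grad_L2 gu].
    by congr ip; apply/funext => x; rewrite /comp !mxE.
  have -> : I (fun x => psi p (u x) * (-1 * v x)) = - I (fun x => psi p (u x) * v x).
    rewrite -[RHS]mulN1r -IZ; last exact: Lp_psi_rint (grad_Lp gu) (grad_Lp gv).
    by apply: I_eq => x; ring.
  lra.
move=> gw; set P := I _; set L := ipG G W; set B := en W.
have B0 : 0 <= B by exact: en_ge0.
have Lu := grad_Lp gu; have Lw := grad_Lp gw.
(* Chosen so that |s| <= s0 t for 0 < t <= 1, with s the exponent defined below. *)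
pose s0 := p / 2 / A * (2 * `|L| + B).
have c0 : 0 <= p / 2 / A.
  by apply: divr_ge0; [apply: divr_ge0; [exact: ltW p0 |] | exact: ltW A0].
have s00 : 0 <= s0 by rewrite mulr_ge0// addr_ge0// mulr_ge0.
apply: (@quad_le0 R _ (A / p * (p / 2 / A * B + expR s0 * s0 ^+ 2)) 1) => // t t0 t1.
have gutw := gradD hp gu (gradZ t p0 gw).
have := min_np gutw; rewrite (en_expand t gu gw) -/A -/L -/B => h1.
pose s := p / 2 / A * (t * (2 * L) + t ^+ 2 * B).
have h2 : (A + t * (2 * L) + t ^+ 2 * B) `^ (p / 2) <= A `^ (p / 2) * expR s.
  have X0 : 0 <= A + t * (2 * L) + t ^+ 2 * B.
    by rewrite -(en_expand t gu gw) en_ge0.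
  have -> : A `^ (p / 2) * expR s = (A * expR ((t * (2 * L) + t ^+ 2 * B) / A)) `^ (p / 2).
    rewrite powRM ?(ltW A0) ?expR_ge0// -expRM; congr (_ * expR _).
    by rewrite /s; field; rewrite gt_eqF.
  apply: powR_le => //; first by rewrite divr_ge0// ltW.
  rewrite [X in X <= _](_ : _ = A * (1 + (t * (2 * L) + t ^+ 2 * B) / A)); last first.
    by field; rewrite gt_eqF.
  by rewrite ler_pM2l// expR_ge1Dx.
have AE := powR_pred (p / 2) A0.
have h3 : np mu p (fun x => u x + t * w x) <= A * expR s.
  have := le_trans h1 h2; rewrite AE -[X in _ <= X]mulrA ler_pM2l//.
  exact: powR_gt0.
have h4 : A + t * p * P <= np mu p (fun x => u x + t * w x).
  have ip1 := Lp_psi_rint hp Lu Lw.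
  rewrite /A -npE /np /P -IZ// -ID//; [|by case: Lu|exact: rintZ].
  apply: I_le; [by apply: rintD; [case: Lu | exact: rintZ] | |].
    by case: (LpD hp Lu (LpZ t p0 Lw)) => -[].
  move=> x; have := powR_convex (u x) (u x + t * w x) hp.
  by rewrite (addrC (u x)) addrK; apply: le_trans; rewrite le_eqVlt; apply/orP; left; apply/eqP; ring.
have sn : `|s| <= s0 * t.
  rewrite /s normrM (ger0_norm c0) /s0 -[X in _ <= X]mulrA; apply: ler_wpM2l => //.
  apply: le_trans (ler_normD _ _) _; rewrite !normrM (gtr0_norm t0) (ger0_norm B0).
  rewrite (ger0_norm (ler0n R 2)).
  have : t * t * B <= t * B by rewrite ler_wpM2r// ler_piMr// ltW.
  by lra.
have s2 : s ^+ 2 <= s0 ^+ 2 * t ^+ 2.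
  rewrite -exprMn -(real_normK (num_real s)) ler_pXn2r ?nnegrE// mulr_ge0//.
  exact: ltW.
have h5 : expR s <= 1 + s + expR s0 * (s0 ^+ 2 * t ^+ 2).
  have := expR_rem s; rewrite ler_norml => /andP[_ h5].
  have : expR `|s| * s ^+ 2 <= expR s0 * (s0 ^+ 2 * t ^+ 2).
    rewrite ler_pM ?expR_ge0 ?sqr_ge0// ler_expR; apply: le_trans sn _.
    by rewrite ler_piMr.
  by lra.
have h6 : A * expR s <= A * (1 + s + expR s0 * (s0 ^+ 2 * t ^+ 2)) by rewrite ler_pM2l.
have h7 : p * (t * (P - L)) <= A * (p / 2 / A * B + expR s0 * s0 ^+ 2) * t ^+ 2.
  have -> : A * (p / 2 / A * B + expR s0 * s0 ^+ 2) * t ^+ 2 =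
     p / 2 * B * t ^+ 2 + A * (expR s0 * (s0 ^+ 2 * t ^+ 2)) by field; rewrite gt_eqF.
  have As : A * s = p * t * L + p / 2 * B * t ^+ 2.
    by rewrite /s; field; rewrite gt_eqF.
  by lra.
have -> : A / p * (p / 2 / A * B + expR s0 * s0 ^+ 2) * t ^+ 2 =
  p^-1 * (A * (p / 2 / A * B + expR s0 * s0 ^+ 2) * t ^+ 2) by ring.
by rewrite ler_pdivlMl.
Qed.

End minimizer.

Lemma no_least_energy_solution Omega u : (3 <= N)%N -> open Omega -> bounded_set Omega ->
  ~ least_energy_solution Omega u.
Proof.
move=> hN oO bO [neu Ju]; have hp := crit_exp_gt2 R hN; have p0 : 0 < p by lra.
have [G [gu nz uE]] := nehari_grad hp neu.
have umin v : nehari Omega v -> J0 Omega u <= J0 Omega v.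
  move=> nev; rewrite Ju; apply: ge_inf; last by exists v.
  (* The infimum is a genuine lower bound because J0 is non-negative on the Nehari manifold. *)
  exists 0 => _ [w new <-]; have [H [gw _ wE]] := nehari_grad hp new.
  rewrite (J0_nehari hp gw wE) mulr_ge0 ?en_ge0// subr_ge0 lef_pV2 ?posrE//.
  exact: ltW.
have [uO _] := min_support hN oO gu nz uE umin.
apply: (nz); apply: (uc_bounded hN (open_measurable_rV oO) bO gu uO).
by move=> v H gv; exact: (min_equation hN oO gu nz uE umin gv).
Qed.

End least_energy.

(** * Strictly starshaped domains *)

Section cone.
Context (R : realType) (N : nat).
Implicit Types (x y z D zeta : 'rV[R]_N) (i k : 'I_N) (t h r s e : R)
  (rho : 'rV[R]_N -> R) (Omega : set 'rV[R]_N).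

Notation e_ i := (delta_mx 0 i : 'rV[R]_N).

(** Strict differentiability: the base point [y] varies too. The increment is made one coordinate at
    a time, and the mean value theorem compares each partial derivative with its value at [zeta]. *)
Lemma smooth_increment rho zeta e : smooth rho -> 0 < e ->
  exists2 d : R, 0 < d & forall y D, `|y - zeta| < d -> `|D| < d ->
    `|rho (y + D) - rho y - dot D (gradient rho zeta)| <= e * `|D|.
Proof.
move=> srho e0; pose e' := e / (N%:R + 1).
have N1 : 0 < N%:R + 1 :> R by rewrite ltr_wpDl.
have e'0 : 0 < e' by rewrite divr_gt0.
have [r r0 Hr] : exists2 r : R, 0 < r & forall x i, `|x - zeta| < r ->
    `|partial i rho x - partial i rho zeta| <= e'.
  have H i : exists2 r : R, 0 < r & forall x, `|x - zeta| < r ->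
      `|partial i rho x - partial i rho zeta| <= e'.
    have [ci _] := srho [:: i]; have /cvgrPdist_le/(_ _ e'0) := ci zeta.
    move=> /nbhs_normP[r /= r0 Hr]; exists r => // x xr; rewrite distrC.
    by apply: Hr; rewrite /= distrC.
  pose r := \big[Num.min/1]_i (sval (cid2 (H i))).
  exists r; first by apply: lt_bigmin => // i _; case: cid2.
  move=> x i xr; have := svalP (cid2 (H i)) => -[_]; apply.
  by apply: lt_le_trans xr _; exact: bigmin_le_cond.
(* The intermediate points are at distance at most |y - zeta| + (N + 1) |D| from [zeta], hence
   within r. *)
exists (r / (N%:R + 2)); first by rewrite divr_gt0// ltr_wpDl.
move=> y D yd Dd; have N2 : 0 < N%:R + 2 :> R by rewrite ltr_wpDl.
have drv i x s : is_derive s (1 : R) (fun h => rho (x + h *: e_ i)) (partial i rho (x + s *: e_ i)).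
  by apply: line_is_derive; exact: test_smooth_derive.
pose ys (s : seq 'I_N) := \sum_(i <- s) D 0 i *: e_ i.
have nys (s : seq 'I_N) : `|ys s| <= (size s)%:R * `|D|.
  elim: s => [|i s IH]; first by rewrite /ys big_nil normr0 mul0r.
  rewrite /ys big_cons /= -natr1 mulrDl mul1r addrC; apply: le_trans (ler_normD _ _) _.
  rewrite lerD//; apply: le_trans (norm_delta_mx i (D 0 i)) _; exact: norm_coord_le.
have K (s : seq 'I_N) : (size s <= N)%N -> `|rho (y + ys s) - rho y - \sum_(i <- s) D 0 i * partial i rho zeta| <=
    (size s)%:R * (e' * `|D|).
  elim: s => [_|i s IH sz].
    by rewrite /ys !big_nil addr0 subrr subr0 normr0 mul0r.
  have {}IH := IH (ltnW sz).
  have Ey : y + ys (i :: s) = y + ys s + D 0 i *: e_ i.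
    by rewrite /ys big_cons (addrC (D 0 i *: _)) addrA.
  have [c cD] := mean_value (drv i (y + ys s)) 0 (D 0 i).
  rewrite scale0r addr0 !subr0 -Ey => Ec.
  rewrite big_cons.
  have -> : rho (y + ys (i :: s)) - rho y - (D 0 i * partial i rho zeta + \sum_(j <- s) D 0 j * partial j rho zeta) =
    (partial i rho (y + ys s + c *: e_ i) - partial i rho zeta) * D 0 i +
    (rho (y + ys s) - rho y - \sum_(j <- s) D 0 j * partial j rho zeta).
    by rewrite mulrBl -Ec; ring.
  rewrite !subr0 in cD.
  have -> : (size (i :: s))%:R * (e' * `|D|) = e' * `|D| + (size s)%:R * (e' * `|D|).
    by rewrite /= -natr1 mulrDl mul1r addrC.
  apply: le_trans (ler_normD _ _) _; rewrite lerD//.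
  rewrite normrM ler_pM ?norm_coord_le//; apply: Hr.
  have -> : y + ys s + c *: e_ i - zeta = (y - zeta) + (ys s + c *: e_ i).
    by apply/rowP => j; rewrite !mxE; ring.
  apply: le_lt_trans (ler_normD _ _) _.
  have h1 : `|ys s + c *: e_ i| <= (N%:R + 1) * `|D|.
    apply: le_trans (ler_normD _ _) _; rewrite mulrDl mul1r lerD//.
      by apply: le_trans (nys s) _; rewrite ler_wpM2r// ler_nat ltnW.
    by apply: le_trans (norm_delta_mx i c) _; apply: le_trans cD _; exact: norm_coord_le.
  apply: le_lt_trans (lerD (lexx _) h1) _.
  have : (N%:R + 1) * `|D| <= (N%:R + 1) * (r / (N%:R + 2)) by rewrite ler_pM2l// ltW.
  have -> : (N%:R + 1) * (r / (N%:R + 2)) = r - r / (N%:R + 2) by field; rewrite gt_eqF.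
  by lra.
have sz : size (index_enum 'I_N) = N by rewrite -[RHS]card_ord cardE enumT.
have := K (index_enum 'I_N); rewrite sz leqnn => /(_ isT).
have -> : ys (index_enum 'I_N) = D by rewrite /ys [RHS]matrix_sum_delta big_ord1.
have -> : \sum_i D 0 i * partial i rho zeta = dot D (gradient rho zeta).
  by apply: eq_bigr => i _; rewrite mxE.
move/le_trans; apply; rewrite mulrA ler_wpM2r// /e' mulrCA ler_piMr ?(ltW e0)//.
by rewrite ler_pdivrMr// mul1r lerDl.
Qed.

Lemma dotDl x y z : dot (x + y) z = dot x z + dot y z.
Proof. by rewrite /dot -big_split; apply: eq_bigr => i _; rewrite mxE mulrDl. Qed.

Lemma dotZl (a : R) x z : dot (a *: x) z = a * dot x z.
Proof. by rewrite /dot mulr_sumr; apply: eq_bigr => i _; rewrite mxE mulrA. Qed.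

Lemma dotZr (a : R) x z : dot x (a *: z) = a * dot x z.
Proof. by rewrite /dot mulr_sumr; apply: eq_bigr => i _; rewrite mxE mulrCA. Qed.

Lemma dot_lin (a b : R) x y z : dot (a *: x - b *: y) z = a * dot x z - b * dot y z.
Proof. by rewrite dotDl -scaleNr !dotZl mulNr. Qed.

Lemma dot_le x z : `|dot x z| <= `|x| * \sum_i `|z 0 i|.
Proof.
rewrite /dot mulr_sumr; apply: le_trans (ler_norm_sum _ _ _) _.
by apply: ler_sum => i _; rewrite normrM ler_wpM2r// norm_coord_le.
Qed.

(** The exponential parameter makes the contractions a semigroup in t, see [pull_pull]. *)
Definition pull x0 t y : 'rV[R]_N := x0 + expR (- t) *: (y - x0).

Lemma pull_displacement x0 t y z :
  pull x0 t (y + z) = y + (expR (- t) *: z - (1 - expR (- t)) *: (y - x0)).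
Proof.
apply/rowP => i; rewrite /pull !mxE; ring.
Qed.

Lemma one_sub_exp t : 0 < t -> t <= 1 -> t / 2 <= 1 - expR (- t) <= t.
Proof.
move=> t0 t1; have h := expR_ge1Dx (- t); have h2 := expR_ge1Dx t.
have E : expR (- t) <= (1 + t)^-1 by rewrite expRN lef_pV2 ?posrE ?expR_gt0//; lra.
have : (1 + t)^-1 <= 1 - t / 2.
  rewrite -div1r ler_pdivrMr; last by lra.
  have : t * t <= t * 1 by rewrite ler_pM2l.
  by lra.
by move=> h3; apply/andP; split; lra.
Qed.

Lemma displacement_le x0 zeta d t y z : 0 < d -> d <= 1 -> `|y - zeta| < d -> 0 < t -> t < d ->
  `|z| <= d * t ->
  `|expR (- t) *: z - (1 - expR (- t)) *: (y - x0)| <= t * (`|zeta - x0| + 2).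
Proof.
move=> d0 d1 yd t0 td zt; have t1 : t <= 1 by lra.
have /andP[h1 h2] := one_sub_exp t0 t1.
have e1 : expR (- t) <= 1 by rewrite -expR0 ler_expR oppr_le0 ltW.
have e0 := expR_ge0 (- t).
apply: le_trans (ler_normB _ _) _; rewrite !normrZ ger0_norm// (ger0_norm (_ : 0 <= 1 - expR (- t))); last by lra.
have hz : expR (- t) * `|z| <= 1 * `|z| by rewrite ler_wpM2r.
have hy : `|y - x0| <= `|zeta - x0| + 1.
  have -> : y - x0 = (zeta - x0) + (y - zeta) by rewrite [RHS]addrC addrA subrK.
  by apply: le_trans (ler_normD _ _) _; rewrite lerD2l ltW//; exact: lt_le_trans yd d1.
have : (1 - expR (- t)) * `|y - x0| <= t * (`|zeta - x0| + 1).
  by rewrite ler_pM//; lra.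
have : d * t <= 1 * t by rewrite ler_pM2r.
by lra.
Qed.

(** Quantitative starshapedness: contraction by e^(-t) leaves room for a perturbation of size
    proportional to t. *)
Definition cone_at Omega x0 e y := Omega y -> forall t z, 0 < t -> t < e -> `|z| <= e * t ->
  Omega (pull x0 t (y + z)).

Lemma cone_interior Omega x0 zeta : open Omega -> Omega zeta ->
  exists2 d : R, 0 < d & forall e y, 0 < e -> e <= d -> `|y - zeta| < d -> cone_at Omega x0 e y.
Proof.
move=> oO Oz; have [r r0 Hr] := ball_of_open oO Oz.
pose L := `|zeta - x0| + 3; have L0 : 0 < L by rewrite ltr_wpDl.
exists (Num.min 1 (r / L)); first by rewrite lt_min ltr01 divr_gt0.
move=> e y e0; rewrite le_min => /andP[e1 er]; rewrite lt_min => /andP[y1 yr].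
move=> _ t z t0 te zt; rewrite pull_displacement; apply: Hr.
have -> : y + (expR (- t) *: z - (1 - expR (- t)) *: (y - x0)) - zeta =
  (y - zeta) + (expR (- t) *: z - (1 - expR (- t)) *: (y - x0)) by rewrite addrAC.
apply: le_lt_trans (ler_normD _ _) _.
have zt' : `|z| <= 1 * t by apply: le_trans zt _; rewrite ler_pM2r.
have t1 : t < 1 by apply: lt_le_trans e1.
have := displacement_le x0 ltr01 (lexx 1) y1 t0 t1 zt'.
have tr : t < r / L by apply: lt_le_trans er.
have : t * (`|zeta - x0| + 2) <= r / L * (`|zeta - x0| + 2) by rewrite ler_wpM2r ?addr_ge0// ltW.
have : r / L * (`|zeta - x0| + 2) = r - r / L by rewrite /L; field; rewrite gt_eqF.
by lra.
Qed.

(** To first order the displacement is -t (zeta - x0), which lowers rho by at least t m / 2. The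
    errors from z, from y - zeta and from the remainder are at most t m / 16, t m / 16 and t m / 8,
    so rho stays negative. *)
Lemma cone_boundary Omega x0 zeta rho : defining_function Omega zeta rho ->
  0 < dot (zeta - x0) (gradient rho zeta) ->
  exists2 d : R, 0 < d & forall e y, 0 < e -> e <= d -> `|y - zeta| < d -> cone_at Omega x0 e y.
Proof.
move=> [srho _ /nbhs_normP[r /= r0 Hr]]; set m := dot _ _ => m0.
pose g := \sum_i `|gradient rho zeta 0 i|; have g0 : 0 <= g by exact: sumr_ge0.
pose L := `|zeta - x0| + 3; have L0 : 0 < L by rewrite ltr_wpDl.
have e'0 : 0 < m / (8 * L) by rewrite divr_gt0// mulr_gt0.
have [d0 d00 Hd] := smooth_increment zeta srho e'0.
have gm : 0 < m / (16 * (g + 1)) by rewrite divr_gt0// mulr_gt0// ltr_wpDl.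
exists (Num.min (Num.min 1 (m / (16 * (g + 1)))) (Num.min (r / (2 * L)) (d0 / (2 * L)))).
  by rewrite !lt_min ltr01 gm !divr_gt0// mulr_gt0.
move=> e y e0; rewrite !le_min => /andP[/andP[e1 eg] /andP[er ed]].
rewrite !lt_min => /andP[/andP[y1 yg] /andP[yr yd]].
move=> Oy t z t0 te zt; rewrite pull_displacement.
set D := (expR (- t) *: z - _).
have zt' : `|z| <= 1 * t by apply: le_trans zt _; rewrite ler_pM2r.
have t1 : t < 1 by apply: lt_le_trans e1.
have DD := displacement_le x0 ltr01 (lexx 1) y1 t0 t1 zt'; rewrite -/D in DD.
have L3 : 3 <= L by rewrite /L lerDr.
have Dt : `|D| <= t * L by apply: le_trans DD _; rewrite ler_pM2l// lerD2l ler_nat.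
have tLr : t * L < r / 2.
  by rewrite -ltr_pdivlMr// -mulrA -invfM; apply: lt_le_trans er.
have tLd : t * L < d0 / 2.
  by rewrite -ltr_pdivlMr// -mulrA -invfM; apply: lt_le_trans ed.
have rL : r / (2 * L) <= r / 2.
  by rewrite ler_pM2l// lef_pV2 ?posrE ?mulr_gt0//; lra.
have dL : d0 / (2 * L) <= d0 / 2.
  by rewrite ler_pM2l// lef_pV2 ?posrE ?mulr_gt0//; lra.
have ry : rho y < 0 by apply/Hr => //=; rewrite distrC; lra.
apply/Hr => /=.
  rewrite distrC addrAC; apply: le_lt_trans (ler_normD _ _) _.
  by apply: le_lt_trans (lerD (lexx _) Dt) _; lra.
have /ler_normlP[_ h] := Hd y D ltac:(lra) ltac:(lra).
have /andP[h1 h2] := one_sub_exp t0 (ltW t1).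
have gD : dot D (gradient rho zeta) <= - (t / 2 * m) + t * (m / 8).
  have E : dot D (gradient rho zeta) = expR (- t) * dot z (gradient rho zeta) -
     (1 - expR (- t)) * m - (1 - expR (- t)) * dot (y - zeta) (gradient rho zeta).
    rewrite [dot D _](dot_lin (expR (- t)) (1 - expR (- t)) z (y - x0)).
    have -> : y - x0 = (zeta - x0) + (y - zeta) by rewrite [RHS]addrC addrA subrK.
    by rewrite dotDl -/m; ring.
  have e2 : expR (- t) <= 1 by rewrite -expR0 ler_expR oppr_le0 ltW.
  have e3 := expR_ge0 (- t).
  have gg : (m / (16 * (g + 1))) * g <= m / 16.
    have -> : m / (16 * (g + 1)) * g = m / 16 * (g / (g + 1)).
      by field; rewrite gt_eqF// ltr_wpDl.
    by rewrite ler_piMr ?divr_ge0 ?(ltW m0)// ler_pdivrMr ?mul1r ?lerDl// ltr_wpDl.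
  have a1 : expR (- t) * dot z (gradient rho zeta) <= t * (m / 16).
    apply: le_trans (ler_norm _) _; rewrite normrM ger0_norm//.
    apply: (@le_trans _ _ (1 * ((e * t) * g))).
      by rewrite ler_pM//; apply: le_trans (dot_le _ _) _; rewrite ler_wpM2r.
    have : t * (e * g) <= t * (m / (16 * (g + 1)) * g).
      by rewrite ler_pM2l// ler_wpM2r.
    have : t * (m / (16 * (g + 1)) * g) <= t * (m / 16) by rewrite ler_pM2l.
    by clear -N; lra.
  have a2 : - ((1 - expR (- t)) * dot (y - zeta) (gradient rho zeta)) <= t * (m / 16).
    apply: le_trans (ler_norm _) _; rewrite normrN normrM ger0_norm ?subr_ge0//.
    apply: ler_pM => //; first by rewrite subr_ge0.
    apply: le_trans (dot_le _ _) _; apply: le_trans gg.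
    by rewrite ler_wpM2r// ltW.
  have a3 : t / 2 * m <= (1 - expR (- t)) * m by rewrite ler_wpM2r// ltW.
  by rewrite E; move: a1 a2 a3; clear -N; lra.
have : m / (8 * L) * `|D| <= t * (m / 8).
  have : m / (8 * L) * `|D| <= m / (8 * L) * (t * L) by rewrite ler_pM2l.
  have : m / (8 * L) * (t * L) = t * (m / 8) by field; rewrite gt_eqF.
  by clear -N; lra.
have tm : 0 < t * m by rewrite mulr_gt0.
by move: h gD tm ry; clear -N; lra.
Qed.

(** The local statements hold for every e below a threshold, the form in which compactness of the
    closure yields one e for all points. *)
Lemma cone Omega x0 : (0 < N)%N -> smooth_open Omega -> bounded_set Omega ->
  (forall zeta, boundary Omega zeta -> 0 < dot (zeta - x0) (exterior_normal Omega zeta)) ->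
  exists2 e : R, 0 < e & forall y, cone_at Omega x0 e y.
Proof.
move=> N0 [oO sO] bO star.
have loc zeta : closure Omega zeta -> exists2 d : R, 0 < d &
    forall e y, 0 < e -> e <= d -> `|y - zeta| < d -> cone_at Omega x0 e y.
  move=> cz; have [Oz|Oz] := pselect (Omega zeta); first exact: cone_interior.
  have bz : boundary Omega zeta.
    by split => // /interior_subset.
  have := star _ bz; have [rho0 drho0] := sO _ bz.
  have : is_exterior_normal Omega zeta (exterior_normal Omega zeta).
    apply: (@xgetPex _ _ [set nu | is_exterior_normal Omega zeta nu]).
    by eexists; exists rho0.
  move=> [rho drho ->]; rewrite dotZr => h; apply: (cone_boundary drho).
  have : 0 <= (enorm (gradient rho zeta))^-1 by rewrite invr_ge0 sqrtr_ge0.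
  rewrite le_eqVlt => /predU1P[h0|h0]; first by move: h; rewrite -h0 mul0r ltxx.
  by move: h; rewrite pmulr_rgt0.
have cc : compact (closure Omega).
  have [r r0 Or] := bounded_cube bO.
  have cB : closed [set x : 'rV[R]_N | `|x| <= r].
    have -> : [set x : 'rV[R]_N | `|x| <= r] = (fun x : 'rV[R]_N => `|x|) @^-1` [set t | t <= r] by [].
    by apply: closed_comp; [move=> x _; exact: norm_continuous | exact: closed_le].
  have OB : closure Omega `<=` [set x : 'rV[R]_N | `|x| <= r].
    rewrite ((closure_id _).1 cB); apply: closure_subset => x /Or; exact: ltW.
  apply: bounded_closed_compact; last exact: closed_closure.
  exists r; split; first exact: num_real.
  by move=> M rM x /OB /le_trans; apply; exact: ltW.
have H : \forall e \near 0^'+, closure Omega `<=` (fun y => cone_at Omega x0 e y).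
  apply: ((compact_near_coveringP _).1 cc R (0^'+) (fun e y => cone_at Omega x0 e y)).
  move=> zeta cz; have [d d0 Hd] := loc _ cz.
  exists ([set y | `|y - zeta| < d], [set e | 0 < e /\ e <= d]).
    split => /=; last by near=> e; split; near: e; [exact: nbhs_right_gt | exact: nbhs_right_le].
    by apply/(@nbhs_normP R 'rV[R]_N zeta); exists d => // y /=; rewrite distrC.
  by move=> [y e] /= [h1 [h2 h3]]; exact: Hd.
near ((0:R)^'+) => e; exists e; first by near: e; exact: nbhs_right_gt.
move=> y Oy; have He : closure Omega `<=` (fun y => cone_at Omega x0 e y) by near: e.
exact: (He y (subset_closure Oy) Oy).
Unshelve. all: by end_near.
Qed.

End cone.

Lemma sqr_diff_le (R : realType) (a b c : R) :
  (b - a) ^+ 2 <= 2 * (c - b) ^+ 2 + 2 * (c - a) ^+ 2.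
Proof. by have := sqr_ge0 ((c - b) + (c - a)); lra. Qed.

(** * Increments under dilation, by averaging *)

Section averaging.
Context (R : realType) (N : nat) (p : R).
Implicit Types (u v f g : 'rV[R]_N -> R) (G H : 'rV[R]_N -> 'rV[R]_N)
  (x y z c : 'rV[R]_N) (i k : 'I_N) (a h s r : R).

Notation mu := (lebesgue_rV N : {measure set 'rV[R]_N -> \bar R}).
Notation I f := (Rintegral mu setT f).
Notation grad := (grad p).

Definition osc u s y z : R := \1_(cube s) z * (u (y + z) - u y) ^+ 2.
Definition mean_osc u s y : R := I (osc u s y).

Lemma rint_osc u s y : 2 < p -> Lp mu p u -> rint mu (osc u s y).
Proof.
move=> hp Lu; have p0 : 0 < p by lra.
have Lv : Lp mu p (fun z => u (y + z)).
  have -> : (fun z => u (y + z)) = tau y u by apply/funext => z; rewrite /tau addrC.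
  exact: Lp_tau.
have L1 := Lp_mul_L2_cube s hp Lv.
have L2 : L2 mu (fun z => u y * \1_(cube s) z) by apply: L2Z; exact: L2_indic_cube.
apply: rint_eq (L2B L1 L2).2 => z; rewrite /osc indicE.
by case: (z \in _) => /=; rewrite ?mulr1 ?mulr0 ?mul1r ?mul0r ?subrr ?expr0n.
Qed.

Lemma mean_osc_le u G s : 2 < p -> 0 < s -> grad u G ->
  rint mu (mean_osc u s) /\ I (mean_osc u s) <= (2 * s) ^+ N * ((N%:R * s) ^+ 2 * en G).
Proof.
move=> hp s0 gu; have Lu := grad_Lp gu; have [mu_ _] := Lu.
have mcube := @measurable_cube R N s.
have osc0 y z : 0 <= osc u s y z by rewrite mulr_ge0 ?sqr_ge0.
set B := (N%:R * s) ^+ 2 * en G.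
have B0 : 0 <= B by rewrite mulr_ge0 ?sqr_ge0 ?en_ge0.
have mk : measurable_fun setT (fun z : 'rV[R]_N * 'rV[R]_N => (osc u s z.1 z.2)%:E).
  apply/measurable_EFinP; apply: measurable_funM.
    by apply: measurable_fun_comp_snd; exact: measurable_indic.
  apply: measurable_funX; apply: measurable_funB.
    exact: (measurable_fun_comp mu_ (@measurable_fun_add_rV R N)).
  exact: (measurable_fun_comp mu_ measurable_fst).
have k0 (z : 'rV[R]_N * 'rV[R]_N) : (0 <= (osc u s z.1 z.2)%:E)%E by rewrite lee_fin.
have E y : ((mean_osc u s y)%:E = \int[mu]_z (osc u s y z)%:E)%E.
  by rewrite /mean_osc EFin_I//; exact: rint_osc.
have mint : measurable_fun setT (fun y => \int[mu]_z (osc u s y z)%:E)%E.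
  have := @measurable_fun_fubini_tonelli_F _ _ _ _ _ (lebesgue_rV N)
      (fun z : 'rV[R]_N * 'rV[R]_N => (osc u s z.1 z.2)%:E) mk k0.
  by rewrite /fubini_F /=.
have mm : measurable_fun setT (EFin \o mean_osc u s).
  rewrite (_ : EFin \o _ = fun y => \int[mu]_z (osc u s y z)%:E)%E; last exact/funext.
  exact: mint.
have bound : (\int[mu]_y (mean_osc u s y)%:E <= ((2 * s) ^+ N * B)%:E)%E.
  under eq_integral do rewrite E.
  rewrite (@fubini_tonelli _ _ _ _ _ (lebesgue_rV N) (lebesgue_rV N)
    (fun z : 'rV[R]_N * 'rV[R]_N => (osc u s z.1 z.2)%:E) mk k0)/=.
  rewrite mulrC EFinM -(mu_cube N s0).
  have -> : (B%:E * mu (@cube R N s) = \int[mu]_z (B * \1_(cube s) z)%:E)%E.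
    under eq_integral do rewrite EFinM.
    rewrite ge0_integralZl ?lee_fin//; last by apply/measurable_EFinP; exact: measurable_indic.
    by rewrite integral_indic// setIT.
  apply: ge0_le_integral => //.
  - by move=> z _; apply: integral_ge0 => y _; exact: (k0 (y, z)).
  - exact: (@measurable_fun_fubini_tonelli_G _ _ _ _ _ (lebesgue_rV N)
      (fun z : 'rV[R]_N * 'rV[R]_N => (osc u s z.1 z.2)%:E) mk k0).
  - by apply/measurable_EFinP; apply: measurable_funM => //; exact: measurable_indic.
  move=> z _; have [zs|zs] := pselect (cube s z); last first.
    rewrite /osc indicE memNset// mulr0; under eq_integral do rewrite mul0r.
    by rewrite integral0.
  have [Lz nz] := grad_tau_le z hp gu.
  rewrite /osc indicE mem_set// mulr1; under eq_integral do rewrite mul1r.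
  rewrite -EFin_I; last by case: Lz.
  rewrite lee_fin; apply: le_trans nz _; rewrite /B ler_wpM2r ?en_ge0//.
  rewrite ler_pXn2r ?nnegrE ?mulr_ge0// ?(ltW s0)//.
  by rewrite ler_wpM2l//; exact: ltW.
have m0 y : 0 <= mean_osc u s y by exact: I_ge0.
have rm : rint mu (mean_osc u s).
  apply/integrableP; split => //; apply: le_lt_trans (ltry ((2 * s) ^+ N * B)).
  apply: le_trans bound; rewrite le_eqVlt; apply/orP; left; apply/eqP.
  by apply: eq_integral => y _ /=; rewrite ger0_norm.
by split => //; rewrite -lee_fin EFin_I.
Qed.

(** The displacement depends on x, so translation estimates do not apply directly. Both values of u
    are compared with u(x + z), and the result is averaged over z in a cube of half-side h = a - 1,
    comparable to the displacement. *)
Lemma dil_le r x0 u G : 2 < p -> 0 < r -> grad u G ->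
  exists2 C, 0 <= C & forall a, 1 < a ->
    rint mu (fun x => \1_(cube r) x * (u (a *: x + (1 - a) *: x0) - u x) ^+ 2) /\
    I (fun x => \1_(cube r) x * (u (a *: x + (1 - a) *: x0) - u x) ^+ 2) <= C * (a - 1) ^+ 2.
Proof.
move=> hp r0 gu; have Lu := grad_Lp gu; have [mu_ _] := Lu.
(* From the dilated point, x + z is at distance at most h |x - x0| + |z|, which is less than h
   rr. *)
pose rr := r + `|x0| + 1; have rr1 : 1 <= rr by rewrite lerDr addr_ge0// ltW.
have rr0 : 0 < rr by lra.
pose C := 2 * (rr ^+ N * ((N%:R * rr) ^+ 2 * en G)) + 2 * (N%:R ^+ 2 * en G).
have C0 : 0 <= C.
  by rewrite addr_ge0// mulr_ge0// mulr_ge0 ?sqr_ge0 ?en_ge0 ?exprn_ge0// ?mulr_ge0 ?sqr_ge0 ?en_ge0// ltW.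
exists C => // a a1; set h := a - 1; have h0 : 0 < h by rewrite subr_gt0.
have a0 : 0 < a by lra.
have yE x : a *: x + (1 - a) *: x0 = x + h *: (x - x0).
  by apply/rowP => j; rewrite !mxE /h; ring.
have V0 : 0 < (2 * h) ^+ N by rewrite exprn_gt0// mulr_gt0.
have hr0 : 0 < h * rr by rewrite mulr_gt0.
have [r1 b1] := mean_osc_le hp hr0 gu; have [r2 b2] := mean_osc_le hp h0 gu.
have key x : (2 * h) ^+ N * (\1_(cube r) x * (u (a *: x + (1 - a) *: x0) - u x) ^+ 2) <=
    2 * mean_osc u (h * rr) (a *: x + (1 - a) *: x0) + 2 * mean_osc u h x.
  have m0 s y : 0 <= mean_osc u s y by apply: I_ge0 => z; rewrite mulr_ge0 ?sqr_ge0.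
  have [xr|xr] := pselect (cube r x); last first.
    by rewrite [\1_(cube r) x]indicE memNset// mul0r mulr0 addr_ge0// mulr_ge0.
  rewrite [\1_(cube r) x]indicE mem_set// mul1r.
  set y := a *: x + _; set d := (u y - u x) ^+ 2.
  have o1 := rint_osc (h * rr) y hp Lu; have o2 := rint_osc h x hp Lu.
  have ic : rint mu (fun z => \1_(@cube R N h) z : R).
    by apply: rint_indic; [exact: measurable_cube | exact: mu_cube_fin].
  have -> : (2 * h) ^+ N = I (\1_(@cube R N h)).
    by rewrite I_indic ?mu_cube//; [exact: measurable_cube | exact: ltry].
  pose c := - (h *: (x - x0)).
  have o1' := rint_tau c o1.
  rewrite mulrC -IZ// /mean_osc -(I_tau c o1) -!IZ// -ID; [|exact: rintZ..].
  apply: I_le; [exact: rintZ | by apply: rintD; exact: rintZ |].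
  move=> z; rewrite /tau /osc [\1_(cube h) z]indicE.
  have [zh|zh] := pselect (cube h z); last first.
    rewrite memNset// mulr0 mul0r mulr0 addr0 mulr_ge0// mulr_ge0 ?sqr_ge0//.
  rewrite mem_set// mulr1 mul1r.
  have -> : \1_(cube (h * rr)) (z + c) = 1 :> R.
    rewrite indicE mem_set// /cube /= /c; apply: le_lt_trans (ler_normB _ _) _.
    rewrite normrZ (gtr0_norm h0).
    have : `|x - x0| <= r + `|x0|.
      by apply: le_trans (ler_normB _ _) _; rewrite lerD2r ltW.
    rewrite -(ler_pM2l h0) => hx.
    have -> : h * rr = h + h * (r + `|x0|) by rewrite /rr; ring.
    exact: ltr_leD.
  rewrite mul1r; have -> : y + (z + c) = x + z.
    by rewrite /y yE /c; apply/rowP => j; rewrite !mxE; ring.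
  exact: sqr_diff_le.
have rd : rint mu (fun x => \1_(cube r) x * (u (a *: x + (1 - a) *: x0) - u x) ^+ 2).
  apply: (rint_le _ (rintZ ((2 * h) ^+ N)^-1 (rintD (rintZ 2 (rint_affine ((1 - a) *: x0) a0 r1)) (rintZ 2 r2)))).
    apply: measurable_funM; first by apply: measurable_indic; exact: measurable_cube.
    apply: measurable_funX; apply: measurable_funB => //; exact: measurable_comp_affine.
  move=> x; rewrite ger0_norm; last by rewrite mulr_ge0 ?sqr_ge0.
  by rewrite ler_pdivlMl.
split => //; rewrite -(ler_pM2l V0) -IZ//.
have r3 := rint_affine ((1 - a) *: x0) a0 r1.
apply: (@le_trans _ _ (2 * I (fun x => mean_osc u (h * rr) (a *: x + (1 - a) *: x0)) + 2 * I (mean_osc u h))).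
  rewrite -(IZ _ r3) -(IZ _ r2) -ID; [|exact: rintZ..].
  by apply: I_le => //; [exact: rintZ | by apply: rintD; exact: rintZ].
rewrite (I_affine _ a0 r1).
have aN : (a ^+ N)^-1 * I (mean_osc u (h * rr)) <= I (mean_osc u (h * rr)).
  rewrite ler_piMl; first by [].
    by apply: I_ge0 => x; apply: I_ge0 => z; rewrite mulr_ge0 ?sqr_ge0.
  by rewrite invf_le1 ?exprn_gt0// exprn_ege1// ltW.
have e1 : (2 * (h * rr)) ^+ N = (2 * h) ^+ N * rr ^+ N by rewrite -exprMn mulrA.
have -> : (2 * h) ^+ N * (C * h ^+ 2) =
  2 * ((2 * (h * rr)) ^+ N * ((N%:R * (h * rr)) ^+ 2 * en G)) + 2 * ((2 * h) ^+ N * ((N%:R * h) ^+ 2 * en G)).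
  by rewrite e1 /C; ring.
by apply: lerD; rewrite ler_pM2l//; exact: le_trans aN b1.
Qed.

End averaging.

Lemma sqr_powR_half (R : realType) (q t : R) : 0 <= t -> (t ^+ 2) `^ (q / 2) = t `^ q.
Proof.
move=> t0; rewrite -(powR_mulrn 2 t0) -powRrM; congr (_ `^ _).
by rewrite mulrC divfK.
Qed.

Lemma absorb (R : realType) (q X Y Z : R) :
  q / 2 * X + Y <= q / 4 * X + Z -> q / 4 * X + Y <= Z.
Proof. by move=> h; lra. Qed.

Lemma drop_right (R : realType) (X Y Z : R) : X + 2 * Y <= Z -> 0 <= Y -> X <= Z.
Proof. by move=> h1 h2; lra. Qed.

Lemma drop_left (R : realType) (X Y Z : R) : X + 2 * Y <= Z -> 0 <= Y -> 0 <= X -> Y <= Z.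
Proof. by move=> h1 h2 h3; lra. Qed.

Lemma expR_sub1_le (R : realType) (s : R) : expR s - 1 <= s * expR s.
Proof.
have : expR s * (1 - s) <= expR s * expR (- s).
  by rewrite ler_wpM2l ?expR_ge0//; exact: expR_ge1Dx.
by rewrite expRN mulfV ?gt_eqF ?expR_gt0//; lra.
Qed.

(** * The gap between a solution and its dilations *)

Section dilation_gap.
Context (R : realType) (N : nat).
Implicit Types (v f g : 'rV[R]_N -> R) (H : 'rV[R]_N -> 'rV[R]_N)
  (x y z c : 'rV[R]_N) (i k : 'I_N) (a t h s r e : R).

Notation mu := (lebesgue_rV N : {measure set 'rV[R]_N -> \bar R}).
Notation I f := (Rintegral mu setT f).
Notation p := (@crit_exp R N).
Notation grad := (grad p).

Lemma dil1 a c v x : 0 < a -> `|dil a c v x| = a `^ (N%:R / p) * `|v (a *: x + c)|.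
Proof. by move=> a0; rewrite /dil normrM ger0_norm ?powR_ge0. Qed.

Lemma np_dil a c v : 2 < p -> 0 < a -> Lp mu p v -> np mu p (dil a c v) = np mu p v.
Proof.
move=> hp a0 Lv; have one : measurable_fun setT (fun _ : 'rV[R]_N => 1 : R) by [].
have := @I_dil R N a c v (fun=> 1) hp a0 Lv one (fun=> ltac:(by rewrite normr1)).
rewrite /np => E; transitivity (I (fun x => 1 * `|dil a c v x| `^ p)).
  by apply: I_eq => x; rewrite mul1r.
by rewrite E; apply: I_eq => x; rewrite mul1r.
Qed.

Lemma np_le f g : 0 < p -> measurable_fun setT f -> Lp mu p g ->
  (forall x, `|f x| <= `|g x|) -> np mu p f <= np mu p g.
Proof.
move=> p0 mf Lg fg.
have [_] := @Lp_dom _ _ _ mu p f g 1 p0 ler01 mf Lg (fun x => ltac:(by rewrite mul1r)).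
by rewrite powR1 mul1r.
Qed.

Variables (Omega : set 'rV[R]_N) (x0 : 'rV[R]_N) (u : 'rV[R]_N -> R)
  (G : 'rV[R]_N -> 'rV[R]_N) (e0 : R).
Hypotheses (hN : (3 <= N)%N) (oO : open Omega) (bO : bounded_set Omega).
Hypotheses (e00 : 0 < e0) (cone0 : forall y, cone_at Omega x0 e0 y).
Hypotheses (gu : grad u G)
  (EL : forall v H, grad v H -> ipG G H = I (fun x => Q Omega x * (psi p (u x) * v x))).

Let hp : 2 < p := crit_exp_gt2 R hN.
Let p0 : 0 < p. Proof. by have := hp; lra. Qed.
Let N0 : (0 < N)%N := leq_trans (isT : (0 < 3)%N) hN.
Let mO : measurable Omega := open_measurable_rV oO.

(* The dilated domain x0 + e^t (Omega - x0). *)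
Definition swell t : set 'rV[R]_N := [set y | Omega (pull x0 t y)].
(** The quantity E(t) of the overview. *)
Definition swollen t : R := I (fun y => \1_(swell t `\` Omega) y * `|u y| `^ p).
Definition dilated t v : 'rV[R]_N -> R := dil (expR t) ((1 - expR t) *: x0) v.
Definition dilated_grad t H : 'rV[R]_N -> 'rV[R]_N :=
  fun x => expR t `^ (N%:R / p) *: (expR t *: H (expR t *: x + (1 - expR t) *: x0)).

Lemma swell_sub t : 0 < t -> t < e0 -> Omega `<=` swell t.
Proof.
move=> t0 te y Oy; have := cone0 Oy t0 te (z := 0).
by rewrite addr0; apply; rewrite normr0 mulr_ge0// ltW.
Qed.

Lemma pullE t y : (expR t)^-1 *: (y - (1 - expR t) *: x0) = pull x0 t y.
Proof.
have e : expR t != 0 by rewrite gt_eqF ?expR_gt0.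
by rewrite /pull expRN; apply/rowP => j; rewrite !mxE; field.
Qed.

Lemma pull_pull s t y : pull x0 s (pull x0 t y) = pull x0 (s + t) y.
Proof.
rewrite /pull (_ : x0 + expR (- t) *: (y - x0) - x0 = expR (- t) *: (y - x0)).
  by rewrite scalerA -expRD opprD.
by rewrite addrC addKr.
Qed.

Lemma measurable_swell_gen (A : set 'rV[R]_N) t : measurable A ->
  measurable [set y | A (pull x0 t y)].
Proof.
move=> mA; have m : measurable_fun setT (fun y : 'rV[R]_N => \1_A (pull x0 t y) : R).
  have -> : (fun y : 'rV[R]_N => \1_A (pull x0 t y) : R) =
      fun y => \1_A (expR (- t) *: y + (x0 - expR (- t) *: x0)).
    by apply/funext => y; rewrite /pull; congr (\1_A _); apply/rowP => j; rewrite !mxE; ring.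
  by apply: measurable_comp_affine; exact: measurable_indic.
have -> : [set y | A (pull x0 t y)] = (fun y => \1_A (pull x0 t y) : R) @^-1` [set 1].
  apply/seteqP; split => y /=; rewrite indicE.
    by move=> Ay; rewrite mem_set.
  have [/set_mem //|_] := boolP (pull x0 t y \in A).
  by move=> /eqP; rewrite eq_sym oner_eq0.
by rewrite -[X in measurable X]setTI; apply: m.
Qed.

Lemma measurable_swell t : measurable (swell t).
Proof. exact: measurable_swell_gen. Qed.

Lemma rint_cut_np (A : set 'rV[R]_N) v : measurable A -> Lp mu p v ->
  rint mu (fun x => \1_A x * `|v x| `^ p).
Proof.
move=> mA [mv iv]; apply: rint_weight => //.
by move=> x; rewrite indicE; case: (x \in A); rewrite ?normr1 ?normr0.
Qed.

Lemma I_dilated (A : set 'rV[R]_N) t v : measurable A -> Lp mu p v ->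
  I (fun x => \1_A x * `|dilated t v x| `^ p) =
  I (fun y => \1_[set y | A (pull x0 t y)] y * `|v y| `^ p).
Proof.
move=> mA Lv; rewrite /dilated (I_dil _ hp (expR_gt0 t) Lv); last 2 first.
- exact: measurable_indic.
- by move=> x; rewrite indicE; case: (x \in A); rewrite ?normr1 ?normr0.
by apply: I_eq => y; rewrite pullE.
Qed.

Lemma grad_dilated t v H : grad v H -> grad (dilated t v) (dilated_grad t H).
Proof. by move=> gv; apply: grad_dil => //; exact: expR_gt0. Qed.

Lemma en_dilated t v H : grad v H -> en (dilated_grad t H) = en H.
Proof. by move=> gv; apply: en_dil gv => //; exact: expR_gt0. Qed.

Lemma np_dilated t v : Lp mu p v -> np mu p (dilated t v) = np mu p v.
Proof. by move=> Lv; apply: np_dil => //; exact: expR_gt0. Qed.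

Lemma swollen_ge0 t : 0 <= swollen t.
Proof. by apply: I_ge0 => x; rewrite mulr_ge0// powR_ge0. Qed.

Definition gap t : 'rV[R]_N -> R := fun x => dilated t u x - u x.
Definition gap_grad t : 'rV[R]_N -> 'rV[R]_N := fun x => dilated_grad t G x - G x.

Lemma grad_gap t : grad (gap t) (gap_grad t).
Proof. by apply: gradB => //; exact: grad_dilated. Qed.

Lemma Qint_split v : Lp mu p v ->
  I (fun x => Q Omega x * `|v x| `^ p) = 2 * I (fun x => \1_Omega x * `|v x| `^ p) - np mu p v.
Proof.
move=> Lv; have i1 := rint_cut_np mO Lv; have [_ i2] := Lv.
rewrite -IZ// -IB//; last exact: rintZ.
by apply: I_eq => x; rewrite Q_indic; ring.
Qed.

Lemma Qint_dilated t : 0 < t -> t < e0 ->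
  I (fun x => Q Omega x * `|dilated t u x| `^ p) - I (fun x => Q Omega x * `|u x| `^ p) =
  2 * swollen t.
Proof.
move=> t0 te; have Lu := grad_Lp gu.
rewrite (Qint_split (grad_Lp (grad_dilated t gu))) (Qint_split Lu) (np_dilated t Lu) (I_dilated t mO Lu).
have -> : I (fun y => \1_(swell t) y * `|u y| `^ p) =
    I (fun x => \1_Omega x * `|u x| `^ p) + swollen t.
  rewrite /swollen -ID; [|exact: rint_cut_np|]; last first.
    by apply: rint_cut_np => //; apply: measurableD => //; exact: measurable_swell.
  apply: I_eq => x; rewrite -mulrDl; congr (_ * _).
  rewrite !indicE in_setD; have [Ox|Ox] := boolP (x \in Omega).
    rewrite andbF addr0 (_ : x \in swell t)//.
    by apply/mem_set/swell_sub => //; exact: set_mem.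
  by rewrite andbT add0r.
by ring.
Qed.

Lemma weighted_gap_rint (A : set 'rV[R]_N) f g : measurable A -> Lp mu p f -> Lp mu p g ->
  rint mu (fun x => \1_A x * (`|f x| `^ (p - 2) * g x ^+ 2)).
Proof.
move=> mA Lf Lg; apply: rint_weight => //.
  by move=> x; rewrite indicE; case: (x \in A); rewrite ?normr1 ?normr0.
exact: Lp_sqr_rint.
Qed.

(** As the energy is preserved, en(gap) = -2 ipG(G, gap). With the weak equation and [Qint_dilated],
    the left side is the integral of Q times the Taylor remainder of |.|^p between u and its
    dilation. The remainder is non-negative, so only its part on Omega has to be bounded. *)
Lemma gap_energy t : 0 < t -> t < e0 ->
  p / 2 * en (gap_grad t) + 2 * swollen t <=
  p * (p - 1) * (I (fun x => \1_Omega x * (`|u x| `^ (p - 2) * gap t x ^+ 2)) +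
    I (fun x => \1_Omega x * (`|dilated t u x| `^ (p - 2) * gap t x ^+ 2))).
Proof.
move=> t0 te; have gw := grad_gap t; have Lw := grad_Lp gw; have Lu := grad_Lp gu.
have Ld := grad_Lp (grad_dilated t gu).
have E : en (gap_grad t) = - 2 * ipG G (gap_grad t).
  have := en_expand 1 gu gw; rewrite expr1n !mul1r.
  have -> : (fun x => G x + 1 *: gap_grad t x) = dilated_grad t G.
    by apply/funext => x; rewrite scale1r /gap_grad addrC subrK.
  by rewrite (en_dilated t gu); lra.
have mQ := measurable_Q mO; have Q1 x : `|Q Omega x| <= 1 by rewrite norm_Q.
have i0 := rint_weight mQ Q1 (Lp_psi_rint hp Lu Lw).
have i1 := rint_weight mQ Q1 Ld.2; have i2 := rint_weight mQ Q1 Lu.2.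
have i3 := weighted_gap_rint mO Lu Lw; have i4 := weighted_gap_rint mO Ld Lw.
have -> : p / 2 * en (gap_grad t) + 2 * swollen t =
    I (fun x => Q Omega x * `|dilated t u x| `^ p) - I (fun x => Q Omega x * `|u x| `^ p) -
    p * I (fun x => Q Omega x * (psi p (u x) * gap t x)).
  by rewrite Qint_dilated// E (EL gw); field.
rewrite -IZ// -IB// -IB; [|exact: rintB|exact: rintZ].
rewrite -ID// -IZ; last exact: rintD.
apply: I_le; [by apply: rintB; [exact: rintB | exact: rintZ] | by apply: rintZ; exact: rintD |].
move=> x; have h1 := powR_convex (u x) (dilated t u x) hp.
have h2 := powR_taylor (u x) (dilated t u x) hp.
rewrite Q_indic indicE -/(gap t x) in h1 h2 *.
case: (x \in Omega) => /=; lra.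
Qed.

Lemma gap_L2_bound r : 0 < r -> Omega `<=` @cube R N r ->
  exists2 C, 0 <= C & forall t, 0 < t -> t <= 1 ->
    rint mu (fun x => \1_Omega x * gap t x ^+ 2) /\
    I (fun x => \1_Omega x * gap t x ^+ 2) <= C * t ^+ 2.
Proof.
move=> r0 Or; have [C C0 HC] := dil_le x0 hp r0 gu; have Lu := grad_Lp gu.
have [mu_ _] := Lu.
pose k := N%:R / p; have k0 : 0 <= k by rewrite divr_ge0// ltW.
pose b := expR k; pose b1 := expR (1 : R).
pose U := n2 mu (fun x => u x * \1_(@cube R N r) x).
have U0 : 0 <= U by exact: n2_ge0.
exists (2 * b ^+ 2 * (C * b1 ^+ 2) + 2 * (k * b) ^+ 2 * U).
  have q1 := sqr_ge0 b; have q2 := sqr_ge0 b1; have q3 := sqr_ge0 (k * b).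
  by apply: addr_ge0; apply: mulr_ge0 => //; apply: mulr_ge0.
move=> t t0 t1; have a1 : 1 < expR t by rewrite -expR0 ltr_expR.
have [i1 b_1] := HC _ a1.
have bt : expR t `^ k = expR (t * k) by rewrite -expRM.
have btb : expR t `^ k <= b by rewrite bt ler_expR ler_piMl.
have bt1 : 0 <= expR t `^ k - 1 <= t * (k * b).
  rewrite subr_ge0 bt; apply/andP; split; first by rewrite -expR0 ler_expR mulr_ge0// ltW.
  apply: le_trans (expR_sub1_le _) _; rewrite -mulrA ler_pM2l// ler_wpM2l//.
  by rewrite -bt.
have Lw := grad_Lp (grad_gap t).
have Lc := Lp_mul_L2_cube r hp Lw; have Lc' := Lp_mul_L2_cube r hp Lu.
have ri : rint mu (fun x => \1_Omega x * gap t x ^+ 2).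
  apply: (rint_eq (f := fun x => \1_Omega x * (gap t x * \1_(cube r) x) ^+ 2)).
    move=> x; rewrite !indicE; have [Ox|Ox] := pselect (Omega x).
      by rewrite (mem_set (Or _ Ox)) mulr1.
    by rewrite memNset// !mul0r.
  apply: rint_weight Lc.2 => //.
  by move=> x; rewrite indicE; case: (x \in Omega); rewrite ?normr1 ?normr0.
split => //.
apply: (@le_trans _ _ (2 * b ^+ 2 * (C * (expR t - 1) ^+ 2) + 2 * (t * (k * b)) ^+ 2 * U)); last first.
  rewrite [X in _ <= X]mulrDl; apply: lerD; last first.
    by rewrite le_eqVlt; apply/orP; left; apply/eqP; ring.
  have -> : 2 * b ^+ 2 * (C * b1 ^+ 2) * t ^+ 2 = 2 * b ^+ 2 * (C * (t * b1) ^+ 2) by ring.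
  have q1 := sqr_ge0 b; apply: ler_wpM2l; first exact: mulr_ge0.
  apply: ler_wpM2l => //; rewrite ler_pXn2r ?nnegrE ?subr_ge0 ?(ltW a1)//; last first.
    by rewrite mulr_ge0 ?(ltW t0)// expR_ge0.
  by apply: le_trans (expR_sub1_le _) _; rewrite ler_pM2l// ler_expR.
apply: (@le_trans _ _ (2 * b ^+ 2 * I (fun x => \1_(cube r) x *
    (u (expR t *: x + (1 - expR t) *: x0) - u x) ^+ 2) + 2 * (t * (k * b)) ^+ 2 * U)); last first.
  by rewrite lerD2r ler_wpM2l// mulr_ge0 ?sqr_ge0.
rewrite /U /n2 -IZ// -IZ; last exact: Lc'.2.
rewrite -ID; [|exact: rintZ|by apply: rintZ; exact: Lc'.2].
apply: I_le => //; first by apply: rintD; apply: rintZ => //; exact: Lc'.2.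
move=> x; have [Ox|Ox] := pselect (Omega x); last first.
  rewrite [\1_Omega x]indicE memNset// mul0r.
  have q1 := sqr_ge0 b; have q2 := sqr_ge0 (t * (k * b)).
  apply: addr_ge0; apply: mulr_ge0; try exact: mulr_ge0; last exact: sqr_ge0.
  by apply: mulr_ge0 => //; exact: sqr_ge0.
rewrite !indicE (mem_set Ox) (mem_set (Or _ Ox)) /= mulr1 !mul1r.
(* The change of argument, handled by [dil_le], is separated from the change of amplitude, whose
   factor is O(t). *)
have -> : gap t x = expR t `^ k * (u (expR t *: x + (1 - expR t) *: x0) - u x) + (expR t `^ k - 1) * u x.
  by rewrite /gap /dilated /dil -/k; ring.
set d := u _ - u x.
have := sqr_ge0 (expR t `^ k * d - (expR t `^ k - 1) * u x) => h.
have h1 : (expR t `^ k * d) ^+ 2 <= b ^+ 2 * d ^+ 2.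
  by rewrite exprMn ler_wpM2r ?sqr_ge0// ler_pXn2r ?nnegrE ?powR_ge0 ?expR_ge0.
have h2 : ((expR t `^ k - 1) * u x) ^+ 2 <= (t * (k * b)) ^+ 2 * u x ^+ 2.
  case/andP: bt1 => l1 l2; rewrite exprMn ler_wpM2r ?sqr_ge0// ler_pXn2r ?nnegrE//.
  exact: le_trans l2.
have -> : (expR t `^ k * d + (expR t `^ k - 1) * u x) ^+ 2 =
  2 * (expR t `^ k * d) ^+ 2 + 2 * ((expR t `^ k - 1) * u x) ^+ 2 -
  (expR t `^ k * d - (expR t `^ k - 1) * u x) ^+ 2 by ring.
lra.
Qed.

Lemma weight_split (A : set 'rV[R]_N) f g K : measurable A -> 0 <= K -> Lp mu p f -> Lp mu p g ->
  rint mu (fun x => \1_A x * g x ^+ 2) ->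
  I (fun x => \1_A x * (`|f x| `^ (p - 2) * g x ^+ 2)) <=
  I (fun x => `|cut f K x| `^ (p - 2) * g x ^+ 2) + K `^ (p - 2) * I (fun x => \1_A x * g x ^+ 2).
Proof.
move=> mA K0 Lf Lg ig; have i1 := weighted_gap_rint mA Lf Lg.
have i2 := rint_cut_split hp K0 Lf Lg.
rewrite -IZ// -ID//; last exact: rintZ.
apply: I_le; [exact: i1 | by apply: rintD => //; exact: rintZ |].
move=> x; have h0 : 0 <= \1_A x :> R by [].
have h1 : \1_A x <= 1 :> R by rewrite indicE; case: (x \in A).
rewrite /cut; case: ifP => fK.
  rewrite normr0 powR0 ?mul0r ?add0r; last by rewrite gt_eqF// subr_gt0.
  rewrite mulrCA; apply: ler_wpM2r; first by apply: mulr_ge0 => //; exact: sqr_ge0.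
  by apply: powR_le => //; rewrite subr_ge0 ltW.
have g0 := sqr_ge0 (g x); have f0 := powR_ge0 `|f x| (p - 2).
apply: ler_wpDr; first by apply: mulr_ge0; [exact: powR_ge0 | exact: mulr_ge0].
by apply: ler_piMl => //; exact: mulr_ge0.
Qed.

(** In [gap_energy] the large values of u and of its dilation are absorbed by the left side; the
    bounded part leaves the integral of gap^2 over Omega, which is O(t^2). The L^p bound is then the
    Sobolev inequality. *)
Lemma gap_bounds : exists T C : R, [/\ 0 < T, T < e0, T <= 1, 0 <= C &
  forall t, 0 < t -> t <= T ->
    [/\ en (gap_grad t) <= C * t ^+ 2, swollen t <= C * t ^+ 2 &
      np mu p (gap t) <= C * t `^ p]].
Proof.
have [r r0 Or] := bounded_cube bO; have [C1 C10 HC1] := gap_L2_bound r0 Or.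
have [Cs Cs0 sob] := sobolev hp N0 (crit_exp_sobolev R hN).
have Lu := grad_Lp gu.
have p1 : 0 < p - 1 by have := hp; lra.
(* Two terms of size [ep], times p (p - 1), make p/4, half of the coefficient p/2 to be absorbed. *)
pose ep := (8 * (p - 1))^-1; have ep0 : 0 < ep by rewrite invr_gt0 mulr_gt0.
have [K K0 HK] := np_cut_small hp Lu (divr_gt0 ep0 (mulr_gt0 (ltr0n R 2) Cs0)).
pose k := N%:R / p; have k0 : 0 <= k by rewrite divr_ge0// ltW.
pose b := expR k.
pose D := p * (p - 1) * ((K `^ (p - 2) + (b * K) `^ (p - 2)) * C1).
have pp : 0 <= p * (p - 1) by exact: (mulr_ge0 (ltW p0) (ltW p1)).
have D0 : 0 <= D by do 2 apply: mulr_ge0 => //; apply: addr_ge0; exact: powR_ge0.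
pose C2 := 4 / p * D + D; have C20 : 0 <= C2 by rewrite addr_ge0// mulr_ge0// divr_ge0// ltW.
pose C := C2 + (Cs * C2) `^ (p / 2).
pose T := Num.min 1 (e0 / 2).
have T0 : 0 < T by rewrite lt_min ltr01 divr_gt0.
have Te : T < e0 by rewrite gt_min; apply/orP; right; rewrite ltr_pdivrMr// ltr_pMr// ltr1n.
have T1 : T <= 1 by rewrite ge_min lexx.
exists T, C; split => //; first by rewrite addr_ge0// powR_ge0.
move=> t t0 tT; have te : t < e0 by exact: le_lt_trans Te.
have t1 : t <= 1 by exact: le_trans T1.
have gw := grad_gap t; have Lw := grad_Lp gw; have Ld := grad_Lp (grad_dilated t gu).
have [i1 b1] := HC1 t t0 t1.
have bK0 : 0 <= b * K by rewrite mulr_ge0 ?expR_ge0.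
have s1 := weight_split mO K0 Lu Lw i1; have s2 := weight_split mO bK0 Ld Lw i1.
have c1 := Lp_sqr_small hp Cs0 sob (Lp_cut K p0 Lu) HK gw.
(* For t <= 1 the dilation multiplies values by at most [b], so at threshold b K the large part of
   the dilation is below the dilated large part of u, whose norm is that of [cut u K]. *)
have c2 : I (fun x => `|cut (dilated t u) (b * K) x| `^ (p - 2) * gap t x ^+ 2) <= ep * en (gap_grad t).
  apply: (Lp_sqr_small hp Cs0 sob (Lp_cut _ p0 Ld) _ gw).
  apply: le_trans HK; apply: powR_le; [|exact: np_ge0|].
    by rewrite subr_ge0 ler_pdivrMr// mul1r ltW.
  rewrite -(np_dilated t (Lp_cut K p0 Lu)).
  have Ldc : Lp mu p (dilated t (cut u K)).
    by apply: LpZ => //; apply: Lp_affine; [exact: expR_gt0 | exact: Lp_cut].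
  apply: np_le => //; first by apply: measurable_cut; case: Ld.
  move=> x; rewrite /cut /dilated !dil1 ?expR_gt0//.
  case: ifP => dK; first by rewrite normr0 mulr_ge0// powR_ge0.
  rewrite dil1 ?expR_gt0// ler_wpM2l ?powR_ge0//; case: ifP => // uK.
  exfalso; move/negP: dK; apply; rewrite ler_pM ?powR_ge0//.
  by rewrite -expRM ler_expR ler_piMl.
have en0 := en_ge0 (gap_grad t); have sw0 := swollen_ge0 t.
have main : p / 4 * en (gap_grad t) + 2 * swollen t <= D * t ^+ 2.
  have h := gap_energy t0 te.
  have hs : I (fun x => \1_Omega x * (`|u x| `^ (p - 2) * gap t x ^+ 2)) +
    I (fun x => \1_Omega x * (`|dilated t u x| `^ (p - 2) * gap t x ^+ 2)) <=
    2 * ep * en (gap_grad t) + (K `^ (p - 2) + (b * K) `^ (p - 2)) * (C1 * t ^+ 2).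
    have h1 : K `^ (p - 2) * I (fun x => \1_Omega x * gap t x ^+ 2) <= K `^ (p - 2) * (C1 * t ^+ 2).
      by rewrite ler_wpM2l ?powR_ge0.
    have h2 : (b * K) `^ (p - 2) * I (fun x => \1_Omega x * gap t x ^+ 2) <= (b * K) `^ (p - 2) * (C1 * t ^+ 2).
      by rewrite ler_wpM2l ?powR_ge0.
    apply: le_trans (lerD s1 s2) _; rewrite mulrDl.
    by apply: le_trans (lerD (lerD c1 h1) (lerD c2 h2)) _; rewrite le_eqVlt; apply/orP; left; apply/eqP; ring.
  have {}hs : p * (p - 1) * (I (fun x => \1_Omega x * (`|u x| `^ (p - 2) * gap t x ^+ 2)) +
    I (fun x => \1_Omega x * (`|dilated t u x| `^ (p - 2) * gap t x ^+ 2))) <=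
    p / 4 * en (gap_grad t) + D * t ^+ 2.
    have -> : p / 4 * en (gap_grad t) + D * t ^+ 2 = p * (p - 1) *
        (2 * ep * en (gap_grad t) + (K `^ (p - 2) + (b * K) `^ (p - 2)) * (C1 * t ^+ 2)).
      by rewrite /D /ep; field; rewrite gt_eqF.
    by rewrite ler_wpM2l.
  exact: absorb (le_trans h hs).
have t20 : 0 <= t ^+ 2 by exact: sqr_ge0.
have enC : en (gap_grad t) <= 4 / p * D * t ^+ 2.
  have p4 : 0 < p / 4 by rewrite divr_gt0.
  rewrite -(ler_pM2l p4).
  have -> : p / 4 * (4 / p * D * t ^+ 2) = D * t ^+ 2 by field; rewrite gt_eqF.
  exact: (drop_right main).
have Dt : 0 <= D * t ^+ 2 by rewrite mulr_ge0.
have C2t : C2 * t ^+ 2 <= C * t ^+ 2 by rewrite ler_wpM2r// lerDl powR_ge0.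
have enC2 : en (gap_grad t) <= C2 * t ^+ 2.
  by apply: le_trans enC _; rewrite ler_wpM2r// lerDl.
split; first exact: le_trans C2t.
  apply: le_trans C2t; apply: (@le_trans _ _ (D * t ^+ 2)).
    have : 0 <= p / 4 * en (gap_grad t) by rewrite mulr_ge0// divr_ge0// ltW.
    move=> en4; exact: (drop_left main).
  by rewrite ler_wpM2r// lerDr mulr_ge0// divr_ge0// ltW.
have nE : np mu p (gap t) = (np mu p (gap t) `^ (2 / p)) `^ (p / 2).
  rewrite -powRrM (_ : 2 / p * (p / 2) = 1) ?powRr1 ?np_ge0//.
  by field; rewrite gt_eqF.
rewrite nE; apply: (@le_trans _ _ ((Cs * C2 * t ^+ 2) `^ (p / 2))).
  apply: powR_le; [by apply: divr_ge0; [exact: ltW p0 |] | exact: powR_ge0 |].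
  by apply: le_trans (sob _ _ gw) _; rewrite -mulrA ler_pM2l.
have CC : 0 <= Cs * C2 by exact: mulr_ge0 (ltW Cs0) C20.
rewrite (powRM _ CC t20).
rewrite (sqr_powR_half p (ltW t0)).
by rewrite ler_wpM2r ?powR_ge0// lerDr.
Qed.

End dilation_gap.

(** By induction f(t) <= C 2^(-j) t^2 + 2 D t^p. Passing from t/M to t halves the first constant
    because 2q <= M^2, and preserves the second because also 2q <= M^p. *)
Lemma iterated_decay (R : realType) (f : R -> R) (T C q D p M : R) : 2 < p -> 1 <= M ->
  0 <= C -> 0 <= q -> 0 <= D -> 2 * q <= M ^+ 2 ->
  (forall t, 0 < t -> t <= T -> f t <= C * t ^+ 2) ->
  (forall t, 0 < t -> t <= T -> f t <= q * f (t / M) + D * t `^ p) ->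
  forall t, 0 < t -> t <= T -> f t <= 2 * D * t `^ p.
Proof.
move=> hp M1 C0 q0 D0 qM fC fq; have M0 : 0 < M by exact: lt_le_trans M1.
have qMp : 2 * q <= M `^ p.
  by apply: le_trans qM _; rewrite -powR_mulrn ?(ltW M0)//; apply: ler_powR => //; exact: ltW.
have claim j t : 0 < t -> t <= T -> f t <= C * hs R j * t ^+ 2 + 2 * D * t `^ p.
  elim: j t => [|j IH] t t0 tT.
    apply: le_trans (fC t t0 tT) _; rewrite /hs expr0 mulr1 lerDl.
    by rewrite !mulr_ge0 ?powR_ge0.
  apply: le_trans (fq t t0 tT) _; have tM0 : 0 < t / M by rewrite divr_gt0.
  have tMT : t / M <= T by apply: le_trans tT; rewrite ler_pdivrMr// ler_peMr// ltW.
  have h := IH _ tM0 tMT.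
  have e2 : M ^+ 2 * (t / M) ^+ 2 = t ^+ 2 by rewrite -exprMn mulrC divfK// gt_eqF.
  have ep : M `^ p * (t / M) `^ p = t `^ p.
    by rewrite -powRM ?(ltW M0) ?(ltW tM0)// mulrC divfK// gt_eqF.
  have h1 : 2 * q * (t / M) ^+ 2 <= t ^+ 2 by rewrite -e2 ler_wpM2r ?sqr_ge0.
  have h2 : 2 * q * (t / M) `^ p <= t `^ p by rewrite -ep ler_wpM2r ?powR_ge0.
  have h3 : q * f (t / M) <= q * (C * hs R j * (t / M) ^+ 2 + 2 * D * (t / M) `^ p).
    by rewrite ler_wpM2l.
  have h4 : C * hs R j * (2 * q * (t / M) ^+ 2) <= C * hs R j * t ^+ 2.
    by rewrite ler_wpM2l// mulr_ge0// ltW// hs_gt0.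
  have h5 : D * (2 * q * (t / M) `^ p) <= D * t `^ p by rewrite ler_wpM2l.
  have -> : hs R j.+1 = 2^-1 * hs R j by rewrite /hs exprS.
  by lra.
move=> t t0 tT; have c1 : (fun j => C * hs R j * t ^+ 2 + 2 * D * t `^ p) @ \oo --> 2 * D * t `^ p.
  rewrite -[X in _ --> X]add0r; apply: cvgD; last exact: cvg_cst.
  rewrite [X in _ --> X](_ : _ = C * 0 * t ^+ 2); last by ring.
  by apply: cvgM; [apply: cvgM; [exact: cvg_cst | exact: hs_cvg0] | exact: cvg_cst].
by apply: (le_cvg_seq (cvg_cst (f t)) c1) => j; exact: claim.
Qed.

(** * Decay in the collar and vanishing outside Omega *)

Section starshaped.
Context (R : realType) (N : nat).
Implicit Types (v f g : 'rV[R]_N -> R) (H : 'rV[R]_N -> 'rV[R]_N)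
  (x y z c : 'rV[R]_N) (i k : 'I_N) (a t h s r e : R).

Notation e_ i := (delta_mx 0 i : 'rV[R]_N).
Notation mu := (lebesgue_rV N : {measure set 'rV[R]_N -> \bar R}).
Notation I f := (Rintegral mu setT f).
Notation p := (@crit_exp R N).
Notation grad := (grad p).

Variables (Omega : set 'rV[R]_N) (x0 : 'rV[R]_N) (u : 'rV[R]_N -> R)
  (G : 'rV[R]_N -> 'rV[R]_N) (e0 : R).
Hypotheses (hN : (3 <= N)%N) (oO : open Omega) (bO : bounded_set Omega).
Hypotheses (e00 : 0 < e0) (cone0 : forall y, cone_at Omega x0 e0 y).
Hypotheses (gu : grad u G)
  (EL : forall v H, grad v H -> ipG G H = I (fun x => Q Omega x * (psi p (u x) * v x))).

Let hp : 2 < p := crit_exp_gt2 R hN.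
Let p0 : 0 < p. Proof. by have := hp; lra. Qed.
Let N0 : (0 < N)%N := leq_trans (isT : (0 < 3)%N) hN.
Let mO : measurable Omega := open_measurable_rV oO.
Let Lu : Lp mu p u := grad_Lp gu.

Notation swell := (swell Omega x0).
Notation swollen := (swollen Omega x0 u).
Notation dilated := (dilated x0).
Notation gap := (gap x0 u).

Definition collar t : set 'rV[R]_N := swell t `\` Omega.

Lemma measurable_collar t : measurable (collar t).
Proof. by apply: measurableD => //; exact: measurable_swell. Qed.

(** The part of [swell (s + t)] beyond [swell t] is the image of [collar s] under the dilation by
    e^t, so its contribution is the integral over [collar s] of the dilated function, which is u +
    gap. *)
Lemma swollen_add s t : 0 < s -> s < e0 -> 0 < t -> t < e0 ->
  swollen (s + t) <= swollen t + 2 `^ p * (swollen s + np mu p (gap t)).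
Proof.
move=> s0 se t0 te.
have Ld := grad_Lp (grad_dilated x0 hN t gu).
have Lg : Lp mu p (gap t) by have [] := LpB hp Ld Lu.
have sub1 := swell_sub e00 cone0 t0 te.
have sub2 : swell t `<=` swell (s + t).
  by move=> y ty; rewrite /swell /= -pull_pull; apply: (swell_sub e00 cone0 s0 se).
have mc := measurable_collar.
have E : swollen (s + t) = swollen t + I (fun x => \1_(collar s) x * `|dilated t u x| `^ p).
  rewrite (I_dilated x0 hN t (mc s) Lu) /swollen -ID; last 2 first.
  - exact: rint_cut_np (mc t) Lu.
  - by apply: (rint_cut_np _ Lu); exact: measurable_swell_gen.
  apply: I_eq => y; rewrite -mulrDl; congr (_ * _).
  have -> : [set y | collar s (pull x0 t y)] = swell (s + t) `\` swell t.
    by apply/seteqP; split => z; rewrite /collar /swell /= -pull_pull.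
  rewrite !indicE !in_setD.
  have [Oy|Oy] := boolP (y \in Omega).
    have ty : y \in swell t by apply/mem_set/sub1/set_mem.
    by rewrite ty !andbF addr0.
  rewrite !andbT; have [ty|ty] := boolP (y \in swell t).
    by rewrite andbF addr0 (_ : y \in swell (s + t))//; apply/mem_set/sub2/set_mem.
  by rewrite andbT add0r.
rewrite E lerD2l; have i1 := rint_cut_np (mc s) Lu; have [_ i2] := Lg.
rewrite /swollen /np -ID// -IZ; last exact: rintD.
apply: I_le; [exact: (rint_cut_np (mc s) Ld) | by apply: rintZ; exact: rintD |].
move=> x; have := powRD_le (u x) (gap t x) hp.
have -> : u x + gap t x = dilated t u x by rewrite /gap addrC subrK.
have h1 := powR_ge0 `|gap t x| p; have h2 := powR_ge0 (2:R) p.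
rewrite indicE; case: (x \in collar s) => /= h; first by rewrite !mul1r.
by rewrite !mul0r add0r; exact: mulr_ge0.
Qed.

(** Each new layer is compared with the innermost collar of parameter [s], at cost at most [Z]. The
    factor 2^p is therefore not compounded and the bound is linear in the number of layers. *)
Lemma swollen_mul (T C : R) n s : 0 < T -> T < e0 -> 0 <= C ->
  (forall t, 0 < t -> t <= T -> np mu p (gap t) <= C * t `^ p) ->
  0 < s -> n.+1%:R * s <= T ->
  swollen (n.+1%:R * s) <= n.+1%:R * (2 `^ p * (swollen s + C * (n.+1%:R * s) `^ p)).
Proof.
move=> T0 Te C0 HC s0 nT; set Z := 2 `^ p * _.
have two1 : 1 <= 2 `^ p :> R.
  have := @powR_le R 1 2 p (ltW p0) ler01 ltac:(by rewrite ler1n).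
  by rewrite powR1.
have X0 : 0 <= C * (n.+1%:R * s) `^ p by rewrite mulr_ge0 ?powR_ge0.
have sw0 := swollen_ge0 Omega x0 u s.
have sZ : swollen s <= Z.
  apply: (@le_trans _ _ (1 * (swollen s + C * (n.+1%:R * s) `^ p))); first by rewrite mul1r lerDl.
  by rewrite ler_wpM2r// addr_ge0.
have sT : s <= T by apply: le_trans nT; rewrite ler_peMl ?(ltW s0)// ler1n.
suff K (k : nat) : (k <= n)%N -> swollen (k.+1%:R * s) <= k.+1%:R * Z by exact: (K n (leqnn n)).
elim: k => [_|k IH kn]; first by rewrite !mul1r.
have {}IH := IH (ltnW kn).
have ks0 : 0 < k.+1%:R * s by rewrite mulr_gt0.
have ksn : k.+1%:R * s <= n.+1%:R * s by rewrite ler_pM2r// ler_nat ltnW.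
have ksT : k.+1%:R * s <= T by exact: le_trans nT.
have -> : k.+2%:R * s = s + k.+1%:R * s by rewrite -[k.+2%:R]natr1; ring.
apply: le_trans (swollen_add s0 (le_lt_trans sT Te) ks0 (le_lt_trans ksT Te)) _.
rewrite -[k.+2%:R]natr1 mulrDl mul1r; apply: lerD => //.
rewrite ler_wpM2l ?powR_ge0// lerD2l; apply: le_trans (HC _ ks0 ksT) _.
by rewrite ler_wpM2l//; apply: powR_le => //; exact: ltW.
Qed.

Lemma swollen_decay : exists T C : R, [/\ 0 < T, T < e0, T <= 1, 0 <= C &
  forall t, 0 < t -> t <= T -> swollen t <= C * t `^ p].
Proof.
have [T [C [T0 Te T1 C0 HC]]] := gap_bounds hN oO bO e00 cone0 gu EL.
have P0 : 0 <= 2 `^ p :> R by exact: powR_ge0.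
have x0' : 0 <= 2 * 2 `^ p :> R by rewrite mulr_ge0.
(* With M = m + 1 and q = M 2^p this is the condition 2q <= M^2 of [iterated_decay]. *)
have [m mP] : exists m : nat, 2 * 2 `^ p <= m.+1%:R :> R.
  exists (Num.bound (2 * 2 `^ p : R)); apply: ltW.
  by apply: lt_trans (archi_boundP x0') _; rewrite ltr_nat.
exists T, (2 * (m.+1%:R * (2 `^ p * C))); split => //; first by rewrite !mulr_ge0.
have M1 : 1 <= m.+1%:R :> R by rewrite ler1n.
have q0 : 0 <= m.+1%:R * 2 `^ p :> R by rewrite mulr_ge0.
have D0 : 0 <= m.+1%:R * (2 `^ p * C) by rewrite !mulr_ge0.
have qM : 2 * (m.+1%:R * 2 `^ p) <= m.+1%:R ^+ 2 :> R by rewrite mulrCA expr2 ler_wpM2l.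
have sC t : 0 < t -> t <= T -> swollen t <= C * t ^+ 2.
  by move=> t0 tT; have [] := HC t t0 tT.
apply: (iterated_decay hp M1 C0 q0 D0 qM sC).
move=> t t0 tT; have m0 : 0 < m.+1%:R :> R by rewrite ltr0n.
have tm0 : 0 < t / m.+1%:R by rewrite divr_gt0.
have E : m.+1%:R * (t / m.+1%:R) = t by rewrite mulrC divfK// gt_eqF.
have := @swollen_mul T C m (t / m.+1%:R) T0 Te C0 _ tm0; rewrite E.
move=> H; apply: le_trans (H _ tT) _.
  by move=> s s0 sT; have [] := HC s s0 sT.
by rewrite le_eqVlt; apply/orP; left; apply/eqP; ring.
Qed.

Lemma collar_volume : exists2 C, 0 <= C & forall t, 0 < t -> t < e0 -> t <= 1 ->
  rint mu (\1_(collar t) : _ -> R) /\ I (\1_(collar t)) <= C * t.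
Proof.
have [r r0 Or] := bounded_cube bO.
have iO : rint mu (\1_Omega : _ -> R).
  apply: rint_indic => //; apply: le_lt_trans (@mu_cube_fin R N r).
  by apply: le_measure; rewrite ?inE//; exact: measurable_cube.
have V0 : 0 <= I (\1_Omega : _ -> R) by apply: I_ge0.
exists (N%:R * expR N%:R * I (\1_Omega : _ -> R)); first by rewrite !mulr_ge0 ?expR_ge0.
move=> t t0 te t1.
have E1 y : \1_(swell t) y = \1_Omega (expR (- t) *: y + (x0 - expR (- t) *: x0)) :> R.
  rewrite !indicE; congr (_%:R); congr nat_of_bool; apply/idP/idP => /set_mem yt; apply/mem_set;
    move: yt; rewrite /swell /pull /=; congr Omega; apply/rowP => j; rewrite !mxE; ring.
have is_ : rint mu (\1_(swell t) : _ -> R).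
  by apply: rint_eq (rint_affine (x0 - expR (- t) *: x0) (expR_gt0 (- t)) iO) => y; rewrite E1.
have E2 y : \1_(collar t) y = \1_(swell t) y - \1_Omega y :> R.
  rewrite !indicE in_setD; have [Oy|Oy] := boolP (y \in Omega).
    by rewrite andbF (_ : y \in swell t) ?subrr//; apply/mem_set/(swell_sub e00 cone0 t0 te)/set_mem.
  by rewrite andbT subr0.
split; first by apply: rint_eq (rintB is_ iO) => y; rewrite E2.
rewrite (I_eq mu E2) IB// (I_eq mu E1) I_affine ?expR_gt0//.
rewrite -expRM_natl -expRN mulrN opprK.
have -> : expR (N%:R * t) * I (\1_Omega : _ -> R) - I (\1_Omega : _ -> R) =
  (expR (N%:R * t) - 1) * I (\1_Omega : _ -> R) by ring.
rewrite mulrAC ler_wpM2r//; apply: le_trans (expR_sub1_le _) _.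
rewrite mulrAC ler_wpM2r ?mulr_ge0 ?(ltW t0)//; last first.
by rewrite ler_wpM2l// ler_expR ler_piMr.
Qed.

(** Hölder's inequality: the decay t^p of E gives t^2, and the volume O(t) of the collar gives the
    additional factor t^(1-2/p), which makes the bound o(t^2). *)
Lemma collar_sqr : exists T C : R, [/\ 0 < T, T < e0, T <= 1, 0 <= C &
  forall t, 0 < t -> t <= T -> L2 mu (fun x => \1_(collar t) x * u x) /\
    n2 mu (fun x => \1_(collar t) x * u x) <= C * t ^+ 2 * t `^ (1 - 2 / p)].
Proof.
have [T [C [T0 Te T1 C0 HC]]] := swollen_decay; have [C1 C10 HC1] := collar_volume.
exists T, (2 * (C1 `^ (1 - 2 / p) * C `^ (2 / p))); split => //.
  by rewrite !mulr_ge0 ?powR_ge0.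
move=> t t0 tT; have [ic bc] := HC1 t t0 (le_lt_trans tT Te) (le_trans tT T1).
have p2 : 0 < p - 2 by have := hp; lra.
have mc := measurable_collar t; have [mu_ _] := Lu.
have ind r x : 0 < r -> `|\1_(collar t) x| `^ r = \1_(collar t) x :> R.
  by move=> r0; rewrite indicE; case: (x \in _) => /=;
    rewrite ?normr1 ?powR1// normr0 powR0// gt_eqF.
have L1 : Lp mu p (\1_(collar t) : _ -> R).
  by split; [exact: measurable_indic | apply: rint_eq ic => x; rewrite ind].
have L2' : Lp mu p (fun x => \1_(collar t) x * u x).
  apply: (proj1 (@Lp_dom _ _ _ _ _ _ u 1 _ _ _ _ _)) => //.
    by apply: measurable_funM => //; exact: measurable_indic.
  by move=> x; rewrite mul1r indicE; case: (x \in _); rewrite ?mul1r ?mul0r ?normr0.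
have E x : `|\1_(collar t) x| `^ (p - 2) * (\1_(collar t) x * u x) ^+ 2 = (\1_(collar t) x * u x) ^+ 2.
  by rewrite ind// indicE; case: (x \in _); rewrite ?mul1r// !mul0r expr0n.
have H := Lp_sqr_le hp L1 L2'; have i1 := Lp_sqr_rint hp L1 L2'.
split; first by split; [case: L2' | apply: rint_eq i1 => x; rewrite E].
rewrite /n2 -(I_eq mu E); apply: le_trans H _.
have e1 : np mu p (\1_(collar t) : _ -> R) `^ (1 - 2 / p) <= (C1 * t) `^ (1 - 2 / p).
  apply: powR_le; rewrite ?np_ge0//.
    by rewrite subr_ge0 ler_pdivrMr// mul1r ltW.
  by apply: le_trans bc; rewrite le_eqVlt; apply/orP; left; apply/eqP; apply: I_eq => x; rewrite ind.
have e2 : np mu p (fun x => \1_(collar t) x * u x) `^ (2 / p) <= (C * t `^ p) `^ (2 / p).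
  apply: powR_le; rewrite ?np_ge0//; first by apply: divr_ge0 => //; exact: ltW p0.
  apply: le_trans (HC t t0 tT); rewrite le_eqVlt; apply/orP; left; apply/eqP.
  apply: I_eq => x; rewrite indicE; case: (x \in _) => /=; rewrite ?mul1r// !mul0r.
  by rewrite normr0 powR0// gt_eqF.
apply: (@le_trans _ _ (2 * ((C1 * t) `^ (1 - 2 / p) * (C * t `^ p) `^ (2 / p)))).
  by rewrite ler_pM2l// ler_pM ?powR_ge0.
rewrite (powRM _ C10 (ltW t0)) (powRM _ C0 (powR_ge0 t p)) -powRrM.
have -> : p * (2 / p) = 2%:R by rewrite mulrCA mulfV ?mulr1// gt_eqF.
by rewrite (powR_mulrn 2 (ltW t0)) le_eqVlt; apply/orP; left; apply/eqP; ring.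
Qed.

Definition outside : 'rV[R]_N -> R := fun x => u x - \1_Omega x * u x.
Definition outside_grad : 'rV[R]_N -> 'rV[R]_N := fun x => (1 - \1_Omega x) *: G x.

Lemma outside_in x : Omega x -> outside x = 0.
Proof. by move=> Ox; rewrite /outside indicE mem_set// mul1r subrr. Qed.

Lemma outside_out x : ~ Omega x -> outside x = u x.
Proof. by move=> Ox; rewrite /outside indicE memNset// mul0r subr0. Qed.

Lemma hs_powR_cvg0 (q : R) : 0 < q -> (fun n => hs R n `^ q) @ \oo --> 0.
Proof.
move=> q0; have h0 : 0 <= 2^-1 `^ q :> R by exact: powR_ge0.
have -> : (fun n => hs R n `^ q) = (fun n => (2^-1 `^ q) ^+ n).
  apply/funext => n; rewrite /hs -(powR_mulrn _ (_ : 0 <= 2^-1 :> R)) ?invr_ge0//.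
  by rewrite -powRrM mulrC powRrM powR_mulrn ?powR_ge0.
apply: cvg_expr; rewrite ger0_norm//.
have : (2^-1 : R) `^ q < 1 `^ q.
  by apply: gt0_ltr_powR; rewrite ?nnegrE ?invr_ge0// invf_lt1// ltr1n.
by rewrite powR1.
Qed.

(* A segment of length at most [e0 * t] that crosses the boundary of Omega has its
   outer end in [collar t], on which [u] is small by [collar_sqr]. *)
Lemma grad_outside : grad outside outside_grad.
Proof.
have [T [C [T0 Te T1 C0 HC]]] := collar_sqr; have [C1 C10 HC1] := collar_volume.
have [_ LG Ldu cG] := gu; have [mu_ _] := Lu.
have [r r0 Or] := bounded_cube bO.
have mi : measurable_fun setT (\1_Omega : 'rV[R]_N -> R) by exact: measurable_indic.
have mout : measurable_fun setT outside.
  by apply: measurable_funB => //; exact: measurable_funM.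
have i01 x : \1_Omega x = 1 :> R \/ \1_Omega x = 0 :> R.
  by rewrite indicE; case: (x \in Omega); [left | right].
have LGo i : L2 mu (comp i outside_grad).
  apply: (proj1 (@L2_dom _ _ _ _ _ (comp i G) 1 _ _ _)); [|exact: LG|].
    rewrite /comp /outside_grad; under eq_fun do rewrite mxE.
    by apply: measurable_funM; [exact: measurable_funB | case: (LG i)].
  by move=> x; rewrite mul1r /comp mxE; case: (i01 x) => ->;
    rewrite ?subrr ?subr0 ?mul0r ?mul1r ?normr0.
have Lin : L2 mu (fun x => \1_Omega x * u x).
  apply: (proj1 (@L2_dom _ _ _ _ _ (fun x => u x * \1_(cube r) x) 1 _ _ _)).
  - exact: measurable_funM.
  - exact: (Lp_mul_L2_cube r hp Lu).
  - move=> x; rewrite mul1r; have [Ox|Ox] := pselect (Omega x).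
      by rewrite !indicE (mem_set Ox) (mem_set (Or _ Ox)) mul1r mulr1.
    by rewrite [\1_Omega x]indicE memNset// mul0r normr0.
split.
- apply: (proj1 (@Lp_dom _ _ _ _ _ _ u 1 _ _ _ _ _)) => //.
  move=> x; rewrite mul1r /outside; case: (i01 x) => ->.
    by rewrite mul1r subrr normr0.
  by rewrite mul0r subr0.
- exact: LGo.
- move=> i n.
  have -> : dq i (hs R n) outside = fun x => dq i (hs R n) u x - dq i (hs R n) (fun x => \1_Omega x * u x) x.
    by apply/funext => x; rewrite /dq /outside; ring.
  apply: L2B => //; apply: L2Z; apply: L2B => //.
  exact: (L2_tau (hs R n *: e_ i) Lin).
move=> i; pose t n := hs R n / e0.
have tn0 n : 0 < t n by rewrite divr_gt0// hs_gt0.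
have tc : t @ \oo --> 0.
  rewrite -(mul0r e0^-1); apply: cvgM; [exact: hs_cvg0 | exact: cvg_cst].
have [n0 _ Hn0] : \forall n \near \oo, t n <= T.
  have /cvgrPdist_le/(_ _ T0) := tc; apply: filterS => n.
  by rewrite sub0r normrN ger0_norm// ltW.
have tT n : t (n + n0)%N <= T by apply: Hn0 => /=; rewrite leq_addl.
rewrite -(cvg_shiftn n0).
pose S n := collar (t (n + n0)%N); pose h n := hs R (n + n0)%N.
have h0 n : 0 < h n by exact: hs_gt0.
have he n : h n = e0 * t (n + n0)%N by rewrite /t mulrC divfK// gt_eqF.
have nh n : `|h n *: e_ i| <= e0 * t (n + n0)%N.
  by apply: le_trans (norm_delta_mx i _) _; rewrite gtr0_norm// he.
have te n : t (n + n0)%N < e0 by exact: le_lt_trans Te.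
have hit n x y : Omega y -> ~ Omega x -> `|x - y| <= e0 * t (n + n0)%N -> S n x.
  move=> Oy Ox xy; split => //; rewrite /swell /=.
  have := cone0 Oy (tn0 _) (te n) (z := x - y) xy.
  by rewrite addrC subrK.
(* The error of the difference quotient is split: [a] when both ends are outside Omega, [b] and [c]
   when only the starting point is, [d] when only the end point is. *)
pose a n x := dq i (h n) u x - G x 0 i.
pose b n x := \1_(S n) x * G x 0 i.
pose c n x := (h n)^-1 * (\1_(S n) x * u x).
pose d n x := tau (h n *: e_ i) (c n) x.
have mS n : measurable (S n) by exact: measurable_collar.
have La n : L2 mu (a n) by apply: L2B; [exact: Ldu | exact: LG].
have Lb n : L2 mu (b n) by apply: (L2_cut (mS n) (LG i)).1.
have Lc n : L2 mu (c n) by apply: L2Z; exact: (HC _ (tn0 _) (tT n)).1.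
have Ld n : L2 mu (d n) by exact: L2_tau.
have nrm f : L2 mu f -> L2 mu (fun x => `|f x|) /\ n2 mu (fun x => `|f x|) = n2 mu f.
  move=> Lf; have E x : `|f x| ^+ 2 = f x ^+ 2 by rewrite real_normK ?num_real.
  split; last by apply: I_eq => x; rewrite E.
  by split; [apply: measurableT_comp => //; case: Lf | apply: rint_eq Lf.2 => x; rewrite E].
have key n x : `|dq i (h n) outside x - outside_grad x 0 i| <=
    (`|a n x| + `|b n x|) + (`|c n x| + `|d n x|).
  set y := x + h n *: e_ i.
  have dy : d n x = (h n)^-1 * (\1_(S n) y * u y) by [].
  have ge4 (A B : R) : 0 <= A -> 0 <= B -> 0 <= A + B by exact: addr_ge0.
  rewrite /dq -/y mxE; have [Ox|Ox] := pselect (Omega x).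
    rewrite (outside_in Ox) subr0 indicE mem_set// subrr mul0r subr0.
    have [Oy|Oy] := pselect (Omega y).
      by rewrite (outside_in Oy) mulr0 normr0 !ge4.
    rewrite (outside_out Oy) dy indicE mem_set ?mul1r.
      by rewrite addrA lerDr !ge4.
    by apply: (hit _ _ x) => //; rewrite /y addrC addKr.
  rewrite (outside_out Ox) [\1_Omega x]indicE memNset// subr0 mul1r.
  have [Oy|Oy] := pselect (Omega y).
    have Sx : S n x.
      by apply: (hit _ _ y) => //; rewrite /y opprD addrA subrr sub0r normrN.
    rewrite (outside_in Oy) sub0r mulrN -opprD normrN /b /c indicE mem_set// !mul1r.
    apply: le_trans (ler_normD _ _) _; rewrite addrC.
    by apply: lerD; [rewrite lerDr | rewrite lerDl].
  rewrite (outside_out Oy) -[X in `|X| <= _]/(a n x) -addrA lerDl.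
  by rewrite !ge4.
have bound n : n2 mu (fun x => dq i (h n) outside x - outside_grad x 0 i) <=
    2 * (2 * n2 mu (a n) + 2 * n2 mu (b n)) + 2 * (2 * n2 mu (c n) + 2 * n2 mu (d n)).
  have [na na'] := nrm _ (La n); have [nb nb'] := nrm _ (Lb n).
  have [nc nc'] := nrm _ (Lc n); have [nd nd'] := nrm _ (Ld n).
  have s1 := L2D na nb; have s2 := L2D nc nd; have s3 := L2D s1 s2.
  apply: (@le_trans _ _ (1 ^+ 2 * n2 mu (fun x => (`|a n x| + `|b n x|) + (`|c n x| + `|d n x|)))).
    apply: (proj2 (L2_dom _ s3 _)).
      apply: measurable_funB; last by case: (LGo i).
      apply: measurable_funM => //; apply: measurable_funB => //.
      exact: (measurable_tau (h n *: e_ i) mout).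
    by move=> x; rewrite mul1r [X in _ <= X]ger0_norm ?addr_ge0.
  rewrite expr1n mul1r; apply: le_trans (n2D_le s1 s2) _; apply: lerD; rewrite ler_pM2l//.
    by apply: le_trans (n2D_le na nb) _; rewrite na' nb'.
  by apply: le_trans (n2D_le nc nd) _; rewrite nc' nd'.
have c_le n : n2 mu (c n) <= C / e0 ^+ 2 * t (n + n0)%N `^ (1 - 2 / p).
  rewrite /c n2Z; last exact: (HC _ (tn0 _) (tT n)).1.
  apply: (@le_trans _ _ ((h n)^-1 ^+ 2 * (C * t (n + n0)%N ^+ 2 * t (n + n0)%N `^ (1 - 2 / p)))).
    by rewrite ler_wpM2l ?sqr_ge0//; exact: (HC _ (tn0 _) (tT n)).2.
  have t_neq0 : t (n + n0)%N != 0 by rewrite gt_eqF.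
  rewrite he le_eqVlt; apply/orP; left; apply/eqP; field.
  by rewrite t_neq0 gt_eqF.
have q0 : 0 < 1 - 2 / p by rewrite subr_gt0 ltr_pdivrMr// mul1r.
have cc : (fun n => n2 mu (c n)) @ \oo --> 0.
  have c1 : (fun n => C / e0 ^+ 2 * t (n + n0)%N `^ (1 - 2 / p)) @ \oo --> 0.
    have cF : (fun n => C / e0 ^+ 2 * t n `^ (1 - 2 / p)) @ \oo --> (0 : R).
      have -> : (fun n => C / e0 ^+ 2 * t n `^ (1 - 2 / p)) =
          fun n => C / e0 ^+ 2 * (e0^-1 `^ (1 - 2 / p)) * hs R n `^ (1 - 2 / p).
        apply/funext => n; rewrite /t powRM ?invr_ge0 ?(ltW (hs_gt0 R n)) ?(ltW e00)//; ring.
      have c2 : (fun n => C / e0 ^+ 2 * (e0^-1 `^ (1 - 2 / p)) * hs R n `^ (1 - 2 / p)) @ \oo -->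
          C / e0 ^+ 2 * (e0^-1 `^ (1 - 2 / p)) * 0.
        by apply: cvgM; [exact: cvg_cst | exact: hs_powR_cvg0].
      by rewrite mulr0 in c2.
    by have := cF; rewrite -(cvg_shiftn n0).
  by apply: norm_cvg0_le c1 => n; rewrite ger0_norm ?n2_ge0.
have dc : (fun n => n2 mu (d n)) @ \oo --> 0.
  by under eq_fun do rewrite /d n2_tau//.
have ac : (fun n => n2 mu (a n)) @ \oo --> 0.
  by have := cG i; rewrite -(cvg_shiftn n0).
have bc : (fun n => n2 mu (b n)) @ \oo --> 0.
  apply: (n2_dct0 (g := fun x => `|comp i G x|)).
  - by move=> n; case: (Lb n).
  - by have [] := nrm _ (LG i).
  - move=> n x; rewrite /b /comp indicE; case: (x \in S n) => /=; first by rewrite mul1r.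
    by rewrite mul0r normr0.
  (* The volumes of the collars are geometric in n, so almost every point lies in finitely many of
     them. *)
  have hq : (0 <= 2^-1 :> R) && (2^-1 < 1 :> R) by rewrite invr_ge0 ler0n invf_lt1 ?ltr1n.
  have hv n := HC1 _ (tn0 (n + n0)%N) (te n) (le_trans (tT n) T1).
  have hb n : I (\1_(S n)) <= C1 / e0 * hs R n0 * 2^-1 ^+ n.
    apply: le_trans (hv n).2 _; rewrite /t /hs exprD.
    by rewrite le_eqVlt; apply/orP; left; apply/eqP; field; rewrite gt_eqF.
  have i0 n x : 0 <= \1_(S n) x :> R by rewrite indicE.
  apply: filterS (ae_cvg0 hq (fun n => (hv n).1) i0 hb) => x xS.
  by rewrite -(mul0r (G x 0 i)); apply: cvgM => //; exact: cvg_cst.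
have tot : (fun n => 2 * (2 * n2 mu (a n) + 2 * n2 mu (b n)) + 2 * (2 * n2 mu (c n) + 2 * n2 mu (d n))) @ \oo --> 0.
  rewrite [X in _ --> X](_ : _ = 2 * (2 * 0 + 2 * 0) + 2 * (2 * 0 + 2 * 0)); last by ring.
  have m2 (f : nat -> R) (l : R) : f @ \oo --> l -> (fun n => 2 * f n) @ \oo --> 2 * l.
    by move=> fl; apply: cvgM => //; exact: cvg_cst.
  by apply: cvgD; apply: (m2); apply: cvgD; exact: m2.
by apply: norm_cvg0_le tot => n; rewrite ger0_norm ?n2_ge0//; exact: bound.
Qed.

(** Testing the equation with [outside]: the gradient pairing is an energy, hence non-negative,
    while Q = -1 makes the other side - np outside. *)
Lemma starshaped_support : \forall x \ae mu, Omega x \/ u x = 0.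
Proof.
have go := grad_outside; have Lo := grad_Lp go; have [mo io] := Lo.
have h1 : 0 <= ipG G outside_grad.
  apply: sumr_ge0 => i _; apply: I_ge0 => x; rewrite /comp mxE mulrCA -expr2.
  apply: mulr_ge0; last exact: sqr_ge0.
  by rewrite subr_ge0 indicE; case: (x \in Omega).
have h2 : ipG G outside_grad = - np mu p outside.
  rewrite (EL go) -[RHS]mulN1r -IZ//; apply: I_eq => x.
  have [Ox|Ox] := pselect (Omega x).
    by rewrite outside_in// !mulr0 normr0 powR0 ?mulr0// gt_eqF.
  by rewrite outside_out// /Q memNset// psi_mul.
have h3 : np mu p outside = 0.
  by apply/eqP; rewrite eq_le np_ge0 andbT -oppr_ge0 -h2.
have := np_eq0 Lo h3; apply: filterS => x; have [Ox|Ox] := pselect (Omega x).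
  by left.
by rewrite outside_out// => ->; right.
Qed.

Lemma starshaped_trivial : \forall x \ae mu, u x = 0.
Proof.
have uO := starshaped_support; apply: (uc_bounded hN mO bO gu uO) => v H gv.
rewrite (EL gv); have Lv := grad_Lp gv; have ir := Lp_psi_rint hp Lu Lv.
have mQ := measurable_Q mO.
apply: I_ae; last first.
- apply: filterS uO => x [Ox|->]; first by rewrite /Q mem_set// mul1r.
  by rewrite psi0 !mul0r mulr0.
- exact: rint_measurable ir.
- apply: (rint_measurable (mu := mu)); apply: rint_weight => // x; by rewrite norm_Q.
Qed.

End starshaped.

(** By the Sobolev inequality the nonlinear term is O(s^p) with s the norm of v, and s^p <= s^2 for
    s <= 1; so J0 is quadratically small at 0. *)
Lemma critical_point0 (R : realType) (N : nat) (Omega : set 'rV[R]_N) : (3 <= N)%N ->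
  measurable Omega -> critical_point Omega (cst 0).
Proof.
move=> hN mO; have hp := crit_exp_gt2 R hN; set p := @crit_exp R N in hp *.
have p0 : 0 < p by lra.
have N0 : (0 < N)%N by exact: leq_trans hN.
have [C C0 sob] := sobolev hp N0 (crit_exp_sobolev R hN).
have g0 := @grad0 R N p p0.
split; first by apply/D12_grad => //; eexists; exact: g0.
move=> e e0; pose K := p^-1 * C `^ (p / 2).
have K0 : 0 < K by rewrite mulr_gt0 ?invr_gt0 ?powR_gt0.
(* The bound 1 gives s^p <= s^2; the other two make the quadratic and the nonlinear terms at most e
   s / 2 each. *)
exists (Num.min 1 (Num.min e (e / (2 * K)))).
  by rewrite !lt_min ltr01 e0 divr_gt0// mulr_gt0.
move=> v /(D12_grad _ hp)[H gv]; rewrite !lt_min => /andP[s1 /andP[se sK]].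
have sE := D12_norm_sqr hp gv; have s0 : 0 <= D12_norm v by exact: sqrtr_ge0.
have J00 : J0 Omega (cst 0 : 'rV[R]_N -> R) = 0.
  rewrite (J0E Omega hp g0) /en big1 => [|i _]; last first.
    by rewrite /n2 -[RHS](I0 (lebesgue_rV N)); apply: I_eq => x; rewrite /comp mxE expr0n.
  rewrite mulr0 sub0r; apply/eqP; rewrite oppr_eq0 mulf_eq0; apply/orP; right.
  apply/eqP; rewrite -[RHS](I0 (lebesgue_rV N)); apply: I_eq => x.
  by rewrite /= normr0 powR0 ?mulr0// gt_eqF.
have -> : (cst 0 : 'rV[R]_N -> R) \+ v = v by apply/funext => x; rewrite /= add0r.
rewrite J00 subr0 (J0E Omega hp gv) -sE; set s := D12_norm v in s0 s1 se sK sE *.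
have Lv := grad_Lp gv; have mQ := measurable_Q mO.
have np_s : np (lebesgue_rV N) p v <= C `^ (p / 2) * s ^+ 2.
  have -> : np (lebesgue_rV N) p v = np (lebesgue_rV N) p v `^ (2 / p) `^ (p / 2).
    rewrite -powRrM (_ : 2 / p * (p / 2) = 1) ?powRr1 ?np_ge0//.
    by field; rewrite gt_eqF.
  apply: (@le_trans _ _ ((C * s ^+ 2) `^ (p / 2))).
    apply: powR_le; [by apply: divr_ge0 => //; exact: ltW p0 | exact: powR_ge0 |].
    by rewrite sE; exact: sob.
  rewrite (powRM _ (ltW C0) (sqr_ge0 s)) (sqr_powR_half p s0) ler_wpM2l ?powR_ge0//.
  have := s0; rewrite le_eqVlt => /predU1P[<-|s_gt0].
    by rewrite powR0 ?expr0n// gt_eqF.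
  rewrite -(powR_mulrn 2 s0); apply: ger_powR; first by rewrite s_gt0 ltW.
  exact: ltW hp.
set q := Rintegral _ _ _.
have qn : `|q| <= np (lebesgue_rV N) p v.
  apply: le_trans (I_norm _) _; first by apply: rint_weight => //; [move=> x; rewrite norm_Q | case: Lv].
  rewrite le_eqVlt; apply/orP; left; apply/eqP; apply: I_eq => x.
  by rewrite normrM norm_Q mul1r ger0_norm// powR_ge0.
have n1 : `|2^-1 * s ^+ 2| = 2^-1 * s ^+ 2.
  by apply: ger0_norm; apply: mulr_ge0; [rewrite invr_ge0 | exact: sqr_ge0].
have n2 : `|p^-1 * q| = p^-1 * `|q|.
  by rewrite normrM (ger0_norm (_ : 0 <= p^-1))// invr_ge0 ltW.
apply: le_trans (ler_normB _ _) _; rewrite n1 n2.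
have a1 : 2^-1 * s ^+ 2 <= 2^-1 * (e * s).
  by rewrite ler_pM2l ?invr_gt0// expr2 ler_wpM2r// ltW.
have a2 : p^-1 * `|q| <= K * s ^+ 2.
  rewrite /K -mulrA ler_pM2l ?invr_gt0//; exact: le_trans qn np_s.
have a3 : K * s ^+ 2 <= 2^-1 * (e * s).
  have h : K * s <= 2^-1 * e.
    have -> : 2^-1 * e = K * (e / (2 * K)) by field; rewrite gt_eqF.
    by rewrite ler_pM2l// ltW.
  by rewrite expr2 !mulrA; apply: ler_wpM2r.
have -> : e * s = 2^-1 * (e * s) + 2^-1 * (e * s) by field.
by apply: lerD => //; exact: le_trans a3.
Qed.

Theorem theorem1p2 (R : realType) (N : nat) (hN : (3 <= N)%N)
    (Omega : set 'rV[R]_N) (hsmooth : smooth_open Omega)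
    (hbounded : bounded_set Omega) :
  (~ exists u : 'rV[R]_N -> R, least_energy_solution Omega u) /\
  (strictly_starshaped Omega ->
     critical_point Omega (cst 0) /\
     forall u : 'rV[R]_N -> R, critical_point Omega u -> ae_zero u).
Proof.
have [oO _] := hsmooth; have mO := open_measurable_rV oO.
have hp := crit_exp_gt2 R hN.
have N0 : (0 < N)%N by exact: leq_trans hN.
split; first by move=> [u]; exact: no_least_energy_solution.
move=> [x0 _ star]; split; first exact: critical_point0.
move=> u cu; have [/(D12_grad _ hp)[G gu] _] := cu.
have [e0 e00 cone0] := cone N0 hsmooth hbounded star.
have EL v H : grad (@crit_exp R N) v H -> ipG G H =
    Rintegral (lebesgue_rV N) setT (fun x => Q Omega x * (psi (@crit_exp R N) (u x) * v x)).
  by move=> gv; exact: critical_equation mO cu gu gv.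
have := starshaped_trivial hN oO hbounded e00 cone0 gu EL.
by apply: filterS => x ->.
Qed.
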